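(* Let $d\in\{1,2\}$ and let $u_0\in\mathscr{A}^2(\mathbb{T}^d)$ be real-valued with $\int_{\mathbb{T}^d}u_0\,dx=0$ and such that the value $$\delta(|u_0|_2)=2-e^{|u_0|_2}-7|u_0|_2e^{|u_0|_2}-6|u_0|_2^2e^{|u_0|_2}-|u_0|_2^3e^{|u_0|_2}$$ satisfies $\delta(|u_0|_2)>0$. Then there exists at least one global weak solution $u$ (in the sense defined in the context) of $$\partial_tu=\Delta e^{-\Delta u},\qquad u(0,x)=u_0(x),$$ with $$u\in C([0,T];\mathscr{H}^2(\mathbb{T}^d))\cap L^2(0,T;\mathscr{H}^4(\mathbb{T}^d))\qquad\text{for all }0<T<\infty.$$ Furthermore, the solution satisfies $$\|\Delta u(t)\|_{L^\infty}\le|u_0|_2\,e^{-\delta(|u_0|_2)t}\qquad\text{for all }t\ge0.$$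
   Context: $\mathbb{T}^d=[-\pi,\pi]^d$ is the $d$-dimensional torus (periodic boundary conditions). Fourier coefficients: $\widehat u(k)=(2\pi)^{-d}\int_{\mathbb{T}^d}u(x)e^{-ix\cdot k}\,dx$, $k\in\mathbb{Z}^d$. For $\alpha\ge0$: $\mathscr{A}^\alpha(\mathbb{T}^d)=\{u\in L^1(\mathbb{T}^d):|u|_\alpha:=\sum_{k\in\mathbb{Z}^d}|k|^\alpha|\widehat u(k)|<\infty\}$ and $\mathscr{H}^\alpha(\mathbb{T}^d)=\{u\in L^2(\mathbb{T}^d):\|u\|_{\mathscr{H}^\alpha}^2:=\sum_{k\in\mathbb{Z}^d}|k|^{2\alpha}|\widehat u(k)|^2<\infty\}$ (with $|0|^0=1$). Weak solution: $u$ is a global weak solution of $\partial_tu=\Delta e^{-\Delta u}$ with initial data $u_0$ if $\int_{\mathbb{T}^d}u(t,x)\,dx=0$ for all $t$ and $v=\Delta u$ is, for every $T>0$, a weak solution on $[0,T]$ of $\partial_tv=\Delta^2e^{-v}$ with initial data $v_0=\Delta u_0$, that is, $v\in L^\infty(0,T;L^\infty(\mathbb{T}^d))$ and $$\int_{\mathbb{T}^d}\varphi(0,x)v_0(x)\,dx+\int_0^T\int_{\mathbb{T}^d}\big(\partial_t\varphi(t,x)\,v(t,x)+\Delta^2\varphi(t,x)\,e^{-v(t,x)}\big)\,dx\,dt=0$$ for all $\varphi\in W^{1,1}(0,T;L^1(\mathbb{T}^d))\cap L^1(0,T;W^{4,1}(\mathbb{T}^d))$ with $\varphi(T,\cdot)=0$.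 *)

(* Defs.v *)
From HB Require Import structures.
From mathcomp Require Import all_boot all_order all_algebra.
From mathcomp Require Import all_classical all_reals all_analysis.
From mathcomp.real_closed Require Import complex.
Set Implicit Arguments.
Unset Strict Implicit.
Unset Printing Implicit Defensive.
Import Order.TTheory GRing.Theory Num.Theory.
Import numFieldNormedType.Exports.
Local Open Scope classical_set_scope.
Local Open Scope ring_scope.

(* The torus T^d is the box [-pi, pi]^d: functions on it are functions on
   d.-tuple R, and everything is integrated against torus_measure, i.e.
   Lebesgue measure restricted to the box. *)

Definition interval_measure (R : realType) : set (measurableTypeR R) -> \bar R :=
  mrestr lebesgue_measure (measurable_itv `[- pi : R, pi]).

HB.instance Definition _ (R : realType) :=
  Measure.copy (@interval_measure R)
    (mrestr lebesgue_measure (measurable_itv `[- pi : R, pi])).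

Lemma interval_measure_fin (R : realType) : fin_num_fun (@interval_measure R).
Proof.
move=> A mA; rewrite ge0_fin_numE ?measure_ge0// /interval_measure /mrestr.
apply: (@le_lt_trans _ _ (lebesgue_measure `[- pi : R, pi]%classic)).
  by apply: le_measure; rewrite ?inE//; exact: measurableI.
by rewrite lebesgue_measure_itv/=; case: ifP => // _; rewrite -EFinB ltry.
Qed.

HB.instance Definition _ (R : realType) :=
  Measure_isFinite.Build _ _ _ (@interval_measure R) (@interval_measure_fin R).

Definition cons_pair (R : realType) (n : nat)
    (p : measurableTypeR R * n.-tuple R) : n.+1.-tuple R :=
  [tuple of p.1 :: p.2].

Lemma measurable_cons_pair (R : realType) (n : nat) :
  measurable_fun setT (@cons_pair R n).
Proof. exact: measurable_cons. Qed.

Section torus_step.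
Variables (R : realType) (n : nat).
Variable m : {finite_measure set (n.-tuple R) -> \bar R}.

Definition torus_step : set (n.+1.-tuple R) -> \bar R :=
  pushforward (@interval_measure R \x m)%E (@cons_pair R n).

Let step0 : torus_step set0 = 0%E.
Proof. by rewrite /torus_step /pushforward preimage_set0 measure0. Qed.

Let step_preimage (A : set (n.+1.-tuple R)) :
  measurable A -> measurable (@cons_pair R n @^-1` A).
Proof.
by move=> mA; rewrite -[X in measurable X]setTI; exact: measurable_cons_pair.
Qed.

Let step_ge0 (A : set (n.+1.-tuple R)) : (0 <= torus_step A)%E.
Proof. exact: (measure_ge0 (@interval_measure R \x m)%E). Qed.

Let step_sigma_additive : semi_sigma_additive torus_step.
Proof.
move=> F mF tF mUF; rewrite /torus_step /pushforward preimage_bigcup.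
apply: measure_semi_sigma_additive.
- by move=> k; exact: step_preimage.
- apply/trivIsetP => /= i j _ _ ij; rewrite -preimage_setI.
  by move/trivIsetP : tF => /(_ _ _ _ _ ij) ->//; rewrite preimage_set0.
- by rewrite -preimage_bigcup; exact: step_preimage.
Qed.

HB.instance Definition _ :=
  isMeasure.Build _ _ _ torus_step step0 step_ge0 step_sigma_additive.

Let step_fin : fin_num_fun torus_step.
Proof.
move=> A mA; rewrite ge0_fin_numE ?measure_ge0//.
have le_T : (torus_step A <= (@interval_measure R \x m)%E [set: _])%E.
  apply: (le_measure (@interval_measure R \x m)%E); rewrite ?inE//.
  exact: step_preimage.
apply: (le_lt_trans le_T); rewrite -setXTT product_measure1E//.
by rewrite lte_mul_pinfty ?measure_ge0// ?fin_num_measure// -ge0_fin_numE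
  ?fin_num_measure.
Qed.

HB.instance Definition _ := Measure_isFinite.Build _ _ _ torus_step step_fin.

End torus_step.

Fixpoint torus_measure (R : realType) (d : nat) :
    {finite_measure set (d.-tuple R) -> \bar R} :=
  match d return {finite_measure set (d.-tuple R) -> \bar R} with
  | 0%N => dirac [tuple]
  | n.+1 => torus_step (torus_measure R n)
  end.

Section fourier.
Variables (R : realType) (d : nat).
Local Notation mu := (torus_measure R d).
Implicit Types (u : d.-tuple R -> R) (k : d.-tuple int) (a : R).

Definition phase k (x : d.-tuple R) : R :=
  \sum_(i < d) (tnth k i)%:~R * tnth x i.

(* (2 pi)^-d \int u(x) e^{- i x.k} dx for real-valued u, written with
   e^{-i s} = cos s - i sin s. *)
Definition fourier u k : R[i] :=
  Complex (((2 * pi) ^- d) * \int[mu]_x (u x * cos (phase k x)))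
          (- (((2 * pi) ^- d) * \int[mu]_x (u x * sin (phase k x)))).

Definition freq_norm k : R := Num.sqrt (\sum_(i < d) ((tnth k i)%:~R) ^+ 2).

(* powR satisfies 0 `^ 0 = 1, the convention |0|^0 = 1. *)
Definition wiener_norm a u : \bar R :=
  \esum_(k in [set: d.-tuple int])
    (freq_norm k `^ a * Normc.normc (fourier u k))%:E.

Definition wiener_space a : set (d.-tuple R -> R) :=
  [set u | u \in Lfun mu 1%E /\ (wiener_norm a u < +oo)%E].

Definition sobolevH_norm a u : \bar R :=
  poweR (\esum_(k in [set: d.-tuple int])
    (freq_norm k `^ (2 * a) * Normc.normc (fourier u k) ^+ 2)%:E) 2^-1.

End fourier.

Section weak_derivatives.
Variables (R : realType) (d : nat).
Local Notation mu := (torus_measure R d).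
Implicit Types (psi : 'rV[R]_d -> R) (f g : d.-tuple R -> R) (l : seq 'I_d).

(* A list l = [:: i1; ...; im] of directions stands for the differential
   operator d_{i1} ... d_{im}, of order size l. *)
Definition partials l psi : 'rV[R]_d -> R :=
  foldr (fun i h => fun x => 'D_(delta_mx 0 i) h x) psi l.

Definition smooth psi : Prop :=
  forall l, continuous (partials l psi) /\
    forall x i, derivable (partials l psi) x (delta_mx 0 i).

Definition periodic psi : Prop :=
  forall x i, psi (x + (2 * pi) *: delta_mx 0 i) = psi x.

Definition row_of (x : d.-tuple R) : 'rV[R]_d := \row_i tnth x i.

(* Weak derivatives on the torus: the test functions are the smooth
   2 pi-periodic functions, not the compactly supported ones. *)
Definition is_weak_deriv l f g : Prop :=
  [/\ f \in Lfun mu 1%E, g \in Lfun mu 1%E &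
    forall psi, smooth psi -> periodic psi ->
      \int[mu]_x (f x * partials l psi (row_of x)) =
      (-1) ^+ size l * \int[mu]_x (g x * psi (row_of x))].

Definition has_weak_deriv l f : Prop := exists g, is_weak_deriv l f g.

(* Meaningful only under has_weak_deriv l f, and then only up to a null set. *)
Definition weak_deriv l f : d.-tuple R -> R :=
  xget (cst 0) [set g | is_weak_deriv l f g].

Definition has_laplacian f : Prop :=
  forall i : 'I_d, has_weak_deriv [:: i; i] f.

Definition laplacian f : d.-tuple R -> R :=
  fun x => \sum_(i < d) weak_deriv [:: i; i] f x.

Definition bilaplacian f : d.-tuple R -> R :=
  fun x => \sum_(i < d) \sum_(j < d) weak_deriv [:: i; i; j; j] f x.

End weak_derivatives.

(* A space of functions on T^d with its (semi)norm; the norm is used only on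
   elements of the carrier. *)
Record funSpace (R : realType) (d : nat) := FunSpace {
  carrier : set (d.-tuple R -> R) ;
  fnorm : (d.-tuple R -> R) -> \bar R }.

Section spaces.
Variables (R : realType) (d : nat).
Local Notation mu := (torus_measure R d).

Definition spaceL (p : \bar R) : funSpace R d :=
  FunSpace [set f | f \in Lfun mu p] (fun f => 'N[mu]_p[EFin \o f]%E).

Definition spaceH (a : R) : funSpace R d :=
  FunSpace
    [set f | f \in Lfun mu 2%:E /\ (sobolevH_norm a f < +oo)%E]
    (sobolevH_norm a).

(* W^{m,1}: the sum of the L^1 norms of all iterated partial derivatives of
   order at most m; a multi-index is counted once for each of its orderings,
   which gives an equivalent norm. *)
Definition spaceW1 (m : nat) : funSpace R d :=
  FunSpace
    [set f | f \in Lfun mu 1%E /\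
      forall l : seq 'I_d, (size l <= m)%N -> has_weak_deriv l f]
    (fun f => \sum_(n < m.+1) \sum_(l : n.-tuple 'I_d)
                 'N[mu]_1[EFin \o weak_deriv l f])%E.

End spaces.

(* Functions of time with values in a space E of functions on T^d. *)
Section bochner.
Variables (R : realType) (d : nat).
Implicit Types (T : R) (E : funSpace R d) (f g : R -> d.-tuple R -> R).
Local Notation leb := (@lebesgue_measure R).

Record simple := Simple {
  simple_len : nat ;
  simple_set : 'I_simple_len -> set R ;
  simple_val : 'I_simple_len -> d.-tuple R -> R }.

Definition simple_in E (s : simple) : Prop :=
  forall j : 'I_(simple_len s),
    measurable (simple_set j) /\ carrier E (simple_val j).

Definition simple_fun (s : simple) : R -> d.-tuple R -> R :=
  fun t x => \sum_(j < simple_len s) \1_(simple_set j) t * simple_val j x.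

Definition simple_integral T (s : simple) : d.-tuple R -> R :=
  fun x => \sum_(j < simple_len s)
    fine (leb (simple_set j `&` `[0, T]%classic)) * simple_val j x.

Definition approximates T E (s : nat -> simple) f : Prop :=
  [/\ forall n, simple_in E (s n),
      {ae leb, forall t, `[0, T]%classic t -> carrier E (f t)} &
      {ae leb, forall t, `[0, T]%classic t ->
        fnorm E (f t \- simple_fun (s n) t) @[n --> \oo] --> 0%E}].

Definition strongly_measurable T E f : Prop :=
  exists s : nat -> simple, approximates T E s f.

Definition bochner_L (p : \bar R) T E : set (R -> d.-tuple R -> R) :=
  [set f | strongly_measurable T E f /\
    ('N[leb]_p[(fun t => fnorm E (f t)) \_ `[0%R, T]%classic] < +oo)%E].

Definition has_bochner_integral T E f (I : d.-tuple R -> R) : Prop :=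
  carrier E I /\
  exists s : nat -> simple,
    [/\ approximates T E s f,
        (\int[leb]_(t in `[0%R, T]%classic)
           fnorm E (f t \- simple_fun (s n) t)%R)%E @[n --> \oo] --> 0%E &
        fnorm E (I \- simple_integral T (s n)) @[n --> \oo] --> 0%E].

Definition bochner_C T E : set (R -> d.-tuple R -> R) :=
  [set f | forall t, `[0, T]%classic t -> carrier E (f t) /\
    fnorm E (f s \- f t) @[s --> within `[0, T]%classic (nbhs t)] --> 0%E].

Definition time_test T (eta : R -> R) : Prop :=
  (forall n t, derivable (eta^`(n))%classic t 1) /\
  exists a b, [/\ 0 < a, b < T & forall t, ~ (a <= t <= b) -> eta t = 0].

Definition is_time_deriv T E f g : Prop :=
  forall eta, time_test T eta ->
    exists I, has_bochner_integral T E (fun t x => (eta^`())%classic t * f t x) I /\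
              has_bochner_integral T E (fun t x => eta t * g t x) (fun x => - I x).

End bochner.

Section weak_solutions.
Variables (R : realType) (d : nat).
Local Notation mu := (torus_measure R d).
Local Notation leb := (@lebesgue_measure R).

(* phi in W^{1,1}(0,T;L^1) /\ L^1(0,T;W^{4,1}) with time derivative psi and
   phi(T) = 0. As usual phi is taken to be its representative in C([0,T];L^1),
   which gives a meaning to phi(0) and phi(T). *)
Definition test_function (T : R) (phi psi : R -> d.-tuple R -> R) : Prop :=
  [/\ bochner_L 1 T (spaceL d 1%:E) phi /\ bochner_L 1 T (spaceL d 1%:E) psi,
      is_time_deriv T (spaceL d 1%:E) phi psi,
      bochner_L 1 T (spaceW1 R d 4) phi,
      bochner_C T (spaceL d 1%:E) phi &
      {ae mu, forall x, phi T x = 0}].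

(* Weak solutions on [0,T] of  d_t v = Laplacian^2 e^{-v},  v(0) = v0. *)
Definition weak_solution (T : R) (v : R -> d.-tuple R -> R)
    (v0 : d.-tuple R -> R) : Prop :=
  bochner_L +oo T (spaceL d +oo%E) v /\
  forall phi psi, test_function T phi psi ->
    \int[mu]_x (phi 0 x * v0 x) +
    \int[leb]_(t in `[0, T]%classic)
      (\int[mu]_x (psi t x * v t x +
                   bilaplacian (phi t) x * expR (- v t x))) = 0.

(* Global weak solutions of  d_t u = Laplacian e^{- Laplacian u},  u(0) = u0. *)
Definition global_weak_solution (u : R -> d.-tuple R -> R)
    (u0 : d.-tuple R -> R) : Prop :=
  (forall t, 0 <= t ->
    [/\ u t \in Lfun mu 1%E, \int[mu]_x u t x = 0 & has_laplacian (u t)]) /\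
  forall T, 0 < T ->
    weak_solution T (fun t => laplacian (u t)) (laplacian u0).

End weak_solutions.

Definition delta (R : realType) (r : R) : R :=
  2 - expR r - 7 * r * expR r - 6 * r ^+ 2 * expR r - r ^+ 3 * expR r.

(* Main.v *)
(* Write p = - Laplacian u, so that v = - p, and let c_k be the Fourier
   coefficients of p. They satisfy c_k' = - |k|^4 (c_k + N_k), where the N_k are
   the Fourier coefficients of e^p - 1 - p, and sum_k |c_k(0)| = |u_0|_2 =: r.
   The condition delta(r) > 0 gives r < 1/7, which makes Duhamel's formula a
   contraction in the Wiener algebra, with sum_k |c_k| <= 1/5; comparing
   |c_k(t)| with M_k exp(- |k| t^(1/4) / 100), a weight that convolution
   preserves, shows that sum_k |k|^4 |c_k| is integrable in time.
   Since n^4/n! = 1/(n-1)! + 7/(n-2)! + 6/(n-3)! + 1/(n-4)!, the power series of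
   e^p - 1 - p gives sum_k |k|^4 |N_k| <= (1 - delta(r)) sum_k |k|^4 |c_k| as long
   as sum_k |c_k| <= r, and Gronwall's argument yields the decay of sum_k |c_k|,
   which bounds the L^infinity norm of Laplacian u.
   For the weak formulation, the Fourier coefficients of a test function are
   absolutely continuous in time by the du Bois-Reymond lemma; integrating by
   parts against c_k and summing over k by dominated convergence gives the
   claim. *)
Require Import Defs.
From HB Require Import structures.
From mathcomp Require Import all_boot all_order all_algebra.
From mathcomp Require Import all_classical all_reals all_analysis.
From mathcomp Require Import measurable_realfun.
From mathcomp.real_closed Require Import complex.
From mathcomp Require Import ring lra.
Set Implicit Arguments.
Unset Strict Implicit.
Unset Printing Implicit Defensive.
Import Order.TTheory GRing.Theory Num.Theory.
Import numFieldNormedType.Exports.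
Local Open Scope classical_set_scope.
Local Open Scope ring_scope.

(** * Sums over countable types and convolution on the frequency lattice *)

(** The work is done on Fourier coefficients. Sums of nonnegative families are taken in the extended
    reals, so that convolutions and exponentials are defined without summability conditions and
    finiteness is read off from total sums. Gronwall's argument moves a time integral of sum_k |k|^4
    |c_k| from one side of an inequality to the other, so this integral must be known beforehand to
    be finite, although only sum_k |c_k| is finite initially. A bound by M_k exp(- |k|^4 t) would
    give it, but |k|^4 is not subadditive and such a bound does not survive products. Replacing
    |k|^4 t by a small multiple of its fourth root |k| t^(1/4) restores subadditivity in k, while
    |k|^4 times the new weight still has a time integral bounded uniformly in k. In the weak
    formulation, test functions are only Bochner measurable, and inner integrals and norms, as
    functions of time, are not known to be measurable. The comparison and convergence theorems used
    there are therefore proved without that assumption. *)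

Section esum_theory.
Variable R : realType.
Local Open Scope ereal_scope.

Lemma esum_ub (T : choiceType) (I : set T) (a : T -> \bar R) M :
  (forall X : set T, finite_set X -> X `<=` I -> \sum_(i \in X) a i <= M) ->
  \esum_(i in I) a i <= M.
Proof. by move=> H; apply: ge_ereal_sup => _ [X [fX XI] <-]; exact: H. Qed.

Lemma esum_ge_term (T : choiceType) (a : T -> \bar R) k :
  (forall i, 0 <= a i) -> a k <= \esum_(i in [set: T]) a i.
Proof.
move=> a0; apply: esum_ge; exists [set k]; first by split; [exact: finite_set1|].
by rewrite fsbig_set1.
Qed.

Lemma ge0_esumZl (T : choiceType) (a : T -> \bar R) (c : \bar R) :
  0 <= c -> (forall i, 0 <= a i) ->
  \esum_(i in [set: T]) (c * a i) = c * \esum_(i in [set: T]) a i.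
Proof.
move=> c0 a0; apply/eqP; rewrite eq_le; apply/andP; split.
  apply: esum_ub => X fX _; rewrite -ge0_mule_fsumr//.
  by apply: lee_wpmul2l => //; apply: esum_ge; exists X.
case: c c0 => [r r0| _|//].
  rewrite /esum -ereal_supZl//; last first.
    by apply/set0P; exists 0; exists set0; [exact: fsets_set0|rewrite fsbig_set0].
  apply: ge_ereal_sup => _ [_ [X fX <-] <-].
  by rewrite ge0_mule_fsumr//; apply: ereal_sup_ubound; exists X.
(* For c = +oo: either the sum is 0, and so is every product, or a single nonzero term already makes
   the left side +oo. *)
have [->|] := eqVneq (\esum_(i in [set: T]) a i) 0.
  by rewrite mule0; apply: esum_ge0 => i _; rewrite mule_ge0.
move=> s0; have [k ak] : exists k, a k != 0.
  apply: contrapT => /forallNP h; move/negP: s0; apply; rewrite esum1// => i _.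
  by apply: contrapT => /eqP; exact: h.
apply: le_trans (esum_ge_term k _); last by move=> i; rewrite mule_ge0.
by rewrite [leRHS]gt0_mulye ?leey// lt0e ak a0.
Qed.

Lemma esum_swap (T1 T2 : choiceType) (a : T1 -> T2 -> \bar R) :
  (forall i j, 0 <= a i j) ->
  \esum_(i in [set: T1]) \esum_(j in [set: T2]) a i j =
  \esum_(j in [set: T2]) \esum_(i in [set: T1]) a i j.
Proof.
move=> a0; rewrite !esum_esum//.
rewrite (reindex_esum ([set: T2] `*`` (fun=> [set: T1])) _ (fun x => (x.2, x.1)))//.
split=> //= [[x y] [x' y'] _ _ [-> ->]//|[x y] _].
by exists (y, x).
Qed.

Lemma esum_bij (T : choiceType) (e f : T -> T) (a : T -> \bar R) :
  cancel e f -> cancel f e ->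
  \esum_(i in [set: T]) a (e i) = \esum_(i in [set: T]) a i.
Proof.
move=> ef fe; rewrite [RHS](reindex_esum [set: T] _ e)//.
split=> //= [x y _ _ /(congr1 f)|y _]; first by rewrite !ef.
by exists (f y).
Qed.

Lemma ge0_lee_esum (T : choiceType) (a b : T -> \bar R) :
  (forall i, a i <= b i) ->
  \esum_(i in [set: T]) a i <= \esum_(i in [set: T]) b i.
Proof. by move=> ab; apply: le_esum => i _; exact: ab. Qed.

End esum_theory.

Definition freq_add d (k l : d.-tuple int) : d.-tuple int :=
  [tuple tnth k i + tnth l i | i < d].
Definition freq_opp d (k : d.-tuple int) : d.-tuple int :=
  [tuple - tnth k i | i < d].
Definition freq_zero d : d.-tuple int := [tuple 0 | i < d].

Lemma freq_addA d : associative (@freq_add d).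
Proof. by move=> k l m; apply: eq_from_tnth => i; rewrite !tnth_mktuple addrA. Qed.

Lemma freq_addC d : commutative (@freq_add d).
Proof. by move=> k l; apply: eq_from_tnth => i; rewrite !tnth_mktuple addrC. Qed.

Lemma freq_add0 d : left_id (freq_zero d) (@freq_add d).
Proof. by move=> k; apply: eq_from_tnth => i; rewrite !tnth_mktuple add0r. Qed.

Lemma freq_addN d : left_inverse (freq_zero d) (@freq_opp d) (@freq_add d).
Proof. by move=> k; apply: eq_from_tnth => i; rewrite !tnth_mktuple addNr. Qed.

(** Frequencies become an instance of the abstract [zmodType] on which convolution is developed
    below. *)
HB.instance Definition _ d := GRing.isZmodule.Build (d.-tuple int)
  (@freq_addA d) (@freq_addC d) (@freq_add0 d) (@freq_addN d).

Lemma tnth_freqD d (k l : d.-tuple int) i : tnth (k + l) i = tnth k i + tnth l i.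
Proof. by rewrite tnth_mktuple. Qed.

Lemma tnth_freqN d (k : d.-tuple int) i : tnth (- k) i = - tnth k i.
Proof. by rewrite tnth_mktuple. Qed.

Lemma tnth_freq0 d i : tnth (0 : d.-tuple int) i = 0.
Proof. by rewrite tnth_mktuple. Qed.

Section freq_norm.
Variables (R : realType) (d : nat).
Implicit Types k l : d.-tuple int.
Local Notation fn := (@freq_norm R d).

Lemma freq_norm_ge0 k : 0 <= fn k.
Proof. exact: sqrtr_ge0. Qed.

Lemma sqr_freq_norm k : fn k ^+ 2 = \sum_(i < d) ((tnth k i)%:~R : R) ^+ 2.
Proof. by rewrite sqr_sqrtr// sumr_ge0// => i _; rewrite sqr_ge0. Qed.

Lemma freq_normN k : fn (- k) = fn k.
Proof.
by rewrite /freq_norm; under eq_bigr do rewrite tnth_freqN rmorphN sqrrN.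
Qed.

Lemma freq_norm0 : fn 0 = 0.
Proof.
rewrite /freq_norm big1 ?sqrtr0// => i _.
by rewrite tnth_freq0 expr0n.
Qed.

(** Lagrange's identity: the defect is half the sum of the squares of x_i y_j - x_j y_i. *)
Lemma cauchy_schwarz (x y : 'I_d -> R) :
  (\sum_i x i * y i) ^+ 2 <= (\sum_i x i ^+ 2) * (\sum_i y i ^+ 2).
Proof.
rewrite -subr_ge0.
suff -> : (\sum_i x i ^+ 2) * (\sum_i y i ^+ 2) - (\sum_i x i * y i) ^+ 2 =
    2^-1 * \sum_i \sum_j (x i * y j - x j * y i) ^+ 2.
  by rewrite mulr_ge0// sumr_ge0// => i _; rewrite sumr_ge0// => j _; rewrite sqr_ge0.
transitivity (2^-1 * (\sum_i \sum_j (x i ^+ 2 * y j ^+ 2 + x j ^+ 2 * y i ^+ 2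
    - 2 * ((x i * y i) * (x j * y j))))); last first.
  by congr (_ * _); apply: eq_bigr => i _; apply: eq_bigr => j _; ring.
have -> : \sum_i \sum_j (x i ^+ 2 * y j ^+ 2 + x j ^+ 2 * y i ^+ 2
    - 2 * ((x i * y i) * (x j * y j))) = \sum_i (x i ^+ 2 * (\sum_j y j ^+ 2) +
    (\sum_j x j ^+ 2) * y i ^+ 2 - 2 * ((x i * y i) * \sum_j x j * y j)).
  by apply: eq_bigr => i _; rewrite big_split sumrN/= big_split/= mulr_sumr mulr_suml !mulr_sumr.
rewrite big_split sumrN/= big_split/= -mulr_suml -mulr_sumr -mulr_sumr -mulr_suml.
by field.
Qed.

Lemma freq_normD k l : fn (k + l) <= fn k + fn l.
Proof.
rewrite -(@ler_pXn2r _ 2)// ?nnegrE ?addr_ge0 ?freq_norm_ge0//.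
rewrite sqrrD !sqr_freq_norm.
under eq_bigr do rewrite tnth_freqD rmorphD/= sqrrD.
have -> : \sum_i (((tnth k i)%:~R : R) ^+ 2 + (tnth k i)%:~R * (tnth l i)%:~R *+ 2 +
    (tnth l i)%:~R ^+ 2) = \sum_i ((tnth k i)%:~R : R) ^+ 2 +
    (\sum_i ((tnth k i)%:~R : R) * (tnth l i)%:~R) *+ 2 + \sum_i ((tnth l i)%:~R : R) ^+ 2.
  by rewrite big_split big_split/= sumrMnl.
rewrite lerD2r lerD2l lerMn2r/=.
apply: (le_trans (ler_norm _)).
rewrite -(@ler_pXn2r _ 2)// ?nnegrE ?mulr_ge0 ?freq_norm_ge0//.
by rewrite real_normK ?num_real// exprMn !sqr_freq_norm cauchy_schwarz.
Qed.

Lemma freq_norm_ge1 k : k != 0 -> 1 <= fn k.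
Proof.
move=> k0.
have [i ki] : exists i, tnth k i != 0.
  apply: contrapT => /forallNP h; move/eqP: k0; apply; apply: eq_from_tnth => i.
  by rewrite tnth_freq0; apply: contrapT => /eqP; exact: h.
rewrite -(@ler_pXn2r _ 2)// ?nnegrE ?freq_norm_ge0// expr1n sqr_freq_norm.
rewrite (bigD1 i)//= ler_wpDr ?sumr_ge0// => [j _|]; first by rewrite sqr_ge0.
rewrite -rmorphXn/= -[1](_ : 1%:~R = _)// ler_int -gtz0_ge1.
by rewrite exprn_even_gt0.
Qed.

End freq_norm.

(** * Convolution powers and the exponential series *)

Section convolution.
Variables (R : realType) (K : zmodType).
Local Open Scope ereal_scope.
Implicit Types A B : K -> \bar R.

Definition conv A B : K -> \bar R :=
  fun k => \esum_(l in [set: K]) (A l * B (k - l)%R).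

Lemma conv_ge0 A B : (forall k, 0 <= A k) -> (forall k, 0 <= B k) ->
  forall k, 0 <= conv A B k.
Proof. by move=> A0 B0 k; apply: esum_ge0 => l _; rewrite mule_ge0. Qed.

Lemma le_conv A A' B B' : (forall k, 0 <= A k) -> (forall k, 0 <= B k) ->
  (forall k, A k <= A' k) -> (forall k, B k <= B' k) ->
  forall k, conv A B k <= conv A' B' k.
Proof.
by move=> A0 B0 AA BB k; apply: ge0_lee_esum => l; exact: lee_pmul.
Qed.

Lemma esum_shift A (l : K) :
  \esum_(k in [set: K]) A (k - l)%R = \esum_(k in [set: K]) A k.
Proof.
by apply: (@esum_bij _ _ (fun k => k - l)%R (fun k => k + l)%R) => k /=;
  rewrite ?subrK ?addrK.
Qed.

(** Tonelli for the double sum, then the shift from k to k + l in the inner one. *)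
Lemma esum_conv_weight (f : K -> \bar R) A B :
  (forall k, 0 <= A k) -> (forall k, 0 <= B k) -> (forall k, 0 <= f k) ->
  \esum_(k in [set: K]) (f k * conv A B k) =
  \esum_(l in [set: K]) (A l * \esum_(k in [set: K]) (f (k + l)%R * B k)).
Proof.
move=> A0 B0 f0.
transitivity (\esum_(k in [set: K]) \esum_(l in [set: K]) (f k * (A l * B (k - l)%R))).
  by apply: eq_esum => k _; rewrite ge0_esumZl// => l; rewrite mule_ge0.
rewrite esum_swap; last by move=> k l; rewrite !mule_ge0.
apply: eq_esum => l _.
under eq_esum => k _ do rewrite muleCA.
rewrite ge0_esumZl//; last by move=> k; rewrite mule_ge0.
congr (_ * _); rewrite -(esum_shift _ l).
by apply: eq_esum => k _; rewrite subrK.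
Qed.

Lemma esum_conv A B : (forall k, 0 <= A k) -> (forall k, 0 <= B k) ->
  \esum_(k in [set: K]) conv A B k =
  (\esum_(k in [set: K]) A k) * (\esum_(k in [set: K]) B k).
Proof.
move=> A0 B0.
transitivity (\esum_(k in [set: K]) (1 * conv A B k)).
  by apply: eq_esum => k _; rewrite mul1e.
rewrite (esum_conv_weight (f := cst 1))//.
under eq_esum => l _.
  under eq_esum do rewrite mul1e.
  rewrite muleC.
  over.
rewrite /= ge0_esumZl// 1?muleC//; exact: esum_ge0.
Qed.

Fixpoint cpow A n : K -> \bar R :=
  if n is n'.+1 then conv A (cpow A n') else fun k => ((k == 0%R)%:R)%:E.

Lemma cpow_ge0 A n : (forall k, 0 <= A k) -> forall k, 0 <= cpow A n k.
Proof.
by move=> A0; elim: n => [|n IH] k /=; [rewrite lee_fin|exact: conv_ge0].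
Qed.

Lemma le_cpow A A' n : (forall k, 0 <= A k) -> (forall k, A k <= A' k) ->
  forall k, cpow A n k <= cpow A' n k.
Proof.
by move=> A0 AA; elim: n => [|n IH] k //=; apply: le_conv => //; exact: cpow_ge0.
Qed.

Lemma esum_cpow A (a : R) n : (forall k, 0 <= A k) ->
  \esum_(k in [set: K]) A k = a%:E ->
  \esum_(k in [set: K]) cpow A n k = (a ^+ n)%:E.
Proof.
move=> A0 Aa; elim: n => [|n IH] /=.
  rewrite (esumID [set (0 : K)%R])//.
  rewrite setTI esum_set1 ?lee_fin// eqxx esum1 ?adde0 ?expr0// => k [_ /= /eqP].
  by move/negbTE => ->.
by rewrite esum_conv// ?Aa ?IH -?EFinM ?exprS//; exact: cpow_ge0.
Qed.

(** Supermultiplicativity bounds each product w l * w (k - l) by w k, so the weight leaves one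
    convolution after the other. *)
Lemma cpow_weight A (w : K -> \bar R) n : (forall k, 0 <= A k) ->
  (forall k, 0 <= w k) -> w 0%R = 1 ->
  (forall k l, w k * w l <= w (k + l)%R) ->
  forall k, cpow (fun k => A k * w k) n k <= cpow A n k * w k.
Proof.
move=> A0 w0 w1 wM; elim: n => [|n IH] k /=.
  by case: eqP => [->|_]; rewrite ?w1 ?mule1// mul0e.
rewrite muleC /conv -ge0_esumZl//; last first.
  by move=> l; rewrite mule_ge0//; exact: cpow_ge0.
apply: ge0_lee_esum => l.
apply: (@le_trans _ _ (A l * w l * (cpow A n (k - l)%R * w (k - l)%R))).
  by apply: lee_wpmul2l => //; rewrite mule_ge0.
rewrite muleACA muleC.
apply: lee_wpmul2r; first by rewrite mule_ge0//; exact: cpow_ge0.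
by apply: le_trans (wM _ _) _; rewrite addrC subrK.
Qed.

(** If A bounds the coefficients of p, this bounds those of the tail sum_(n >= j) p^n / n!. The
    cases used are j = 1, for e^p - 1, and j = 2, for e^p - 1 - p. *)
Definition cexp j A : K -> \bar R :=
  fun k => \esum_(n in [set: nat]) ((((n + j)`!)%:R^-1)%:E * cpow A (n + j) k).

Lemma invfact_ge0 n : (0 : \bar R) <= ((n`!)%:R^-1 : R)%:E.
Proof. by rewrite lee_fin invr_ge0 ler0n. Qed.

Hint Resolve invfact_ge0 : core.

Lemma cexp_ge0 j A : (forall k, 0 <= A k) -> forall k, 0 <= cexp j A k.
Proof.
by move=> A0 k; apply: esum_ge0 => n _; rewrite mule_ge0//; exact: cpow_ge0.
Qed.

Lemma le_cexp j A A' : (forall k, 0 <= A k) -> (forall k, A k <= A' k) ->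
  forall k, cexp j A k <= cexp j A' k.
Proof.
move=> A0 AA k; apply: ge0_lee_esum => n; apply: lee_wpmul2l => //.
exact: le_cpow.
Qed.

Lemma cexp_weight j A (w : K -> \bar R) : (forall k, 0 <= A k) ->
  (forall k, 0 <= w k) -> w 0%R = 1 ->
  (forall k l, w k * w l <= w (k + l)%R) ->
  forall k, cexp j (fun k => A k * w k) k <= cexp j A k * w k.
Proof.
move=> A0 w0 w1 wM k; rewrite muleC /cexp -ge0_esumZl//; last first.
  by move=> n; rewrite mule_ge0//; exact: cpow_ge0.
apply: ge0_lee_esum => n; rewrite muleCA; apply: lee_wpmul2l => //.
by rewrite muleC; exact: cpow_weight.
Qed.

Lemma esum_cexp_weight (f : K -> \bar R) j A : (forall k, 0 <= A k) ->
  (forall k, 0 <= f k) ->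
  \esum_(k in [set: K]) (f k * cexp j A k) =
  \esum_(n in [set: nat]) (((n + j)`!)%:R^-1)%:E *
     \esum_(k in [set: K]) (f k * cpow A (n + j) k).
Proof.
move=> A0 f0.
transitivity (\esum_(k in [set: K]) \esum_(n in [set: nat])
    (f k * ((((n + j)`!)%:R^-1)%:E * cpow A (n + j) k))).
  apply: eq_esum => k _; rewrite ge0_esumZl// => n.
  by rewrite mule_ge0//; exact: cpow_ge0.
rewrite esum_swap; last first.
  by move=> k n; rewrite !mule_ge0//; exact: cpow_ge0.
apply: eq_esum => n _; rewrite -ge0_esumZl//.
  by apply: eq_esum => k _; rewrite muleCA.
by move=> k; rewrite mule_ge0//; exact: cpow_ge0.
Qed.

Lemma esum_nat_ub (a : nat -> \bar R) (M : \bar R) : (forall n, 0 <= a n) ->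
  (forall n, \sum_(0 <= i < n) a i <= M) -> \esum_(n in [set: nat]) a n <= M.
Proof.
move=> a0 aM; rewrite -nneseries_esumT//.
by apply: lime_le; [exact: is_cvg_nneseries|exact: nearW].
Qed.

(** Since (i + 2)! >= 2^(i+1) and a <= 1, the series is at most a^2 times a geometric series of sum
    1. *)
Lemma esum_cexp2 A (a : R) : (forall k, 0 <= A k) ->
  \esum_(k in [set: K]) A k <= a%:E -> (a <= 1)%R ->
  \esum_(k in [set: K]) cexp 2 A k <= (a ^+ 2)%:E.
Proof.
move=> A0 Aa a1.
have [b Ab] : exists b : R, \esum_(k in [set: K]) A k = b%:E.
  exists (fine (\esum_(k in [set: K]) A k)); rewrite fineK// ge0_fin_numE.
    exact: le_lt_trans Aa (ltry _).
  exact: esum_ge0.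
have ba : (b <= a)%R by rewrite -lee_fin -Ab.
have b0 : (0 <= b)%R by rewrite -lee_fin -Ab; apply: esum_ge0.
apply: (@le_trans _ _ (\esum_(k in [set: K]) (1 * cexp 2 A k))).
  by apply: ge0_lee_esum => k; rewrite mul1e.
rewrite (esum_cexp_weight (f := cst 1))//.
apply: esum_nat_ub => [n|n].
  by rewrite mule_ge0//; apply: esum_ge0 => k _; rewrite mul1e; exact: cpow_ge0.
apply: (@le_trans _ _ (\sum_(0 <= i < n) (a ^+ 2 * 2^-1 ^+ i.+1)%:E)).
  apply: lee_sum => i _.
  under eq_esum do rewrite mul1e.
  rewrite (esum_cpow _ A0 Ab) -EFinM lee_fin addn2 mulrC ler_pM//.
  - by rewrite exprn_ge0.

  - apply: (@le_trans _ _ (a ^+ i.+2)%R); first by rewrite lerXn2r// nnegrE (le_trans b0).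
    rewrite -add2n exprD ler_piMr ?exprn_ge0 ?(le_trans b0)//.
    by rewrite exprn_ile1// (le_trans b0).
  - rewrite exprVn lef_pV2 ?posrE ?exprn_gt0 ?ltr0n ?fact_gt0//.
    rewrite -natrX ler_nat.
    elim: i => // i IH; rewrite expnS factS; apply: leq_mul => //.
rewrite sumEFin lee_fin -mulr_sumr ler_piMr ?exprn_ge0//; first by rewrite (le_trans b0).
have -> : (\sum_(0 <= i < n) 2^-1 ^+ i.+1 = 1 - 2^-1 ^+ n :> R)%R.
  elim: n => [|n IH]; first by rewrite big_nil expr0 subrr.
  by rewrite big_nat_recr//= IH !exprS; field.
by rewrite gerBl exprn_ge0.
Qed.

(** Once the linear term is split off, [cexp 1 A] is at most A plus [cexp 2 A]. *)
Lemma esum_cexp1 A (a : R) : (forall k, 0 <= A k) ->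
  \esum_(k in [set: K]) A k <= a%:E -> (a <= 1)%R ->
  \esum_(k in [set: K]) cexp 1 A k <= (a + a ^+ 2)%:E.
Proof.
move=> A0 Aa a1.
apply: (@le_trans _ _ (\esum_(k in [set: K]) (A k + cexp 2 A k))); last first.
  rewrite esumD//; last by move=> k _; exact: cexp_ge0.
  by rewrite EFinD leeD//; exact: esum_cexp2.
apply: ge0_lee_esum => k.
have t0 n : 0 <= ((n`!)%:R^-1 : R)%:E * cpow A n k by rewrite mule_ge0//; exact: cpow_ge0.
rewrite /cexp -!nneseries_esumT//.
rewrite nneseries_recl//; first apply: leeD.
- rewrite /= invr1 mul1e /conv.
  apply: esum_ub => X fX _.
  apply: (@le_trans _ _ (\esum_(l in [set: K]) (A l * ((k - l == 0)%R)%:R%:E))).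
    by apply: esum_ge; exists X.
  rewrite (esumID [set k])//; last by move=> l _; rewrite mule_ge0 ?lee_fin.
  rewrite setTI esum_set1 ?subrr ?eqxx ?mule1// esum1 ?adde0// => l [_ /= /eqP lk].
  by rewrite subr_eq0 eq_sym (negbTE lk) mule0.
- rewrite -(@nneseries_addn _ (fun n => (((n + 1)`!)%:R^-1)%:E * cpow A (n + 1) k) 1)//.
  apply: lee_nneseries => // n _.
  by rewrite -addnA.
Qed.

Section moment.
Variable q : K -> R.
Hypothesis q0 : forall k, (0 <= q k)%R.
Hypothesis qD : forall k l, (q (k + l) <= q k + q l)%R.
Hypothesis qz : q 0%R = 0%R.

(** Jensen's inequality for the fourth power, with weights (n+1)/(n+2) and 1/(n+2) at the points
    x/(n+1) and y. Equality holds when x is n + 1 times y, the case of n + 2 equal frequencies, so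
    the induction in [moment4_cpow] loses nothing. *)
Lemma expr4D_le (x y : R) n : (0 <= x)%R -> (0 <= y)%R ->
  ((x + y) ^+ 4 <= (n.+2%:R ^+ 3) * (x ^+ 4 / n.+1%:R ^+ 3 + y ^+ 4))%R.
Proof.
move=> x0 y0; set m := (n.+1%:R : R)%R.
have m0 : (0 < m)%R by rewrite ltr0n.
have -> : (n.+2%:R = m + 1 :> R)%R by rewrite /m -natr1.
set z := (x / m)%R; have z0 : (0 <= z)%R by rewrite divr_ge0// ltW.
have -> : x = (m * z)%R by rewrite /z mulrC divfK// gt_eqF.
rewrite -subr_ge0.
(* With m = n + 1 and x = m z, the defect has the factor (z - y)^2 and a cofactor with nonnegative
   coefficients. *)
have -> : ((m + 1) ^+ 3 * ((m * z) ^+ 4 / m ^+ 3 + y ^+ 4) - (m * z + y) ^+ 4 =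
  m * (z - y) ^+ 2 * (m ^+ 2 * (3 * z ^+ 2 + 2 * z * y + y ^+ 2) +
    m * (3 * z ^+ 2 + 6 * z * y + 3 * y ^+ 2) + (z ^+ 2 + 2 * z * y + 3 * y ^+ 2)))%R.
  by field; rewrite gt_eqF.
have m1 := ltW m0.
have zy := mulr_ge0 z0 y0; have z2 := sqr_ge0 z; have y2 := sqr_ge0 y.
apply: mulr_ge0; first by rewrite mulr_ge0 ?sqr_ge0.
apply: addr_ge0; last by lra.
apply: addr_ge0; apply: mulr_ge0; rewrite ?exprn_ge0//; lra.
Qed.

(** This sums |k_1 + ... + k_m|^4 <= m^3 (|k_1|^4 + ... + |k_m|^4), for m = n + 1, against the
    product of the A's: each of the m terms contributes a^n W. The inequality is applied one
    convolution factor at a time. *)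
Lemma moment4_cpow A (a W : R) n : (forall k, 0 <= A k) ->
  \esum_(k in [set: K]) A k = a%:E ->
  \esum_(k in [set: K]) ((q k ^+ 4)%:E * A k) = W%:E ->
  \esum_(k in [set: K]) ((q k ^+ 4)%:E * cpow A n.+1 k) <=
    ((n.+1%:R ^+ 4) * a ^+ n * W)%:E.
Proof.
move=> A0 Aa AW.
have q40 k : 0 <= (q k ^+ 4)%:E by rewrite lee_fin exprn_ge0.
elim: n => [|n IH].
  rewrite expr0 expr1n !mul1r -AW; apply: ge0_lee_esum => k.
  apply: lee_wpmul2l => //=; rewrite /conv.
  rewrite (esumID [set k])//; last by move=> l _; rewrite mule_ge0 ?lee_fin.
  rewrite setTI esum_set1 ?subrr ?eqxx ?mule1// esum1 ?adde0// => l [_ /= /eqP lk].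
  by rewrite subr_eq0 eq_sym (negbTE lk) mule0.
have c0 := cpow_ge0 n.+1 A0.
rewrite [cpow _ _]/= -/(cpow A n.+1) esum_conv_weight//.
(* [expr4D_le] under the double sum: x = q k belongs to the n + 1 factors already present, y = q l
   to the new one. *)
apply: (@le_trans _ _ (\esum_(l in [set: K]) (A l *
   (n.+2%:R ^+ 3)%:E * ((n.+1%:R ^- 3)%:E * (\esum_(k in [set: K]) ((q k ^+ 4)%:E * cpow A n.+1 k))
     + (q l ^+ 4)%:E * \esum_(k in [set: K]) cpow A n.+1 k)))).
  apply: ge0_lee_esum => l; rewrite -muleA; apply: lee_wpmul2l => //.
  have -> : (n.+1%:R ^- 3)%:E * (\esum_(k in [set: K]) ((q k ^+ 4)%:E * cpow A n.+1 k)) +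
      (q l ^+ 4)%:E * (\esum_(k in [set: K]) cpow A n.+1 k) =
      \esum_(k in [set: K]) ((n.+1%:R ^- 3)%:E * ((q k ^+ 4)%:E * cpow A n.+1 k) +
        (q l ^+ 4)%:E * cpow A n.+1 k).
    rewrite esumD; last 2 first.
    - by move=> k _; apply: mule_ge0; [rewrite lee_fin invr_ge0 exprn_ge0|apply: mule_ge0].
    - by move=> k _; apply: mule_ge0.
    by congr (_ + _); rewrite ge0_esumZl// => [k]; apply: mule_ge0.
  rewrite -ge0_esumZl; last 2 first.
  - by rewrite lee_fin exprn_ge0.
  - move=> k; apply: adde_ge0; last exact: mule_ge0.
    by apply: mule_ge0; [rewrite lee_fin invr_ge0 exprn_ge0|apply: mule_ge0].
  apply: ge0_lee_esum => k.
  have -> : (n.+2%:R ^+ 3)%:E * ((n.+1%:R ^- 3)%:E * ((q k ^+ 4)%:E * cpow A n.+1 k) +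
      (q l ^+ 4)%:E * cpow A n.+1 k) =
      ((n.+2%:R ^+ 3 * (n.+1%:R ^- 3 * q k ^+ 4 + q l ^+ 4))%R)%:E * cpow A n.+1 k.
    rewrite [X in _ * (X + _)]muleA -EFinM -ge0_muleDl; first by rewrite muleA -EFinD -EFinM.
      by rewrite lee_fin mulr_ge0 ?invr_ge0 ?exprn_ge0.
    by rewrite lee_fin exprn_ge0.
  apply: lee_wpmul2r => //; rewrite lee_fin.
  apply: le_trans (_ : (q k + q l) ^+ 4 <= _)%R; first by rewrite lerXn2r// nnegrE// addr_ge0.
  by apply: le_trans (expr4D_le n (q0 k) (q0 l)) _; rewrite [(_ / _)%R]mulrC.
rewrite (esum_cpow _ A0 Aa).
set I := \esum_(k in _) _ in IH *.
have I0 : 0 <= I by apply: esum_ge0 => k _; rewrite mule_ge0.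
have a0 : (0 <= a)%R by rewrite -lee_fin -Aa; apply: esum_ge0.
apply: (@le_trans _ _ (\esum_(l in [set: K]) ((n.+2%:R ^+ 3)%:E *
   ((n.+1%:R * a ^+ n * W)%:E * A l + (a ^+ n.+1)%:E * ((q l ^+ 4)%:E * A l))))).
  apply: ge0_lee_esum => l; rewrite [A l * _]muleC -muleA; apply: lee_wpmul2l.
    by rewrite lee_fin exprn_ge0.
  rewrite ge0_muleDr; last 2 first.
  - by rewrite mule_ge0// lee_fin invr_ge0 exprn_ge0.
  - by rewrite mule_ge0// lee_fin exprn_ge0.
  apply: leeD; last by rewrite muleA muleC [A l * _]muleC.
  rewrite muleC; apply: lee_wpmul2r => //.
  apply: (@le_trans _ _ ((n.+1%:R ^- 3)%:E * (n.+1%:R ^+ 4 * a ^+ n * W)%:E)).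
    by apply: lee_wpmul2l => //; rewrite lee_fin invr_ge0 exprn_ge0.
  rewrite -EFinM lee_fin [leLHS](_ : _ = n.+1%:R * a ^+ n * W)%R//.
  have : (n.+1%:R != 0 :> R)%R by rewrite pnatr_eq0.
  by move: (n.+1%:R)%R => m m0; field.
have W0 : (0 <= W)%R by rewrite -lee_fin -AW; apply: esum_ge0 => k _; rewrite mule_ge0.
have naW : 0 <= (n.+1%:R * a ^+ n * W)%:E by rewrite lee_fin !mulr_ge0 ?exprn_ge0.
have an0 : 0 <= (a ^+ n.+1)%:E by rewrite lee_fin exprn_ge0.
rewrite ge0_esumZl//; last first.
  by move=> l; apply: adde_ge0; rewrite !mule_ge0.
rewrite esumD; last 2 first.
- by move=> l _; rewrite mule_ge0.
- by move=> l _; rewrite !mule_ge0.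
rewrite ge0_esumZl// ge0_esumZl//; last by move=> l; rewrite mule_ge0.
rewrite Aa AW -[X in X + _]EFinM -[X in _ + X]EFinM -EFinD -EFinM lee_fin.
rewrite le_eqVlt; apply/orP; left; apply/eqP; rewrite (exprS a) -[n.+2%:R]natr1.
by move: (n.+1%:R)%R => m; ring.
Qed.

(* n^4/n! = 1/(n-1)! + 7/(n-2)! + 6/(n-3)! + 1/(n-4)! *)
Lemma moment4_cexp2 A (a W : R) : (forall k, 0 <= A k) ->
  \esum_(k in [set: K]) A k = a%:E ->
  \esum_(k in [set: K]) ((q k ^+ 4)%:E * A k) = W%:E ->
  \esum_(k in [set: K]) ((q k ^+ 4)%:E * cexp 2 A k) <=
    ((expR a * (1 + 7 * a + 6 * a ^+ 2 + a ^+ 3) - 1) * W)%:E.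
Proof.
move=> A0 Aa AW.
have a0 : (0 <= a)%R by rewrite -lee_fin -Aa; apply: esum_ge0.
have W0 : (0 <= W)%R.
  by rewrite -lee_fin -AW; apply: esum_ge0 => k _; rewrite mule_ge0// lee_fin exprn_ge0.
rewrite esum_cexp_weight//; last by move=> k; rewrite lee_fin exprn_ge0.
apply: esum_nat_ub => [n|n].
  rewrite mule_ge0//; apply: esum_ge0 => k _.
  by rewrite mule_ge0 ?lee_fin ?exprn_ge0//; exact: cpow_ge0.
apply: (@le_trans _ _ (\sum_(0 <= i < n)
    ((i.+2`!%:R^-1 * i.+2%:R ^+ 4 * a ^+ i.+1) * W)%:E)).
  apply: lee_sum => i _.
  apply: (@le_trans _ _ (((i.+2)`!%:R^-1)%:E * (i.+2%:R ^+ 4 * a ^+ i.+1 * W)%:E)).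
    by rewrite addn2; apply: lee_wpmul2l => //; exact: moment4_cpow.
  by rewrite -EFinM !mulrA.
rewrite sumEFin lee_fin -mulr_suml; apply: ler_wpM2r => //.
pose e i := (a ^+ i / i`!%:R)%R.
have e_ge0 i : (0 <= e i)%R by rewrite divr_ge0// exprn_ge0.
have eE m : (\sum_(0 <= i < m) e i <= expR a)%R.
  apply: (@nondecreasing_cvgn_le R (series (exp_coeff a))); last exact: is_cvg_series_exp_coeff.
  by apply: nondecreasing_series => k _ _; exact: e_ge0.
(* Here n^4/n! is taken at n = i + 2 and multiplied by a^(i+1): the four terms are e (i+1), 7 a e i,
   6 a^2 e (i-1) and a^3 e (i-2), with value 0 for negative indices. *)
apply: (@le_trans _ _ (\sum_(0 <= i < n) (e i.+1 + 7 * a * e i + 6 * a ^+ 2 * (if i is j.+1 then e j else 0)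
    + a ^+ 3 * (if i is j.+2 then e j else 0)))%R).
  apply: ler_sum => i _; rewrite le_eqVlt; apply/orP; left; apply/eqP.
  have f0 j : (j`!%:R != 0 :> R)%R by rewrite pnatr_eq0 -lt0n fact_gt0.
  case: i => [|[|i]]; rewrite /e.
  - by rewrite !factS fact0; field.
  - by rewrite !factS fact0; field.
  - rewrite !(factS, natrM) !exprS; field.
    have i0 : (0 <= i%:R :> R)%R by [].
    by rewrite f0/=; apply/and4P; split; apply/eqP; lra.
rewrite !big_split/= -!mulr_sumr.
(* The missing term e 0 = 1 is the origin of the - 1 in the statement. *)
have s1 : (\sum_(0 <= i < n) e i.+1 <= expR a - 1)%R.
  rewrite lerBrDl; apply: le_trans (eE n.+1).
  have -> : 1%R = e 0%N by rewrite /e expr0 fact0 divr1.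
  by rewrite big_nat_recl.
have s2 : (\sum_(0 <= i < n) (if i is j.+1 then e j else 0) <= expR a)%R.
  case: n => [|n] in s1 *; first by rewrite big_nil expR_ge0.
  by rewrite big_nat_recl//= add0r.
have s3 : (\sum_(0 <= i < n) (if i is j.+2 then e j else 0) <= expR a)%R.
  case: n => [|[|n]] in s1 s2 *; first by rewrite big_nil expR_ge0.
    by rewrite big_nat1 expR_ge0.
  by rewrite big_nat_recl//= big_nat_recl//= !add0r.
apply: (@le_trans _ _ ((expR a - 1) + 7 * a * expR a + 6 * a ^+ 2 * expR a + a ^+ 3 * expR a)%R).
  by rewrite !lerD// ler_wpM2l// ?mulr_ge0 ?exprn_ge0.
by rewrite le_eqVlt; apply/orP; left; apply/eqP; ring.
Qed.

End moment.
End convolution.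

(** * Integration on the torus and uniqueness of Fourier coefficients *)

Section integral_tools.
Context d (T : measurableType d) (R : realType).
Variable mu : {measure set T -> \bar R}.
Implicit Types (D : set T) (f g : T -> R).

Lemma integrable_mul_bounded D f g (M : R) : measurable D ->
  mu.-integrable D (EFin \o f) -> measurable_fun D g ->
  (forall x, D x -> `|g x| <= M) ->
  mu.-integrable D (EFin \o (fun x => f x * g x)).
Proof.
move=> mD fi mg gM.
have -> : EFin \o (fun x => f x * g x) = ((EFin \o f) \* (EFin \o g))%E.
  by apply/funext => x; rewrite /= EFinM.
apply: integrableMl => //.
exists M; split; first exact: num_real.
by move=> N MN x Dx; apply: le_trans (ltW MN); exact: gM.
Qed.

Lemma integrable_scale D f (c : R) : measurable D ->
  mu.-integrable D (EFin \o f) -> mu.-integrable D (EFin \o (fun x => c * f x)).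
Proof.
move=> mD fi; apply: (@eq_integrable _ _ _ mu D mD (fun x => c%:E * (EFin \o f) x)%E).
  by move=> x _; rewrite /= EFinM.
exact: integrableZl.
Qed.

Lemma integrable_add D f g : measurable D ->
  mu.-integrable D (EFin \o f) -> mu.-integrable D (EFin \o g) ->
  mu.-integrable D (EFin \o (fun x => f x + g x)).
Proof.
move=> mD fi gi; apply: (@eq_integrable _ _ _ mu D mD ((EFin \o f) \+ (EFin \o g))%E).
  by move=> x _; rewrite /= EFinD.
exact: integrableD.
Qed.

Lemma integrable_sub D f g : measurable D ->
  mu.-integrable D (EFin \o f) -> mu.-integrable D (EFin \o g) ->
  mu.-integrable D (EFin \o (fun x => f x - g x)).
Proof.
move=> mD fi gi; apply: (@eq_integrable _ _ _ mu D mD ((EFin \o f) \- (EFin \o g))%E).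
  by move=> x _; rewrite /= EFinB.
exact: integrableB.
Qed.

Lemma integrable_bigsum D (J : Type) (s : seq J) (h : J -> T -> R) : measurable D ->
  (forall j, mu.-integrable D (EFin \o h j)) ->
  mu.-integrable D (EFin \o (fun x => \sum_(j <- s) h j x)).
Proof.
move=> mD hi; apply: (@eq_integrable _ _ _ mu D mD (fun x => \sum_(j <- s) (EFin \o h j) x)%E).
  by move=> x _; rewrite /= sumEFin.
by apply: integrable_sum => // j _; exact: hi.
Qed.

Lemma Rintegral_bigsum D (J : Type) (s : seq J) (h : J -> T -> R) : measurable D ->
  (forall j, mu.-integrable D (EFin \o h j)) ->
  \int[mu]_(x in D) (\sum_(j <- s) h j x) = \sum_(j <- s) \int[mu]_(x in D) h j x.
Proof.
move=> mD hi; elim: s => [|j s IH].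
  under eq_Rintegral do rewrite big_nil.
  by rewrite big_nil /Rintegral integral0.
under eq_Rintegral do rewrite big_cons.
by rewrite RintegralD// ?IH ?big_cons//; exact: integrable_bigsum.
Qed.

Lemma Rdominated_convergence D (f_ : nat -> T -> R) f g : measurable D ->
  (forall n, measurable_fun D (f_ n)) -> measurable_fun D f ->
  {ae mu, forall x, D x -> f_ n x @[n --> \oo] --> f x} ->
  mu.-integrable D (EFin \o g) ->
  (forall n x, D x -> `|f_ n x| <= g x) ->
  mu.-integrable D (EFin \o f) /\
  \int[mu]_(x in D) f_ n x @[n --> \oo] --> \int[mu]_(x in D) f x.
Proof.
move=> mD mf_ mf cf gi fg.
have cf' : {ae mu, forall x, D x -> (f_ n x)%:E @[n --> \oo] --> (f x)%:E}.
  by apply: filterS cf => x H Dx; apply: cvg_EFin; [exact: nearW|exact: H].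
have fg' : {ae mu, forall x (n : nat), D x -> (`|(f_ n x)%:E| <= (g x)%:E)%E}.
  by apply: aeW => x n Dx; rewrite lee_fin; exact: fg.
have [fi _ cv] := @dominated_convergence _ _ _ mu D mD (fun n => EFin \o f_ n)
  (EFin \o f) (EFin \o g) (fun n => (measurable_EFinP _ _).2 (mf_ n))
  ((measurable_EFinP _ _).2 mf) cf' gi fg'.
split => //.
rewrite /Rintegral; apply: fine_cvg.
by rewrite fineK//; exact: integrable_fin_num.
Qed.

End integral_tools.

Lemma measurable_cos (R : realType) : measurable_fun setT (@cos R).
Proof. by apply: continuous_measurable_fun; exact: continuous_cos. Qed.

Lemma measurable_sin (R : realType) : measurable_fun setT (@sin R).
Proof. by apply: continuous_measurable_fun; exact: continuous_sin. Qed.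

Section interval_measure.
Variable R : realType.
Local Notation I := (@interval_measure R).
Local Notation leb := (@lebesgue_measure R).
Local Notation D := (`[- pi : R, pi]%classic).

Lemma interval_measureC : I (~` D) = 0%E.
Proof. by rewrite /interval_measure /mrestr setICl measure0. Qed.

Lemma interval_measure_sub A : measurable A -> A `<=` D -> I A = leb A.
Proof. by move=> mA AD; rewrite /interval_measure /mrestr setIidl. Qed.

Lemma interval_measureT : I setT = (2 * pi)%:E.
Proof.
rewrite /interval_measure /mrestr setTI lebesgue_measure_itv/= lte_fin.
by rewrite gtrN ?pi_gt0// -EFinB opprK mulr_natl mulr2n.
Qed.

Lemma ge0_integral_interval_measure (f : measurableTypeR R -> \bar R) : measurable_fun setT f ->
  (forall x, 0 <= f x)%E -> (\int[I]_x f x = \int[leb]_(x in D) f x)%E.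
Proof.
move=> mf f0.
rewrite [LHS](@ge0_negligible_integral _ _ R (@interval_measure R) setT (~` D) f)//; last exact: interval_measureC.
  rewrite setDE setCK setTI; apply: eq_measure_integral => A mA AD.
  exact: interval_measure_sub.
exact: measurableC.
Qed.

Lemma integrable_interval_measure (f : measurableTypeR R -> R) : measurable_fun setT f ->
  I.-integrable setT (EFin \o f) <-> leb.-integrable D (EFin \o f).
Proof.
move=> mf; split => /integrableP[mf' fi]; apply/integrableP; split.
- exact: (measurable_funS _ _ mf').
- by rewrite -ge0_integral_interval_measure//; apply: measurableT_comp => //; exact: measurableT_comp.
- exact: measurableT_comp.
- by rewrite ge0_integral_interval_measure//; apply: measurableT_comp => //; exact: measurableT_comp.
Qed.

End interval_measure.

(** * Uniqueness of Fourier coefficients in dimension one *)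

Section fourier_uniqueness_1d.
Variable R : realType.
Local Notation leb := (@lebesgue_measure R).
Local Notation D := (`[- pi : R, pi]%classic).
Variable f : R -> R.
Hypothesis fi : leb.-integrable D (EFin \o f).
Hypothesis f0 : forall (n : int) (th : R),
  \int[leb]_(x in D) (f x * cos (n%:~R * x + th)) = 0.

Let mcos (n : int) (th : R) : measurable_fun D (fun x : R => cos (n%:~R * x + th)).
Proof.
apply: measurable_funTS; apply: measurableT_comp; first exact: measurable_cos.
by apply: measurable_funD => //; exact: measurable_funM.
Qed.

Let mcosX (m : R) j : measurable_fun D (fun x : R => cos (x - m) ^+ j).
Proof.
apply: measurable_funX; apply: measurable_funTS.
apply: measurableT_comp; first exact: measurable_cos.
exact: measurable_funB.
Qed.

Let int_cosX (m : R) j (n : int) th : leb.-integrable D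
  (EFin \o (fun x => f x * (cos (x - m) ^+ j * cos (n%:~R * x + th)))).
Proof.
apply: (@integrable_mul_bounded _ _ _ _ _ _ _ 1) => //.
  exact: measurable_funM (mcosX m j) (mcos n th).
move=> x _; rewrite normrM mulr_ile1// ?normrX ?exprn_ile1// ?normr_ge0//;
  by rewrite ler_norml cos_geN1 cos_le1.
Qed.

(** Induction on j: cos (x - m) times cos (n x + th) is half the sum of two cosines of frequencies n
    + 1 and n - 1. The phase th must be arbitrary for this. *)
Lemma integral_trig_monomial (m : R) j (n : int) th :
  \int[leb]_(x in D) (f x * (cos (x - m) ^+ j * cos (n%:~R * x + th))) = 0.
Proof.
elim: j n th => [|j IH] n th.
  by rewrite -(f0 n th); apply: eq_Rintegral => x _; rewrite expr0 mul1r.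
transitivity (\int[leb]_(x in D) (2^-1 * (f x * (cos (x - m) ^+ j * cos ((n + 1)%:~R * x + (th - m))))
  + 2^-1 * (f x * (cos (x - m) ^+ j * cos ((n - 1)%:~R * x + (th + m)))))).
  apply: eq_Rintegral => x _.
  have -> : (n + 1)%:~R * x + (th - m) = (n%:~R * x + th) + (x - m).
    by rewrite rmorphD/=; ring.
  have -> : (n - 1)%:~R * x + (th + m) = (n%:~R * x + th) - (x - m).
    by rewrite rmorphB/=; ring.
  rewrite exprS (cosD (n%:~R * x + th)) (cosB (n%:~R * x + th)); by field.
have ii a b : leb.-integrable D
    (EFin \o (fun x => 2^-1 * (f x * (cos (x - m) ^+ j * cos (a%:~R * x + b))))).
  by apply: integrable_scale => //; exact: int_cosX.
rewrite RintegralD//.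
by rewrite !RintegralZl// !IH mulr0 addr0.
Qed.

Lemma integral_trig_poly (m : R) (p : {poly R}) :
  \int[leb]_(x in D) (f x * p.[cos (x - m)]) = 0.
Proof.
transitivity (\int[leb]_(x in D)
    (\sum_(i < size p) p`_i * (f x * (cos (x - m) ^+ i * cos (0%:~R * x + 0))))).
  apply: eq_Rintegral => x _; rewrite horner_coef mulr_sumr; apply: eq_bigr => i _.
  by rewrite mul0r addr0 cos0 mulr1 mulrCA.
rewrite Rintegral_bigsum//; last by move=> i; apply: integrable_scale => //; exact: int_cosX.
by rewrite big1// => i _; rewrite RintegralZl// integral_trig_monomial mulr0.
Qed.

(* The polynomials (1 - s^n)^(2^n) converge to the indicator of s < 1/2, boundedly on [0,1]. *)
Lemma bernstein_step_lt (s : R) : 0 <= s < 2^-1 ->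
  (1 - s ^+ n) ^+ (2 ^ n) @[n --> \oo] --> (1 : R).
Proof.
move=> /andP[s0 s1].
apply: (@squeeze_cvgr _ _ _ _ (fun n => 1 - (2 * s) ^+ n) (cst 1)); last exact: cvg_cst.
  near=> n.
  have sn0 : 0 <= s ^+ n by rewrite exprn_ge0.
  have sn1 : s ^+ n <= 1 by rewrite exprn_ile1//; lra.
  apply/andP; split; last by rewrite exprn_ile1// ?subr_ge0// lerBlDr lerDl.
  (* Bernoulli's inequality; at y = s^n and k = 2^n the product k y is (2 s)^n, which tends to 0. *)
  have H (y : R) k : 0 <= y <= 1 -> 1 - k%:R * y <= (1 - y) ^+ k.
    move=> /andP[y0 y1]; elim: k => [|k IH]; first by rewrite expr0 mul0r subr0.
    rewrite exprSr -natr1.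
    apply: le_trans (_ : (1 - k%:R * y) * (1 - y) <= _).
      have : 0 <= k%:R * y ^+ 2 :> R by rewrite mulr_ge0// exprn_ge0.
      by nra.
    by apply: ler_wpM2r IH; rewrite subr_ge0.
  by have := H (s ^+ n) (2 ^ n)%N; rewrite sn0 sn1 natrX exprMn; exact.
rewrite -[X in _ --> X]subr0; apply: cvgB; first exact: cvg_cst.
apply: cvg_expr; rewrite ger0_norm ?mulr_ge0//; lra.
Unshelve. all: by end_near. Qed.

Lemma bernstein_step_gt (s : R) : 2^-1 < s <= 1 ->
  (1 - s ^+ n) ^+ (2 ^ n) @[n --> \oo] --> (0 : R).
Proof.
move=> /andP[s1 s2].
have s0 : 0 < 2 * s by lra.
apply: (@squeeze_cvgr _ _ _ _ (cst 0) (fun n => ((2 * s)^-1) ^+ n)); last 2 first.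
- exact: cvg_cst.
- apply: cvg_expr; rewrite ger0_norm ?invr_ge0; last by lra.
  by rewrite invf_lt1//; lra.
near=> n.
have sn0 : 0 <= s ^+ n by rewrite exprn_ge0//; lra.
have sn1 : s ^+ n <= 1 by rewrite exprn_ile1//; lra.
apply/andP; split; first by rewrite exprn_ge0// subr_ge0.
(* That is, (1 - y)^k <= 1 / (1 + k y), where k y = (2 s)^n now tends to infinity. *)
have H (y : R) k : 0 <= y <= 1 -> (1 - y) ^+ k * (1 + k%:R * y) <= 1.
  move=> /andP[y0 y1]; elim: k => [|k IH]; first by rewrite expr0 mul0r addr0 mulr1.
  apply: le_trans IH; rewrite exprSr -mulrA; apply: ler_wpM2l.
    by rewrite exprn_ge0// subr_ge0.
  rewrite -natr1; have : 0 <= k%:R * y ^+ 2 :> R by rewrite mulr_ge0// exprn_ge0.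
  by have := sqr_ge0 y; nra.
have := H (s ^+ n) (2 ^ n)%N; rewrite sn0 sn1 natrX -exprMn => /(_ isT) h.
rewrite exprVn -[leRHS]div1r ler_pdivlMr ?exprn_gt0//; apply: le_trans h; apply: ler_wpM2l.
  by rewrite exprn_ge0// subr_ge0.
by rewrite lerDr.
Unshelve. all: by end_near. Qed.

Let ltr_cos_in (a b : R) : 0 <= a -> a < b -> b <= pi -> cos b < cos a.
Proof.
move=> a0 ab bpi; rewrite ltr_cos// in_itv/=; first by rewrite a0 (le_trans (ltW ab)).
by rewrite bpi andbT (le_trans a0)// ltW.
Qed.

(** The indicator of [-pi, y] is a bounded almost everywhere limit of polynomials in cos (x - m),
    with m the midpoint of the interval and w its half-length: modulo the period, cos (x - m) > cos
    w exactly inside the interval. *)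
Lemma integral_initial_eq0 (y : R) : - pi <= y <= pi ->
  \int[leb]_(x in `[- pi, y]) f x = 0.
Proof.
move=> /andP[y1 y2].
pose m := (y - pi) / 2; pose w := (y + pi) / 2.
(* h is below 1/2 inside the interval and above 1/2 outside; the division by 4 keeps it in [0, 1],
   as the step polynomials require. *)
pose h (x : R) := 2^-1 - (cos (x - m) - cos w) / 4.
pose p n : {poly R} := (1 - (2^-1%:P - 4^-1%:P * ('X - (cos w)%:P)) ^+ n) ^+ (2 ^ n).
have pE n x : (p n).[cos (x - m)] = (1 - h x ^+ n) ^+ (2 ^ n).
  rewrite /p !(horner_exp, hornerE)/=; congr ((1 - _ ^+ _) ^+ _).
  by rewrite /h; field.
have h01 x : 0 <= h x <= 1.
  rewrite /h; have := cos_geN1 (x - m); have := cos_le1 (x - m).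
  have := cos_geN1 w; have := cos_le1 w; lra.
have mh : measurable_fun D h.
  apply: measurable_funB => //; apply: measurable_funM => //; apply: measurable_funB => //.
  apply: measurable_funTS; apply: measurableT_comp; first exact: measurable_cos.
  exact: measurable_funB.
have cv := @Rdominated_convergence _ _ _ leb D
  (fun n x => f x * (1 - h x ^+ n) ^+ (2 ^ n)) (fun x => f x * \1_(`[- pi, y]%classic) x)
  (fun x => `|f x|) (measurable_itv _).
suff : \int[leb]_(x in D) (f x * \1_(`[- pi, y]%classic) x) = 0.
  move=> <-; rewrite Rintegral_mkcond [RHS]Rintegral_mkcond; apply: eq_Rintegral => x _.
  rewrite !patchE indicE; case: ifPn => [xy|xy].
    rewrite mulr1 ifT// inE; move: xy; rewrite inE/= !in_itv/= => /andP[-> xy].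
    by rewrite (le_trans xy).
  by rewrite mulr0 if_same.
have mfD : measurable_fun D f by case/integrableP : fi => /measurable_EFinP.
suff cv0 : (fun n : nat => \int[leb]_(x in D) (f x * (1 - h x ^+ n) ^+ (2 ^ n))) @ \oo --> (0 : R).
  apply: cvg_unique cv0; first exact: Rhausdorff.
  apply: (cv _ _ _ _ _).2 => //.
  - move=> n; apply: measurable_funM => //; apply: measurable_funX.
    by apply: measurable_funB => //; exact: measurable_funX.
  - by apply: measurable_funM => //; exact: measurable_indic.
  (* At -pi, y and pi the value of h is 1/2, where the limit is left aside. *)
  - exists ([set - pi] `|` ([set y] `|` [set pi])); split.
    + by apply: measurableU => //; exact: measurableU.
    + apply: countable_lebesgue_measure0; apply: finite_set_countable.
      by rewrite !finite_setU; split; [|split]; exact: finite_set1.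
    + move=> x /= /not_implyP[xD ncv]; apply: contrapT => /not_orP[/eqP x1 /not_orP[/eqP x2 /eqP x3]].
      apply: ncv; move: xD; rewrite in_itv/= => /andP[xl xr].
      have {}xl : - pi < x by rewrite lt_neqAle eq_sym x1.
      have {}xr : x < pi by rewrite lt_neqAle x3.
      apply: cvgMr; rewrite indicE.
      have wpi : 0 <= w <= pi by rewrite /w; lra.
      have [xy|xy] := ltP x y.
        rewrite mem_set/= ?in_itv/= ?(ltW xl) ?(ltW xy)//.
        apply: bernstein_step_lt.
        have [xm|xm] := leP 0 (x - m).
          have : cos w < cos (x - m) by apply: ltr_cos_in => //; rewrite ?/w /m; lra.
          by have := h01 x; rewrite /h; lra.
        have : cos w < cos (x - m).
          by rewrite -[cos (x - m)]cosN; apply: ltr_cos_in; rewrite /m ?/w in xm wpi *; lra.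
        by have := h01 x; rewrite /h; lra.
      have {}xy : y < x by rewrite lt_neqAle eq_sym x2.
      rewrite memNset/= ?in_itv/=; last by move=> /andP[_]; rewrite leNgt xy.
      apply: bernstein_step_gt.
      suff : cos (x - m) < cos w by have := h01 x; rewrite /h; lra.
      have [xm|xm] := leP (x - m) pi.
        by apply: ltr_cos_in; rewrite /m ?/w in xm wpi *; lra.
      (* Beyond pi the cosine increases again; the reflection brings the argument back to the
         interval where it decreases. *)
      have -> : cos (x - m) = cos (pi *+ 2 - (x - m)).
        by rewrite -cosN -[in LHS](cosD2pi (- (x - m))) addrC.
        have ew : w = (y + pi) / 2 by [].
      have em : m = (y - pi) / 2 by [].
      by rewrite mulr2n; apply: ltr_cos_in; lra.
  - have := fi => /integrable_norm; exact.
  - move=> n x Dx; rewrite normrM ler_piMr// normrX exprn_ile1//.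
    have [h0 h1] := andP (h01 x).
    by rewrite ger0_norm ?subr_ge0 ?exprn_ile1// gerBl exprn_ge0.
rewrite (_ : (fun n => _) = cst 0); first exact: cvg_cst.
  apply/funext => n; rewrite -[RHS](integral_trig_poly m (p n)).
  by apply: eq_Rintegral => x _; rewrite pE.
Qed.

(** The primitive of f, extended by 0 outside [-pi, pi], vanishes identically, hence so does its
    derivative, which equals the extension almost everywhere. *)
Lemma fourier_uniqueness_1d : {ae leb, forall x, D x -> f x = 0}.
Proof.
pose g : R -> R := f \_ D.
have pp : - pi <= pi :> R by rewrite lerNl -subr_ge0 opprK addr_ge0// pi_ge0.
have gi : leb.-integrable setT (EFin \o g).
  rewrite /g -restrict_EFin; apply/integrable_restrict => //=; by rewrite setTI.
have F0 y : \int[leb]_(t in `]-oo, y]) g t = 0.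
  rewrite -Rintegral_mkcondr.
  have [yl|yl] := ltP y (- pi).
    rewrite (_ : _ `&` _ = set0) ?Rintegral_set0//.
    apply/seteqP; split => x //=; rewrite !in_itv/= => -[xy /andP[px _]].
    by have := lt_le_trans yl px; rewrite ltNge xy.
  have [yr|yr] := leP y pi.
    rewrite (_ : _ `&` _ = `[- pi, y]%classic) ?integral_initial_eq0 ?yl//.
    apply/seteqP; split => x /=; rewrite !in_itv/=; first by case=> -> /andP[->].
    by move=> /andP[-> xy]; rewrite xy (le_trans xy).
  rewrite (_ : _ `&` _ = D) ?integral_initial_eq0 ?lexx ?pp//.
  apply/seteqP; split => x /=; rewrite !in_itv/=; first by case.
  by move=> /andP[-> xy]; rewrite xy (le_trans xy)// ltW.
have gl : locally_integrable setT g.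
  by apply: integrable_locally.
have ig y : leb.-integrable `]-oo, y] (EFin \o g).
  by apply: integrableS gi.
have := @FTC1Ny R g ig.
move=> /(_ gl); apply: filterS; first exact: (ae_filter_ringOfSetsType leb).
move=> x [_].
rewrite (_ : (fun x => _) = cst 0); last by apply/funext => z; rewrite F0.
by rewrite derive1_cst /g patchE => + xD; rewrite mem_set.
Qed.

End fourier_uniqueness_1d.

(** * Integration on the torus, one coordinate at a time *)

Section torus_integral.
Variable R : realType.
Local Notation I := (@interval_measure R).
Local Notation leb := (@lebesgue_measure R).
Local Notation D := (`[- pi : R, pi]%classic).
Local Notation mu d := (torus_measure R d).

Lemma integral_interval_measure (f : measurableTypeR R -> \bar R) :
  measurable_fun setT f -> (\int[I]_x f x = \int[leb]_(x in D) f x)%E.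
Proof.
move=> mf; rewrite integralE [RHS]integralE; congr (_ - _)%E.
  by apply: ge0_integral_interval_measure => //; exact: measurable_funepos.
by apply: ge0_integral_interval_measure => //; exact: measurable_funeneg.
Qed.

Definition set_coord d (x : d.-tuple R) (i : 'I_d) (s : R) : d.-tuple R :=
  [tuple if j == i then s else tnth x j | j < d].

Lemma set_coord0 n (s t : R) (y : n.-tuple R) :
  set_coord [tuple of s :: y] ord0 t = [tuple of t :: y].
Proof.
apply: eq_from_tnth => j; rewrite tnth_mktuple.
case: (unliftP ord0 j) => [k ->|->]; last by rewrite eqxx.
by rewrite -(inj_eq val_inj) /= !tnthS.
Qed.

Lemma set_coordS n (s t : R) (y : n.-tuple R) (i : 'I_n) :
  set_coord [tuple of s :: y] (lift ord0 i) t = [tuple of s :: set_coord y i t].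
Proof.
apply: eq_from_tnth => j; rewrite tnth_mktuple.
case: (unliftP ord0 j) => [k ->|->].
  by rewrite (inj_eq lift_inj) !tnthS tnth_mktuple.
by rewrite -(inj_eq val_inj) /= !tnth0.
Qed.

Lemma measurable_cons1 n (y : n.-tuple R) :
  measurable_fun setT (fun x : measurableTypeR R => @cons_pair R n (x, y)).
Proof.
by apply: measurable_cons; [exact: measurable_id|exact: measurable_cst].
Qed.

Lemma integrable_torusS n (f : n.+1.-tuple R -> \bar R) :
  (mu n.+1).-integrable setT f ->
  (I \x mu n)%E.-integrable setT (f \o @cons_pair R n).
Proof.
move=> /integrableP[mf fi]; apply/integrableP; split.
  by apply: measurableT_comp => //; exact: measurable_cons_pair.
have := @ge0_integral_pushforward _ _ _ _ R (@cons_pair R n) (@measurable_cons_pair R n)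
  (I \x mu n)%E setT (abse \o f) measurableT (measurableT_comp (@abse_measurable _ setT) mf).
by rewrite preimage_setT => <- // y _; exact: abse_ge0.
Qed.

Lemma integral_torusS n (f : n.+1.-tuple R -> \bar R) :
  (mu n.+1).-integrable setT f ->
  (\int[mu n.+1]_x f x = \int[I \x mu n]_x (f (cons_pair x)))%E.
Proof.
move=> fi.
have := @integral_pushforward _ _ _ _ R (@cons_pair R n) (@measurable_cons_pair R n)
  (I \x mu n)%E setT f (measurable_int _ fi).
by rewrite preimage_setT => -> //; exact: integrable_torusS.
Qed.

Lemma ge0_integral_torusS n (f : n.+1.-tuple R -> \bar R) :
  measurable_fun setT f -> (forall x, 0 <= f x)%E ->
  (\int[mu n.+1]_x f x = \int[I \x mu n]_x (f (cons_pair x)))%E.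
Proof.
move=> mf f0.
have := @ge0_integral_pushforward _ _ _ _ R (@cons_pair R n) (@measurable_cons_pair R n)
  (I \x mu n)%E setT f measurableT mf.
by rewrite preimage_setT => -> //.
Qed.

(** The torus measure grows by one coordinate in front. If i is that coordinate, Fubini's theorem
    integrates it first; otherwise the induction hypothesis applies to almost every slice. *)
Lemma torus_integral_coord0 d (i : 'I_d) (G : d.-tuple R -> R) :
  (mu d).-integrable setT (EFin \o G) ->
  (forall x, \int[leb]_(s in D) (G (set_coord x i s))%:E = 0)%E ->
  (\int[mu d]_x (G x)%:E = 0)%E.
Proof.
elim: d i G => [[]//|n IH] i G Gi G0.
have mG : measurable_fun setT G by apply/measurable_EFinP; exact: measurable_int Gi.
have Gi' := integrable_torusS Gi.
rewrite [LHS](integral_torusS Gi).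
case: (unliftP ord0 i) => [j|] ij; last first.
  rewrite -(integral21_prod_meas1 Gi').
  rewrite [LHS](_ : _ = \int[mu n]_x cst 0 x)%E; last first.
    apply: eq_integral => y _; rewrite /fubini_G integral_interval_measure; last first.
      apply/measurable_EFinP; apply: measurableT_comp => //; exact: measurable_cons1.
    rewrite -[RHS](G0 [tuple of 0 :: y]) ij; apply: eq_integral => s _.
    by rewrite set_coord0.
  by rewrite integral0.
rewrite -(integral12_prod_meas1 Gi').
apply: (@eq_trans _ _ (\int[I]_x cst 0 x)%E); last by rewrite integral0.
apply: ae_eq_integral => //.
  exact: (measurable_fubini_F Gi').
have := ae_integrable1 Gi'; apply: filterS => x xi _.
apply: (IH j (fun y => G (cons_pair (x, y)))) => // y.
rewrite -[RHS](G0 [tuple of x :: y]) ij; apply: eq_integral => s _.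
by rewrite set_coordS.
Qed.

Lemma torus_measureT d : mu d setT = ((2 * pi) ^+ d)%:E.
Proof.
elim: d => [|n IH]; first by rewrite expr0 /= /dirac indicE in_setT.
transitivity ((I \x mu n)%E setT); first by [].
transitivity (I setT * mu n setT)%E.
  by rewrite -[LHS]/((I \x mu n)%E setT) -setXTT product_measure1E.
by rewrite [X in (X * _)%E]interval_measureT IH exprS EFinM.
Qed.

Definition torus_box d : set (d.-tuple R) := [set x | forall i, - pi <= tnth x i <= pi].

Lemma measurable_torus_box d : measurable (@torus_box d).
Proof.
rewrite (_ : @torus_box d = \big[setI/setT]_(i < d) ((fun x => tnth x i) @^-1` D)).
  apply: bigsetI_measurable => i _; rewrite -[X in measurable X]setTI.
  exact: (measurable_tnth i).
apply/seteqP; split => x.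
  by move=> H; rewrite -bigcap_seq => i _ /=; rewrite in_itv/=; exact: H.
rewrite -bigcap_seq => H i; have /= := H i; rewrite in_itv/=; apply.
exact: mem_index_enum.
Qed.

Lemma torus_boxC d : mu d (~` @torus_box d) = 0%E.
Proof.
elim: d => [|n IH].
  by rewrite /= /dirac indicE memNset//= => H; apply: H => -[].
transitivity ((I \x mu n)%E (@cons_pair R n @^-1` (~` @torus_box n.+1))); first by [].
apply/eqP; rewrite eq_le measure_ge0 andbT.
have mD : measurable (~` D : set (measurableTypeR R)) by apply: measurableC.
have mB : measurable (~` @torus_box n) by apply: measurableC; exact: measurable_torus_box.
apply: (@le_trans _ _ ((I \x mu n)%E ((~` D `*` setT) `|` (setT `*` ~` @torus_box n)))).
  apply: le_measure; rewrite ?inE.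
  - rewrite -[X in measurable X]setTI; apply: measurable_cons_pair => //.
    by apply: measurableC; exact: measurable_torus_box.
  - by apply: measurableU; apply: measurableX.
  move=> [x y] /= H; apply: contrapT => /not_orP[/not_andP[xD|//] /not_andP[//|yB]].
  apply: H => i; case: (unliftP ord0 i) => [j ->|->].
    by rewrite tnthS; move: yB => /contrapT; exact.
  by rewrite tnth0; move: xD => /contrapT/=; rewrite in_itv.
have h1 : (I \x mu n)%E (~` D `*` setT) = 0%E.
  by rewrite product_measure1E// [X in (X * _)%E]interval_measureC mul0e.
have h2 : (I \x mu n)%E (setT `*` ~` @torus_box n) = 0%E.
  by rewrite product_measure1E// [X in (_ * X)%E]IH mule0.
apply: (le_trans (measureU2 _ _ _)); try by apply: measurableX.
by rewrite [X in (X + _)%E]h1 [X in (_ + X)%E]h2 adde0.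
Qed.

Lemma torus_ae_box d : {ae mu d, forall x, @torus_box d x}.
Proof.
exists (~` @torus_box d); split => //.
  by apply: measurableC; exact: measurable_torus_box.
exact: torus_boxC.
Qed.

Lemma integrable_bounded_box d (G : d.-tuple R -> R) (M : R) :
  measurable_fun setT G -> (forall x, torus_box x -> `|G x| <= M) ->
  (mu d).-integrable setT (EFin \o G).
Proof.
move=> mG GM; apply/integrableP; split; first exact/measurable_EFinP.
apply: (@le_lt_trans _ _ (\int[mu d]_x (`|M|)%:E)%E).
  apply: ae_ge0_le_integral => //.
  - by apply: measurableT_comp => //; exact/measurable_EFinP.
  - by have := @torus_ae_box d; apply: filterS => x xB _; rewrite /= lee_fin (le_trans (GM _ xB))// ler_norm.
by rewrite integral_cst// [X in (_ * X)%E]torus_measureT -EFinM ltry.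
Qed.

End torus_integral.

Section continuous_torus.
Variables (R : realType) (d : nat).
Implicit Types psi : 'rV[R]_d -> R.

(** Tuples carry the product sigma-algebra and rows the topology. The bridge is a pointwise limit of
    functions of the integer parts of (n + 1) x, which take countably many values, each on a
    measurable box. *)
Lemma measurable_continuous_row psi : continuous psi ->
  measurable_fun setT (psi \o @row_of R d).
Proof.
move=> cpsi.
pose q n (x : d.-tuple R) : d.-tuple int := [tuple Num.floor (n.+1%:R * tnth x i) | i < d].
pose h n (m : d.-tuple int) : R := psi (\row_i ((tnth m i)%:~R / n.+1%:R)).
apply: (@measurable_fun_cvg _ _ _ _ (fun n => h n \o q n)).
  move=> n _ B mB; rewrite setTI.
  rewrite (_ : _ @^-1` B = \bigcup_(m : d.-tuple int)
    (if pselect (B (h n m)) then [set x | q n x = m] else set0)); last first.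
    apply/seteqP; split => x /=.
      by move=> Bx; exists (q n x) => //; case: pselect.
    by move=> [m _]; case: pselect => //= Bm ->.
  apply: countable_bigcupT_measurable => [|m]; first exact: countableP.
  case: pselect => //= Bm.
  rewrite (_ : [set x | _] = \big[setI/setT]_(i < d) ((fun x => tnth x i) @^-1`
      `[((tnth m i)%:~R / n.+1%:R : R), ((tnth m i + 1)%:~R / n.+1%:R)[%classic)).
    apply: bigsetI_measurable => i _; rewrite -[X in measurable X]setTI.
    exact: (measurable_tnth i).
  have key (x : d.-tuple R) i : (Num.floor (n.+1%:R * tnth x i) == tnth m i) =
      (((tnth m i)%:~R / n.+1%:R <= tnth x i) && (tnth x i < (tnth m i + 1)%:~R / n.+1%:R)).
    by rewrite ler_pdivrMr// ltr_pdivlMr// -floor_eq ?num_real// mulrC.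
  apply/seteqP; split => x /=; rewrite -bigcap_seq.
    by move=> qm i _ /=; rewrite in_itv/= -key -qm tnth_mktuple.
  move=> H; apply: eq_from_tnth => i; rewrite tnth_mktuple; apply/eqP.
  by rewrite key; have /= := H i; rewrite in_itv/=; apply; exact: mem_index_enum.
move=> x _ /=.
suff cq : (fun n => \row_i ((tnth (q n x) i)%:~R / n.+1%:R) : 'rV[R]_d) @ \oo --> row_of x.
  exact: cvg_comp cq (cpsi _).
apply/cvg_ballP => e e0; near=> n; split => // i j.
rewrite !mxE tnth_mktuple /ball/=.
have n0 : 0 < n.+1%:R :> R by [].
set y := tnth x j; have /andP[h1 h2] := floor_itv (n.+1%:R * y).
rewrite ger0_norm; last by rewrite subr_ge0 ler_pdivrMr// [y * _]mulrC.
rewrite ltrBlDr -ltrBlDl ltr_pdivlMr//.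
apply: (@le_lt_trans _ _ (n.+1%:R * y - 1)); last by rewrite ltrBlDr -intrD1.
rewrite mulrBl mulrC lerD2l lerN2.
near: n; have [N _ HN] := near_infty_natSinv_lt (PosNum e0).
exists N => // n /HN /= ne; apply: ltW.
by rewrite -ltr_pdivrMr// mul1r; exact: ne.
Unshelve. all: by end_near. Qed.

Lemma continuous_bounded_box psi : continuous psi ->
  exists M, forall x, torus_box x -> `|psi (row_of x)| <= M.
Proof.
move=> cpsi.
have cA : compact [set v : 'rV[R]_d | forall i, `[- pi, pi]%classic (v ord0 i)].
  by apply: (@rV_compact R d (fun=> `[- pi, pi]%classic)) => i; exact: segment_compact.
have := compact_bounded (continuous_compact (continuous_subspaceT cpsi) cA).
move=> [M [Mr HM]]; exists (M + 1) => x xB; apply: HM; first by rewrite ltrDl.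
exists (row_of x) => // i /=; rewrite mxE in_itv/=; exact: xB.
Qed.

Lemma integrable_continuous_row psi : continuous psi ->
  (torus_measure R d).-integrable setT (EFin \o (psi \o @row_of R d)).
Proof.
move=> cpsi; have [M HM] := continuous_bounded_box cpsi.
by apply: (integrable_bounded_box (M := M)) => //; exact: measurable_continuous_row.
Qed.

Lemma row_of_set_coord (x : d.-tuple R) i (s : R) :
  row_of (set_coord x i s) = row_of (set_coord x i 0) + s *: delta_mx 0 i.
Proof.
apply/rowP => j; rewrite !mxE !tnth_mktuple eqxx/=.
by case: (j == i); rewrite /= ?mulr1 ?add0r ?mulr0 ?addr0.
Qed.

Lemma is_derive_line (f : 'rV[R]_d -> R) (y v : 'rV[R]_d) (s : R) :
  derivable f (y + s *: v) v ->
  is_derive s 1 (fun t => f (y + t *: v)) ('D_v f (y + s *: v)).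
Proof.
have E : (fun h : R => h^-1 *: ((f \o shift (y + s *: v)) (h *: v) - f (y + s *: v))) =
  (fun h : R => h^-1 *: (((fun t => f (y + t *: v)) \o shift s) (h *: (1 : R)) - f (y + s *: v))).
  apply/funext => h; rewrite /=; congr (_ *: (f _ - _)).
  by rewrite scalerDl addrCA /GRing.scale/= mulr1 addrC.
by rewrite /derive E /derivable E => fd; apply: DeriveDef.
Qed.

(** On each line in direction i the fundamental theorem of calculus leaves the difference of the
    values at pi and -pi, which periodicity cancels. *)
Lemma torus_integral_derive psi (i : 'I_d) : continuous psi ->
  (forall x, derivable psi x (delta_mx 0 i)) ->
  continuous (fun x => 'D_(delta_mx 0 i) psi x) -> Defs.periodic psi ->
  \int[torus_measure R d]_x 'D_(delta_mx 0 i) psi (row_of x) = 0.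
Proof.
move=> cpsi dpsi cdpsi ppsi; rewrite /Rintegral.
rewrite (torus_integral_coord0 (i := i) (G := fun x => 'D_(delta_mx 0 i) psi (row_of x)))//.
  exact: (integrable_continuous_row cdpsi).
move=> x; set y := row_of (set_coord x i 0); pose F (s : R) := psi (y + s *: delta_mx 0 i).
have ppos : (- pi : R) < pi by rewrite gtrN ?pi_gt0.
have dF (s : R) : is_derive s 1 F ('D_(delta_mx 0 i) psi (y + s *: delta_mx 0 i)).
  exact: is_derive_line.
have cline : continuous (fun s : R => y + s *: delta_mx 0 i : 'rV[R]_d).
  by move=> s; apply: cvgD; [exact: cvg_cst|apply: cvgZr_tmp].
have cF : continuous F by move=> s; apply: cvg_comp (cline s) (cpsi _).
rewrite (_ : (fun s => _) = (fun s => ('D_(delta_mx 0 i) psi (y + s *: delta_mx 0 i))%:E)); last first.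
  by apply/funext => s; rewrite row_of_set_coord.
rewrite (continuous_FTC2 (F := F) ppos).
- rewrite -EFinB /F.
  have -> : y + pi *: delta_mx 0 i = y + (- pi) *: delta_mx 0 i + (2 * pi) *: delta_mx 0 i.
    by rewrite -addrA -scalerDl; congr (_ + _ *: _); ring.
  by rewrite ppsi subrr.
- apply: continuous_subspaceT => s.
  exact: cvg_comp (cline s) (cdpsi _).
- split.
  + by move=> s _; exact: (@ex_derive _ _ _ _ _ _ _ (dF s)).
  + by apply: cvg_at_right_filter; exact: cF.
  + by apply: cvg_at_left_filter; exact: cF.
- by move=> s _; rewrite derive1E; exact: (@derive_val _ _ _ _ _ _ _ (dF s)).
Qed.

End continuous_torus.

(** * Plane waves *)

Section waves.
Variables (R : realType) (d : nat).
Local Notation mu := (torus_measure R d).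
Implicit Types (k : d.-tuple int) (x : d.-tuple R) (th : R).

(** Keeping a phase th covers cosine (th = 0) and sine (th = - pi / 2) at once, and differentiation
    merely adds pi / 2 to it. *)
Definition wave k th (y : 'rV[R]_d) : R :=
  cos (\sum_(i < d) (tnth k i)%:~R * y 0 i + th).

Lemma wave_row k th x : wave k th (row_of x) = cos (phase k x + th).
Proof. by rewrite /wave; under eq_bigr do rewrite mxE. Qed.

Lemma phaseD k l x : phase (k + l) x = phase k x + phase l x.
Proof.
rewrite /phase -big_split/=; apply: eq_bigr => i _.
by rewrite tnth_freqD rmorphD mulrDl.
Qed.

Lemma phaseN k x : phase (- k) x = - phase k x.
Proof.
rewrite /phase -sumrN; apply: eq_bigr => i _.
by rewrite tnth_freqN rmorphN mulNr.
Qed.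

Lemma phase0 x : phase 0 x = 0.
Proof. by rewrite /phase big1// => i _; rewrite tnth_freq0 mul0r. Qed.

Lemma measurable_phase k : measurable_fun setT (@phase R d k).
Proof.
apply: measurable_sum => i; apply: measurable_funM => //.
exact: measurable_tnth.
Qed.

Lemma measurable_cos_phase k th : measurable_fun setT (fun x => cos (phase k x + th)).
Proof.
apply: measurableT_comp; first exact: measurable_cos.
by apply: measurable_funD => //; exact: measurable_phase.
Qed.

Lemma norm_cos_le1 (t : R) : `|cos t| <= 1.
Proof. by rewrite ler_norml cos_geN1 cos_le1. Qed.

Lemma norm_sin_le1 (t : R) : `|sin t| <= 1.
Proof. by rewrite ler_norml sin_geN1 sin_le1. Qed.

Lemma continuous_wave k th : continuous (wave k th).
Proof.
move=> y; apply: (@continuous_comp _ _ _ (fun y : 'rV[R]_d =>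
  \sum_(i < d) (tnth k i)%:~R * y 0 i + th) cos); last exact: continuous_cos.
have cs (s : seq 'I_d) : continuous (fun y0 : 'rV[R]_d => \sum_(i <- s) (tnth k i)%:~R * y0 0 i).
  elim: s => [|i s IH] z.
    rewrite (_ : (fun y0 => _) = cst 0); first exact: cst_continuous.
    by apply/funext => y0; rewrite big_nil.
  rewrite (_ : (fun y0 => _) = (fun y0 : 'rV[R]_d => (tnth k i)%:~R * y0 0 i) \+
      (fun y0 => \sum_(i <- s) (tnth k i)%:~R * y0 0 i)); last first.
    by apply/funext => y0; rewrite big_cons.
  apply: continuousD; last exact: IH.
  by apply: continuousM; [exact: cst_continuous|exact: coord_continuous].
have H := cs (index_enum _) y.
by apply: continuousD; [exact: H|exact: cst_continuous].
Qed.

Lemma wave_line k th y i (h : R) :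
  wave k th (h *: delta_mx 0 i + y) =
  cos ((tnth k i)%:~R * h + (\sum_(j < d) (tnth k j)%:~R * y 0 j + th)).
Proof.
rewrite /wave addrA; congr (cos (_ + _)).
under eq_bigr do rewrite !mxE mulrDr.
rewrite big_split/=; congr (_ + _).
rewrite (bigD1 i)//= eqxx mulr1 big1 ?addr0// => j ji.
by rewrite (negbTE ji) !mulr0.
Qed.

Lemma is_derive_wave k th y i :
  is_derive y (delta_mx 0 i) (wave k th) ((tnth k i)%:~R * wave k (th + pi / 2) y).
Proof.
set A := \sum_(j < d) (tnth k j)%:~R * y 0 j + th.
pose g (t : R) := cos ((tnth k i)%:~R * t + A).
have dg : is_derive (0 : R) 1 g ((tnth k i)%:~R * wave k (th + pi / 2) y).
  apply: is_derive_eq; rewrite mulr0 add0r /wave addrA cosDpihalf -/A.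
  by rewrite /GRing.scale/= ?mulr1 ?mulr0 ?addr0 mulrC.
have E : (fun h : R => h^-1 *: ((wave k th \o shift y) (h *: delta_mx 0 i) - wave k th y)) =
  (fun h : R => h^-1 *: ((g \o shift 0) (h *: (1 : R)) - g 0)).
  apply/funext => h; congr (_ *: (_ - _)).
    by rewrite /= wave_line /g /GRing.scale/= mulr1 addr0.
  by rewrite /g mulr0 add0r.
have [dg1 dg2] := (@ex_derive _ _ _ _ _ _ _ dg, @derive_val _ _ _ _ _ _ _ dg).
by apply: DeriveDef; rewrite ?/derivable ?/derive E.
Qed.

Lemma partials_wave l k th (c : R) : partials l (fun y => c * wave k th y) =
  (fun y => c * (\prod_(i <- l) (tnth k i)%:~R) * wave k (th + (size l)%:R * (pi / 2)) y).
Proof.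
elim: l => [|i l IH].
  by apply/funext => y; rewrite /= big_nil mulr1 mul0r addr0.
rewrite /= IH; apply/funext => y.
rewrite (_ : (fun y => _) = (c * \prod_(i <- l) (tnth k i)%:~R) \*: wave k (th + (size l)%:R * (pi / 2)))//.
have dw := is_derive_wave k (th + (size l)%:R * (pi / 2)) y i.
rewrite deriveZ; last exact: (@ex_derive _ _ _ _ _ _ _ dw).
have -> : th + (size (i :: l))%:R * (pi / 2) = th + (size l)%:R * (pi / 2) + pi / 2.
  by rewrite /= -natr1; ring.
by rewrite (@derive_val _ _ _ _ _ _ _ dw) /GRing.scale/= big_cons; ring.
Qed.

Lemma smooth_wave k th : smooth (wave k th).
Proof.
have E : wave k th = (fun y => 1 * wave k th y) by apply/funext => y; rewrite mul1r.
move=> l; rewrite E partials_wave; split.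
  move=> y; have cw := @continuous_wave k (th + (size l)%:R * (pi / 2)) y.
  by apply: (@continuousM _ _ (cst _) (wave _ _)); [exact: cst_continuous|exact: cw].
move=> y i; apply: derivableZ.
exact: (@ex_derive _ _ _ _ _ _ _ (is_derive_wave _ _ _ _)).
Qed.

Lemma cos_int_period (n : int) (t : R) : cos (t + n%:~R * (2 * pi)) = cos t.
Proof.
have nat_period m (s : R) : cos (s + m%:R * (2 * pi)) = cos s.
  elim: m s => [|m IH] s; first by rewrite mul0r addr0.
  rewrite -natr1 mulrDl mul1r addrA -[RHS]IH.
  by rewrite (mulr_natl pi 2) cosD2pi.
case: n => n; first exact: nat_period.
rewrite NegzE rmorphN mulNr -[RHS](nat_period n.+1 _) -[in RHS](addrNK (n.+1%:R * (2 * pi)) t).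
by rewrite [in RHS]nat_period nat_period.
Qed.

Lemma periodic_wave k th : Defs.periodic (wave k th).
Proof.
move=> y i; rewrite addrC wave_line /wave addrC cos_int_period.
by [].
Qed.

Lemma integral_cos_phase k th :
  \int[mu]_x cos (phase k x + th) = if k == 0 then (2 * pi) ^+ d * cos th else 0.
Proof.
case: eqP => [->|/eqP k0].
  under eq_Rintegral do rewrite phase0 add0r.
  rewrite Rintegral_cst// mulrC; congr (_ * _).
  by rewrite [X in fine X]torus_measureT.
have [i ki] : exists i, tnth k i != 0.
  apply: contrapT => /forallNP h; move/eqP: k0; apply; apply: eq_from_tnth => i.
  by rewrite tnth_freq0; apply: contrapT => /eqP; exact: h.
(* As k_i is nonzero, the wave is up to this factor the i-th derivative of another wave, so its
   integral vanishes. *)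
have E : 'D_(delta_mx 0 i) (wave k (th - pi / 2)) = (fun y => (tnth k i)%:~R * wave k th y).
  apply/funext => y; rewrite (@derive_val _ _ _ _ _ _ _ (is_derive_wave _ _ _ _)).
  by rewrite subrK.
have cD : continuous ('D_(delta_mx 0 i) (wave k (th - pi / 2))).
  rewrite E => y.
  by apply: (@continuousM _ _ (cst _) (wave _ _)); [exact: cst_continuous|exact: continuous_wave].
have dW y : derivable (wave k (th - pi / 2)) y (delta_mx 0 i).
  exact: (@ex_derive _ _ _ _ _ _ _ (is_derive_wave _ _ _ _)).
have H := torus_integral_derive (@continuous_wave k (th - pi / 2)) dW cD (periodic_wave k (th - pi / 2)).
have : \int[mu]_x ((tnth k i)%:~R * wave k th (row_of x)) = 0.
  rewrite -[RHS]H; apply: eq_Rintegral => x _.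
  by have /= -> := congr1 (fun f => f (row_of x)) E.
rewrite RintegralZl//; last exact: (integrable_continuous_row (@continuous_wave k th)).
move=> /eqP; rewrite mulf_eq0 intr_eq0 (negbTE ki)/= => /eqP <-.
by apply: eq_Rintegral => x _; rewrite wave_row.
Qed.

Lemma integrable_mul_cos_phase (f : d.-tuple R -> R) k th :
  mu.-integrable setT (EFin \o f) ->
  mu.-integrable setT (EFin \o (fun x => f x * cos (phase k x + th))).
Proof.
move=> fi; apply: (integrable_mul_bounded (M := 1)) => //.
  exact: measurable_cos_phase.
by move=> x _; exact: norm_cos_le1.
Qed.

End waves.

Lemma ae_forall_count d (T : measurableType d) (R : realType) (J : countType)
  (mu : {measure set T -> \bar R}) (P : J -> T -> Prop) :
  (forall j, {ae mu, forall x, P j x}) -> {ae mu, forall x, forall j, P j x}.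
Proof.
move=> H; have : {ae mu, forall x (n : nat), if unpickle n is Some j then P j x else True}.
  apply: ae_foralln => n; case: (unpickle n) => [j|]; first exact: H.
  exact: aeW.
by apply: filterS => x Hx j; have := Hx (pickle j); rewrite pickleK.
Qed.

Lemma integrable_fubini_G d1 d2 (T1 : measurableType d1) (T2 : measurableType d2)
  (R : realType) (m1 : {sigma_finite_measure set T1 -> \bar R})
  (m2 : {sigma_finite_measure set T2 -> \bar R}) (f : T1 * T2 -> \bar R) :
  (m1 \x m2)%E.-integrable setT f -> m2.-integrable setT (fubini_G m1 f).
Proof.
move=> fi; have mf := measurable_int _ fi.
apply/integrableP; split; first exact: measurable_fubini_G fi.
apply: le_lt_trans ((integrable21ltyP m1 m2 mf).1 fi).
apply: ge0_le_integral => //.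
- by apply: measurableT_comp => //; exact: measurable_fubini_G fi.
- by apply: (measurable_fun_fubini_tonelli_G (abse \o f)) => //=; exact: measurableT_comp.
- by move=> y _; apply: le_abse_integral => //; exact: measurableT_comp.
Qed.

Section fourier_uniqueness.
Variable R : realType.
Local Notation I := (@interval_measure R).
Local Notation leb := (@lebesgue_measure R).
Local Notation D := (`[- pi : R, pi]%classic).
Local Notation mu d := (torus_measure R d).

Lemma phase_cons n (k1 : int) (k : n.-tuple int) (x : R) (y : n.-tuple R) :
  phase [tuple of k1 :: k] (cons_pair (x, y)) = k1%:~R * x + phase k y.
Proof.
rewrite /phase big_ord_recl/= !tnth0; congr (_ + _).
by apply: eq_bigr => i _; rewrite !tnthS.
Qed.

(** Induction on d. For each frequency k1, the Fourier integral A k1 of f in the first variable is a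
    function on the smaller torus with vanishing coefficients, hence zero almost everywhere. One
    null set serves all k1, and off it every slice falls under the one-dimensional case. *)
Theorem fourier_uniqueness d (f : d.-tuple R -> R) :
  (mu d).-integrable setT (EFin \o f) ->
  (forall k th, \int[mu d]_x (f x * cos (phase k x + th)) = 0) ->
  {ae mu d, forall x, f x = 0}.
Proof.
elim: d f => [|n IH] f fi f0.
  apply: aeW => x; rewrite (tuple0 x); have := f0 0 0.
  rewrite /Rintegral/= integral_dirac//; last first.
    by case/integrableP: (integrable_mul_cos_phase 0 0 fi).
  by rewrite diracE in_setT mul1e/= phase0 addr0 cos0 mulr1.
pose g (p : measurableTypeR R * n.-tuple R) : R := f (cons_pair p).
have gi : (I \x mu n)%E.-integrable setT (EFin \o g) by exact: integrable_torusS fi.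
have mg : measurable_fun setT g by case/integrableP: gi => /measurable_EFinP.
pose h (k1 : int) th (p : measurableTypeR R * n.-tuple R) := g p * cos (k1%:~R * p.1 + th).
have mc (k1 : int) th : measurable_fun setT
    (fun p : measurableTypeR R * n.-tuple R => cos (k1%:~R * p.1 + th)).
  apply: measurableT_comp; first exact: measurable_cos.
  by apply: measurable_funD => //; apply: measurable_funM.
have hi k1 th : (I \x mu n)%E.-integrable setT (EFin \o h k1 th).
  by apply: (integrable_mul_bounded (M := 1)) => // x _; exact: norm_cos_le1.
pose A k1 th y := fine (fubini_G I (EFin \o h k1 th) y).
have Ai k1 th : (mu n).-integrable setT (EFin \o A k1 th).
  have Gi := integrable_fubini_G (hi k1 th).
  apply/integrableP; split.
    apply/measurable_EFinP; apply: measurableT_comp => //.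
    exact: (measurable_int _ Gi).
  case/integrableP: Gi => mG; apply: le_lt_trans.
  apply: ge0_le_integral => //.
  - by apply: measurableT_comp => //; apply/measurable_EFinP; apply: measurableT_comp.
  - exact: measurableT_comp.
  - move=> y _; rewrite /= /A; by case: (fubini_G _ _ y) => [r| |] //=; exact: leey.
have A0 k1 th : {ae mu n, forall y, A k1 th y = 0}.
  apply: IH => // k th'.
  pose u (p : measurableTypeR R * n.-tuple R) := h k1 th p * cos (phase k p.2 + th').
  have ui : (I \x mu n)%E.-integrable setT (EFin \o u).
    apply: (integrable_mul_bounded (M := 1)) => //.
      by apply: measurableT_comp (measurable_cos_phase _ _) _.
    by move=> x _; exact: norm_cos_le1.
  have : \int[(I \x mu n)%E]_p u p = 0.
    transitivity (\int[mu n.+1]_x (2^-1 * (f x * cos (phase [tuple of k1 :: k] x + (th + th')))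
        + 2^-1 * (f x * cos (phase [tuple of k1 :: - k] x + (th - th'))))); last first.
      rewrite RintegralD//; try by apply: integrable_scale => //; exact: integrable_mul_cos_phase.
      by rewrite !RintegralZl// ?f0 ?mulr0 ?addr0//; exact: integrable_mul_cos_phase.
    rewrite /Rintegral [in RHS]integral_torusS; last first.
      by apply: integrable_add => //; apply: integrable_scale => //; exact: integrable_mul_cos_phase.
    congr fine; apply: eq_integral => -[x y] _; congr EFin.
    rewrite !phase_cons phaseN /u /h /g/=.
    have -> : k1%:~R * x + phase k y + (th + th') = (k1%:~R * x + th) + (phase k y + th') by ring.
    have -> : k1%:~R * x - phase k y + (th - th') = (k1%:~R * x + th) - (phase k y + th') by ring.
    by rewrite (cosD (k1%:~R * x + th)) (cosB (k1%:~R * x + th)); field.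
  rewrite /Rintegral -[X in fine X = _](integral21_prod_meas1 ui) => <-; congr fine.
  apply: ae_eq_integral => //.
  - by apply: (measurable_int (mu n)); exact: integrable_mul_cos_phase.
  - exact: (measurable_fubini_G ui).
  have := ae_integrable2 (hi k1 th); apply: filterS => y yi _.
  rewrite /= EFinM /A fineK; last exact: integrable_fin_num.
  by rewrite /fubini_G -integralZr.
(* Two phases per frequency keep the exceptional sets countable in number; [H0] below recovers the
   others by the addition formula. *)
have A0' : {ae mu n, forall y, forall (p : int * bool), A p.1 (if p.2 then pi / 2 else 0) y = 0}.
  by apply: ae_forall_count => p; exact: A0.
have g0 : {ae mu n, forall y, (\int[I]_x `|(g (x, y))%:E| = 0)%E}.
  have := ae_integrable2 gi; apply: filterS2 A0' => y Ay yi.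
  have mgy : measurable_fun setT (fun x : measurableTypeR R => g (x, y)).
    by case/integrableP: yi => /measurable_EFinP.
  have yi' : leb.-integrable D (EFin \o (fun x => g (x, y))).
    by apply/integrable_interval_measure.
  have mcx (k1 : int) (th : R) :
      measurable_fun setT (fun x : measurableTypeR R => cos (k1%:~R * x + th)).
    apply: measurableT_comp; first exact: measurable_cos.
    apply: measurable_funD; last exact: measurable_cst.
    by apply: measurable_funM; [exact: measurable_cst|exact: measurable_id].
  have hint (k1 : int) (b : bool) :
      \int[leb]_(x in D) (g (x, y) * cos (k1%:~R * x + (if b then pi / 2 else 0))) = 0.
    have := Ay (k1, b); rewrite /A /fubini_G/= integral_interval_measure//.
    by apply/measurable_EFinP; apply: measurable_funM => //; exact: mcx.
  have := @fourier_uniqueness_1d R _ yi'.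
  have ci (k1 : int) th : leb.-integrable D (EFin \o (fun x => g (x, y) * cos (k1%:~R * x + th))).
    apply: (integrable_mul_bounded (M := 1)) => //; first exact: measurable_funTS.
    by move=> x _; exact: norm_cos_le1.
  have H0 (k1 : int) th : \int[leb]_(x in D) (g (x, y) * cos (k1%:~R * x + th)) = 0.
    transitivity (\int[leb]_(x in D) (cos th * (g (x, y) * cos (k1%:~R * x + 0)) +
        sin th * (g (x, y) * cos (k1%:~R * x + pi / 2)))).
      by apply: eq_Rintegral => x _; rewrite cosDpihalf addr0 cosD; ring.
    rewrite RintegralD//; try by apply: integrable_scale.
    by rewrite !RintegralZl// (hint k1 false) (hint k1 true) !mulr0 addr0.
  move=> /(_ H0) => gae.
  rewrite ge0_integral_interval_measure//; last first.
    by apply: measurableT_comp => //; exact/measurable_EFinP.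
  apply/ae_eq_integral_abs => //; first exact: (measurable_int _ yi').
  by apply: (@filterS _ _ (ae_filter_ringOfSetsType leb) _ _ _ gae) => x H xD; rewrite /= H.
suff : (\int[mu n.+1]_x `|(f x)%:E| = 0)%E.
  have mf : measurable_fun setT f by case/integrableP: fi => /measurable_EFinP.
  move=> /ae_eq_integral_abs => /(_ measurableT ((measurable_EFinP _ _).2 mf)).
  by apply: filterS => x /(_ Logic.I) [].
have mf : measurable_fun setT f by case/integrableP: fi => /measurable_EFinP.
rewrite ge0_integral_torusS//; last by apply: measurableT_comp => //; exact/measurable_EFinP.
have mabs : measurable_fun setT (fun p => `|(g p)%:E|)%E.
  by apply: measurableT_comp => //; exact/measurable_EFinP.
rewrite (fubini_tonelli2 (fun p => `|(g p)%:E|)%E)//.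
apply: (@eq_trans _ _ (\int[mu n]_x cst 0 x)%E); last by rewrite integral0.
apply: ae_eq_integral => //; first exact: measurable_fun_fubini_tonelli_G.
by apply: filterS g0 => y H _; rewrite /fubini_G H.
Qed.

End fourier_uniqueness.

(** * Absolutely convergent Fourier series *)

Section complex_norm.
Variable R : realType.
Implicit Types z w : R[i].

Definition cconj z : R[i] := Complex (complex.Re z) (- complex.Im z).

Lemma normc_ge0 z : 0 <= Normc.normc z.
Proof. by case: z => a b; exact: sqrtr_ge0. Qed.

Lemma sqr_normc z : Normc.normc z ^+ 2 = complex.Re z ^+ 2 + complex.Im z ^+ 2.
Proof. by case: z => a b /=; rewrite sqr_sqrtr// addr_ge0 ?sqr_ge0. Qed.

Lemma normc_leP z (B : R) : 0 <= B ->
  complex.Re z ^+ 2 + complex.Im z ^+ 2 <= B ^+ 2 -> Normc.normc z <= B.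
Proof.
by move=> B0; rewrite -sqr_normc => h; rewrite -(@ler_pXn2r _ 2)// nnegrE ?normc_ge0.
Qed.

Lemma norm_dot_le_normc z (c s : R) : c ^+ 2 + s ^+ 2 = 1 ->
  `|complex.Re z * c + complex.Im z * s| <= Normc.normc z.
Proof.
move=> cs; rewrite -(@ler_pXn2r _ 2)// ?nnegrE ?normc_ge0// real_normK ?num_real//.
rewrite sqr_normc; move: (complex.Re z) (complex.Im z) => a b.
have -> : a ^+ 2 + b ^+ 2 = (a ^+ 2 + b ^+ 2) * (c ^+ 2 + s ^+ 2) by rewrite cs mulr1.
rewrite -subr_ge0; have -> : (a ^+ 2 + b ^+ 2) * (c ^+ 2 + s ^+ 2) - (a * c + b * s) ^+ 2 =
  (a * s - b * c) ^+ 2 by ring.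
exact: sqr_ge0.
Qed.

Lemma norm_Re_le z : `|complex.Re z| <= Normc.normc z.
Proof.
have := @norm_dot_le_normc z 1 0; rewrite mulr1 mulr0 addr0; apply.
by rewrite expr1n expr0n addr0.
Qed.

Lemma norm_Im_le z : `|complex.Im z| <= Normc.normc z.
Proof.
have := @norm_dot_le_normc z 0 1; rewrite mulr1 mulr0 add0r; apply.
by rewrite expr1n expr0n add0r.
Qed.

Lemma normcJ z : Normc.normc (cconj z) = Normc.normc z.
Proof. by case: z => a b /=; rewrite sqrrN. Qed.

Lemma normcD_le z w : Normc.normc (z + w) <= Normc.normc z + Normc.normc w.
Proof. exact: (le_normcD z w). Qed.

Lemma normcB_le z w : Normc.normc (z - w) <= Normc.normc z + Normc.normc w.
Proof. by apply: le_trans (normcD_le _ _) _; rewrite (normcN w). Qed.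

Lemma normcBC z w : Normc.normc (z - w) = Normc.normc (w - z).
Proof. by rewrite -(normcN (z - w)) opprB. Qed.

Lemma normc_sum_le (J : Type) (s : seq J) (F : J -> R[i]) :
  Normc.normc (\sum_(j <- s) F j) <= \sum_(j <- s) Normc.normc (F j).
Proof.
elim: s => [|j s IH]; first by rewrite !big_nil Normc.normc0.
by rewrite !big_cons; apply: le_trans (normcD_le _ _) _; rewrite lerD2l.
Qed.

Lemma normc_real (a : R) : Normc.normc (Complex a 0) = `|a|.
Proof. by rewrite /= expr0n addr0 sqrtr_sqr. Qed.

Lemma ReM z w : complex.Re (z * w) =
  complex.Re z * complex.Re w - complex.Im z * complex.Im w.
Proof. by case: z w => [a b] [c e]. Qed.

Lemma ImM z w : complex.Im (z * w) =
  complex.Re z * complex.Im w + complex.Im z * complex.Re w.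
Proof. by case: z w => [a b] [c e]. Qed.

Lemma ReD z w : complex.Re (z + w) = complex.Re z + complex.Re w.
Proof. by case: z w => [a b] [c e]. Qed.

Lemma ImD z w : complex.Im (z + w) = complex.Im z + complex.Im w.
Proof. by case: z w => [a b] [c e]. Qed.

Lemma ReN z : complex.Re (- z) = - complex.Re z.
Proof. by case: z. Qed.

Lemma ImN z : complex.Im (- z) = - complex.Im z.
Proof. by case: z. Qed.

Lemma complex_ext z w : complex.Re z = complex.Re w -> complex.Im z = complex.Im w -> z = w.
Proof. by case: z w => [a b] [c e] /= -> ->. Qed.

Lemma normc_cvg_le (F : nat -> R[i]) z (B : R) :
  complex.Re (F n) @[n --> \oo] --> complex.Re z ->
  complex.Im (F n) @[n --> \oo] --> complex.Im z ->
  (forall n, Normc.normc (F n) <= B) -> Normc.normc z <= B.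
Proof.
move=> cR cI FB; apply: normc_leP; first exact: le_trans (normc_ge0 _) (FB 0%N).
have c2 : (complex.Re (F n) ^+ 2 + complex.Im (F n) ^+ 2) @[n --> \oo] -->
    (complex.Re z ^+ 2 + complex.Im z ^+ 2).
  by apply: cvgD; rewrite !expr2; apply: cvgM.
rewrite -(cvg_lim (@Rhausdorff R) c2); apply: limr_le; first by apply/cvg_ex; eexists; exact: c2.
apply: nearW => n; rewrite -sqr_normc lerXn2r// nnegrE ?normc_ge0//.
exact: le_trans (normc_ge0 _) (FB 0%N).
Qed.

End complex_norm.

Section countable_sum.
Variables (R : realType) (K : countType).
Implicit Types (F G : K -> R) (A : K -> R).

(** Summation follows the enumeration by [pickle_inv]; an integer that codes no index contributes 0.
    Convergence is always drawn from an absolutely summable majorant. *)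
Definition psum F n : R := \sum_(0 <= j < n) oapp F 0 (pickle_inv j).
Definition rsum F : R := limn (psum F).
Definition asum A : \bar R := \esum_(k in [set: K]) (A k)%:E.

Lemma asum_ge0 A : (forall k, 0 <= A k) -> (0 <= asum A)%E.
Proof. by move=> A0; apply: esum_ge0 => k _; rewrite lee_fin. Qed.

Lemma esum_countable (a : K -> \bar R) : (forall k, 0 <= a k)%E ->
  \esum_(k in [set: K]) a k = (\sum_(j <oo) oapp a 0%E (pickle_inv j))%E.
Proof.
move=> a0; pose b j := oapp a 0%E (@pickle_inv K j).
have b0 j : (0 <= b j)%E by rewrite /b; case: pickle_inv => //= k.
rewrite nneseries_esumT//.
transitivity (\esum_(j in pickle @` [set: K]) b j).
  by rewrite esum_image//; apply: eq_esum => k _; rewrite /b pickleK_inv.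
rewrite esum_mkcond; apply: eq_esum => j _; rewrite /b; case: ifPn => // jn.
case E : (pickle_inv j) => [k|]//=; move: jn; rewrite notin_setE; case.
by exists k => //; have := @pickle_invK K j; rewrite /ocancel E.
Qed.

Lemma psum_asum A n : (forall k, 0 <= A k) -> ((psum A n)%:E <= asum A)%E.
Proof.
move=> A0; rewrite /asum esum_countable// -[leLHS](_ : (\sum_(0 <= j < n)
    oapp (fun k => (A k)%:E) 0%E (pickle_inv j) = _)%E).
  by apply: nneseries_lim_ge => j _ _; case: pickle_inv => //= k; rewrite lee_fin.
by rewrite /psum -sumEFin; apply: eq_bigr => j _; case: pickle_inv.
Qed.

Lemma psum_le_fine A n : (forall k, 0 <= A k) -> (asum A < +oo)%E ->
  psum A n <= fine (asum A).
Proof.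
move=> A0 Aoo; rewrite -lee_fin fineK; first exact: psum_asum.
by rewrite ge0_fin_numE// asum_ge0.
Qed.

Lemma cvg_psum_asum A : (forall k, 0 <= A k) -> (asum A < +oo)%E ->
  psum A n @[n --> \oo] --> fine (asum A).
Proof.
move=> A0 Aoo.
have : (psum A n)%:E @[n --> \oo] --> asum A.
  rewrite /asum esum_countable//.
  rewrite (_ : (fun n => _) = (fun n => \sum_(0 <= j < n)
    oapp (fun k => (A k)%:E) 0%E (pickle_inv j))%E).
    by apply: is_cvg_nneseries => j _ _; case: pickle_inv => //= k; rewrite lee_fin.
  by apply/funext => n; rewrite /psum -sumEFin; apply: eq_bigr => j _; case: pickle_inv.
rewrite -{1}[asum A]fineK; last by rewrite ge0_fin_numE// asum_ge0.
by move/fine_cvgP => [].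
Qed.

Lemma norm_psum_le F A n : (forall k, `|F k| <= A k) -> `|psum F n| <= psum A n.
Proof.
move=> FA; apply: le_trans (ler_norm_sum _ _ _) _; apply: ler_sum => j _.
by case: pickle_inv => /= [k|]; rewrite ?normr0.
Qed.

Lemma is_cvg_psum F A : (forall k, `|F k| <= A k) -> (asum A < +oo)%E ->
  cvgn (psum F).
Proof.
move=> FA Aoo.
have A0 k : 0 <= A k by exact: le_trans (FA k).
pose f j := oapp F 0 (@pickle_inv K j).
rewrite (_ : psum F = series f)//; apply: normed_cvg.
apply: (@series_le_cvg _ _ (fun j => oapp A 0 (@pickle_inv K j))) => [j|j|j|].
- exact: normr_ge0.
- by case: pickle_inv.
- by rewrite /f /=; case: pickle_inv => //=; rewrite normr0.
- by apply/cvg_ex; exists (fine (asum A)); exact: cvg_psum_asum.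
Qed.

Lemma cvg_psum F A : (forall k, `|F k| <= A k) -> (asum A < +oo)%E ->
  psum F n @[n --> \oo] --> rsum F.
Proof. exact: is_cvg_psum. Qed.

Lemma norm_rsum_le F A : (forall k, `|F k| <= A k) -> (asum A < +oo)%E ->
  `|rsum F| <= fine (asum A).
Proof.
move=> FA Aoo.
have A0 k : 0 <= A k by exact: le_trans (FA k).
have cF : `|psum F n| @[n --> \oo] --> `|rsum F|.
  by apply: cvg_norm; exact: cvg_psum FA Aoo.
rewrite -(cvg_lim (@Rhausdorff R) cF).
apply: limr_le; first by apply/cvg_ex; eexists; exact: cF.
by apply: nearW => n; apply: le_trans (norm_psum_le n FA) _; exact: psum_le_fine.
Qed.

Lemma psumD F G n : psum (fun k => F k + G k) n = psum F n + psum G n.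
Proof.
rewrite /psum -big_split; apply: eq_bigr => j _ /=.
by case: pickle_inv => //=; rewrite addr0.
Qed.

Lemma psumZ F (a : R) n : psum (fun k => a * F k) n = a * psum F n.
Proof.
rewrite /psum mulr_sumr; apply: eq_bigr => j _.
by case: pickle_inv => //=; rewrite mulr0.
Qed.

Lemma cvg_psum_delta k (v : R) : psum (fun l => if l == k then v else 0) n @[n --> \oo] --> v.
Proof.
apply: (cvg_near_cst); exists (pickle k).+1 => // n /= kn.
rewrite /psum (bigD1_seq (pickle k))/= ?mem_index_iota ?iota_uniq//; last first.
rewrite pickleK_inv/= eqxx big1 ?addr0// => j jk.
case E : (pickle_inv j) => [l|]//=; case: eqP => // lk.
move: jk; have := @pickle_invK K j; rewrite /ocancel E/= lk => ->; by rewrite eqxx.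
Qed.

End countable_sum.

(** Dominated convergence for series along an arbitrary filter: the majorant makes the terms beyond
    some n sum to at most e / 2 for all t, and the finitely many others tend to 0. *)
Lemma asum_dominated_cvg0 (R : realType) (K : countType) (T : Type) (Fl : set_system T)
    (FF : Filter Fl) (g : T -> K -> R) (A : K -> R) :
  (forall k, 0 <= A k) -> (asum A < +oo)%E ->
  (\forall t \near Fl, forall k, 0 <= g t k <= A k) ->
  (forall k, g t k @[t --> Fl] --> 0) ->
  asum (g t) @[t --> Fl] --> 0%E.
Proof.
move=> A0 Aoo gA g0.
have Afin : asum A \is a fin_num by rewrite ge0_fin_numE// asum_ge0.
suff H (e : R) : 0 < e -> \forall t \near Fl, (asum (g t) <= e%:E)%E.
  apply/fine_cvgP; split.
    have := H 1 ltr01; apply: filterS2 gA => t gt h.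
    rewrite ge0_fin_numE; first exact: le_lt_trans h (ltry _).
    by apply: asum_ge0 => k; have /andP[] := gt k.
  apply/cvgrPdist_le => e e0; have := H e e0; apply: filterS2 gA => t gt h.
  have t0 : (0 <= asum (g t))%E by apply: asum_ge0 => k; have /andP[] := gt k.
  rewrite sub0r normrN ger0_norm ?fine_ge0// -lee_fin fineK//.
  by rewrite ge0_fin_numE//; exact: le_lt_trans h (ltry _).
move=> e0.
have e2 : 0 < e / 2 by rewrite divr_gt0.
have [n nA] : exists n, fine (asum A) - psum A n <= e / 2.
  have /cvgrPdist_le/(_ _ e2)[n _ H] := cvg_psum_asum A0 Aoo.
  by exists n; apply: le_trans (ler_norm _) (H n _) => /=.
have cg m : psum (g t) m @[t --> Fl] --> 0.
  elim: m => [|m IH].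
    rewrite (_ : (fun t => _) = cst 0); first exact: cvg_cst.
    by apply/funext => t; rewrite /psum big_geq.
  rewrite (_ : (fun t => _) = (fun t => psum (g t) m + oapp (g t) 0 (pickle_inv m))); last first.
    by apply/funext => t; rewrite /psum big_nat_recr.
  rewrite -[X in _ --> X]addr0; apply: cvgD => //.
  by case: pickle_inv => [k|] /=; [exact: g0|exact: cvg_cst].
have /cvgrPdist_le/(_ _ e2) := cg n; apply: filterS2 gA => t gt.
rewrite sub0r normrN => gn.
have gt0 k : 0 <= g t k by have /andP[] := gt k.
have gtA k : g t k <= A k by have /andP[] := gt k.
have gtoo : (asum (g t) < +oo)%E.
  by apply: le_lt_trans Aoo; apply: ge0_lee_esum => k; rewrite lee_fin.
rewrite -(@fineK _ (asum (g t))) ?ge0_fin_numE ?asum_ge0// lee_fin.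
rewrite -(cvg_lim (@Rhausdorff R) (cvg_psum_asum gt0 gtoo)).
apply: limr_le; first by apply/cvg_ex; eexists; exact: cvg_psum_asum gt0 gtoo.
exists n => // N /= nN.
have -> : psum (g t) N = psum (g t) n + \sum_(n <= j < N) oapp (g t) 0 (pickle_inv j).
  by rewrite /psum (big_cat_nat _ nN).
have AN : psum A N = psum A n + \sum_(n <= j < N) oapp A 0 (@pickle_inv K j).
  by rewrite /psum (big_cat_nat _ nN).
have : \sum_(n <= j < N) oapp (g t) 0 (pickle_inv j) <= \sum_(n <= j < N) oapp A 0 (@pickle_inv K j).
  by apply: ler_sum => j _; case: pickle_inv.
have := psum_le_fine N A0 Aoo; rewrite AN.
have := ler_norm (psum (g t) n); lra.
Qed.

Section fourier_coefficients.
Variables (R : realType) (d : nat).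
Local Notation mu := (torus_measure R d).
Local Notation K := (d.-tuple int).
Local Notation V := ((2 * pi) ^+ d : R).
Implicit Types (f g : d.-tuple R -> R) (k l : K) (x : d.-tuple R).

Definition ftabs f k : R := Normc.normc (fourier f k).

Lemma torus_volume_gt0 : 0 < V.
Proof. by rewrite exprn_gt0// mulr_gt0// pi_gt0. Qed.

Lemma integrable_mul_cos f k : mu.-integrable setT (EFin \o f) ->
  mu.-integrable setT (EFin \o (fun x => f x * cos (phase k x))).
Proof.
move=> fi; apply: (integrable_mul_bounded (M := 1)) => //; last by move=> x _; exact: norm_cos_le1.
by apply: measurableT_comp; [exact: measurable_cos|exact: measurable_phase].
Qed.

Lemma integrable_mul_sin f k : mu.-integrable setT (EFin \o f) ->
  mu.-integrable setT (EFin \o (fun x => f x * sin (phase k x))).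
Proof.
move=> fi; apply: (integrable_mul_bounded (M := 1)) => //; last by move=> x _; exact: norm_sin_le1.
by apply: measurableT_comp; [exact: measurable_sin|exact: measurable_phase].
Qed.

Lemma fourierD f g k : mu.-integrable setT (EFin \o f) -> mu.-integrable setT (EFin \o g) ->
  fourier (fun x => f x + g x) k = fourier f k + fourier g k.
Proof.
move=> fi gi; apply: complex_ext => /=.
  rewrite -mulrDr -RintegralD//; try exact: integrable_mul_cos.
  by congr (_ * _); apply: eq_Rintegral => x _; rewrite mulrDl.
rewrite -opprD -mulrDr -RintegralD//; try exact: integrable_mul_sin.
by congr (- (_ * _)); apply: eq_Rintegral => x _; rewrite mulrDl.
Qed.

Lemma fourierZ f (a : R) k : mu.-integrable setT (EFin \o f) ->
  fourier (fun x => a * f x) k = Complex a 0 * fourier f k.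
Proof.
move=> fi; apply: complex_ext => /=; rewrite mul0r ?subr0 ?addr0.
  rewrite (_ : \int[mu]_x _ = a * \int[mu]_x (f x * cos (phase k x))); first by rewrite mulrCA.
  rewrite -(RintegralZl _ measurableT (integrable_mul_cos k fi)).
  by apply: eq_Rintegral => x _; rewrite mulrA.
rewrite (_ : \int[mu]_x _ = a * \int[mu]_x (f x * sin (phase k x))).
  by rewrite mulrN mulrCA.
rewrite -(RintegralZl _ measurableT (integrable_mul_sin k fi)).
by apply: eq_Rintegral => x _; rewrite mulrA.
Qed.

Lemma fourierN f k : mu.-integrable setT (EFin \o f) ->
  fourier (fun x => - f x) k = - fourier f k.
Proof.
move=> fi; have := fourierZ (-1) k fi.
rewrite (_ : (fun x => -1 * f x) = (fun x => - f x)); last by apply/funext => x; rewrite mulN1r.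
by move=> ->; apply: complex_ext; rewrite ?ReM ?ImM ?ReN ?ImN/=; ring.
Qed.

Lemma fourierB f g k : mu.-integrable setT (EFin \o f) -> mu.-integrable setT (EFin \o g) ->
  fourier (fun x => f x - g x) k = fourier f k - fourier g k.
Proof.
move=> fi gi; rewrite -fourierN//; apply: fourierD => //.
rewrite (_ : _ \o _ = EFin \o (fun x => -1 * g x)); last first.
  by apply/funext => x; rewrite /= mulN1r.
exact: integrable_scale.
Qed.

Lemma fourier_sum (J : Type) (s : seq J) (h : J -> d.-tuple R -> R) k :
  (forall j, mu.-integrable setT (EFin \o h j)) ->
  fourier (fun x => \sum_(j <- s) h j x) k = \sum_(j <- s) fourier (h j) k.
Proof.
move=> hi; elim: s => [|j s IH].
  rewrite big_nil; apply: complex_ext => /=; under eq_Rintegral do rewrite big_nil mul0r.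
    by rewrite /Rintegral integral0 mulr0.
  by rewrite /Rintegral integral0 mulr0 oppr0.
rewrite big_cons -IH -fourierD//; last exact: integrable_bigsum.
by congr (fourier _ k); apply/funext => x; rewrite big_cons.
Qed.

Lemma fourier_ae f g k : mu.-integrable setT (EFin \o f) -> mu.-integrable setT (EFin \o g) ->
  {ae mu, forall x, f x = g x} -> fourier f k = fourier g k.
Proof.
move=> fi gi fg; apply: complex_ext => /=; [congr (_ * _)|congr (- (_ * _))];
  rewrite /Rintegral; congr fine; apply: ae_eq_integral => //;
  try (by apply: (measurable_int mu); exact: integrable_mul_cos);
  try (by apply: (measurable_int mu); exact: integrable_mul_sin).
  by apply: filterS fg => x -> _.
by apply: filterS fg => x -> _.
Qed.

Lemma fourier_opp f k : mu.-integrable setT (EFin \o f) ->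
  fourier f (- k) = cconj (fourier f k).
Proof.
move=> fi; apply: complex_ext => /=; first by under eq_Rintegral do rewrite phaseN cosN.
apply/eqP; rewrite eqr_opp; apply/eqP; rewrite -mulrN; congr (_ * _); rewrite -mulN1r.
rewrite -(RintegralZl _ measurableT (integrable_mul_sin k fi)).
by apply: eq_Rintegral => x _; rewrite phaseN sinN mulrN mulN1r.
Qed.

Lemma fourier_dominated (F : nat -> d.-tuple R -> R) f (M : R) k :
  (forall n, measurable_fun setT (F n)) -> measurable_fun setT f ->
  (forall n x, `|F n x| <= M) -> (forall x, F n x @[n --> \oo] --> f x) ->
  complex.Re (fourier (F n) k) @[n --> \oo] --> complex.Re (fourier f k) /\
  complex.Im (fourier (F n) k) @[n --> \oo] --> complex.Im (fourier f k).
Proof.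
move=> mF mf FM Ff.
have mc : measurable_fun setT (fun x => cos (phase k x)).
  by apply: measurableT_comp; [exact: measurable_cos|exact: measurable_phase].
have ms : measurable_fun setT (fun x => sin (phase k x)).
  by apply: measurableT_comp; [exact: measurable_sin|exact: measurable_phase].
have ci : mu.-integrable setT (EFin \o cst M) by exact: finite_measure_integrable_cst.
split => /=; [apply: cvgMr|apply: cvgN; apply: cvgMr].
  apply: (Rdominated_convergence (g := cst M) measurableT _ _ _ ci _).2 => [n|||n x _].
  - exact: measurable_funM.
  - exact: measurable_funM.
  - by apply: aeW => x _; apply: cvgMl; exact: Ff.
  - rewrite normrM -[leRHS]mulr1; apply: ler_pM => //; exact: norm_cos_le1.
apply: (Rdominated_convergence (g := cst M) measurableT _ _ _ ci _).2 => [n|||n x _].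
- exact: measurable_funM.
- exact: measurable_funM.
- by apply: aeW => x _; apply: cvgMl; exact: Ff.
- rewrite normrM -[leRHS]mulr1; apply: ler_pM => //; exact: norm_sin_le1.
Qed.

End fourier_coefficients.

Lemma rcvg_unique (R : realType) (u : nat -> R) (a b : R) :
  u n @[n --> \oo] --> a -> u n @[n --> \oo] --> b -> a = b.
Proof. by move=> ua ub; apply: cvg_unique ua ub; exact: Rhausdorff. Qed.

Lemma integrable_cos_phase (R : realType) d k (th : R) :
  (torus_measure R d).-integrable setT (EFin \o (fun x => cos (phase k x + th))).
Proof.
have := integrable_continuous_row (@continuous_wave R d k th).
rewrite (_ : _ \o _ = EFin \o (fun x => cos (phase k x + th)))//.
by apply/funext => x /=; rewrite wave_row.
Qed.

(** * Absolutely summable series of modes and Fourier inversion *)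

Section wiener_series.
Variables (R : realType) (d : nat).
Local Notation mu := (torus_measure R d).
Local Notation K := (d.-tuple int).
Local Notation V := ((2 * pi) ^+ d : R).
Implicit Types (c : K -> R[i]) (f g : d.-tuple R -> R) (k l : K) (x : d.-tuple R).

Definition cabs c k : R := Normc.normc (c k).
(** The real part of z e^{i k.x}. For a Hermitian family the imaginary parts of the modes k and -k
    cancel, so [wser c] is the full series sum_k c_k e^{i k.x}. *)
Definition mode (z : R[i]) k x : R :=
  complex.Re z * cos (phase k x) - complex.Im z * sin (phase k x).
Definition wser c x : R := rsum (fun k => mode (c k) k x).
Definition csummable c : Prop := (asum (cabs c) < +oo)%E.
Definition hermitian c : Prop := forall k, c (- k) = cconj (c k).

Lemma cabs_ge0 c k : 0 <= cabs c k.
Proof. exact: normc_ge0. Qed.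
Hint Resolve cabs_ge0 : core.

Lemma norm_mode_le (z : R[i]) k x : `|mode z k x| <= Normc.normc z.
Proof.
rewrite /mode -mulrN; apply: norm_dot_le_normc.
by rewrite sqrrN cos2Dsin2.
Qed.

Lemma modeD (z w : R[i]) k x : mode (z + w) k x = mode z k x + mode w k x.
Proof. by rewrite /mode ReD ImD; ring. Qed.

Lemma modeN (z : R[i]) k x : mode (- z) k x = - mode z k x.
Proof. by rewrite /mode ReN ImN; ring. Qed.

Lemma measurable_mode (z : R[i]) k : measurable_fun setT (mode z k).
Proof.
apply: measurable_funB; apply: measurable_funM => //.
  by apply: measurableT_comp; [exact: measurable_cos|exact: measurable_phase].
by apply: measurableT_comp; [exact: measurable_sin|exact: measurable_phase].
Qed.

Lemma cvg_wser c x : csummable c ->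
  psum (fun k => mode (c k) k x) n @[n --> \oo] --> wser c x.
Proof. by move=> cs; apply: cvg_psum cs => k; exact: norm_mode_le. Qed.

Lemma norm_wser_le c x : csummable c -> `|wser c x| <= fine (asum (cabs c)).
Proof. by move=> cs; apply: norm_rsum_le cs => k; exact: norm_mode_le. Qed.

Lemma csummableN c : csummable c -> csummable (fun k => - c k).
Proof.
rewrite /csummable; congr (_ < +oo)%E; apply: eq_esum => k _.
by rewrite /cabs normcN.
Qed.

Lemma csummableB c c' : csummable c -> csummable c' -> csummable (fun k => c k - c' k).
Proof.
move=> cs cs'; apply: le_lt_trans (lte_add_pinfty cs cs').
rewrite -esumD; try by move=> k _; rewrite lee_fin.
by apply: ge0_lee_esum => k; rewrite -EFinD lee_fin; exact: normcB_le.
Qed.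

Lemma csummable_le c (A : K -> \bar R) : (forall k, (cabs c k)%:E <= A k)%E ->
  (\esum_(k in [set: K]) A k < +oo)%E -> csummable c.
Proof. by move=> cA; apply: le_lt_trans; apply: ge0_lee_esum. Qed.

Lemma wserN c x : csummable c -> wser (fun k => - c k) x = - wser c x.
Proof.
move=> cs; have w := @cvg_wser _ x (csummableN cs); apply: (rcvg_unique w).
rewrite (_ : psum _ = fun n => - psum (fun k => mode (c k) k x) n).
  by apply: cvgN; exact: cvg_wser.
apply/funext => n; rewrite -mulN1r -psumZ; congr (psum _ n).
by apply/funext => k; rewrite modeN mulN1r.
Qed.

Lemma wserB c c' x : csummable c -> csummable c' ->
  wser (fun k => c k - c' k) x = wser c x - wser c' x.
Proof.
move=> cs cs'; rewrite -wserN//.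
have w := @cvg_wser _ x (csummableB cs cs'); apply: (rcvg_unique w).
rewrite (_ : psum _ = fun n => psum (fun k => mode (c k) k x) n +
    psum (fun k => mode (- c' k) k x) n).
  by apply: cvgD; apply: cvg_wser => //; exact: csummableN.
by apply/funext => n; rewrite -psumD; congr (psum _ n); apply/funext => k; rewrite modeD.
Qed.

Lemma measurable_psum_mode c n :
  measurable_fun setT (fun x => psum (fun k => mode (c k) k x) n).
Proof.
apply: measurable_sum => j; case: (pickle_inv j) => [k|] /=; last exact: measurable_cst.
exact: measurable_mode.
Qed.

Lemma measurable_wser c : csummable c -> measurable_fun setT (wser c).
Proof.
move=> cs; apply: (measurable_fun_cvg (measurable_psum_mode c)) => x _.
exact: cvg_wser.
Qed.

Lemma integrable_wser c : csummable c -> mu.-integrable setT (EFin \o wser c).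
Proof.
move=> cs; apply: (integrable_bounded_box (M := fine (asum (cabs c)))).
  exact: measurable_wser.
by move=> x _; exact: norm_wser_le.
Qed.

Lemma integrable_mode_mul (z : R[i]) k g : mu.-integrable setT (EFin \o g) ->
  mu.-integrable setT (EFin \o (fun x => g x * mode z k x)).
Proof.
move=> gi; apply: (integrable_mul_bounded (M := Normc.normc z)) => //.
  exact: measurable_mode.
by move=> x _; exact: norm_mode_le.
Qed.

Lemma cvg_integral_wser c g : csummable c -> mu.-integrable setT (EFin \o g) ->
  psum (fun k => \int[mu]_x (g x * mode (c k) k x)) n @[n --> \oo] -->
    \int[mu]_x (g x * wser c x).
Proof.
move=> cs gi; have mg : measurable_fun setT g by case/integrableP: gi => /measurable_EFinP.
rewrite (_ : psum _ = fun n => \int[mu]_x (g x * psum (fun k => mode (c k) k x) n)); last first.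
  apply/funext => n; rewrite /psum.
  have -> : \int[mu]_x (g x * \sum_(0 <= j < n) oapp (fun k => mode (c k) k x) 0 (pickle_inv j)) =
      \int[mu]_x (\sum_(0 <= j < n) oapp (fun k => g x * mode (c k) k x) 0 (pickle_inv j)).
    apply: eq_Rintegral => x _; rewrite mulr_sumr; apply: eq_bigr => j _.
    by case: pickle_inv => //=; rewrite mulr0.
  rewrite Rintegral_bigsum//; last first.
    move=> j; case: (pickle_inv j) => [k|] /=; first exact: integrable_mode_mul.
    exact: integrable0.
  apply: eq_bigr => j _; case: (pickle_inv j) => [k|] //=.
  by rewrite /Rintegral integral0.
apply: (Rdominated_convergence (g := fun x => fine (asum (cabs c)) * `|g x|) measurableT _ _ _ _ _).2.
- by move=> n; apply: measurable_funM => //; exact: measurable_psum_mode.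
- by apply: measurable_funM => //; exact: measurable_wser.
- by apply: aeW => x _; apply: cvgMr; exact: cvg_wser.
- by apply: integrable_scale => //; exact: integrable_norm.
- move=> n x _; rewrite normrM mulrC; apply: ler_wpM2r => //.
  apply: (@le_trans _ _ (psum (cabs c) n)); last exact: psum_le_fine.
  by apply: norm_psum_le => k; exact: norm_mode_le.
Qed.

(** Orthogonality of real modes: cos (k.x) does not distinguish k from -k, and the two indicators
    add up when k = 0. *)
Lemma integral_mode_cos (z : R[i]) k l :
  \int[mu]_x (cos (phase k x) * mode z l x) =
  V / 2 * complex.Re z * ((l == k)%:R + (l == - k)%:R).
Proof.
have ci m : mu.-integrable setT (EFin \o (fun x => cos (@phase R d m x + 0))).
  exact: integrable_cos_phase.
have si m : mu.-integrable setT (EFin \o (fun x => cos (@phase R d m x + - (pi / 2)))).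
  exact: integrable_cos_phase.
(* Sines are written as cosines with phase - pi / 2, so that [integral_cos_phase] evaluates all four
   terms. *)
transitivity (\int[mu]_x ((complex.Re z / 2 * cos (phase (l + k) x + 0) +
    complex.Re z / 2 * cos (phase (l - k) x + 0)) + (- (complex.Im z / 2) * cos (phase (l + k) x + - (pi / 2)) +
    - (complex.Im z / 2) * cos (phase (l - k) x + - (pi / 2))))).
  apply: eq_Rintegral => x _; rewrite !addr0 !cosBpihalf !phaseD phaseN /mode.
  by rewrite !(cosD, sinD) ?cosN ?sinN; field.
rewrite RintegralD//; try by apply: integrable_add => //; apply: integrable_scale.
rewrite RintegralD//; try by apply: integrable_scale.
rewrite RintegralD//; try by apply: integrable_scale.
rewrite !RintegralZl// !integral_cos_phase cosN cos_pihalf cos0 mulr0 !if_same !mulr0 !addr0.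
rewrite addr_eq0 subr_eq0.
by case: eqP; case: eqP => _ _ /=; ring.
Qed.

Lemma integral_mode_sin (z : R[i]) k l :
  \int[mu]_x (sin (phase k x) * mode z l x) =
  - (V / 2) * complex.Im z * ((l == k)%:R - (l == - k)%:R).
Proof.
have ci m : mu.-integrable setT (EFin \o (fun x => cos (@phase R d m x + 0))).
  exact: integrable_cos_phase.
have si m : mu.-integrable setT (EFin \o (fun x => cos (@phase R d m x + - (pi / 2)))).
  exact: integrable_cos_phase.
transitivity (\int[mu]_x ((complex.Re z / 2 * cos (phase (l + k) x + - (pi / 2)) +
    - (complex.Re z / 2) * cos (phase (l - k) x + - (pi / 2))) + ((complex.Im z / 2) * cos (phase (l + k) x + 0) +
    - (complex.Im z / 2) * cos (phase (l - k) x + 0)))).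
  apply: eq_Rintegral => x _; rewrite !addr0 !cosBpihalf !phaseD phaseN /mode.
  by rewrite !(cosD, sinD) ?cosN ?sinN; field.
rewrite RintegralD//; try by apply: integrable_add => //; apply: integrable_scale.
rewrite RintegralD//; try by apply: integrable_scale.
rewrite RintegralD//; try by apply: integrable_scale.
rewrite !RintegralZl// !integral_cos_phase cosN cos_pihalf cos0 mulr0 !if_same !mulr0 !add0r.
rewrite addr_eq0 subr_eq0.
by case: eqP; case: eqP => _ _ /=; ring.
Qed.

Lemma cvg_psum_mul_delta (F : K -> R) k :
  psum (fun l => F l * (l == k)%:R) n @[n --> \oo] --> F k.
Proof.
rewrite (_ : (fun l => _) = (fun l => if l == k then F k else 0)); first exact: cvg_psum_delta.
by apply/funext => l; case: eqP => [->|_]; rewrite ?mulr1 ?mulr0.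
Qed.

(** In the termwise integral the modes k and -k contribute one half each, and Hermitian symmetry
    makes the two contributions equal. *)
Lemma fourier_wser c k : csummable c -> hermitian c -> fourier (wser c) k = c k.
Proof.
move=> cs ch; have V0 := torus_volume_gt0 R d.
have c1 : mu.-integrable setT (EFin \o (fun x => cos (@phase R d k x))).
  have := integrable_cos_phase k (0 : R).
  by congr (_.-integrable _ _); apply/funext => x /=; rewrite addr0.
have s1 : mu.-integrable setT (EFin \o (fun x => sin (@phase R d k x))).
  have := integrable_cos_phase k (- (pi / 2) : R).
  by congr (_.-integrable _ _); apply/funext => x /=; rewrite cosBpihalf.
apply: complex_ext => /=.
  apply: (canLR (mulKf _)); first by rewrite gt_eqF.
  under eq_Rintegral do rewrite mulrC.
  apply: (rcvg_unique (cvg_integral_wser cs c1)).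
  under eq_fun do under eq_fun do rewrite integral_mode_cos mulrDr.
  rewrite (_ : V * complex.Re (c k) = V / 2 * complex.Re (c k) + V / 2 * complex.Re (c (- k))).
    rewrite (_ : (fun n => _) = (fun n => psum (fun l => V / 2 * complex.Re (c l) * (l == k)%:R) n +
      psum (fun l => V / 2 * complex.Re (c l) * (l == - k)%:R) n)).
      by apply: cvgD; apply: (@cvg_psum_mul_delta (fun l => V / 2 * complex.Re (c l))).
    by apply/funext => n; rewrite psumD.
  by rewrite ch /=; field.
rewrite -mulrN; apply: (canLR (mulKf _)); first by rewrite gt_eqF.
apply: oppr_inj; rewrite opprK.
under eq_Rintegral do rewrite mulrC.
apply: (rcvg_unique (cvg_integral_wser cs s1)).
under eq_fun do under eq_fun do rewrite integral_mode_sin mulrBr.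
rewrite (_ : - (V * complex.Im (c k)) = - (V / 2) * complex.Im (c k) - (- (V / 2) * complex.Im (c (- k)))).
  rewrite (_ : (fun n => _) = (fun n => psum (fun l => - (V / 2) * complex.Im (c l) * (l == k)%:R) n -
    psum (fun l => - (V / 2) * complex.Im (c l) * (l == - k)%:R) n)).
    by apply: cvgB; apply: (@cvg_psum_mul_delta (fun l => - (V / 2) * complex.Im (c l))).
  apply/funext => n; rewrite -[X in _ = _ + X]mulN1r -psumZ -psumD; congr (psum _ n).
  by apply/funext => l; rewrite mulN1r.
by rewrite ch /=; field.
Qed.

(** The difference between f and its series is integrable and has vanishing coefficients, so
    [fourier_uniqueness] applies to it. *)
Lemma fourier_inversion f : mu.-integrable setT (EFin \o f) -> csummable (fourier f) ->
  {ae mu, forall x, f x = wser (fourier f) x}.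
Proof.
move=> fi fs; have wi := integrable_wser fs.
have gi : mu.-integrable setT (EFin \o (fun x => f x - wser (fourier f) x)).
  exact: integrable_sub.
have herm : hermitian (fourier f) by move=> k; exact: fourier_opp.
have V0 := torus_volume_gt0 R d.
have := fourier_uniqueness gi.
have F0 k : fourier (fun x => f x - wser (fourier f) x) k = 0.
  by rewrite fourierB// fourier_wser// subrr.
move=> H; have {}H : {ae mu, forall x, f x - wser (fourier f) x = 0}.
  apply: H => k th.
  have e1 : \int[mu]_x ((f x - wser (fourier f) x) * cos (phase k x)) = 0.
    have /(congr1 (@complex.Re R))/= /eqP := F0 k.
    by rewrite mulf_eq0 invr_eq0 gt_eqF//= => /eqP.
  have e2 : \int[mu]_x ((f x - wser (fourier f) x) * sin (phase k x)) = 0.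
    have /(congr1 (@complex.Im R))/= /eqP := F0 k.
    by rewrite oppr_eq0 mulf_eq0 invr_eq0 gt_eqF//= => /eqP.
  transitivity (\int[mu]_x (cos th * ((f x - wser (fourier f) x) * cos (phase k x)) +
     - sin th * ((f x - wser (fourier f) x) * sin (phase k x)))).
    by apply: eq_Rintegral => x _; rewrite cosD; ring.
  rewrite RintegralD//; first rewrite !RintegralZl// ?e1 ?e2 ?mulr0 ?addr0//.
  - exact: integrable_mul_sin.
  - exact: integrable_mul_cos.
  - by apply: integrable_scale => //; exact: integrable_mul_cos.
  - by apply: integrable_scale => //; exact: integrable_mul_sin.
by apply: filterS H => x /eqP; rewrite subr_eq0 => /eqP.
Qed.

(** A mode is half the sum of z e^{i l.x} and its conjugate, and multiplication by e^{i l.x} shifts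
    Fourier coefficients by l. *)
Lemma fourier_mode_mul (z : R[i]) l g k : mu.-integrable setT (EFin \o g) ->
  fourier (fun x => g x * mode z l x) k =
  Complex (2^-1) 0 * (z * fourier g (k - l) + cconj z * fourier g (k + l)).
Proof.
move=> gi; case: z => a b.
apply: complex_ext; rewrite !(ReM, ImM, ReD, ImD)/= !(mul0r, subr0, addr0).
  transitivity (V^-1 * \int[mu]_x ((a / 2 * (g x * cos (phase (k - l) x)) + a / 2 * (g x * cos (phase (k + l) x)))
     + (b / 2 * (g x * sin (phase (k - l) x)) + - (b / 2) * (g x * sin (phase (k + l) x))))).
    congr (_ * _); apply: eq_Rintegral => x _; rewrite /mode/= !phaseD phaseN.
    by rewrite !(cosD, sinD) ?cosN ?sinN; field.
  rewrite !RintegralD//; try by [apply: integrable_scale => //; first [exact: integrable_mul_cos|exact: integrable_mul_sin]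
    |apply: integrable_add => //; apply: integrable_scale => //; first [exact: integrable_mul_cos|exact: integrable_mul_sin]].
  rewrite !RintegralZl//; try by [exact: integrable_mul_cos|exact: integrable_mul_sin].
  by move: (V^-1) => W; field.
transitivity (- (V^-1 * \int[mu]_x ((a / 2 * (g x * sin (phase (k - l) x)) + a / 2 * (g x * sin (phase (k + l) x)))
     + (- (b / 2) * (g x * cos (phase (k - l) x)) + (b / 2) * (g x * cos (phase (k + l) x)))))).
  congr (- (_ * _)); apply: eq_Rintegral => x _; rewrite /mode/= !phaseD phaseN.
  by rewrite !(cosD, sinD) ?cosN ?sinN; field.
rewrite !RintegralD//; try by [apply: integrable_scale => //; first [exact: integrable_mul_cos|exact: integrable_mul_sin]
  |apply: integrable_add => //; apply: integrable_scale => //; first [exact: integrable_mul_cos|exact: integrable_mul_sin]].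
rewrite !RintegralZl//; try by [exact: integrable_mul_cos|exact: integrable_mul_sin].
by move: (V^-1) => W; field.
Qed.

End wiener_series.

(** * The Wiener algebra: products and exponentials *)

Section wiener_algebra.
Variables (R : realType) (d : nat).
Local Notation mu := (torus_measure R d).
Local Notation K := (d.-tuple int).
Implicit Types (c : K -> R[i]) (f g : d.-tuple R -> R) (k l : K) (x : d.-tuple R).

Definition ecabs c k : \bar R := (cabs c k)%:E.
Definition eftabs f k : \bar R := (ftabs f k)%:E.

Lemma ecabs_ge0 c k : (0 <= ecabs c k)%E.
Proof. by rewrite lee_fin; exact: normc_ge0. Qed.
Lemma eftabs_ge0 f k : (0 <= eftabs f k)%E.
Proof. by rewrite lee_fin; exact: normc_ge0. Qed.
Hint Resolve ecabs_ge0 eftabs_ge0 : core.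

Definition bounded_measurable f : Prop :=
  measurable_fun setT f /\ exists M : R, forall x, `|f x| <= M.

Lemma integrable_bm f : bounded_measurable f -> mu.-integrable setT (EFin \o f).
Proof. by move=> [mf [M fM]]; apply: (integrable_bounded_box (M := M)). Qed.

Lemma bmM f g : bounded_measurable f -> bounded_measurable g ->
  bounded_measurable (fun x => f x * g x).
Proof.
move=> [mf [M fM]] [mg [N gN]]; split; first exact: measurable_funM.
by exists (M * N) => x; rewrite normrM ler_pM.
Qed.

Lemma bm_wser c : csummable c -> bounded_measurable (wser c).
Proof.
move=> cs; split; first exact: measurable_wser.
by exists (fine (asum (cabs c))) => x; exact: norm_wser_le.
Qed.

Lemma ftabs_limit_le (F : nat -> d.-tuple R -> R) f (M : R) (B : \bar R) k :
  (forall n, measurable_fun setT (F n)) -> measurable_fun setT f ->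
  (forall n x, `|F n x| <= M) -> (forall x, F n x @[n --> \oo] --> f x) ->
  (forall n, eftabs (F n) k <= B)%E -> (eftabs f k <= B)%E.
Proof.
move=> mF mf FM Ff; case: B => [B FB||].
- have [cR cI] := fourier_dominated k mF mf FM Ff.
  rewrite lee_fin; apply: (normc_cvg_le cR cI) => n.
  by have := FB n; rewrite lee_fin.
- by move=> _; rewrite leey.
- by move=> /(_ 0%N); have := eftabs_ge0 (F 0%N) k; rewrite leeNy_eq => + /eqP H; rewrite H.
Qed.

(** The bound holds for the partial sums of the series, by [fourier_mode_mul], and passes to the
    limit because these are uniformly bounded. *)
Lemma ftabs_wser_mul c g k : csummable c -> hermitian c -> bounded_measurable g ->
  (eftabs (fun x => wser c x * g x)%R k <= conv (ecabs c) (eftabs g) k)%E.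
Proof.
move=> cs ch gb; have gi := integrable_bm gb; case: gb => mg [M gM].
pose a l : R := cabs c l * ftabs g (k - l).
(* A mode l reaches the coefficients k - l and k + l with factor 1/2 each; averaging a over l and -l
   reflects this without changing its sum. *)
pose H l : R := 2^-1 * (a l + a (- l)).
have a0 l : 0 <= a l by rewrite mulr_ge0 ?normc_ge0.
have H0 l : 0 <= H l by rewrite mulr_ge0 ?addr_ge0// invr_ge0.
have -> : conv (ecabs c) (eftabs g) k = asum a.
  by apply: eq_esum => l _; rewrite /ecabs /eftabs -EFinM.
have -> : asum a = asum H.
  rewrite /asum [RHS](_ : _ = (2^-1)%:E * \esum_(l in [set: K]) ((a l)%:E + (a (- l))%:E))%E; last first.
    by rewrite -ge0_esumZl//; move=> l; rewrite adde_ge0 ?lee_fin.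
  rewrite esumD//; try by move=> l _; rewrite lee_fin.
  rewrite (@esum_bij _ _ (fun l => - l) (fun l => - l) (fun l => (a l)%:E))//; try exact: opprK.
  have S0 : (0 <= \esum_(l in [set: K]) (a l)%:E)%E by apply: esum_ge0 => l _; rewrite lee_fin.
  move: S0; case: (\esum_(l in [set: K]) (a l)%:E)%E => [s _||]//.
    by rewrite -EFinD -EFinM; congr (_%:E); field.
  by rewrite addey// gt0_muley// lte_fin invr_gt0.
apply: (@ftabs_limit_le (fun n x => psum (fun l => mode (c l) l x) n * g x) _ (fine (asum (cabs c)) * M)).
- by move=> n; apply: measurable_funM => //; exact: measurable_psum_mode.
- by apply: measurable_funM => //; exact: measurable_wser.
- move=> n x; rewrite normrM ler_pM//.
  apply: (@le_trans _ _ (psum (cabs c) n)); last by apply: psum_le_fine => // l; exact: normc_ge0.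
  by apply: norm_psum_le => l; exact: norm_mode_le.
- by move=> x; apply: cvgMl; exact: cvg_wser.
move=> n; apply: le_trans (psum_asum n H0); rewrite lee_fin /ftabs.
rewrite (_ : (fun x => _) = (fun x => \sum_(0 <= j < n)
    oapp (fun l => g x * mode (c l) l x) 0 (pickle_inv j))); last first.
  apply/funext => x; rewrite /psum mulr_suml; apply: eq_bigr => j _.
  by case: pickle_inv => [l|] /=; rewrite ?mul0r// mulrC.
rewrite fourier_sum; last first.
  move=> j; case: (pickle_inv j) => [l|] /=; first exact: integrable_mode_mul.
  exact: integrable0.
apply: le_trans (normc_sum_le _ _) _; apply: ler_sum => j _.
case: (pickle_inv j) => [l|]; cbv beta iota delta [oapp].
  rewrite fourier_mode_mul// Normc.normcM normc_real ger0_norm ?invr_ge0//.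
  apply: ler_wpM2l; first by rewrite invr_ge0.
  apply: le_trans (normcD_le _ _) _; rewrite !Normc.normcM normcJ /a opprK.
  by rewrite /cabs ch normcJ.
rewrite (_ : fourier _ _ = 0) ?Normc.normc0//.
by apply: complex_ext => /=; under eq_Rintegral do rewrite mul0r;
  rewrite /Rintegral integral0 mulr0 ?oppr0.
Qed.

Lemma ftabs_mul f g k : bounded_measurable f -> bounded_measurable g ->
  csummable (fourier f) ->
  (eftabs (fun x => f x * g x)%R k <= conv (eftabs f) (eftabs g) k)%E.
Proof.
move=> fb gb fs; have fi := integrable_bm fb.
have fh : hermitian (fourier f) by move=> l; exact: fourier_opp.
have := ftabs_wser_mul k fs fh gb.
rewrite /eftabs /ftabs -(@fourier_ae _ _ (fun x => f x * g x))//.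
- by apply: integrable_bm; exact: bmM.
- by apply: integrable_bm; apply: bmM => //; exact: bm_wser.
- by apply: filterS (fourier_inversion fi fs) => x ->.
Qed.

Lemma fourier_cst1 k : fourier (fun _ => 1 : R) k = ((k == 0)%:R : R[i]).
Proof.
have V0 := torus_volume_gt0 R d.
have e1 : \int[mu]_x (1 * cos (phase k x)) = if k == 0 then (2 * pi) ^+ d else 0.
  rewrite -[X in if _ then X else _]mulr1 -[X in _ * X]cos0 -integral_cos_phase.
  by apply: eq_Rintegral => x _; rewrite mul1r addr0.
have e2 : \int[mu]_x (1 * sin (phase k x)) = 0.
  transitivity (\int[mu]_x cos (phase k x + - (pi / 2))).
    by apply: eq_Rintegral => x _; rewrite mul1r cosBpihalf.
  by rewrite integral_cos_phase cosN cos_pihalf mulr0 if_same.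
apply: complex_ext => /=; rewrite ?e1 ?e2 ?mulr0 ?oppr0; case: eqP => _ //=.
- by rewrite mulVf ?gt_eqF.
- by rewrite mulr0.
Qed.

Lemma ftabs_wser_exp c n k : csummable c -> hermitian c ->
  (eftabs (fun x => wser c x ^+ n)%R k <= cpow (ecabs c) n k)%E.
Proof.
move=> cs ch; elim: n k => [|n IH] k.
  rewrite /eftabs /ftabs (_ : (fun x => _) = (fun=> 1)); last by apply/funext => x; rewrite expr0.
  by rewrite fourier_cst1/=; case: eqP => _; rewrite ?Normc.normc1 ?Normc.normc0.
rewrite (_ : (fun x => _) = (fun x => wser c x * wser c x ^+ n)); last first.
  by apply/funext => x; rewrite exprS.
apply: le_trans (ftabs_wser_mul k cs ch _) _.
  elim: n {IH} => [|n [mn [M nM]]].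
    split; first by under eq_fun do rewrite expr0; exact: measurable_cst.
    by exists 1 => x; rewrite expr0 normr1.
  under eq_fun do rewrite exprS; apply: bmM; first exact: bm_wser.
  by split => //; exists M.
by apply: le_conv.
Qed.

(** The remainder of the exponential series whose coefficients [cexp j] bounds; [expT 2] is the
    nonlinearity e^p - 1 - p. *)
Definition expT (j : nat) (y : R) : R := expR y - \sum_(0 <= i < j) (i`!%:R)^-1 * y ^+ i.

Lemma measurable_expT j : measurable_fun setT (expT j).
Proof.
apply: measurable_funB; first exact: measurable_expR.
apply: measurable_sum => i; apply: measurable_funM => //.
Qed.

Lemma series_expT j (y : R) N :
  \sum_(0 <= i < N) ((i + j)`!%:R)^-1 * y ^+ (i + j) =
  series (exp_coeff y) (N + j) - \sum_(0 <= i < j) (i`!%:R)^-1 * y ^+ i.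
Proof.
rewrite /series/= (@big_cat_nat _ _ _ j 0 (N + j))//= ?leq_addl//.
rewrite addrAC [X in X - _](_ : _ = \sum_(0 <= i < j) (i`!%:R)^-1 * y ^+ i); last first.
  by apply: eq_bigr => i _; rewrite exp_coeffE.
rewrite subrr add0r -[in RHS](add0n j) big_addn addnK.
by apply: eq_bigr => i _; rewrite exp_coeffE.
Qed.

Lemma cvg_expT j (y : R) :
  \sum_(0 <= i < N) ((i + j)`!%:R)^-1 * y ^+ (i + j) @[N --> \oo] --> expT j y.
Proof.
under eq_fun do rewrite series_expT.
apply: cvgB; last exact: cvg_cst.
by rewrite (cvg_shiftn j (series (exp_coeff y))); exact: is_cvg_series_exp_coeff.
Qed.

Lemma norm_sum_expT_le j (y M : R) N : `|y| <= M ->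
  `|\sum_(0 <= i < N) ((i + j)`!%:R)^-1 * y ^+ (i + j)| <= expR M.
Proof.
move=> yM; have M0 : 0 <= M by exact: le_trans yM.
apply: (@le_trans _ _ (series (exp_coeff M) (N + j))); last first.
  apply: (@nondecreasing_cvgn_le R (series (exp_coeff M))); last exact: is_cvg_series_exp_coeff.
  apply/nondecreasing_seqP => n; rewrite /series/= big_nat_recr//= lerDl.
  exact: exp_coeff_ge0.
apply: le_trans (ler_norm_sum _ _ _) _.
apply: (@le_trans _ _ (\sum_(0 <= i < N) ((i + j)`!%:R)^-1 * M ^+ (i + j))).
  apply: ler_sum => i _; rewrite normrM normrX ger0_norm ?invr_ge0//.
  by apply: ler_wpM2l; rewrite ?invr_ge0// lerXn2r// nnegrE.
rewrite series_expT lerBlDr lerDl; apply: sumr_ge0 => i _.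
by rewrite mulr_ge0 ?invr_ge0 ?exprn_ge0.
Qed.

Lemma bm_expT_wser j c : csummable c -> bounded_measurable (fun x => expT j (wser c x)).
Proof.
move=> cs; split.
  by apply: (measurableT_comp (measurable_expT j)); exact: measurable_wser.
exists (expR (fine (asum (cabs c)))) => x.
have cN : `|\sum_(0 <= i < N) ((i + j)`!%:R)^-1 * wser c x ^+ (i + j)| @[N --> \oo] -->
    `|expT j (wser c x)| by apply: cvg_norm; exact: cvg_expT.
rewrite -(cvg_lim (@Rhausdorff R) cN); apply: limr_le; first by apply/cvg_ex; eexists; exact: cN.
by apply: nearW => N; apply: norm_sum_expT_le; exact: norm_wser_le.
Qed.

Lemma ftabs_expT j c k : csummable c -> hermitian c ->
  (eftabs (fun x => expT j (wser c x)) k <= cexp j (ecabs c) k)%E.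
Proof.
move=> cs ch.
have mX n : measurable_fun setT (fun x => ((n + j)`!%:R)^-1 * wser c x ^+ (n + j)).
  by apply: measurable_funM => //; apply: measurable_funX; exact: measurable_wser.
apply: (@ftabs_limit_le (fun N x => \sum_(0 <= i < N) ((i + j)`!%:R)^-1 * wser c x ^+ (i + j))
  _ (expR (fine (asum (cabs c))))).
- by move=> N; apply: measurable_sum => i; exact: mX.
- by case: (bm_expT_wser j cs).
- by move=> N x; apply: norm_sum_expT_le; exact: norm_wser_le.
- by move=> x; exact: cvg_expT.
move=> N; rewrite /eftabs /ftabs.
have Xi n : mu.-integrable setT (EFin \o (fun x => wser c x ^+ n)).
  apply: integrable_bm; split; first by apply: measurable_funX; exact: measurable_wser.
  exists (fine (asum (cabs c)) ^+ n) => x; rewrite normrX lerXn2r ?nnegrE//.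
    exact: le_trans (norm_wser_le x cs).
  exact: norm_wser_le.
rewrite fourier_sum; last by move=> i; apply: integrable_scale => //; exact: Xi.
apply: (@le_trans _ _ (\sum_(0 <= i < N) (((i + j)`!%:R)^-1)%:E * cpow (ecabs c) (i + j)%N k)%E).
  apply: (@le_trans _ _ (\sum_(0 <= i < N) (((i + j)`!%:R)^-1)%:E * eftabs (fun x => wser c x ^+ (i + j))%R k)%E).
    rewrite [leRHS](_ : _ = (\sum_(0 <= i < N) ((i + j)`!%:R)^-1 *
      ftabs (fun x => wser c x ^+ (i + j)) k)%:E); last by rewrite -sumEFin.
    rewrite lee_fin; apply: le_trans (normc_sum_le _ _) _; apply: ler_sum => i _.
    by rewrite fourierZ// Normc.normcM normc_real ger0_norm ?invr_ge0.
  apply: lee_sum => i _; apply: lee_wpmul2l; first by rewrite lee_fin invr_ge0.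
  exact: ftabs_wser_exp.
rewrite /cexp -nneseries_esumT; last first.
  by move=> n; rewrite mule_ge0// ?lee_fin ?invr_ge0//; exact: cpow_ge0.
apply: nneseries_lim_ge => i _ _.
by rewrite mule_ge0// ?lee_fin ?invr_ge0//; exact: cpow_ge0.
Qed.

Lemma asum_ftabs_expT1 c (a : R) : hermitian c -> (asum (cabs c) <= a%:E)%E -> a <= 1 ->
  (asum (ftabs (fun x => expT 1 (wser c x))) <= (a + a ^+ 2)%:E)%E.
Proof.
move=> ch ca a1; have cs : csummable c by exact: le_lt_trans ca (ltry _).
apply: le_trans (esum_cexp1 (@ecabs_ge0 c) ca a1).
by apply: ge0_lee_esum => k; exact: ftabs_expT.
Qed.

Lemma asum_ftabs_expT2 c (a : R) : hermitian c -> (asum (cabs c) <= a%:E)%E -> a <= 1 ->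
  (asum (ftabs (fun x => expT 2 (wser c x))) <= (a ^+ 2)%R%:E)%E.
Proof.
move=> ch ca a1; have cs : csummable c by exact: le_lt_trans ca (ltry _).
apply: le_trans (esum_cexp2 (@ecabs_ge0 c) ca a1).
by apply: ge0_lee_esum => k; exact: ftabs_expT.
Qed.

(** On the right stand a product of factors of orders z and y - z and a term of second order in y -
    z. For small data both are small compared with y - z, whence the contraction. *)
Lemma expT2B (y z : R) :
  expT 2 y - expT 2 z = expT 1 z * expT 1 (y - z) + expT 2 (y - z).
Proof.
rewrite /expT !big_nat_recr//= !big_geq// !fact0 !factS fact0 !expr0 !expr1.
have -> : expR y = expR z * expR (y - z) by rewrite -expRD addrC subrK.
by rewrite muln1 invr1; ring.
Qed.

Lemma hermitianB c c' : hermitian c -> hermitian c' -> hermitian (fun k => c k - c' k).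
Proof.
by move=> ch ch' k; rewrite ch ch'; apply: complex_ext; rewrite ?ReD ?ReN ?ImD ?ImN/=; ring.
Qed.

Lemma ftabs_expT2B c c' k : csummable c -> hermitian c -> hermitian c' ->
  (asum (cabs c') <= 1)%E ->
  (eftabs (fun x => expT 2 (wser c x) - expT 2 (wser c' x))%R k <=
    conv (cexp 1 (ecabs c')) (cexp 1 (ecabs (fun k => c k - c' k)%R)) k +
    cexp 2 (ecabs (fun k => c k - c' k)%R) k)%E.
Proof.
move=> cs ch ch' c1; have cs' : csummable c' by exact: le_lt_trans c1 (ltry _).
pose e l := c l - c' l; have es : csummable e by exact: csummableB.
have eh : hermitian e by exact: hermitianB.
have fs : csummable (fourier (fun x => expT 1 (wser c' x))).
  by apply: le_lt_trans (asum_ftabs_expT1 ch' c1 (lexx _)) (ltry _).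
have b1 := bm_expT_wser 1 cs'; have b2 := bm_expT_wser 1 es; have b3 := bm_expT_wser 2 es.
rewrite {1}/eftabs /ftabs (_ : (fun x => _) = (fun x => expT 1 (wser c' x) * expT 1 (wser e x) +
   expT 2 (wser e x))); last by apply/funext => x; rewrite expT2B wserB.
rewrite fourierD; [|exact: integrable_bm (bmM b1 b2)|exact: integrable_bm b3].
apply: (@le_trans _ _ (eftabs (fun x => expT 1 (wser c' x) * expT 1 (wser e x))%R k +
   eftabs (fun x => expT 2 (wser e x)) k)%E).
  by rewrite -EFinD lee_fin; exact: normcD_le.
apply: leeD; last exact: ftabs_expT.
apply: le_trans (ftabs_mul k b1 b2 fs) _.
by apply: le_conv => // l; exact: ftabs_expT.
Qed.

Lemma asum_ftabs_expT2B c c' (a b : R) : hermitian c -> hermitian c' ->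
  (asum (cabs c') <= a%:E)%E -> a <= 1 -> csummable c ->
  (asum (cabs (fun k => c k - c' k)%R) <= b%:E)%E -> b <= 1 ->
  (asum (ftabs (fun x => expT 2 (wser c x) - expT 2 (wser c' x))%R) <=
    ((a + a ^+ 2) * (b + b ^+ 2) + b ^+ 2)%:E)%E.
Proof.
move=> ch ch' c1 a1 cs eb b1.
have c1' : (asum (cabs c') <= 1)%E by apply: le_trans c1 _; rewrite lee_fin.
apply: (@le_trans _ _ (\esum_(k in [set: K])
  (conv (cexp 1 (ecabs c')) (cexp 1 (ecabs (fun k => c k - c' k)%R)) k +
    cexp 2 (ecabs (fun k => c k - c' k)%R) k))%E).
  by apply: ge0_lee_esum => k; exact: ftabs_expT2B.
rewrite esumD; [|by move=> k _; apply: conv_ge0 => l; exact: cexp_ge0|by move=> k _; exact: cexp_ge0].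
rewrite EFinD EFinM; apply: leeD; last exact: esum_cexp2.
rewrite esum_conv; [|by move=> l; exact: cexp_ge0|by move=> l; exact: cexp_ge0].
apply: lee_pmul; [by apply: esum_ge0 => k _; exact: cexp_ge0|
  by apply: esum_ge0 => k _; exact: cexp_ge0|exact: esum_cexp1|exact: esum_cexp1].
Qed.

End wiener_algebra.

(** * The mild formulation and its fixed point *)

Section primitive.
Variable R : realType.
Local Notation leb := (@lebesgue_measure R).
Implicit Types (g h G z : R -> R) (s t a b : R).

(* The lower bound -1 makes the primitive differentiable at 0 as well. *)
Definition prim g t : R :=
  \int[leb]_(s in `[-1, t]) g s - \int[leb]_(s in `[-1, 0]) g s.

Lemma prim0 g : prim g 0 = 0.
Proof. by rewrite /prim subrr. Qed.

Lemma integrable_continuous_itv g a b : continuous g ->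
  leb.-integrable `[a, b] (EFin \o g).
Proof.
move=> cg; apply: continuous_compact_integrable; first exact: segment_compact.
exact: continuous_subspaceT.
Qed.

Lemma is_derive_prim g t : continuous g -> -1 < t -> is_derive t 1 (prim g) (g t).
Proof.
move=> cg t1.
have tu : t < t + 1 by rewrite ltrDl.
have [dF F't] := continuous_FTC1_closed tu (integrable_continuous_itv (-1) (t + 1) cg) t1 (cg t).
have H : is_derive t 1 (fun x => \int[leb]_(s in `[-1, x]) g s) (g t).
  by apply: DeriveDef; [exact: dF|rewrite -derive1E F't].
rewrite -[g t]subr0; exact: is_deriveB.
Qed.

Lemma derive_diff_le (F z : R -> R) t (B : R) : 0 <= t ->
  (forall s, 0 <= s -> is_derive s 1 F (z s)) ->
  (forall s, 0 <= s <= t -> z s <= B) -> F t - F 0 <= B * t.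
Proof.
rewrite le_eqVlt => /predU1P[<-|t0] dF zB; first by rewrite subrr mulr0.
have cF : {within `[0, t], continuous F}.
  apply: derivable_within_continuous => s; rewrite in_itv/= => /andP[s0 _].
  by have [] := dF s s0.
have [s|s sI ->] := @MVT R F z 0 t t0 _ cF.
  by rewrite in_itv/= => /andP[s0 _]; apply: dF; exact: ltW.
rewrite subr0 ler_pM2r//; apply: zB.
by move: sI; rewrite in_itv/= => /andP[s0 st]; rewrite !ltW.
Qed.

Lemma prim_le g G z t : continuous g -> 0 <= t ->
  (forall s, 0 <= s -> is_derive s 1 G (z s)) ->
  (forall s, 0 <= s <= t -> g s <= z s) -> prim g t <= G t - G 0.
Proof.
move=> cg t0 dG gz.
have H s : 0 <= s -> is_derive s 1 (fun x => prim g x - G x) (g s - z s).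
  move=> s0; apply: is_deriveB; last exact: dG.
  by apply: is_derive_prim => //; apply: lt_le_trans s0.
have := @derive_diff_le _ _ t 0 t0 H.
rewrite prim0 mul0r => /(_ _)K; rewrite -subr_le0.
have {}K : prim g t - G t - (0 - G 0) <= 0 by apply: K => s st; rewrite subr_le0; exact: gz.
lra.
Qed.

Lemma prim_unique g G t : continuous g -> 0 <= t ->
  (forall s, 0 <= s -> is_derive s 1 G (g s)) -> prim g t = G t - G 0.
Proof.
move=> cg t0 dG; apply/eqP; rewrite eq_le; apply/andP; split; first exact: prim_le cg t0 dG _.
have H s : 0 <= s -> is_derive s 1 (fun x => G x - prim g x) 0.
  move=> s0; rewrite -(subrr (g s)); apply: is_deriveB; first exact: dG.
  by apply: is_derive_prim => //; apply: lt_le_trans s0.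
have := @derive_diff_le _ _ t 0 t0 H (fun _ _ => lexx _).
rewrite prim0 mul0r; lra.
Qed.

Lemma continuous_prim_max g : continuous g -> continuous (fun t => prim g (Num.max t 0)).
Proof.
move=> cg t; apply: (@continuous_comp _ _ _ (fun t => Num.max t 0) (prim g)).
  by apply: continuous_max; [exact: cvg_id|exact: cvg_cst].
have m1 : -1 < Num.max t 0 by rewrite lt_max ltrN10 orbT.
have [dp _] := is_derive_prim cg m1.
by apply: differentiable_continuous; exact/derivable1_diffP.
Qed.

Lemma is_derive_expZ (a t : R) : is_derive t 1 (fun s => expR (a * s)) (a * expR (a * t)).
Proof.
have H : is_derive t 1 (fun s => a * s) a.
  by rewrite -[X in is_derive _ _ _ X]mulr1; apply: is_deriveZ.
by rewrite mulrC; exact: is_derive1_comp (is_derive_expR (a * t)) H.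
Qed.

Lemma continuous_expZ (a : R) : continuous (fun s : R => expR (a * s)).
Proof.
move=> t; apply: continuous_comp; last exact: continuous_expR.
by apply: (@continuousM _ _ (cst a) id); [exact: cst_continuous|exact: cvg_id].
Qed.

Lemma continuous_comb (x y : R) g h : continuous g -> continuous h ->
  continuous (fun s => x * g s + y * h s).
Proof.
move=> cg ch s; apply: (@continuousD _ _ _ (fun s => x * g s) (fun s => y * h s)).
  by apply: (@continuousM _ _ (cst x) g); [exact: cst_continuous|exact: cg].
by apply: (@continuousM _ _ (cst y) h); [exact: cst_continuous|exact: ch].
Qed.

(* Duhamel's formula for y' = - lam * (y + g), y 0 = a. *)
Definition duh (lam a : R) g t : R :=
  expR (- lam * t) * (a - prim (fun s => lam * expR (lam * s) * g s) t).

Lemma duh0 (lam a : R) g : duh lam a g 0 = a.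
Proof. by rewrite /duh mulr0 expR0 mul1r prim0 subr0. Qed.

Lemma continuous_duh_integrand (lam : R) g : continuous g ->
  continuous (fun s => lam * expR (lam * s) * g s).
Proof.
move=> cg t; apply: (@continuousM _ _ (fun s => lam * expR (lam * s)) g); last exact: cg.
apply: (@continuousM _ _ (cst lam) (fun s => expR (lam * s))); first exact: cst_continuous.
exact: continuous_expZ.
Qed.

Lemma is_derive_duh (lam a : R) g t : continuous g -> -1 < t ->
  is_derive t 1 (duh lam a g) (- lam * (duh lam a g t + g t)).
Proof.
move=> cg t1; have ci := continuous_duh_integrand (lam := lam) cg.
have H1 : is_derive t 1 (fun s => a - prim (fun s => lam * expR (lam * s) * g s) s)
    (0 - lam * expR (lam * t) * g t).
  by apply: is_deriveB; exact: is_derive_prim ci t1.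
have H2 := is_derive_expZ (- lam) t.
have H3 := is_deriveM H2 H1.
rewrite (_ : duh lam a g = (fun s => expR (- lam * s)) * (fun s => a - prim (fun s => lam * expR (lam * s) * g s) s)); last by apply/funext.
rewrite [X in is_derive _ _ _ X](_ : _ = expR (- lam * t) * (0 - lam * expR (lam * t) * g t) +
  (a - prim (fun s => lam * expR (lam * s) * g s) t) * (- lam * expR (- lam * t))); first exact: H3.
have E : expR (- lam * t) * expR (lam * t) = 1 by rewrite -expRD mulNr addNr expR0.
rewrite [LHS](_ : _ = - lam * (expR (- lam * t) * (a - prim (fun s => lam * expR (lam * s) * g s) t) + g t))//.
set p := prim _ _; move: E; move: (expR (- lam * t)) (expR (lam * t)) => e e' E.
transitivity (- lam * (e * (a - p) + (e * e') * g t)); first by rewrite E mul1r.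
ring.
Qed.

Lemma continuous_duh_max (lam a : R) g : continuous g ->
  continuous (fun t => duh lam a g (Num.max t 0)).
Proof.
move=> cg t; apply: (@continuousM _ _ (fun t => expR (- lam * Num.max t 0))
  (fun t => a - prim _ (Num.max t 0))).
  apply: (@continuous_comp _ _ _ (fun t => Num.max t 0) (fun s => expR (- lam * s))).
    by apply: continuous_max; [exact: cvg_id|exact: cvg_cst].
  exact: continuous_expZ.
apply: continuousB; first exact: cst_continuous.
exact/continuous_prim_max/continuous_duh_integrand.
Qed.

Lemma duh_lin (lam a b x y : R) g h t : continuous g -> continuous h -> 0 <= t ->
  duh lam (x * a + y * b) (fun s => x * g s + y * h s) t =
  x * duh lam a g t + y * duh lam b h t.
Proof.
move=> cg ch t0; rewrite /duh.
have -> : prim (fun s => lam * expR (lam * s) * (x * g s + y * h s)) t =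
    x * prim (fun s => lam * expR (lam * s) * g s) t + y * prim (fun s => lam * expR (lam * s) * h s) t;
  last by ring.
pose G s := x * prim (fun s => lam * expR (lam * s) * g s) s +
   y * prim (fun s => lam * expR (lam * s) * h s) s.
transitivity (G t - G 0); last by rewrite /G !prim0; ring.
apply: prim_unique => //.
  by apply: continuous_duh_integrand; exact: continuous_comb.
move=> s s0; have s1 : -1 < s by exact: lt_le_trans s0.
have H1 := is_derive_prim (continuous_duh_integrand (lam := lam) cg) s1.
have H2 := is_derive_prim (continuous_duh_integrand (lam := lam) ch) s1.
have K1 := is_deriveZ x H1; have K2 := is_deriveZ y H2.
have K := is_deriveD K1 K2; apply: is_derive_eq.
by rewrite -![_ *: _]/(_ * _); ring.
Qed.

(** A function G that starts above alpha and grows at least as fast as the bound on the Duhamel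
    integrand dominates data plus integral. Exhibiting G replaces the computation of an integral. *)
Lemma duh_bound (lam a alpha : R) g (beta G z : R -> R) t : 0 <= lam -> continuous g ->
  0 <= t -> `|a| <= alpha -> alpha <= G 0 ->
  (forall s, 0 <= s <= t -> `|g s| <= beta s) ->
  (forall s, 0 <= s -> is_derive s 1 G (z s)) ->
  (forall s, 0 <= s <= t -> lam * expR (lam * s) * beta s <= z s) ->
  `|duh lam a g t| <= expR (- lam * t) * G t.
Proof.
move=> l0 cg t0 aal aG gb dG bz; have ci := continuous_duh_integrand (lam := lam) cg.
have cN : continuous (fun s => - (lam * expR (lam * s) * g s)).
  by move=> s; apply: (@continuousN _ _ _ (fun s => lam * expR (lam * s) * g s)); exact: ci.
have K (e : R) s : `|e| = 1 -> 0 <= s <= t -> e * (lam * expR (lam * s) * g s) <= z s.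
  move=> e1 st; apply: le_trans (bz s st); apply: le_trans (ler_norm _) _.
  rewrite normrM e1 mul1r normrM; have h0 : 0 <= lam * expR (lam * s) by rewrite mulr_ge0 ?expR_ge0.
  by rewrite (ger0_norm h0) ler_wpM2l// gb.
have p1 := @prim_le _ G z t ci t0 dG; have p2 := @prim_le _ G z t cN t0 dG.
have {}p1 : prim (fun s => lam * expR (lam * s) * g s) t <= G t - G 0.
  by apply: p1 => s st; have := K 1 s (normr1 _) st; rewrite mul1r.
have {}p2 : prim (fun s => - (lam * expR (lam * s) * g s)) t <= G t - G 0.
  by apply: p2 => s st; have := K (-1) s (normrN1 _) st; rewrite mulN1r.
have pN : prim (fun s => - (lam * expR (lam * s) * g s)) t = - prim (fun s => lam * expR (lam * s) * g s) t - - prim (fun s => lam * expR (lam * s) * g s) 0.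
  apply: (@prim_unique _ (fun s => - prim (fun s => lam * expR (lam * s) * g s) s)) => //.
  by move=> s s0; apply: is_deriveN; apply: is_derive_prim => //; exact: lt_le_trans s0.
rewrite pN prim0 oppr0 subr0 in p2.
rewrite /duh normrM ger0_norm ?expR_ge0// ler_wpM2l ?expR_ge0//.
move: aal; rewrite !ler_norml => /andP[a1 a2]; apply/andP; split; lra.
Qed.

Lemma duh_bound_cst (lam a alpha b : R) g t : 0 <= lam -> continuous g -> 0 <= t ->
  `|a| <= alpha -> (forall s, 0 <= s <= t -> `|g s| <= b) ->
  `|duh lam a g t| <= alpha + b.
Proof.
move=> l0 cg t0 aal gb.
have b0 : 0 <= b by apply: le_trans (gb 0 _); rewrite ?lexx.
have al0 : 0 <= alpha by exact: le_trans aal.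
apply: le_trans (@duh_bound lam a alpha g (cst b) (fun s => alpha + b * expR (lam * s))
   (fun s => b * (lam * expR (lam * s))) t l0 cg t0 aal _ gb _ _) _.
- by rewrite lerDl mulr_ge0 ?expR_ge0.
- move=> s s0; rewrite -[X in is_derive _ _ _ X]add0r; apply: is_deriveD.
  by apply: is_deriveZ; exact: is_derive_expZ.
- by move=> s _; rewrite mulrC.
rewrite mulrDr mulrCA -expRD mulNr addNr expR0 mulr1 lerD2r ler_piMl//.
by rewrite -expR0 ler_expR oppr_le0 mulr_ge0.
Qed.

End primitive.

(** * The supermultiplicative weight *)

Section weight.
Variables (R : realType) (d : nat).
Local Notation K := (d.-tuple int).
Local Notation q := (@freq_norm R d).
Implicit Types (k l : K) (s t : R).

Definition root4 t : R := Num.sqrt (Num.sqrt t).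
(** Small enough for e^eps / (1 - eps) <= 21/20, the loss factor in [duh_bound_weight]. *)
Definition eps : R := 100^-1.
(* Up to a constant, exp (- |k|^4 t) is dominated by weight t k, which unlike it is
   supermultiplicative in k, so that bounds c_k = O(weight t k) survive convolution. *)
Definition weight t k : R := expR (- (eps * (q k * root4 t))).

Lemma root4_ge0 t : 0 <= root4 t. Proof. exact: sqrtr_ge0. Qed.

Lemma root4X t : 0 <= t -> root4 t ^+ 4 = t.
Proof. by move=> t0; rewrite (exprM _ 2 2) !sqr_sqrtr ?sqrtr_ge0. Qed.

(** Fourth powers are superadditive on nonnegative numbers. *)
Lemma root4_subadd s t : 0 <= s -> s <= t -> root4 t <= root4 s + root4 (t - s).
Proof.
move=> s0 st; have t0 := le_trans s0 st; have ts0 : 0 <= t - s by rewrite subr_ge0.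
have a0 := root4_ge0 s; have b0 := root4_ge0 (t - s).
rewrite -(@ler_pXn2r _ 4)// ?nnegrE ?addr_ge0 ?root4_ge0// (root4X t0).
have E : t = root4 s ^+ 4 + root4 (t - s) ^+ 4 by rewrite !root4X//; ring.
rewrite [leLHS]E.
move: (root4 s) (root4 (t - s)) a0 b0 => a b a0 b0.
rewrite -subr_ge0 (_ : _ - _ = 4 * (a ^+ 3 * b) + 6 * (a ^+ 2 * b ^+ 2) + 4 * (a * b ^+ 3)); last by ring.
by rewrite !addr_ge0// mulr_ge0// mulr_ge0// exprn_ge0.
Qed.

Lemma le_1Dexp4 (x : R) : 0 <= x -> x <= 1 + x ^+ 4.
Proof.
move=> x0; case: (leP x 1) => x1; first by apply: le_trans x1 _; rewrite lerDl exprn_ge0.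
apply: (@le_trans _ _ (x ^+ 4)); last by rewrite lerDr.
by rewrite -[leLHS]expr1 ler_weXn2l// ltW.
Qed.

Lemma eps_gt0 : 0 < eps. Proof. by rewrite /eps invr_gt0. Qed.

Lemma weight_gt0 t k : 0 < weight t k. Proof. exact: expR_gt0. Qed.

Lemma weight_le1 t k : weight t k <= 1.
Proof.
by rewrite -expR0 ler_expR oppr_le0 !mulr_ge0 ?root4_ge0 ?freq_norm_ge0 ?ltW ?eps_gt0.
Qed.

Lemma weight0 t : weight t 0 = 1.
Proof. by rewrite /weight freq_norm0 mul0r mulr0 oppr0 expR0. Qed.

Lemma weight_mul t k l : weight t k * weight t l <= weight t (k + l).
Proof.
rewrite /weight -expRD ler_expR -opprD lerN2 -mulrDr; apply: ler_wpM2l; first exact/ltW/eps_gt0.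
by rewrite -mulrDl ler_wpM2r ?root4_ge0// freq_normD.
Qed.

Lemma expR_eps_le : expR eps <= 100 / 99.
Proof.
have h : 1 - eps <= expR (- eps) by rewrite -subr_ge0 opprB addrA; have := expR_ge1Dx (- eps); lra.
rewrite expRN in h; have e0 := expR_gt0 eps.
rewrite -[leLHS]invrK -[leRHS]invrK lef_pV2 ?posrE ?invr_gt0 ?divr_gt0//.
by apply: le_trans h; rewrite /eps; lra.
Qed.

(** With x = |k| t^(1/4), the exponents satisfy - x^4 <= eps - eps x because x <= 1 + x^4. *)
Lemma expR_le_weight t k : 0 <= t -> expR (- q k ^+ 4 * t) <= expR eps * weight t k.
Proof.
move=> t0; rewrite /weight -expRD ler_expR.
have x0 : 0 <= q k * root4 t by rewrite mulr_ge0 ?root4_ge0 ?freq_norm_ge0.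
have X : (q k * root4 t) ^+ 4 = q k ^+ 4 * t by rewrite exprMn root4X.
have := le_1Dexp4 x0; have x4 : 0 <= (q k * root4 t) ^+ 4 by exact: exprn_ge0.
rewrite mulNr -X; move: (q k * root4 t) x0 x4 => x x0 x4; rewrite /eps; lra.
Qed.

(** Subadditivity of the fourth root, then x <= 1 + x^4 at x = |k| (t - s)^(1/4). The growth rate
    eps |k|^4 is a small fraction of the dissipation rate |k|^4, so Duhamel's integral absorbs
    it. *)
Lemma weight_ratio s t k : 0 <= s -> s <= t ->
  weight s k <= expR eps * weight t k * expR (eps * q k ^+ 4 * (t - s)).
Proof.
move=> s0 st; have ts0 : 0 <= t - s by rewrite subr_ge0.
rewrite /weight -!expRD ler_expR.
have x0 : 0 <= q k * root4 (t - s) by rewrite mulr_ge0 ?root4_ge0 ?freq_norm_ge0.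
have X : (q k * root4 (t - s)) ^+ 4 = q k ^+ 4 * (t - s) by rewrite exprMn root4X.
have h := le_1Dexp4 x0; rewrite X in h.
have h2 : q k * root4 t <= q k * root4 s + q k * root4 (t - s).
  by rewrite -mulrDr ler_wpM2l ?freq_norm_ge0// root4_subadd.
rewrite -mulrA; rewrite /eps; lra.
Qed.

Lemma duh_bound_weight k (a alpha b : R) g t : continuous g -> 0 <= t ->
  `|a| <= alpha -> 0 <= b -> (forall s, 0 <= s <= t -> `|g s| <= b * weight s k) ->
  `|duh (q k ^+ 4) a g t| <= 21 / 20 * (alpha + b) * weight t k.
Proof.
move=> cg t0 aal b0 gb; set lam := q k ^+ 4.
have al0 : 0 <= alpha by exact: le_trans aal.
have l0 : 0 <= lam by rewrite exprn_ge0// freq_norm_ge0.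
have w0 := ltW (weight_gt0 t k); have e0 := expR_ge0 eps.
(* The dissipation rate left after the growth allowed by [weight_ratio]. The constant C below is
   chosen so that lam * C * e^(mu s) is the resulting bound of the Duhamel integrand at time s. *)
pose mu := (1 - eps) * lam.
have eps1 : 0 < 1 - eps by rewrite /eps; lra.
pose C := expR eps * weight t k * b * expR (lam * t - mu * t).
have C0 : 0 <= C by rewrite !mulr_ge0 ?expR_ge0.
apply: le_trans (@duh_bound _ lam a alpha g (fun s => b * weight s k)
  (fun s => alpha + C / (1 - eps) * expR (mu * s))
  (fun s => C / (1 - eps) * (mu * expR (mu * s))) t l0 cg t0 aal _ gb _ _) _.
- by rewrite lerDl mulr_ge0 ?expR_ge0// divr_ge0// ltW.
- move=> s s0; rewrite -[X in is_derive _ _ _ X]add0r; apply: is_deriveD.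
  by apply: is_deriveZ; exact: is_derive_expZ.
- move=> s /andP[s0 st].
  have -> : C / (1 - eps) * (mu * expR (mu * s)) = lam * (C * expR (mu * s)).
    by rewrite /mu; field; rewrite gt_eqF.
  rewrite -[leLHS]mulrA; apply: ler_wpM2l => //.
  have -> : C * expR (mu * s) =
      expR (lam * s) * (b * (expR eps * weight t k * expR (eps * lam * (t - s)))).
    rewrite /C (_ : lam * t - mu * t = lam * s + eps * lam * (t - s) - mu * s); last by rewrite /mu; ring.
    rewrite !expRD; have E : expR (- (mu * s)) * expR (mu * s) = 1 by rewrite -expRD addNr expR0.
    transitivity (expR eps * weight t k * b * (expR (lam * s) * expR (eps * lam * (t - s))) * (expR (- (mu * s)) * expR (mu * s))); first by ring.
    by rewrite E; ring.
  by rewrite ler_wpM2l ?expR_ge0// ler_wpM2l// weight_ratio.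
have h1 := expR_le_weight k t0; rewrite -/lam in h1.
have -> : expR (- lam * t) * (alpha + C / (1 - eps) * expR (mu * t)) =
   expR (- lam * t) * alpha + expR eps / (1 - eps) * weight t k * b.
  rewrite /C mulrDr; congr (_ + _).
  have E : expR (- lam * t) * expR (lam * t - mu * t) * expR (mu * t) = 1.
    by rewrite -!expRD (_ : _ + _ = 0) ?expR0//; ring.
  rewrite -[RHS]mulr1 -E; ring.
have h2 := expR_eps_le.
have h3 : expR eps / (1 - eps) <= 21 / 20.
  by rewrite ler_pdivrMr//; apply: le_trans h2 _; rewrite /eps; lra.
have h4 : expR eps <= 21 / 20 by apply: le_trans h2 _; lra.
rewrite mulrDr mulrDl; apply: lerD.
  apply: (@le_trans _ _ (expR eps * weight t k * alpha)); first by rewrite ler_wpM2r.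
  rewrite mulrAC ler_wpM2r// ler_wpM2r//.
by rewrite mulrAC ler_wpM2r// ler_wpM2r.
Qed.

End weight.

(** * The mild map on Fourier coefficients *)

Section picard.
Variables (R : realType) (d : nat).
Local Notation mu := (torus_measure R d).
Local Notation K := (d.-tuple int).
Local Notation q := (@freq_norm R d).
Implicit Types (k l : K) (s t : R) (c : R -> K -> R[i]) (M D : K -> R).

(** Duhamel's formula is stated for real functions. Testing all rotations a Re z + b Im z recovers
    the modulus exactly, whereas separate bounds of the real and imaginary parts would cost a factor
    sqrt 2. *)
Lemma normc_rot_le (z : R[i]) (B : R) : 0 <= B ->
  (forall a b : R, a ^+ 2 + b ^+ 2 = 1 -> a * complex.Re z + b * complex.Im z <= B) ->
  Normc.normc z <= B.
Proof.
move=> B0 H; have z0 := normc_ge0 z.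
have [zz|zn] := eqVneq (Normc.normc z) 0; first by rewrite zz.
have z2 := sqr_normc z.
have := H (complex.Re z / Normc.normc z) (complex.Im z / Normc.normc z).
rewrite !expr_div_n -mulrDl -z2 divff ?sqrf_eq0// => /(_ erefl).
rewrite [X in X <= _](_ : _ = Normc.normc z)//.
transitivity ((complex.Re z ^+ 2 + complex.Im z ^+ 2) / Normc.normc z); first by ring.
by rewrite -z2 expr2 mulfK.
Qed.

Lemma normc_le_ReIm (z : R[i]) : Normc.normc z <= `|complex.Re z| + `|complex.Im z|.
Proof.
apply: normc_leP; first by rewrite addr_ge0.
rewrite -(real_normK (num_real (complex.Re z))) -(real_normK (num_real (complex.Im z))).
by rewrite sqrrD -addrA lerD2l lerDr mulrn_wge0// mulr_ge0.
Qed.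

Lemma asum_le_psum (A : K -> R) (B : \bar R) : (forall k, 0 <= A k) ->
  (forall n, ((psum A n)%:E <= B)%E) -> (asum A <= B)%E.
Proof.
move=> A0 AB; rewrite /asum esum_countable//.
apply: lime_le; first by apply: is_cvg_nneseries => j _ _; case: pickle_inv => //= k; rewrite lee_fin.
apply: nearW => n; apply: le_trans (AB n); rewrite /psum -sumEFin.
by apply: lee_sum => j _; case: pickle_inv.
Qed.

(** Fatou's lemma for series: each partial sum passes to the limit. *)
Lemma asum_limit_le (F : nat -> K -> R) (f : K -> R) (B : \bar R) :
  (forall n k, 0 <= F n k) -> (forall k, F n k @[n --> \oo] --> f k) ->
  (forall n, asum (F n) <= B)%E -> (asum f <= B)%E.
Proof.
move=> F0 Ff FB.
have f0 k : 0 <= f k.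
  rewrite -(cvg_lim (@Rhausdorff R) (Ff k)); apply: limr_ge; first by apply/cvg_ex; eexists; exact: Ff.
  exact: nearW.
apply: asum_le_psum => // N.
have cN : psum (F n) N @[n --> \oo] --> psum f N.
  elim: N => [|N IH].
    have -> : (fun n => psum (F n) 0) = cst 0 by apply/funext => n; rewrite /psum big_geq.
    by rewrite /psum big_geq//; exact: cvg_cst.
  have -> : psum f N.+1 = psum f N + oapp f 0 (pickle_inv N) by rewrite /psum big_nat_recr.
  have -> : (fun n => psum (F n) N.+1) = (fun n => psum (F n) N + oapp (F n) 0 (pickle_inv N)).
    by apply/funext => n; rewrite /psum big_nat_recr.
  apply: cvgD; first exact: IH.
  by case: pickle_inv => [k|] /=; [exact: Ff|exact: cvg_cst].
case: B FB => [B FB||FB]; last 2 first.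
- by rewrite leey.
- have := asum_ge0 (F0 0%N); have := FB 0%N; rewrite leeNy_eq => /eqP ->; by rewrite leNgt ltNye.
rewrite lee_fin -(cvg_lim (@Rhausdorff R) cN); apply: limr_le; first by apply/cvg_ex; eexists; exact: cN.
apply: nearW => n; rewrite -lee_fin; exact: le_trans (psum_asum N (F0 n)) (FB n).
Qed.

Lemma asumD (A B : K -> R) : (forall k, 0 <= A k) -> (forall k, 0 <= B k) ->
  asum (fun k => A k + B k) = (asum A + asum B)%E.
Proof.
move=> A0 B0; rewrite /asum -esumD; try by move=> k _; rewrite lee_fin.
by apply: eq_esum => k _; rewrite EFinD.
Qed.

Lemma asumZ (a : R) (A : K -> R) : 0 <= a -> (forall k, 0 <= A k) ->
  asum (fun k => a * A k) = (a%:E * asum A)%E.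
Proof.
move=> a0 A0; rewrite /asum -ge0_esumZl ?lee_fin//.
Qed.

Lemma le_asum (A B : K -> R) : (forall k, A k <= B k) -> (asum A <= asum B)%E.
Proof. by move=> AB; apply: ge0_lee_esum => k; rewrite lee_fin. Qed.

Lemma asum_fine_le (A : K -> \bar R) (B : R) : (forall k, 0 <= A k)%E ->
  (\esum_(k in [set: K]) A k <= B%:E)%E ->
  (forall k, (fine (A k))%:E = A k) /\ (asum (fine \o A) <= B%:E)%E.
Proof.
move=> A0 AB; have Af k : (fine (A k))%:E = A k.
  rewrite fineK// ge0_fin_numE//; apply: le_lt_trans (ltry B); apply: le_trans AB.
  exact: esum_ge_term.
by split => //; apply: le_trans AB; apply: ge0_lee_esum => k; rewrite Af.
Qed.

Definition nonlin (c : K -> R[i]) k : R[i] := fourier (fun x => expT 2 (wser c x)) k.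

(** Freezing c at negative times gives continuity on the whole line, hence two-sided derivatives of
    the primitives at time 0. *)
Definition regular c : Prop :=
  [/\ forall t, hermitian (c t), forall t, c t = c (Num.max t 0),
      forall k, continuous (fun t => complex.Re (c t k)) &
      forall k, continuous (fun t => complex.Im (c t k))].

(** The radius 1/5 is preserved by [next_majorant] for data of size 1/7, as 21/20 (1/7 + 1/25) <
    1/5; the term 1/25 is the bound (1/5)^2 of [esum_cexp2]. *)
Definition majorant M : Prop := (forall k, 0 <= M k) /\ (asum M <= (5^-1)%:E)%E.

Definition below c M : Prop := forall t k, cabs (c t) k <= M k * weight t k.

Lemma below_le c M t k : majorant M -> below c M -> cabs (c t) k <= M k.
Proof.
by move=> [M0 _] cM; apply: le_trans (cM t k) _; rewrite ler_piMr// weight_le1.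
Qed.

Lemma below_asum c M t : majorant M -> below c M -> (asum (cabs (c t)) <= (5^-1)%:E)%E.
Proof. by move=> Mm cM; apply: le_trans Mm.2; apply: le_asum => k; exact: below_le. Qed.

Lemma below_csummable c M t : majorant M -> below c M -> csummable (c t).
Proof. by move=> Mm cM; apply: le_lt_trans (below_asum t Mm cM) (ltry _). Qed.

Lemma hermitian_nonlin (c : K -> R[i]) : csummable c -> hermitian (nonlin c).
Proof. by move=> cs k; apply: fourier_opp; apply: integrable_bm; exact: bm_expT_wser. Qed.

Lemma normc_nonlinB (c c' : K -> R[i]) k (b : R) : hermitian c -> hermitian c' ->
  (asum (cabs c) <= (5^-1)%:E)%E -> (asum (cabs c') <= (5^-1)%:E)%E ->
  (asum (cabs (fun l => c l - c' l)%R) <= b%:E)%E -> 0 <= b <= 1 ->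
  Normc.normc (nonlin c k - nonlin c' k) <= 2 * b.
Proof.
move=> ch ch' c5 c5' cb /andP[b0 b1].
have cs : csummable c by exact: le_lt_trans c5 (ltry _).
have cs' : csummable c' by exact: le_lt_trans c5' (ltry _).
have a1 : (5^-1 : R) <= 1 by lra.
have H := asum_ftabs_expT2B ch ch' c5' a1 cs cb b1.
rewrite /nonlin -fourierB; try by apply: integrable_bm; exact: bm_expT_wser.
rewrite -lee_fin; apply: le_trans (le_trans _ H) _.
  exact: (@esum_ge_term _ K (fun k => (ftabs (fun x => expT 2 (wser c x) - expT 2 (wser c' x)) k)%:E) k (fun l => ltac:(by rewrite lee_fin normc_ge0))).
rewrite lee_fin; nra.
Qed.

(** Continuity of each coefficient becomes continuity in the Wiener norm, by dominated convergence
    with majorant 2 M. *)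
Lemma regular_diff_cvg0 c M t : regular c -> majorant M -> below c M ->
  asum (cabs (fun k => c s k - c t k)) @[s --> t] --> 0%E.
Proof.
move=> [_ _ cR cI] Mm cM; have [M0 M5] := Mm.
apply: (@asum_dominated_cvg0 _ _ _ _ _ (fun s => cabs (fun k => c s k - c t k)) (fun k => 2 * M k)).
- by move=> k; rewrite mulr_ge0.
- by rewrite asumZ//; apply: lte_mul_pinfty => //; exact: le_lt_trans M5 (ltry _).
- apply: nearW => s k; rewrite cabs_ge0/= mulr_natl mulr2n.
  by apply: le_trans (normcB_le _ _) _; rewrite lerD//; exact: below_le.
move=> k.
have h : (fun s => `|complex.Re (c s k) - complex.Re (c t k)| + `|complex.Im (c s k) - complex.Im (c t k)|) @ t --> 0.
  have h1 : `|complex.Re (c s k) - complex.Re (c t k)| @[s --> t] --> 0.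
    by rewrite -(normr0 R) -(subrr (complex.Re (c t k))); apply: cvg_norm; apply: cvgB; [exact: cR|exact: cvg_cst].
  have h2 : `|complex.Im (c s k) - complex.Im (c t k)| @[s --> t] --> 0.
    by rewrite -(normr0 R) -(subrr (complex.Im (c t k))); apply: cvg_norm; apply: cvgB; [exact: cI|exact: cvg_cst].
  by rewrite -[X in _ --> X]addr0; apply: cvgD.
apply: (@squeeze_cvgr _ _ _ _ (cst 0) (fun s => `|complex.Re (c s k) - complex.Re (c t k)| + `|complex.Im (c s k) - complex.Im (c t k)|)) => //; last exact: cvg_cst.
apply: nearW => s; rewrite cabs_ge0/=.
by apply: le_trans (normc_le_ReIm _) _; rewrite ReD ImD ReN ImN.
Qed.

(** The nonlinearity is Lipschitz in the Wiener norm by [normc_nonlinB], and c is continuous in that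
    norm. *)
Lemma continuous_nonlin c M k : regular c -> majorant M -> below c M ->
  continuous (fun t => complex.Re (nonlin (c t) k)) /\
  continuous (fun t => complex.Im (nonlin (c t) k)).
Proof.
move=> creg Mm cM; have [ch _ _ _] := creg.
have H t (e : R) : 0 < e -> \forall s \near t,
    Normc.normc (nonlin (c t) k - nonlin (c s) k) <= e.
  move=> e0; pose b := Num.min 1 (e / 2).
  have b0 : 0 < b by rewrite lt_min ltr01 divr_gt0.
  have /fine_cvgP[finA /cvgrPdist_le/(_ _ b0) cA] := @regular_diff_cvg0 c M t creg Mm cM.
  near=> s.
  have sb : (asum (cabs (fun k => c s k - c t k)%R) <= b%:E)%E.
    have fs : asum (cabs (fun k => c s k - c t k)) \is a fin_num by near: s.
    rewrite -(fineK fs) lee_fin; apply: le_trans (ler_norm _) _.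
    by rewrite -normrN -sub0r; near: s.
  rewrite normcBC; apply: le_trans (normc_nonlinB k (ch s) (ch t) _ _ sb _) _.
  - exact: below_asum Mm cM.
  - exact: below_asum Mm cM.
  - by rewrite ltW//= ge_min lexx.
  - have : b <= e / 2 by rewrite ge_min lexx orbT.
    lra.
split => t; apply/cvgrPdist_le => e e0; apply: filterS (H t e e0) => s;
  apply: le_trans; rewrite -?ReN -?ImN -?ReD -?ImD.
- exact: norm_Re_le.
- exact: norm_Im_le.
Unshelve. all: by end_near. Qed.

(* The Fourier modes of the mild formulation of p' = - Laplacian^2 (e^p - 1);
   Num.max t 0 extends them to t < 0 by their initial values. *)
Definition mild_map (c0 : K -> R[i]) c : R -> K -> R[i] := fun t k =>
  Complex
    (duh (q k ^+ 4) (complex.Re (c0 k)) (fun s => complex.Re (nonlin (c s) k)) (Num.max t 0))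
    (duh (q k ^+ 4) (complex.Im (c0 k)) (fun s => complex.Im (nonlin (c s) k)) (Num.max t 0)).

Lemma Re_mild_map (c0 : K -> R[i]) c t k : complex.Re (mild_map c0 c t k) =
  duh (q k ^+ 4) (complex.Re (c0 k)) (fun s => complex.Re (nonlin (c s) k)) (Num.max t 0).
Proof. by []. Qed.

Lemma Im_mild_map (c0 : K -> R[i]) c t k : complex.Im (mild_map c0 c t k) =
  duh (q k ^+ 4) (complex.Im (c0 k)) (fun s => complex.Im (nonlin (c s) k)) (Num.max t 0).
Proof. by []. Qed.

Opaque mild_map.

Lemma max_ge0r t : 0 <= Num.max t 0. Proof. by rewrite le_max lexx orbT. Qed.

Lemma weight_max t k : weight (Num.max t 0) k = weight t k :> R.
Proof.
case: (leP t 0) => // t0; rewrite /weight /root4 sqrtr0 (_ : Num.sqrt (Num.sqrt t) = 0)//.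
  by rewrite !sqrtr0.
by rewrite (ler0_sqrtr t0) sqrtr0.
Qed.

(** What [duh_bound_weight] gives for one application of [mild_map]: 21/20 times the sum of the
    bounds on the datum and on the source. *)
Definition next_majorant (c0 : K -> R[i]) M k : R :=
  21 / 20 * (cabs c0 k + fine (cexp 2 (EFin \o M) k)).

Lemma majorant_cexp2 M : majorant M ->
  (forall k, (fine (cexp 2 (EFin \o M) k))%:E = cexp 2 (EFin \o M) k) /\
  (asum (fine \o cexp 2 (EFin \o M)) <= (25^-1)%:E)%E.
Proof.
move=> [M0 M5]; apply: asum_fine_le.
  by apply: cexp_ge0 => k; rewrite lee_fin.
rewrite (_ : 25^-1 = 5^-1 ^+ 2); last by field.
by apply: esum_cexp2 => //; last lra.
Qed.

Lemma fine_cexp_ge0 j M k : (forall k, 0 <= M k) -> 0 <= fine (cexp j (EFin \o M) k).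
Proof. by move=> M0; apply: fine_ge0; apply: cexp_ge0 => l; rewrite lee_fin. Qed.

Lemma majorant_next (c0 : K -> R[i]) M : (asum (cabs c0) <= (7^-1)%:E)%E ->
  majorant M -> majorant (next_majorant c0 M).
Proof.
move=> c07 Mm; have [fM sM] := majorant_cexp2 Mm; have [M0 _] := Mm.
have f0 k := fine_cexp_ge0 2 k M0.
have n0 k : 0 <= next_majorant c0 M k by rewrite mulr_ge0// addr_ge0// cabs_ge0.
split => //; rewrite asumZ//; last by move=> k; rewrite addr_ge0 ?cabs_ge0.
rewrite asumD//; last by move=> k; exact: cabs_ge0.
apply: (@le_trans _ _ ((21 / 20)%:E * (7^-1 + 25^-1)%:E)%E).
  by apply: lee_wpmul2l => //; rewrite EFinD; exact: leeD.
by rewrite -EFinM lee_fin; lra.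
Qed.

(** Supermultiplicativity enters here: by [cexp_weight], the exponential tail of M times the weight
    is at most the weight times that of M. *)
Lemma normc_nonlin_le c M s k : regular c -> majorant M -> below c M ->
  Normc.normc (nonlin (c s) k) <= fine (cexp 2 (EFin \o M) k) * weight s k.
Proof.
move=> [ch _ _ _] Mm cM; have [fM _] := majorant_cexp2 Mm; have [M0 _] := Mm.
have w0 l : 0 <= weight s l :> R by exact/ltW/weight_gt0.
rewrite -lee_fin EFinM fM.
apply: le_trans (ftabs_expT 2 k (below_csummable s Mm cM) (ch s)) _.
apply: (@le_trans _ _ (cexp 2 (fun k => (EFin \o M) k * (weight s k)%:E)%E k)).
  by apply: le_cexp => l /=; rewrite ?lee_fin ?cabs_ge0//; exact: cM.
apply: (@cexp_weight _ _ 2 (EFin \o M) (fun k => (weight s k)%:E)) => [l|l||l m].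
- by rewrite lee_fin.
- by rewrite lee_fin.
- by rewrite weight0.
- by rewrite -EFinM lee_fin weight_mul.
Qed.

Lemma lam_ge0 k : 0 <= q k ^+ 4. Proof. by rewrite exprn_ge0// freq_norm_ge0. Qed.

Lemma mild_rot (c0 : K -> R[i]) c M t k (a b : R) : regular c -> majorant M -> below c M ->
  a * complex.Re (mild_map c0 c t k) + b * complex.Im (mild_map c0 c t k) =
  duh (q k ^+ 4) (a * complex.Re (c0 k) + b * complex.Im (c0 k))
    (fun s => a * complex.Re (nonlin (c s) k) + b * complex.Im (nonlin (c s) k)) (Num.max t 0).
Proof.
move=> creg Mm cM; have [cR cI] := continuous_nonlin k creg Mm cM.
by rewrite duh_lin// max_ge0r.
Qed.

Lemma continuous_rot c M k (a b : R) : regular c -> majorant M -> below c M ->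
  continuous (fun s => a * complex.Re (nonlin (c s) k) + b * complex.Im (nonlin (c s) k)).
Proof.
move=> creg Mm cM; have [cR cI] := continuous_nonlin k creg Mm cM.
exact: continuous_comb.
Qed.

Lemma norm_rot_le (z : R[i]) (a b : R) : a ^+ 2 + b ^+ 2 = 1 ->
  `|a * complex.Re z + b * complex.Im z| <= Normc.normc z.
Proof. by move=> ab; rewrite mulrC [b * _]mulrC; exact: norm_dot_le_normc. Qed.

Lemma rot_diff_le (z z' : R[i]) (x y X X' b : R) :
  x * complex.Re z + y * complex.Im z = X -> x * complex.Re z' + y * complex.Im z' = X' ->
  1 * X + -1 * X' <= b ->
  x * (complex.Re z - complex.Re z') + y * (complex.Im z - complex.Im z') <= b.
Proof. by move=> <- <-; apply: le_trans; rewrite le_eqVlt; apply/orP; left; apply/eqP; ring. Qed.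

Lemma rot_diffE (z z' : R[i]) (x y : R) :
  1 * (x * complex.Re z + y * complex.Im z) + -1 * (x * complex.Re z' + y * complex.Im z') =
  x * complex.Re (z - z') + y * complex.Im (z - z').
Proof. by rewrite ReD ImD ReN ImN; ring. Qed.

Lemma mild_below (c0 : K -> R[i]) c M : regular c -> majorant M -> below c M ->
  below (mild_map c0 c) (next_majorant c0 M).
Proof.
move=> creg Mm cM t k; have [M0 _] := Mm.
have f0 := fine_cexp_ge0 2 k M0.
apply: normc_rot_le.
  by rewrite mulr_ge0 ?(ltW (weight_gt0 _ _))// mulr_ge0// addr_ge0// cabs_ge0.
move=> a b ab; rewrite (mild_rot c0 t k a b creg Mm cM); apply: le_trans (ler_norm _) _.
rewrite -weight_max; apply: duh_bound_weight => //.
- exact: continuous_rot creg Mm cM.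
- exact: max_ge0r.
- exact: norm_rot_le.
- by move=> s _; apply: le_trans (norm_rot_le _ ab) _; exact: normc_nonlin_le creg Mm cM.
Qed.

Lemma mild_regular (c0 : K -> R[i]) c M : hermitian c0 -> regular c -> majorant M ->
  below c M -> regular (mild_map c0 c).
Proof.
move=> c0h creg Mm cM; have [ch _ _ _] := creg.
have cN k := continuous_nonlin k creg Mm cM.
split.
- move=> t k; have Nh s : nonlin (c s) (- k) = cconj (nonlin (c s) k).
    exact: hermitian_nonlin (below_csummable s Mm cM) k.
  have [_ cI] := cN k.
  have rl : duh (q (- k) ^+ 4) (complex.Re (c0 (- k))) (fun s => complex.Re (nonlin (c s) (- k))) (Num.max t 0) =
      duh (q k ^+ 4) (complex.Re (c0 k)) (fun s => complex.Re (nonlin (c s) k)) (Num.max t 0).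
    have F : (fun s => complex.Re (nonlin (c s) (- k))) = (fun s => complex.Re (nonlin (c s) k)).
      by apply/funext => s; rewrite Nh.
    by rewrite F c0h freq_normN.
  have il : duh (q (- k) ^+ 4) (complex.Im (c0 (- k))) (fun s => complex.Im (nonlin (c s) (- k))) (Num.max t 0) =
      - duh (q k ^+ 4) (complex.Im (c0 k)) (fun s => complex.Im (nonlin (c s) k)) (Num.max t 0).
    have := duh_lin (q k ^+ 4) (complex.Im (c0 k)) 0 (-1) 0 cI cI (max_ge0r t).
    have F : (fun s => complex.Im (nonlin (c s) (- k))) =
        (fun s => -1 * complex.Im (nonlin (c s) k) + 0 * complex.Im (nonlin (c s) k)).
      by apply/funext => s; rewrite Nh mul0r addr0 mulN1r.
    have F0 : complex.Im (c0 (- k)) = -1 * complex.Im (c0 k) + 0 * 0.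
      by rewrite c0h mul0r addr0 mulN1r.
    by rewrite F F0 freq_normN => ->; rewrite mul0r addr0 mulN1r.
  apply: complex_ext.
    exact: (etrans (Re_mild_map c0 c t (- k)) (etrans rl (esym (Re_mild_map c0 c t k)))).
  exact: (etrans (Im_mild_map c0 c t (- k)) (etrans il (esym (congr1 -%R (Im_mild_map c0 c t k))))).
- move=> t; apply/funext => k; apply: complex_ext; rewrite ?Re_mild_map ?Im_mild_map;
    by rewrite (max_idPl (max_ge0r t)).
- move=> k; under eq_fun do rewrite Re_mild_map.
  by apply: continuous_duh_max; have [] := cN k.
- move=> k; under eq_fun do rewrite Im_mild_map.
  by apply: continuous_duh_max; have [] := cN k.
Qed.

(** Both images have the same datum, so by linearity each rotation of their difference is Duhamel's
    formula with initial value 0. *)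
Lemma mild_diff_le (c0 : K -> R[i]) c c' M k (b : R) : regular c -> regular c' ->
  majorant M -> below c M -> below c' M ->
  (forall s, Normc.normc (nonlin (c s) k - nonlin (c' s) k) <= b) ->
  forall t, Normc.normc (mild_map c0 c t k - mild_map c0 c' t k) <= b.
Proof.
move=> creg creg' Mm cM cM' Nb t.
have b0 : 0 <= b by apply: le_trans (normc_ge0 _) (Nb 0).
apply: normc_rot_le => // x y xy; rewrite ReD ImD ReN ImN.
apply: (rot_diff_le (mild_rot c0 t k x y creg Mm cM) (mild_rot c0 t k x y creg' Mm cM')).
rewrite -duh_lin; [|exact: continuous_rot creg Mm cM|exact: continuous_rot creg' Mm cM'|exact: max_ge0r].
apply: le_trans (ler_norm _) _; rewrite -[leRHS]add0r; apply: duh_bound_cst.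
- exact: lam_ge0.
- apply: continuous_comb; first exact: continuous_rot creg Mm cM.
  exact: continuous_rot creg' Mm cM'.
- exact: max_ge0r.
- by rewrite (_ : _ + _ = 0) ?normr0//; ring.
by move=> s _; apply: le_trans (Nb s); rewrite rot_diffE; exact: norm_rot_le.
Qed.

(** The bound of [ftabs_expT2B] with the moduli of c' and c - c' replaced by majorants independent
    of time, which makes the iteration uniform in t. *)
Definition next_diff M D k : R :=
  fine (conv (cexp 1 (EFin \o M)) (cexp 1 (EFin \o D)) k + cexp 2 (EFin \o D) k)%E.

Lemma asum_next_diff M D (e : R) : majorant M -> (forall k, 0 <= D k) ->
  (asum D <= e%:E)%E -> 0 <= e <= 5^-1 ->
  (forall k, 0 <= next_diff M D k) /\
  (forall k, (next_diff M D k)%:E =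
    conv (cexp 1 (EFin \o M)) (cexp 1 (EFin \o D)) k + cexp 2 (EFin \o D) k)%E /\
  (asum (next_diff M D) <= (e / 2)%:E)%E.
Proof.
move=> [M0 M5] D0 De /andP[e0 e5].
have eM k : (0 <= (EFin \o M) k)%E by rewrite lee_fin.
have eD k : (0 <= (EFin \o D) k)%E by rewrite lee_fin.
have X0 k : (0 <= conv (cexp 1 (EFin \o M)) (cexp 1 (EFin \o D)) k + cexp 2 (EFin \o D) k)%E.
  by rewrite adde_ge0 ?cexp_ge0// conv_ge0// => l; exact: cexp_ge0.
have e1 : e <= 1 by lra.
have [h1 h2] : (forall k, (next_diff M D k)%:E =
    conv (cexp 1 (EFin \o M)) (cexp 1 (EFin \o D)) k + cexp 2 (EFin \o D) k)%E /\
  (asum (next_diff M D) <= (e / 2)%:E)%E.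
  apply: asum_fine_le => //.
  rewrite esumD; [|by move=> k _; apply: conv_ge0 => l; exact: cexp_ge0|by move=> k _; exact: cexp_ge0].
  rewrite esum_conv; [|by move=> l; exact: cexp_ge0|by move=> l; exact: cexp_ge0].
  apply: (@le_trans _ _ (((5^-1 + 5^-1 ^+ 2) * (e + e ^+ 2) + e ^+ 2)%R%:E)).
    rewrite EFinD EFinM; apply: leeD; last exact: esum_cexp2.
    apply: lee_pmul; [by apply: esum_ge0 => k _; exact: cexp_ge0|
      by apply: esum_ge0 => k _; exact: cexp_ge0| |exact: esum_cexp1].
    by apply: esum_cexp1 => //; lra.
  rewrite lee_fin; nra.
by split => // k; rewrite -lee_fin h1.
Qed.

Lemma nonlin_diff_le c c' M D k s : regular c -> regular c' -> majorant M ->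
  below c M -> below c' M -> (forall k, 0 <= D k) -> (asum D <= (5^-1)%:E)%E ->
  (forall l, Normc.normc (c s l - c' s l) <= D l) ->
  Normc.normc (nonlin (c s) k - nonlin (c' s) k) <= next_diff M D k.
Proof.
move=> [ch _ _ _] [ch' _ _ _] Mm cM cM' D0 D5 cD; have [M0 M5] := Mm.
have [_ [fD _]] := @asum_next_diff M D (5^-1) Mm D0 D5 (ltac:(by apply/andP; split; lra)).
have cs := below_csummable s Mm cM; have cs' := below_csummable s Mm cM'.
rewrite /nonlin -fourierB; try by apply: integrable_bm; exact: bm_expT_wser.
rewrite -lee_fin fD.
have c1 : (asum (cabs (c' s)) <= 1)%E.
  by apply: le_trans (below_asum s Mm cM') _; rewrite lee_fin; lra.
apply: le_trans (ftabs_expT2B k cs (ch s) (ch' s) c1) _.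
have eD l : (ecabs (fun k => c s k - c' s k)%R l <= (EFin \o D) l)%E by rewrite lee_fin; exact: cD.
have eM l : (ecabs (c' s) l <= (EFin \o M) l)%E by rewrite lee_fin; exact: below_le.
have z1 (f : K -> R[i]) l : (0 <= ecabs f l)%E by rewrite lee_fin normc_ge0.
apply: leeD; last exact: le_cexp.
apply: le_conv => l; try exact: cexp_ge0; exact: le_cexp.
Qed.

End picard.

(** * Convergence of the Picard iterates *)

Section picard_limit.
Variables (R : realType) (d : nat).
Local Notation K := (d.-tuple int).
Local Notation q := (@freq_norm R d).
Variable c0 : K -> R[i].
Implicit Types (k l : K) (s t : R) (M D : K -> R).

Fixpoint picard n : R -> K -> R[i] :=
  if n is n'.+1 then mild_map c0 (picard n') else fun _ _ => 0.

Fixpoint picard_majorant n : K -> R :=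
  if n is n'.+1 then next_majorant c0 (picard_majorant n') else fun _ => 0.

Variables (c0h : hermitian c0) (c07 : (asum (cabs c0) <= (7^-1)%:E)%E).

Lemma majorant_picard n : majorant (picard_majorant n).
Proof.
elim: n => [|n IH]; last exact: majorant_next.
by split => //=; rewrite /asum esum1//.
Qed.

Lemma picard_regular_below n :
  regular (picard n) /\ below (picard n) (picard_majorant n).
Proof.
elim: n => [|n [IHr IHb]].
  split; last by move=> t k; rewrite /cabs Normc.normc0 mul0r.
  by split => // [t k|k|k]; [apply: complex_ext; rewrite /= ?oppr0|exact: cst_continuous|exact: cst_continuous].
split.
  exact: mild_regular c0h IHr (majorant_picard n) IHb.
exact: mild_below IHr (majorant_picard n) IHb.
Qed.

Lemma majorant_le5 M k : majorant M -> M k <= 5^-1.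
Proof.
move=> [M0 M5]; rewrite -lee_fin; apply: le_trans M5.
by apply: (@esum_ge_term _ K (fun k => (M k)%:E) k) => l; rewrite lee_fin.
Qed.

Lemma picard_majorant_nd k : nondecreasing_seq (fun n => picard_majorant n k).
Proof.
apply/nondecreasing_seqP => n; elim: n k => [|n IH] k.
  exact: (majorant_picard 1).1.
have [M0 _] := majorant_picard n; have [M0' _] := majorant_picard n.+1.
have [f1 _] := majorant_cexp2 (majorant_picard n).
have [f2 _] := majorant_cexp2 (majorant_picard n.+1).
rewrite /= /next_majorant ler_wpM2l// lerD2l -lee_fin f1 f2.
by apply: le_cexp => l /=; rewrite lee_fin.
Qed.

(** Comparing consecutive iterates calls for one majorant common to all. Those of the iterates
    increase and have sum at most 1/5, and so has their limit. *)
Definition lim_majorant k : R := limn (fun n => picard_majorant n k).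

Lemma cvg_lim_majorant k : picard_majorant n k @[n --> \oo] --> lim_majorant k.
Proof.
apply: nondecreasing_is_cvgn; first exact: picard_majorant_nd.
by exists 5^-1 => _ [n _ <-]; apply: majorant_le5; exact: majorant_picard.
Qed.

Lemma le_lim_majorant n k : picard_majorant n k <= lim_majorant k.
Proof.
apply: (@nondecreasing_cvgn_le R (fun n => picard_majorant n k)).
  exact: picard_majorant_nd.
by apply/cvg_ex; eexists; exact: cvg_lim_majorant.
Qed.

Lemma majorant_lim : majorant lim_majorant.
Proof.
split => [k|].
  exact: (le_lim_majorant 0 k).
apply: (asum_limit_le _ cvg_lim_majorant) => [n k|n].
  exact: (majorant_picard n).1.
exact: (majorant_picard n).2.
Qed.

Lemma picard_below n : below (picard n) lim_majorant.
Proof.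
move=> t k; apply: le_trans ((picard_regular_below n).2 t k) _.
rewrite ler_wpM2r ?(ltW (weight_gt0 _ _))//.
exact: le_lim_majorant.
Qed.

(** The zeroth iterate is 0, so the first difference is an iterate itself and lies below
    [lim_majorant]. *)
Fixpoint picard_diff n : K -> R :=
  if n is n'.+1 then next_diff lim_majorant (picard_diff n') else lim_majorant.

Lemma picard_diff_bound n : (forall k, 0 <= picard_diff n k) /\
  (asum (picard_diff n) <= (5^-1 / 2 ^+ n)%:E)%E.
Proof.
elim: n => [|n [D0 De]]; first by rewrite expr0 divr1; exact: majorant_lim.
have h : 0 <= (5^-1 / 2 ^+ n : R) <= 5^-1.
  rewrite divr_ge0 ?exprn_ge0//= ler_piMr// invf_le1 ?exprn_gt0//.
  by rewrite exprn_ege1// ler1n.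
have [h1 [_ h2]] := asum_next_diff majorant_lim D0 De h; split => //.
by rewrite exprSr invfM mulrA.
Qed.

Lemma picard_diff_le n t k : Normc.normc (picard n.+1 t k - picard n t k) <= picard_diff n k.
Proof.
elim: n t k => [|n IH] t k.
  have -> : picard 1 t k - picard 0 t k = picard 1 t k by rewrite [X in _ - X](_ : _ = 0)// subr0.
  exact: (below_le t k majorant_lim (picard_below 1)).
have [r1 _] := picard_regular_below n.+1; have [r2 _] := picard_regular_below n.
have [D0 De] := picard_diff_bound n.
apply: (mild_diff_le c0 r1 r2 majorant_lim (picard_below _) (picard_below _)) => s.
apply: nonlin_diff_le => //; try exact: picard_below; first exact: majorant_lim.
apply: le_trans De _; rewrite lee_fin ler_piMr// invf_le1 ?exprn_gt0//.
by rewrite exprn_ege1// ler1n.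
Qed.

Lemma picard_tail n m k t :
  Normc.normc (picard (n + m) t k - picard n t k) <= \sum_(n <= j < n + m) picard_diff j k.
Proof.
elim: m => [|m IH]; first by rewrite addn0 subrr Normc.normc0 big_geq.
rewrite addnS big_nat_recr ?leq_addr//=.
rewrite (_ : _ - _ = (picard (n + m) t k - picard n t k) + (picard (n + m).+1 t k - picard (n + m) t k)); last first.
  by rewrite [RHS]addrC addrA subrK.
apply: le_trans (normcD_le _ _) _; apply: lerD => //; exact: picard_diff_le.
Qed.

Lemma asum_big_nat (A : nat -> K -> R) n m : (forall j k, 0 <= A j k) ->
  asum (fun k => \sum_(n <= j < n + m) A j k) = (\sum_(n <= j < n + m) asum (A j))%E.
Proof.
move=> A0; elim: m => [|m IH].
  rewrite addn0 big_geq// /asum esum1// => k _; by rewrite big_geq.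
rewrite addnS big_nat_recr ?leq_addr//= -IH -asumD//; last by move=> k; exact: sumr_ge0.
by congr asum; apply/funext => k; rewrite big_nat_recr ?leq_addr.
Qed.

Lemma asum_picard_diff n m :
  (asum (fun k => \sum_(n <= j < n + m) picard_diff j k)%R <= (1 / 2 ^+ n)%:E)%E.
Proof.
rewrite asum_big_nat; last by move=> j k; exact: (picard_diff_bound j).1.
apply: (@le_trans _ _ (\sum_(n <= j < n + m) (5^-1 / 2 ^+ j)%:E)%E).
  by apply: lee_sum => j _; exact: (picard_diff_bound j).2.
rewrite sumEFin lee_fin.
(* Telescoping: 1/5 / 2^j is below 1 / 2^j - 1 / 2^(j+1). *)
suff : \sum_(n <= j < n + m) (5^-1 / 2 ^+ j : R) <= 1 / 2 ^+ n - 1 / 2 ^+ (n + m).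
  by move=> h; apply: le_trans h _; rewrite gerBl divr_ge0// exprn_ge0.
elim: m => [|m IH]; first by rewrite addn0 big_geq// subrr.
rewrite addnS big_nat_recr ?leq_addr//= exprS.
move: IH; have : 0 < (2 ^+ (n + m) : R) by rewrite exprn_gt0.
move: (\sum_(_ <= j < _) _) (1 / 2 ^+ n : R) (2 ^+ (n + m) : R) => S a b b0 h.
have -> : 1 / (2 * b) = 1 / b / 2 by field; rewrite gt_eqF.
have : 0 < b^-1 by rewrite invr_gt0.
by move: h; rewrite !mul1r; lra.
Qed.

Lemma picard_dist n m k t : Normc.normc (picard (n + m) t k - picard n t k) <= 1 / 2 ^+ n.
Proof.
apply: le_trans (picard_tail n m k t) _; rewrite -lee_fin; apply: le_trans (asum_picard_diff n m).
apply: (@esum_ge_term _ K (fun k => (\sum_(n <= j < n + m) picard_diff j k)%:E) k) => l.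
by rewrite lee_fin sumr_ge0// => j _; exact: (picard_diff_bound j).1.
Qed.

Lemma half_pow_le n : (1 / 2 ^+ n.+1 : R) <= 1 / 2 ^+ n.
Proof.
rewrite exprS !mul1r lef_pV2 ?posrE ?mulr_gt0 ?exprn_gt0//.
by rewrite ler_peMl ?exprn_ge0// ler1n.
Qed.

Lemma leD3 (x y A B : R) : A <= x -> B <= 2 * y -> x <= y -> A + B <= 3 * y.
Proof. lra. Qed.

Lemma cvg_half_pow : (1 / 2 ^+ n : R) @[n --> \oo] --> 0.
Proof.
rewrite (_ : (fun n => _) = (fun n => 2^-1 ^+ n)); last by apply/funext => n; rewrite mul1r exprVn.
by apply: cvg_expr; rewrite ger0_norm; lra.
Qed.

Lemma cauchy_half_pow (u : nat -> R) : (forall n m, `|u (n + m)%N - u n| <= 1 / 2 ^+ n) ->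
  u n @[n --> \oo] --> limn u.
Proof.
move=> uB; apply: R_complete; apply: cauchy_exP => e e0.
have /cvgrPdist_lt/(_ e e0)[n _ /(_ n (leqnn n))] := cvg_half_pow.
rewrite sub0r normrN ger0_norm; last by rewrite divr_ge0// exprn_ge0.
move=> ne; exists (u n); exists n => // m /= nm; rewrite /ball/= distrC.
by apply: le_lt_trans ne; rewrite -(subnKC nm); exact: uB.
Qed.

Definition picard_lim t k : R[i] :=
  Complex (limn (fun n => complex.Re (picard n t k))) (limn (fun n => complex.Im (picard n t k))).

Lemma cvg_picard_Re t k : complex.Re (picard n t k) @[n --> \oo] --> complex.Re (picard_lim t k).
Proof.
apply: cauchy_half_pow => n m; apply: le_trans (picard_dist n m k t).
by rewrite -ReN -ReD; exact: norm_Re_le.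
Qed.

Lemma cvg_picard_Im t k : complex.Im (picard n t k) @[n --> \oo] --> complex.Im (picard_lim t k).
Proof.
apply: cauchy_half_pow => n m; apply: le_trans (picard_dist n m k t).
by rewrite -ImN -ImD; exact: norm_Im_le.
Qed.

Lemma cvg_normc (T : Type) (F : set_system T) (FF : Filter F) (z : T -> R[i]) (w : R[i]) :
  complex.Re (z n) @[n --> F] --> complex.Re w -> complex.Im (z n) @[n --> F] --> complex.Im w ->
  Normc.normc (z n) @[n --> F] --> Normc.normc w.
Proof.
move=> cR cI; apply/cvgrPdist_le => e e0; have e2 : 0 < e / 2 by rewrite divr_gt0.
have H (x y : R[i]) : `|Normc.normc x - Normc.normc y| <= Normc.normc (x - y).
  have h1 := normcD_le (x - y) y; have h2 := normcD_le (y - x) x.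
  rewrite subrK in h1; rewrite subrK in h2; rewrite normcBC in h2.
  by rewrite ler_norml; apply/andP; split; lra.
near=> n; apply: le_trans (H _ _) _; apply: le_trans (normc_le_ReIm _) _.
rewrite ReD ImD ReN ImN (splitr e); apply: lerD; near: n.
  by move/cvgrPdist_le : cR => /(_ _ e2).
by move/cvgrPdist_le : cI => /(_ _ e2).
Unshelve. all: by end_near. Qed.

Lemma cvg_picard_dist n t k :
  Normc.normc (picard (n + m) t k - picard n t k) @[m --> \oo] -->
  Normc.normc (picard_lim t k - picard n t k).
Proof.
have sh (u : nat -> R) (l : R) : u m @[m --> \oo] --> l -> u (n + m)%N @[m --> \oo] --> l.
  by move=> ul; have := ul; rewrite -(cvg_shiftn n u); under eq_fun do rewrite addnC.
apply: cvg_normc.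
  under eq_fun do rewrite ReD ReN; rewrite ReD ReN; apply: cvgB; last exact: cvg_cst.
  exact: sh (@cvg_picard_Re t k).
under eq_fun do rewrite ImD ImN; rewrite ImD ImN; apply: cvgB; last exact: cvg_cst.
exact: sh (@cvg_picard_Im t k).
Qed.

Lemma asum_picard_lim n t :
  (asum (fun k => Normc.normc (picard_lim t k - picard n t k)%R) <= (1 / 2 ^+ n)%:E)%E.
Proof.
apply: (asum_limit_le _ (@cvg_picard_dist n t)) => [m k|m]; first exact: normc_ge0.
by apply: le_trans (asum_picard_diff n m); apply: le_asum => k; exact: picard_tail.
Qed.

Lemma picard_lim_dist n t k : Normc.normc (picard_lim t k - picard n t k) <= 1 / 2 ^+ n.
Proof.
rewrite -lee_fin; apply: le_trans (asum_picard_lim n t).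
apply: (@esum_ge_term _ K (fun k => (Normc.normc (picard_lim t k - picard n t k))%:E) k) => l.
by rewrite lee_fin normc_ge0.
Qed.

Lemma uniform_limit_continuous_half (f : R -> R) (F : nat -> R -> R) :
  (forall n, continuous (F n)) -> (forall n t, `|f t - F n t| <= 1 / 2 ^+ n) -> continuous f.
Proof.
move=> cF fF t; apply/cvgrPdist_le => e e0; have e3 : 0 < e / 3 by rewrite divr_gt0.
have /cvgrPdist_le/(_ _ e3)[n _ /(_ n (leqnn n))] := cvg_half_pow.
rewrite sub0r normrN ger0_norm; last by rewrite divr_ge0// exprn_ge0.
move=> ne; have /cvgrPdist_le/(_ _ e3) := cF n t; apply: filterS => s h.
have h1 := fF n t; have h2 := fF n s.
rewrite (_ : f t - f s = (f t - F n t) + (F n t - F n s) + - (f s - F n s)); last by ring.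
apply: le_trans (ler_normD _ _) _; rewrite normrN.
apply: (@le_trans _ _ (`|f t - F n t| + `|F n t - F n s| + `|f s - F n s|)).
  by rewrite lerD2r; exact: ler_normD.
by lra.
Qed.

Lemma picard_lim_regular : regular picard_lim.
Proof.
have pr n := (picard_regular_below n).1.
split.
- move=> t k; apply: complex_ext.
    apply: (rcvg_unique (@cvg_picard_Re t (- k))).
    have -> : (fun n => complex.Re (picard n t (- k))) = (fun n => complex.Re (picard n t k)).
      by apply/funext => n; have [-> _ _ _] := pr n.
    exact: cvg_picard_Re.
  apply: (rcvg_unique (@cvg_picard_Im t (- k))).
  have -> : (fun n => complex.Im (picard n t (- k))) = (fun n => - complex.Im (picard n t k)).
    by apply/funext => n; have [-> _ _ _] := pr n.
  by apply: cvgN; exact: cvg_picard_Im.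
- move=> t; apply/funext => k.
  have E : (fun n => picard n t k) = (fun n => picard n (Num.max t 0) k).
    by apply/funext => n; have [_ H _ _] := pr n; rewrite {1}H.
  apply: complex_ext.
    apply: (rcvg_unique (@cvg_picard_Re t k)).
    rewrite (_ : (fun n => complex.Re (picard n t k)) = (fun n => complex.Re (picard n (Num.max t 0) k))); first exact: cvg_picard_Re.
    by apply/funext => n; have [_ H _ _] := pr n; rewrite {1}H.
  apply: (rcvg_unique (@cvg_picard_Im t k)).
  rewrite (_ : (fun n => complex.Im (picard n t k)) = (fun n => complex.Im (picard n (Num.max t 0) k))); first exact: cvg_picard_Im.
  by apply/funext => n; have [_ H _ _] := pr n; rewrite {1}H.
- move=> k; apply: (@uniform_limit_continuous_half _ (fun n t => complex.Re (picard n t k))) => [n|n t].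
    by have [_ _ H _] := pr n; exact: H.
  by apply: le_trans (picard_lim_dist n t k); rewrite -ReN -ReD; exact: norm_Re_le.
- move=> k; apply: (@uniform_limit_continuous_half _ (fun n t => complex.Im (picard n t k))) => [n|n t].
    by have [_ _ _ H] := pr n; exact: H.
  by apply: le_trans (picard_lim_dist n t k); rewrite -ImN -ImD; exact: norm_Im_le.
Qed.

Lemma picard_lim_below : below picard_lim lim_majorant.
Proof.
move=> t k; apply: (normc_cvg_le (@cvg_picard_Re t k) (@cvg_picard_Im t k)) => n.
exact: picard_below.
Qed.

Lemma picard_lim_fixed t k : picard_lim t k = mild_map c0 picard_lim t k.
Proof.
have pr n := (picard_regular_below n).1.
(* Inserting the iterate n + 1 leaves its distance to the limit and, as it is the image of the
   iterate n, a difference controlled by the Lipschitz bound 2 of the nonlinearity. *)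
have H n : Normc.normc (picard_lim t k - mild_map c0 picard_lim t k) <= 3 * (1 / 2 ^+ n).
  have n1 : 0 <= (1 / 2 ^+ n : R) <= 1.
    rewrite divr_ge0 ?exprn_ge0//= mul1r invf_le1 ?exprn_gt0//.
    by rewrite exprn_ege1// ler1n.
  have h1 := picard_lim_dist n.+1 t k.
  have h2 : Normc.normc (mild_map c0 (picard n) t k - mild_map c0 picard_lim t k) <= 2 * (1 / 2 ^+ n).
    apply: (mild_diff_le c0 (pr n) picard_lim_regular majorant_lim (picard_below n) picard_lim_below) => s.
    have [hn _ _ _] := pr n; have [hl _ _ _] := picard_lim_regular.
    rewrite normcBC; apply: normc_nonlinB => //.
    - exact: below_asum majorant_lim picard_lim_below.
    - exact: below_asum majorant_lim (picard_below n).
    - exact: asum_picard_lim.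
  rewrite (_ : picard_lim t k - _ = (picard_lim t k - picard n.+1 t k) +
      (mild_map c0 (picard n) t k - mild_map c0 picard_lim t k)); last by rewrite addrA subrK.
  apply: le_trans (normcD_le _ _) _.
  have h3 := half_pow_le n.
  exact: (leD3 h1 h2 h3).
have z0 : Normc.normc (picard_lim t k - mild_map c0 picard_lim t k) <= 0.
  have c3 : 3 * (1 / 2 ^+ n : R) @[n --> \oo] --> 0.
    by rewrite -[X in _ --> X](mulr0 3); apply: cvgMr; exact: cvg_half_pow.
  rewrite -(cvg_lim (@Rhausdorff R) c3); apply: limr_ge; first by apply/cvg_ex; eexists; exact: c3.
  exact: nearW.
have /Normc.eq0_normc /eqP : Normc.normc (picard_lim t k - mild_map c0 picard_lim t k) = 0.
  by apply/eqP; rewrite eq_le z0 normc_ge0.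
by rewrite subr_eq0 => /eqP.
Qed.

Lemma exists_mild : exists c M, [/\ regular c, majorant M, below c M &
  forall t k, c t k = mild_map c0 c t k].
Proof.
exists picard_lim, lim_majorant; split; [exact: picard_lim_regular|exact: majorant_lim|
  exact: picard_lim_below|exact: picard_lim_fixed].
Qed.

End picard_limit.

(** * Exponential decay *)

Section time_calculus.
Variable R : realType.
Local Notation leb := (@lebesgue_measure R).

Lemma is_derive_continuous (y : R -> R) (s v : R) : is_derive s 1 y v -> {for s, continuous y}.
Proof. by move=> [dy _]; apply: differentiable_continuous; exact/derivable1_diffP. Qed.

Lemma FTC2_at (y z : R -> R) (a b : R) : a <= b ->
  (forall s : R, a <= s <= b -> is_derive s 1 y (z s)) ->
  (forall s : R, a <= s <= b -> {for s, continuous z}) ->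
  \int[leb]_(s in `[a, b]) z s = y b - y a.
Proof.
rewrite le_eqVlt => /predU1P[<-|ab] dy cz.
  by rewrite set_itv1 Rintegral_set1 subrr.
rewrite /Rintegral (@continuous_FTC2 R z y a b ab)//.
- by apply: continuous_in_subspaceT => s; rewrite inE/= in_itv/= => /cz.
- split.
  + by move=> s; rewrite in_itv/= => /andP[s1 s2]; have [] := dy s (ltac:(by rewrite !ltW)).
  + by apply: cvg_at_right_filter; apply: is_derive_continuous (dy a _); rewrite lexx ltW.
  + by apply: cvg_at_left_filter; apply: is_derive_continuous (dy b _); rewrite lexx ltW.
- move=> s; rewrite in_itv/= => /andP[s1 s2].
  by have [_ <-] := dy s (ltac:(by rewrite !ltW)); rewrite derive1E.
Qed.

Lemma EFin_Rintegral (D : set R) (f : R -> R) : leb.-integrable D (EFin \o f) ->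
  measurable D -> (\int[leb]_(t in D) f t)%:E = (\int[leb]_(t in D) (f t)%:E)%E.
Proof. by move=> fi mD; rewrite /Rintegral fineK//; exact: integrable_fin_num. Qed.

Lemma Rintegral_comb (x y a b : R) (g h : R -> R) : continuous g -> continuous h ->
  \int[leb]_(t in `[a, b]) (x * g t + y * h t) =
  x * (\int[leb]_(t in `[a, b]) g t) + y * (\int[leb]_(t in `[a, b]) h t).
Proof.
move=> cg ch; have gi := integrable_continuous_itv a b cg; have hi := integrable_continuous_itv a b ch.
have xg : leb.-integrable `[a, b] (EFin \o (fun t => x * g t)) by apply: integrable_scale => //; exact: gi.
have yh : leb.-integrable `[a, b] (EFin \o (fun t => y * h t)) by apply: integrable_scale => //; exact: hi.
rewrite (RintegralD _ xg yh)//.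
by rewrite (RintegralZl _ _ gi)// (RintegralZl _ _ hi).
Qed.

Lemma measurable_esum (K : countType) (D : set R) (a : K -> R -> \bar R) : measurable D ->
  (forall k t, 0 <= a k t)%E -> (forall k, measurable_fun D (a k)) ->
  measurable_fun D (fun t => \esum_(k in [set: K]) a k t)%E.
Proof.
move=> mD a0 ma.
rewrite (_ : (fun t => _) = (fun t => \sum_(j <oo) oapp (fun k => a k t) 0%E (@pickle_inv K j))%E); last first.
  by apply/funext => t; rewrite esum_countable.
apply: ge0_emeasurable_sum => j; first by move=> t _ _; case: pickle_inv => //= k.
by move=> _; case: (pickle_inv j) => [k|] /=; [exact: ma|exact: measurable_cst].
Qed.

Lemma integral_esum (K : countType) (D : set R) (a : K -> R -> \bar R) : measurable D ->
  (forall k t, 0 <= a k t)%E -> (forall k, measurable_fun D (a k)) ->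
  (\int[leb]_(t in D) (\esum_(k in [set: K]) a k t) = \esum_(k in [set: K]) \int[leb]_(t in D) a k t)%E.
Proof.
move=> mD a0 ma; rewrite [RHS]esum_countable; last by move=> k; exact: integral_ge0.
under eq_integral do rewrite esum_countable//.
rewrite integral_nneseries//; last 2 first.
- by move=> j; case: (pickle_inv j) => [k|] /=; [exact: ma|exact: measurable_cst].
- by move=> j t _; case: pickle_inv => //= k.
by apply: eq_eseriesr => j _; case: pickle_inv => //=; exact: integral0.
Qed.

(* Continuous induction on [0, +oo[. *)
Lemma bootstrap (f : R -> R) (r0 r1 : R) : continuous f -> r0 < r1 ->
  (forall T, 0 <= T -> (forall t, 0 <= t <= T -> f t <= r1) -> f T <= r0) ->
  f 0 <= r0 -> forall T, 0 <= T -> f T <= r0.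
Proof.
move=> cf r01 H f0 T T0; apply: (H) => // t1 /andP[t10 _]; apply: contrapT => /negP; rewrite -ltNge => ft1.
(* The supremum tau of S is the time up to which f stays below r1. There f tau <= r0 by H and left
   continuity, so the bound r1 persists a little longer, contradicting the choice of tau. *)
pose S := [set t | 0 <= t <= t1 /\ forall s, 0 <= s <= t -> f s <= r1].
have S0 : S 0.
  split; first by rewrite lexx t10.
  by move=> s /le_anti <-; apply: le_trans f0 _; exact: ltW.
have Sub : ubound S t1 by move=> t [/andP[]].
have hS : has_sup S by split; [exists 0|exists t1].
pose tau := sup S.
have tau0 : 0 <= tau by exact: sup_upper_bound.
have tau1 : tau <= t1 by apply: sup_le_ub => //; exists 0.
have below s : 0 <= s -> s < tau -> f s <= r1.
  move=> s0 st; have [u [_ Su] su] := sup_adherent (ltac:(by rewrite subr_gt0) : 0 < tau - s) hS.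
  by apply: Su; rewrite s0/= ltW// -(subKr tau s).
have below0 s : 0 <= s -> s < tau -> f s <= r0.
  move=> s0 st; apply: (H) => // u /andP[u0 us]; apply: below => //; exact: le_lt_trans st.
have ftau : f tau <= r0.
  move: tau0; rewrite le_eqVlt => /predU1P[<-//|tau0].
  rewrite leNgt; apply/negP => rf.
  have /cvgrPdist_lt/(_ (f tau - r0)) := cf tau; rewrite subr_gt0 => /(_ rf)/nbhs_ballP[e /= e0 He].
  pose s := Num.max 0 (tau - e / 2).
  have s0 : 0 <= s by rewrite le_max lexx.
  have st : s < tau by rewrite gt_max tau0/= ltrBlDr ltrDl divr_gt0.
  have := He s; rewrite /ball/= => /(_ _)hs.
  have {}hs : `|f tau - f s| < f tau - r0.
    apply: hs; rewrite ger0_norm ?subr_ge0 ?ltW//.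
    have : tau - e / 2 <= s by rewrite le_max lexx orbT.
    by lra.
  by have := below0 s s0 st; move: hs; rewrite ltr_norml => /andP[_]; lra.
have ftau1 : f tau < r1 by exact: le_lt_trans r01.
have tt1 : tau < t1.
  rewrite lt_neqAle tau1 andbT; apply/eqP => E; rewrite E in ftau1.
  by have := lt_trans ft1 ftau1; rewrite ltxx.
have /cvgrPdist_lt/(_ (r1 - f tau)) := cf tau; rewrite subr_gt0 => /(_ ftau1)/nbhs_ballP[e /= e0 He].
pose u := Num.min t1 (tau + e / 2).
have tu : tau < u by rewrite lt_min tt1/= ltrDl divr_gt0.
suff : S u by move/(sup_upper_bound hS); rewrite leNgt tu.
split; first by rewrite ge_min lexx/= andbT; exact: le_trans tau0 (ltW tu).
move=> s /andP[s0 su]; case: (ltP s tau) => [/below->//|ts].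
have := He s; rewrite /ball/= => /(_ _)hs.
have {}hs : `|f tau - f s| < r1 - f tau.
  apply: hs; rewrite ler0_norm ?subr_le0//.
  have : u <= tau + e / 2 by rewrite ge_min lexx orbT.
  by lra.
by move: hs; rewrite ltr_norml => /andP[]; lra.
Qed.

End time_calculus.

(** * Time integrals of the weight *)

Section weight_integral.
Variables (R : realType) (d : nat).
Local Notation K := (d.-tuple int).
Local Notation q := (@freq_norm R d).
Local Notation leb := (@lebesgue_measure R).

Lemma continuous_weight (k : K) : continuous (fun t : R => weight t k).
Proof.
move=> t; apply: (@continuous_comp _ _ _ (fun t => - (eps R * (q k * root4 t))) expR); last exact: continuous_expR.
apply: (@continuousN _ _ _ (fun t => eps R * (q k * root4 t))).
apply: (@continuousM _ _ (cst (eps R)) (fun t => q k * root4 t)); first exact: cst_continuous.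
apply: (@continuousM _ _ (cst (q k)) (@root4 R)); first exact: cst_continuous.
by apply: (@continuous_comp _ _ _ Num.sqrt Num.sqrt); exact: sqrt_continuous.
Qed.

(** With a = eps / 8 and x = |k| t^(1/4): e^(8 a x) >= (1 + a x)^8 >= (1 + a^4 x^4)^2 >= a^8 (1 +
    x^4)^2, the last step because a <= 1. *)
Definition weight_const : R := (eps R / 8) ^- 8.

Lemma weight_const_gt0 : 0 < weight_const.
Proof. by rewrite invr_gt0 exprn_gt0// divr_gt0// eps_gt0. Qed.

(** The rational bound is chosen because lam (1 + lam t)^-2 has the elementary primitive - (1 + lam
    t)^-1. *)
Lemma weight_le_rational (k : K) (t : R) : 0 <= t ->
  weight t k <= weight_const * (1 + q k ^+ 4 * t) ^- 2.
Proof.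
move=> t0; rewrite /weight; set x := q k * root4 t.
have x0 : 0 <= x by rewrite mulr_ge0 ?root4_ge0 ?freq_norm_ge0.
have X : q k ^+ 4 * t = x ^+ 4 by rewrite exprMn root4X.
have e0 := eps_gt0 R; set a := eps R / 8.
have a0 : 0 < a by rewrite divr_gt0.
have a1 : a <= 1 by rewrite /a /eps; lra.
have px : 0 < 1 + x ^+ 4 by rewrite ltr_wpDr ?exprn_ge0.
have pa : 0 < a ^+ 8 * (1 + x ^+ 4) ^+ 2 by rewrite mulr_gt0 ?exprn_gt0.
rewrite X expRN /weight_const -/a -invfM lef_pV2 ?posrE ?expR_gt0//.
have h1 : 1 + a * x <= expR (a * x) by exact: expR_ge1Dx.
have ax0 : 0 <= a * x by rewrite mulr_ge0// ltW.
have h2 : (1 + a * x) ^+ 8 <= expR (eps R * x).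
  rewrite (_ : eps R * x = 8%:R * (a * x)); last by rewrite /a; field.
  by rewrite expRM_natl lerXn2r// nnegrE ?expR_ge0 ?addr_ge0.
apply: le_trans h2.
rewrite (exprM a 4 2) (exprM (1 + a * x) 4 2) -exprMn lerXn2r// ?nnegrE.
- by rewrite mulr_ge0 ?addr_ge0 ?exprn_ge0// ltW.
- by rewrite exprn_ge0// addr_ge0.
have -> : (1 + a * x) ^+ 4 = 1 + (a * x) ^+ 4 + (4 * (a * x) + 6 * (a * x) ^+ 2 + 4 * (a * x) ^+ 3) by ring.
rewrite mulrDr mulr1 -exprMn -[leLHS]addr0; apply: lerD.
  by rewrite lerD2r exprn_ile1// ltW.
by rewrite !addr_ge0// mulr_ge0// exprn_ge0.
Qed.

(* The smoothing bound that makes sum_k |k|^4 |c_k| integrable in time. *)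
Lemma lam_integral_weight (k : K) (T : R) : 0 <= T ->
  q k ^+ 4 * \int[leb]_(t in `[0, T]) weight t k <= weight_const.
Proof.
move=> T0; set lam := q k ^+ 4; have l0 : 0 <= lam by rewrite exprn_ge0// freq_norm_ge0.
have W0 := weight_const_gt0.
have p1 t : 0 <= t -> 0 < 1 + lam * t by move=> t0; rewrite ltr_wpDr// mulr_ge0.
pose y t := - weight_const * (1 + lam * t)^-1.
pose z t := weight_const * (lam * (1 + lam * t) ^- 2).
have dH (s : R) : is_derive s 1 (fun t : R => 1 + lam * t) lam.
  rewrite -[X in is_derive _ _ _ X]add0r; apply: is_deriveD.
  by rewrite -[X in is_derive _ _ _ X]mulr1; apply: is_deriveZ.
have dy (s : R) : 0 <= s -> is_derive s 1 y (z s).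
  move=> s0.
  have H := dH s.
  have ne : 1 + lam * s != 0 by rewrite gt_eqF// p1.
  have H2 := @is_deriveV _ (fun t : R => 1 + lam * t) s lam 1 ne H; have H3 := is_deriveZ (- weight_const) H2.
  rewrite [X in is_derive _ _ _ X](_ : _ = - weight_const *: (- (1 + lam * s) ^- 2 *: lam)); first exact: H3.
  by rewrite /z -![_ *: _]/(_ * _); ring.
have cz (s : R) : 0 <= s -> {for s, continuous z}.
  move=> s0; have c1 : {for s, continuous (fun t : R => (1 + lam * t))}.
    exact: is_derive_continuous (dH s).
  apply: (@continuousM _ _ (cst weight_const) (fun t => lam * (1 + lam * t) ^- 2)); first exact: cst_continuous.
  apply: (@continuousM _ _ (cst lam) (fun t => (1 + lam * t) ^- 2)); first exact: cst_continuous.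
  apply: continuousV; first by rewrite expf_eq0/= gt_eqF// p1.
  by rewrite /= (_ : (fun t => _) = (fun t => (1 + lam * t) * (1 + lam * t))); [exact: continuousM|].
have I1 : leb.-integrable `[0, T] (EFin \o (fun t => weight t k)).
  by apply: integrable_continuous_itv; exact: continuous_weight.
rewrite -(RintegralZl _ _ I1)//.
apply: (@le_trans _ _ (\int[leb]_(t in `[0, T]) z t)).
  apply: le_Rintegral => //.
  - by apply: integrable_scale => //; exact: I1.
  - apply: continuous_compact_integrable; first exact: segment_compact.
    by apply: continuous_in_subspaceT => s; rewrite inE/= in_itv/= => /andP[/cz].
  move=> t; rewrite /= in_itv/= => /andP[t0 _].
  by rewrite /z mulrCA ler_wpM2l// weight_le_rational.
have -> : \int[leb]_(t in `[0, T]) z t = y T - y 0.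
  by apply: FTC2_at => // s /andP[s0 _]; [exact: dy|exact: cz].
have y0 : y 0 = - weight_const by rewrite /y mulr0 addr0 invr1 mulr1.
have yT : y T <= 0.
  rewrite /y mulNr oppr_le0; apply: mulr_ge0; first exact: ltW.
  by rewrite invr_ge0; apply: ltW; exact: p1.
by rewrite y0 opprK gerDr.
Qed.

End weight_integral.

(** * The Gronwall argument for the sum of the moduli *)

Section decay.
Variables (R : realType) (d : nat).
Local Notation K := (d.-tuple int).
Local Notation q := (@freq_norm R d).
Local Notation leb := (@lebesgue_measure R).
Variables (c0 : K -> R[i]) (c : R -> K -> R[i]) (M : K -> R).
Variables (c00 : c0 0 = 0) (creg : regular c) (Mm : majorant M) (cM : below c M).
Variable cfix : forall t k, c t k = mild_map c0 c t k.
Implicit Types (k : K) (t s T : R).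

Definition nlabs k t : R := Normc.normc (nonlin (c t) k).

Lemma nlabs_ge0 k t : 0 <= nlabs k t. Proof. exact: normc_ge0. Qed.

Lemma continuous_nlabs k : continuous (nlabs k).
Proof.
move=> t; have [cR cI] := continuous_nonlin k creg Mm cM.
by apply: cvg_normc; [exact: cR|exact: cI].
Qed.

(* A majorant of |c_k| solving a scalar equation, hence differentiable in time. *)
Definition dom k t : R := duh (q k ^+ 4) (cabs c0 k) (fun s => - nlabs k s) t.
Definition cdom k t : R := dom k (Num.max t 0).

Lemma continuous_opp_nlabs k : continuous (fun s => - nlabs k s).
Proof. by move=> s; apply: (@continuousN _ _ _ (nlabs k)); exact: continuous_nlabs. Qed.

(** The source of [dom] is - |N_k|, so that Duhamel's formula adds absolute values. [duh_bound] then
    applies to every rotation, with G the bracket in [dom] itself. *)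
Lemma cabs_le_dom k t : 0 <= t -> cabs (c t) k <= dom k t.
Proof.
move=> t0; rewrite /cabs cfix.
have b x y : x ^+ 2 + y ^+ 2 = 1 ->
    `|duh (q k ^+ 4) (x * complex.Re (c0 k) + y * complex.Im (c0 k))
      (fun s => x * complex.Re (nonlin (c s) k) + y * complex.Im (nonlin (c s) k)) t| <= dom k t.
  move=> xy.
  have cn := continuous_duh_integrand (lam := q k ^+ 4) (@continuous_opp_nlabs k).
  apply: (@duh_bound _ (q k ^+ 4) _ (cabs c0 k) _ (nlabs k)
    (fun t => cabs c0 k - prim (fun s => q k ^+ 4 * expR (q k ^+ 4 * s) * - nlabs k s) t)
    (fun s => 0 - q k ^+ 4 * expR (q k ^+ 4 * s) * - nlabs k s)) => //.
  - exact: lam_ge0.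
  - exact: continuous_rot creg Mm cM.
  - exact: norm_rot_le.
  - by rewrite prim0 subr0.
  - by move=> s _; exact: norm_rot_le.
  - by move=> s s0; apply: is_deriveB; apply: is_derive_prim => //; exact: lt_le_trans s0.
  - by move=> s _; rewrite sub0r mulrN opprK.
apply: normc_rot_le => [|x y xy].
  by apply: le_trans (normr_ge0 _) (b 1 0 _); rewrite expr1n expr0n addr0.
rewrite (mild_rot c0 t k x y creg Mm cM) (max_idPl t0).
by apply: le_trans (ler_norm _) (b x y xy).
Qed.

Lemma dom_ge0 k t : 0 <= t -> 0 <= dom k t.
Proof. by move=> t0; apply: le_trans (cabs_le_dom k t0); exact: normc_ge0. Qed.

Lemma cdom_ge0 k t : 0 <= cdom k t.
Proof. by apply: dom_ge0; exact: max_ge0r. Qed.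

Lemma dom_le k t : 0 <= t -> dom k t <= next_majorant c0 M k * weight t k.
Proof.
move=> t0; apply: le_trans (ler_norm _) _; have [M0 _] := Mm.
apply: duh_bound_weight => //.
- exact: continuous_opp_nlabs.
- by rewrite ger0_norm ?normc_ge0.
- exact: fine_cexp_ge0.
- by move=> s _; rewrite normrN ger0_norm ?nlabs_ge0//; exact: normc_nonlin_le creg Mm cM.
Qed.

Lemma dom0 t : 0 <= t -> dom 0 t = 0.
Proof.
move=> t0; rewrite /dom /duh freq_norm0 expr0n/= /cabs c00 Normc.normc0.
have -> : prim (fun s => 0 * expR (0 * s) * - nlabs 0 s) t = 0 - 0.
  apply: (@prim_unique _ _ (cst 0)) => //.
    by move=> s; under eq_fun do rewrite !mul0r; exact: cst_continuous.
  by move=> s _; rewrite !mul0r; exact: is_derive_cst.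
by rewrite !subrr mulr0.
Qed.

Lemma continuous_cdom k : continuous (cdom k).
Proof. by apply: continuous_duh_max; exact: continuous_opp_nlabs. Qed.

(** The factor e^(dl t) turns decay at rate dl into boundedness of the weighted quantities. *)
Definition iA (dl : R) k T : R := \int[leb]_(t in `[0, T]) (expR (dl * t) * cdom k t).
Definition iB (dl : R) k T : R := \int[leb]_(t in `[0, T]) (q k ^+ 4 * (expR (dl * t) * nlabs k t)).

Lemma continuous_iA (dl : R) k : continuous (fun t => expR (dl * t) * cdom k t).
Proof.
by move=> t; apply: (@continuousM _ _ (fun t => expR (dl * t)) (cdom k)); [exact: continuous_expZ|exact: continuous_cdom].
Qed.

Lemma continuous_iB (dl : R) k : continuous (fun t => q k ^+ 4 * (expR (dl * t) * nlabs k t)).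
Proof.
move=> t; apply: (@continuousM _ _ (cst (q k ^+ 4)) (fun t => expR (dl * t) * nlabs k t)); first exact: cst_continuous.
by apply: (@continuousM _ _ (fun t => expR (dl * t)) (nlabs k)); [exact: continuous_expZ|exact: continuous_nlabs].
Qed.

Lemma iA_ge0 dl k T : 0 <= iA dl k T.
Proof. by apply: Rintegral_ge0 => t _; rewrite mulr_ge0 ?expR_ge0 ?cdom_ge0. Qed.

Lemma iB_ge0 dl k T : 0 <= iB dl k T.
Proof. by apply: Rintegral_ge0 => t _; rewrite mulr_ge0 ?lam_ge0// mulr_ge0 ?expR_ge0 ?nlabs_ge0. Qed.

(* e^{dl t} times the scalar equation m' = - lam m + lam n, integrated over [0, T]. *)
Lemma decay_identity dl k T : 0 <= T ->
  expR (dl * T) * dom k T + (q k ^+ 4 - dl) * iA dl k T = cabs c0 k + iB dl k T.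
Proof.
move=> T0; set lam := q k ^+ 4.
pose y t := expR (dl * t) * dom k t.
pose z t := (dl - lam) * (expR (dl * t) * dom k t) + lam * (expR (dl * t) * nlabs k t).
have dD (s : R) : 0 <= s -> is_derive s 1 (dom k) (- lam * (dom k s - nlabs k s)).
  by move=> s0; apply: is_derive_duh; [exact: continuous_opp_nlabs|exact: lt_le_trans s0].
have dy (s : R) : 0 <= s -> is_derive s 1 y (z s).
  move=> s0; have H := is_deriveM (is_derive_expZ dl s) (dD s s0).
  rewrite [X in is_derive _ _ _ X](_ : _ = expR (dl * s) *: (- lam * (dom k s - nlabs k s)) +
    dom k s *: (dl * expR (dl * s))); first exact: H.
  by rewrite /z -![_ *: _]/(_ * _); move: (dom k s) (nlabs k s) (expR _) => a b e; ring.
have cz (s : R) : 0 <= s -> {for s, continuous z}.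
  move=> s0; apply: (@continuousD _ _ _ (fun t => (dl - lam) * y t) (fun t => lam * (expR (dl * t) * nlabs k t))); last exact: continuous_iB.
  apply: (@continuousM _ _ (cst (dl - lam)) y); first exact: cst_continuous.
  exact: is_derive_continuous (dy s s0).
have E : \int[leb]_(t in `[0, T]) z t = (dl - lam) * iA dl k T + iB dl k T.
  have h := Rintegral_comb (dl - lam) 1 0 T (continuous_iA (dl := dl) (k := k)) (continuous_iB (dl := dl) (k := k)).
  rewrite mul1r in h; rewrite -h; apply: eq_Rintegral => t; rewrite inE/= in_itv/= => /andP[t0 _].
  by rewrite /z /cdom (max_idPl t0) mul1r.
have F : \int[leb]_(t in `[0, T]) z t = y T - y 0.
  by apply: (FTC2_at T0) => s /andP[s0 _]; [exact: dy|exact: cz].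
have y0 : y 0 = cabs c0 k by rewrite /y mulr0 expR0 mul1r /dom duh0.
rewrite F y0 /y in E; move: E.
by move: (iA dl k T) (iB dl k T) (expR (dl * T) * dom k T) (cabs c0 k) => a b x w; lra.
Qed.

(** Finiteness is what permits the subtraction of this sum in [decay_step]. It rests on the
    smoothing bound [lam_integral_weight], mode by mode. *)
Lemma asum_iA_fin dl T : 0 <= dl -> 0 <= T -> (asum (cabs c0) <= (7^-1)%:E)%E ->
  (asum (fun k => q k ^+ 4 * iA dl k T)%R < +oo)%E.
Proof.
move=> dl0 T0 c07; have Nm := majorant_next c07 Mm; have [N0 N5] := Nm.
have C0 : 0 <= expR (dl * T) * weight_const R by rewrite mulr_ge0 ?expR_ge0 ?ltW ?weight_const_gt0.
apply: (@le_lt_trans _ _ (asum (fun k => expR (dl * T) * weight_const R * next_majorant c0 M k))); last first.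
  by rewrite asumZ// lte_mul_pinfty//; exact: le_lt_trans N5 (ltry _).
apply: le_asum => k.
have I1 : leb.-integrable `[0, T] (EFin \o (fun t => weight t k : R)).
  by apply: integrable_continuous_itv; exact: continuous_weight.
apply: (@le_trans _ _ (q k ^+ 4 * (expR (dl * T) * next_majorant c0 M k * \int[leb]_(t in `[0, T]) weight t k))).
  apply: ler_wpM2l; first exact: lam_ge0.
  rewrite -(RintegralZl _ _ I1)//; apply: le_Rintegral => //.
  - by apply: integrable_continuous_itv; exact: continuous_iA.
  - by apply: integrable_scale => //; exact: I1.
  move=> t; rewrite /= in_itv/= => /andP[t0 tT]; rewrite -mulrA; apply: ler_pM; rewrite ?expR_ge0 ?cdom_ge0//.
    by rewrite ler_expR ler_wpM2l.
  by rewrite /cdom (max_idPl t0); exact: dom_le.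
rewrite mulrCA [leRHS]mulrAC; apply: ler_wpM2l; last exact: lam_integral_weight.
by rewrite mulr_ge0 ?expR_ge0.
Qed.

(** This is 1 - [delta r], see [deltaE], and the constant of [moment4_cexp2]. *)
Definition hfun (r : R) : R := expR r * (1 + 7 * r + 6 * r ^+ 2 + r ^+ 3) - 1.

Lemma hfun_mono (a b : R) : 0 <= a -> a <= b -> hfun a <= hfun b.
Proof.
move=> a0 ab; have b0 := le_trans a0 ab.
rewrite /hfun lerD2r ler_pM ?expR_ge0 ?ler_expR//.
  by rewrite !addr_ge0// ?mulr_ge0 ?exprn_ge0.
by rewrite !lerD// ?ler_wpM2l// lerXn2r ?nnegrE.
Qed.

Lemma hfun_ge (r : R) : 0 <= r -> r <= hfun r.
Proof.
move=> r0; rewrite /hfun; have e1 := expR_ge1Dx r.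
have h : (1 + r) * 1 <= expR r * (1 + 7 * r + 6 * r ^+ 2 + r ^+ 3).
  apply: ler_pM => //; first by rewrite addr_ge0.
  by rewrite -!addrA lerDl !addr_ge0// ?mulr_ge0 ?exprn_ge0.
lra.
Qed.

Lemma nonlin_moment t (r : R) : 0 < r -> (asum (cabs (c t)) <= r%:E)%E ->
  (asum (fun k => q k ^+ 4 * nlabs k t)%R <= (hfun r)%:E * asum (fun k => q k ^+ 4 * cabs (c t) k)%R)%E.
Proof.
move=> r0 cr; have cs := below_csummable t Mm cM; have [ch _ _ _] := creg.
have z0 k : (0 <= ecabs (c t) k)%E by rewrite lee_fin normc_ge0.
have h0 : 0 < hfun r by apply: lt_le_trans (hfun_ge (ltW r0)).
have c00' k : 0 <= q k ^+ 4 * cabs (c t) k by rewrite mulr_ge0 ?lam_ge0 ?normc_ge0.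
have W0 := asum_ge0 c00'.
(* An infinite moment makes the bound trivial, since [hfun r] is positive; [moment4_cexp2] takes
   finite sums. *)
have [|Wfin] := eqVneq (asum (fun k => q k ^+ 4 * cabs (c t) k)) +oo%E.
  by move=> ->; rewrite gt0_muley ?lte_fin// leey.
have {}Wfin : asum (fun k => q k ^+ 4 * cabs (c t) k) \is a fin_num.
  by rewrite ge0_fin_numE// ltey.
have Afin : asum (cabs (c t)) \is a fin_num.
  by rewrite ge0_fin_numE//; apply: asum_ge0 => k; exact: normc_ge0.
have Ae : \esum_(k in [set: K]) ecabs (c t) k = (fine (asum (cabs (c t))))%:E by rewrite fineK.
have We : \esum_(k in [set: K]) ((q k ^+ 4)%:E * ecabs (c t) k)%E =
    (fine (asum (fun k => q k ^+ 4 * cabs (c t) k)))%:E.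
  by rewrite fineK//; apply: eq_esum => k _; rewrite EFinM.
have H := moment4_cexp2 (@freq_norm_ge0 R d) (@freq_normD R d) z0 Ae We.
 apply: (@le_trans _ _ (\esum_(k in [set: K]) ((q k ^+ 4)%:E * cexp 2 (ecabs (c t)) k)%E)).
  apply: ge0_lee_esum => k; rewrite EFinM; apply: lee_wpmul2l; first by rewrite lee_fin lam_ge0.
  exact: ftabs_expT.
apply: le_trans H _; rewrite -[X in (_ <= _ * X)%E](fineK Wfin) -EFinM lee_fin.
apply: ler_wpM2r; first exact: fine_ge0.
apply: hfun_mono; first by apply: fine_ge0; apply: asum_ge0 => k; exact: normc_ge0.
by rewrite -lee_fin fineK.
Qed.

(** By Tonelli the sum goes under the time integral, where [nonlin_moment] applies at each time. *)
Lemma asum_iB_le dl T (r : R) : 0 <= T -> 0 < r ->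
  (forall t, 0 <= t <= T -> (asum (cabs (c t)) <= r%:E)%E) ->
  (asum (fun k => iB dl k T) <= (hfun r)%:E * asum (fun k => q k ^+ 4 * iA dl k T)%R)%E.
Proof.
move=> T0 r0 cr; have h0 : 0 < hfun r by apply: lt_le_trans (hfun_ge (ltW r0)).
have mI (f : R -> R) : continuous f -> measurable_fun `[0, T] (EFin \o f).
  by move=> cf; have /integrableP[] := integrable_continuous_itv 0 T cf.
pose A1 k t : \bar R := (q k ^+ 4 * (expR (dl * t) * cdom k t))%:E.
pose B1 k t : \bar R := (q k ^+ 4 * (expR (dl * t) * nlabs k t))%:E.
have A10 k t : (0 <= A1 k t)%E.
  by rewrite lee_fin mulr_ge0 ?lam_ge0// mulr_ge0 ?expR_ge0 ?cdom_ge0.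
have B10 k t : (0 <= B1 k t)%E.
  by rewrite lee_fin mulr_ge0 ?lam_ge0// mulr_ge0 ?expR_ge0 ?nlabs_ge0.
have cA k : continuous (fun t => q k ^+ 4 * (expR (dl * t) * cdom k t)).
  move=> t; apply: (@continuousM _ _ (cst (q k ^+ 4)) (fun t => expR (dl * t) * cdom k t)); first exact: cst_continuous.
  exact: continuous_iA.
have mA k : measurable_fun `[0, T] (A1 k) by exact: mI.
have mB k : measurable_fun `[0, T] (B1 k) by apply: mI; exact: continuous_iB.
have -> : asum (fun k => iB dl k T) = (\int[leb]_(t in `[0%R, T]) (\esum_(k in [set: K]) B1 k t))%E.
  rewrite integral_esum//; apply: eq_esum => k _; rewrite EFin_Rintegral//.
  by apply: integrable_continuous_itv; exact: continuous_iB.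
have -> : asum (fun k => q k ^+ 4 * iA dl k T) = (\int[leb]_(t in `[0%R, T]) (\esum_(k in [set: K]) A1 k t))%E.
  rewrite integral_esum//; apply: eq_esum => k _.
  have iAi : leb.-integrable `[0, T] (EFin \o (fun t => expR (dl * t) * cdom k t)).
    by apply: integrable_continuous_itv; exact: continuous_iA.
  rewrite -(RintegralZl _ _ iAi)// EFin_Rintegral//.
  by apply: integrable_continuous_itv; exact: cA.
have sA0 t : (0 <= \esum_(k in [set: K]) A1 k t)%E by apply: esum_ge0.
have mSA : measurable_fun `[0, T] (fun t => \esum_(k in [set: K]) A1 k t)%E by exact: measurable_esum.
rewrite -ge0_integralZl//; last by rewrite lee_fin ltW.
apply: ge0_le_integral => //.
- by move=> t _; exact: esum_ge0.
- exact: measurable_esum.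
- by apply: measurable_funeM.
move=> t; rewrite /= in_itv/= => tT; have /andP[t0 _] := tT.
have e0 : (0 <= (expR (dl * t))%:E)%E by rewrite lee_fin expR_ge0.
have -> : \esum_(k in [set: K]) B1 k t = ((expR (dl * t))%:E * asum (fun k => q k ^+ 4 * nlabs k t)%R)%E.
  rewrite /asum -ge0_esumZl//; last by move=> k; rewrite lee_fin mulr_ge0 ?lam_ge0 ?nlabs_ge0.
  by apply: eq_esum => k _; rewrite /B1 mulrCA EFinM.
apply: (@le_trans _ _ ((expR (dl * t))%:E * ((hfun r)%:E * asum (fun k => q k ^+ 4 * cabs (c t) k)%R))%E).
  by apply: lee_wpmul2l => //; apply: nonlin_moment => //; exact: cr.
rewrite muleCA; apply: lee_wpmul2l; first by rewrite lee_fin ltW.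
rewrite /asum -ge0_esumZl//; last by move=> k; rewrite lee_fin mulr_ge0 ?lam_ge0 ?normc_ge0.
apply: ge0_lee_esum => k; rewrite -EFinM lee_fin mulrCA; apply: ler_wpM2l; first exact: lam_ge0.
by apply: ler_wpM2l; rewrite ?expR_ge0// /cdom (max_idPl t0); exact: cabs_le_dom.
Qed.

(** Summation of [decay_identity] over k. For k != 0 one has |k| >= 1, so |k|^4 - dl >= (1 - dl)
    |k|^4, and by [hr] this dissipation absorbs the source; the mode 0 vanishes. *)
Lemma decay_step dl T (r : R) : 0 <= T -> 0 < r -> 0 <= dl -> hfun r <= 1 - dl ->
  (asum (cabs c0) <= (7^-1)%:E)%E ->
  (forall t, 0 <= t <= T -> (asum (cabs (c t)) <= r%:E)%E) ->
  ((expR (dl * T))%:E * asum (cabs (c T)) <= asum (cabs c0))%E.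
Proof.
move=> T0 r0 dl0 hr c07 cr; have h0 : 0 < hfun r by apply: lt_le_trans (hfun_ge (ltW r0)).
have a0 k : 0 <= q k ^+ 4 * iA dl k T by rewrite mulr_ge0 ?lam_ge0 ?iA_ge0.
have e0 := expR_ge0 (dl * T).
have d0 k := dom_ge0 k T0.
have X := asum_iA_fin dl0 T0 c07; have XB := asum_iB_le dl T0 r0 cr.
have Xf : asum (fun k => q k ^+ 4 * iA dl k T) \is a fin_num by rewrite ge0_fin_numE// asum_ge0.
have key k : expR (dl * T) * dom k T + (1 - dl) * (q k ^+ 4 * iA dl k T) <= cabs c0 k + iB dl k T.
  rewrite -decay_identity// lerD2l mulrA.
  have [->|k0] := eqVneq k 0.
    suff -> : iA dl 0 T = 0 by rewrite !mulr0.
    rewrite /iA (_ : (fun t => _) = (fun _ => 0)) ?Rintegral_cst0//; first by rewrite /Rintegral integral0.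
    by apply/funext => t; rewrite /cdom dom0 ?max_ge0r// mulr0.
  apply: ler_wpM2r; first exact: iA_ge0.
  have q1 : 1 <= q k ^+ 4 by rewrite exprn_ege1// freq_norm_ge1.
  by move: (q k ^+ 4) q1 => l l1; nra.
have := le_asum key.
have dl1 : 0 <= 1 - dl by apply: le_trans hr; exact: ltW.
have E1 := asumD (fun k => mulr_ge0 e0 (d0 k)) (fun k => mulr_ge0 dl1 (a0 k)).
have E2 := asumD (fun k => normc_ge0 (c0 k)) (fun k => iB_ge0 dl k T).
rewrite E1 [X in (_ <= X)%E]E2.
rewrite (asumZ e0 d0) (asumZ dl1 a0).
move=> H; have {}H := le_trans H (leeD (lexx _) XB).
have {H} : ((expR (dl * T))%:E * asum (fun k => dom k T) <= asum (cabs c0))%E.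
  move: H; rewrite -(fineK Xf); set x := fine _.
  have x0 : 0 <= x by apply: fine_ge0; apply: asum_ge0.
  have c0f : asum (cabs c0) \is a fin_num.
    by rewrite ge0_fin_numE ?asum_ge0//; [exact: le_lt_trans c07 (ltry _)|move=> k; exact: normc_ge0].
  rewrite -(fineK c0f) -!EFinM -EFinD.
  case: (_ * _)%E => [s||].
  - by rewrite -EFinD !lee_fin; move: (fine _) => w H; have := ler_wpM2r x0 hr; lra.
  - by rewrite addye.
  - by move=> _; rewrite leNye.
apply: le_trans; apply: lee_wpmul2l; first by rewrite lee_fin.
by apply: le_asum => k; exact: cabs_le_dom.
Qed.

Lemma mild0 k : c 0 k = c0 k.
Proof.
rewrite cfix; apply: complex_ext; rewrite ?Re_mild_map ?Im_mild_map (max_idPl (lexx 0)); exact: duh0.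
Qed.

Lemma continuous_total : continuous (fun t => fine (asum (cabs (c t)))).
Proof.
move=> t; apply/cvgrPdist_le => e e0.
have /fine_cvgP[finA /cvgrPdist_le/(_ _ e0) cA] := @regular_diff_cvg0 _ _ c M t creg Mm cM.
have fin s : asum (cabs (c s)) \is a fin_num.
  rewrite ge0_fin_numE; first exact: below_csummable Mm cM.
  by apply: asum_ge0 => k; exact: normc_ge0.
near=> s.
have fs : asum (cabs (fun k => c s k - c t k)) \is a fin_num by near: s.
have De : fine (asum (cabs (fun k => c s k - c t k))) <= e.
  by apply: le_trans (ler_norm _) _; rewrite -normrN -sub0r; near: s.
have h1 : fine (asum (cabs (c s))) <= fine (asum (cabs (c t))) + fine (asum (cabs (fun k => c s k - c t k))).
  rewrite -lee_fin EFinD !fineK//.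
  rewrite -asumD; try by move=> k; exact: normc_ge0.
  by apply: le_asum => k; apply: le_trans (normcD_le _ _); rewrite addrC subrK.
have h2 : fine (asum (cabs (c t))) <= fine (asum (cabs (c s))) + fine (asum (cabs (fun k => c s k - c t k))).
  rewrite -lee_fin EFinD !fineK//.
  rewrite -asumD; try by move=> k; exact: normc_ge0.
  by apply: le_asum => k; rewrite /cabs [X in _ <= _ + X]normcBC; apply: le_trans (normcD_le _ _); rewrite addrC subrK.
by move: De h1 h2; move: (fine _) (fine _) (fine _) => x y z De h1 h2; rewrite ler_norml; apply/andP; split; lra.
Unshelve. all: by end_near. Qed.

Lemma continuous_hfun : continuous hfun.
Proof.
move=> r; apply: (@continuousB _ _ _ (fun r => expR r * (1 + 7 * r + 6 * r ^+ 2 + r ^+ 3)) (cst 1)); last exact: cst_continuous.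
apply: (@continuousM _ _ expR (fun r => 1 + 7 * r + 6 * r ^+ 2 + r ^+ 3)); first exact: continuous_expR.
have -> : (fun r : R => 1 + 7 * r + 6 * r ^+ 2 + r ^+ 3) = (fun r => (1 + 7%:P * 'X + 6%:P * 'X^2 + 'X^3).[r]).
  by apply/funext => x; rewrite !hornerE.
exact: continuous_horner.
Qed.

(** [decay_step] is used twice. With rate 0 and a radius r1 slightly above r0 it feeds the
    continuous induction, which keeps the sum below r0 for all times; then it applies with radius r0
    and the full rate 1 - [hfun r0]. *)
Lemma decay (r0 : R) t : asum (cabs c0) = r0%:E -> r0 <= 7^-1 -> hfun r0 < 1 -> 0 <= t ->
  (asum (cabs (c t)) <= (r0 * expR (- (1 - hfun r0) * t))%:E)%E.
Proof.
move=> c0r r07 hr0; move: t.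
have r00 : 0 <= r0 by rewrite -lee_fin -c0r; apply: asum_ge0 => k; exact: normc_ge0.
have c07 : (asum (cabs c0) <= (7^-1)%:E)%E by rewrite c0r lee_fin.
have fin s : asum (cabs (c s)) \is a fin_num.
  rewrite ge0_fin_numE; first exact: below_csummable Mm cM.
  by apply: asum_ge0 => k; exact: normc_ge0.
have [r1 [r01 hr1]] : exists r1, r0 < r1 /\ hfun r1 <= 1.
  have /cvgrPdist_lt/(_ (1 - hfun r0)) := @continuous_hfun r0; rewrite subr_gt0 => /(_ hr0)/nbhs_ballP[e /= e0 He].
  exists (r0 + e / 2); split; first by rewrite ltrDl divr_gt0.
  have B : `|r0 - (r0 + e / 2)| < e.
    by rewrite opprD addNKr normrN ger0_norm; [lra|rewrite divr_ge0// ltW].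
  by have := He _ B; rewrite /= ltr_norml => /andP[]; lra.
have r10 : 0 < r1 by exact: le_lt_trans r01.
have small : forall T, 0 <= T -> fine (asum (cabs (c T))) <= r0.
  apply: (bootstrap continuous_total r01) => [T T0 H|].
    have := @decay_step 0 T r1 T0 r10 (lexx _) (ltac:(by rewrite subr0)) c07.
    rewrite mul0r expR0 mul1e c0r -(fineK (fin T)) lee_fin; apply=> s sT.
    by rewrite -(fineK (fin s)) lee_fin; exact: H.
  have -> : c 0 = c0 by apply/funext => k; exact: mild0.
  by rewrite c0r.
(* [decay_step] takes a positive radius; if r0 = 0 the first pass already gives the claim. *)
move=> t t0; move: r00; rewrite le_eqVlt => /predU1P[r0z|r00].
  by rewrite -r0z mul0r -(fineK (fin t)) lee_fin r0z; exact: small.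
have dl0 : 0 <= 1 - hfun r0 by rewrite subr_ge0 ltW.
have := @decay_step (1 - hfun r0) t r0 t0 r00 dl0 (ltac:(by rewrite opprB addrC subrK)) c07.
rewrite c0r -(fineK (fin t)) -EFinM !lee_fin => H.
have {}H : expR ((1 - hfun r0) * t) * fine (asum (cabs (c t))) <= r0.
  by apply: H => s /andP[s0 _]; rewrite -(fineK (fin s)) lee_fin; exact: small.
by rewrite mulNr expRN -ler_pdivlMl ?expR_gt0// in H *; rewrite mulrC.
Qed.

End decay.

(** * Weak derivatives and Bochner spaces *)

Section lebesgue_spaces.
Variables (R : realType) (d : nat).
Local Notation mu := (torus_measure R d).
Implicit Types (f g : d.-tuple R -> R).

Lemma torus_measure_gt0 : (0 < mu setT)%E.
Proof. by rewrite torus_measureT lte_fin; exact: torus_volume_gt0. Qed.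

Lemma Linf_le f (M : R) : {ae mu, forall x, `|f x| <= M} ->
  ('N[mu]_+oo[EFin \o f] <= M%:E)%E.
Proof.
move=> fM; rewrite unlock torus_measure_gt0.
by apply/ess_sup_inf.ess_supP; apply: filterS fM => x; rewrite /= lee_fin.
Qed.

Lemma Lfun_inf f (M : R) : measurable_fun setT f -> {ae mu, forall x, `|f x| <= M} ->
  f \in Lfun mu +oo%E.
Proof.
move=> mf fM; rewrite inE; apply/andP; split; rewrite inE//=.
by rewrite /finite_norm; apply: le_lt_trans (Linf_le fM) (ltry _).
Qed.

Lemma Lfun_inf_sub f (p : \bar R) : (1 <= p)%E -> f \in Lfun mu +oo%E -> f \in Lfun mu p.
Proof. by move=> p1; apply: Lfun_subset => //; rewrite ?leey//; exact: fin_num_measure. Qed.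

Lemma Lfun_wser c (p : \bar R) : (1 <= p)%E -> csummable c -> wser c \in Lfun mu p.
Proof.
move=> p1 cs; apply: Lfun_inf_sub => //; apply: (@Lfun_inf _ (fine (asum (cabs c)))).
  exact: measurable_wser.
by apply: aeW => x; exact: norm_wser_le.
Qed.

End lebesgue_spaces.

(** * Weak derivatives of Fourier series *)

Section weak_laplacian.
Variables (R : realType) (d : nat).
Local Notation mu := (torus_measure R d).
Local Notation K := (d.-tuple int).
Local Notation q := (@freq_norm R d).
Local Notation fr k i := ((tnth k i)%:~R : R).
Implicit Types (psi : 'rV[R]_d -> R) (f g : d.-tuple R -> R) (k : K) (c : K -> R[i]).

Lemma periodic_partial psi i : Defs.periodic psi -> Defs.periodic (fun y => 'D_(delta_mx 0 i) psi y).
Proof.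
move=> ppsi x j; rewrite /derive.
rewrite (_ : (fun h : R => h^-1 *: ((psi \o shift (x + (2 * pi) *: delta_mx 0 j)) (h *: delta_mx 0 i) -
    psi (x + (2 * pi) *: delta_mx 0 j))) =
  (fun h : R => h^-1 *: ((psi \o shift x) (h *: delta_mx 0 i) - psi x)))//.
by apply/funext => h /=; rewrite addrA !ppsi.
Qed.

(** Green's identity in direction i: the function G = psi' w - psi w' is periodic, so its derivative
    psi'' w - psi w'' has integral 0. *)
Lemma integral_partials_wave psi k th i : smooth psi -> Defs.periodic psi ->
  \int[mu]_x (partials [:: i; i] psi (row_of x) * cos (phase k x + th)) =
  - fr k i ^+ 2 * \int[mu]_x (psi (row_of x) * cos (phase k x + th)).
Proof.
move=> spsi ppsi; set e := delta_mx 0 i : 'rV[R]_d.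
have [c0 d0] := spsi [::]; have [c1 d1] := spsi [:: i]; have [c2 _] := spsi [:: i; i].
rewrite /= in c0 d0 c1 d1 c2.
pose D1 y := 'D_e psi y; pose D2 y := 'D_e D1 y.
pose G y := D1 y * wave k th y - psi y * (fr k i * wave k (th + pi / 2) y).
pose DG y := D2 y * wave k th y + fr k i ^+ 2 * (psi y * wave k th y).
have wpi y : wave k (th + pi / 2 + pi / 2) y = - wave k th y.
  by rewrite /wave !addrA -cosDpi; congr cos; rewrite -!addrA; congr (_ + (_ + _)); field.
have dG y : is_derive y e G (DG y).
  have h1 : is_derive y e D1 (D2 y) by apply: DeriveDef => //; exact: d1.
  have h0 : is_derive y e psi (D1 y) by apply: DeriveDef => //; exact: d0.
  have hw := is_derive_wave k th y i; have hw' := is_derive_wave k (th + pi / 2) y i.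
  have H := is_deriveB (is_deriveM h1 hw) (is_deriveM h0 (is_deriveZ (fr k i) hw')).
  rewrite [X in is_derive _ _ _ X](_ : _ = D1 y *: (fr k i * wave k (th + pi / 2) y) + wave k th y *: D2 y -
     (psi y *: (fr k i *: (fr k i * wave k (th + pi / 2 + pi / 2) y)) + (fr k i * wave k (th + pi / 2) y) *: D1 y)); first exact: H.
  rewrite wpi /DG -![_ *: _]/(_ * _).
  by move: (D1 y) (D2 y) (psi y) (wave k th y) (wave k (th + pi / 2) y) => a b p w w'; ring.
have EDG : (fun y => 'D_e G y) = DG by apply/funext => y; have [_ ->] := dG y.
have cw t : continuous (wave k t) := @continuous_wave R d k t.
have cpw : continuous (fun y => psi y * wave k th y).
  by move=> y; apply: (@continuousM _ _ psi (wave k th)); [exact: c0|exact: cw].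
have c2w : continuous (fun y => D2 y * wave k th y).
  by move=> y; apply: (@continuousM _ _ D2 (wave k th)); [exact: c2|exact: cw].
have cG : continuous G.
  move=> y; apply: (@continuousB _ _ _ (fun y => D1 y * wave k th y) (fun y => psi y * (fr k i * wave k (th + pi / 2) y))).
    by apply: (@continuousM _ _ D1 (wave k th)); [exact: c1|exact: cw].
  apply: (@continuousM _ _ psi (fun y => fr k i * wave k (th + pi / 2) y)); first exact: c0.
  by apply: (@continuousM _ _ (cst (fr k i)) (wave _ _)); [exact: cst_continuous|exact: cw].
have cDG : continuous DG.
  move=> y; apply: (@continuousD _ _ _ (fun y => D2 y * wave k th y) (fun y => fr k i ^+ 2 * (psi y * wave k th y))).
    exact: c2w.
  by apply: (@continuousM _ _ (cst (fr k i ^+ 2)) (fun y => psi y * wave k th y)); [exact: cst_continuous|exact: cpw].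
have pG : Defs.periodic G.
  move=> y j; rewrite /G ppsi !periodic_wave.
  by rewrite /D1 (periodic_partial i ppsi y j).
have := @torus_integral_derive R d G i cG (fun y => @ex_derive _ _ _ _ _ _ _ (dG y)).
rewrite EDG => /(_ cDG pG) H.
have e1 : mu.-integrable setT (EFin \o (fun x => D2 (row_of x) * cos (phase k x + th))).
  have := integrable_continuous_row c2w.
  by congr (_.-integrable _ _); apply/funext => x /=; rewrite wave_row.
have e2 : mu.-integrable setT (EFin \o (fun x => psi (row_of x) * cos (phase k x + th))).
  have := integrable_continuous_row cpw.
  by congr (_.-integrable _ _); apply/funext => x /=; rewrite wave_row.
have e2' : mu.-integrable setT (EFin \o (fun x => fr k i ^+ 2 * (psi (row_of x) * cos (phase k x + th)))).
  by apply: integrable_scale => //; exact: e2.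
have {}H : \int[mu]_x (D2 (row_of x) * cos (phase k x + th)) +
    fr k i ^+ 2 * \int[mu]_x (psi (row_of x) * cos (phase k x + th)) = 0.
  rewrite -(RintegralZl _ _ e2)// -(RintegralD _ e1 e2')// -[RHS]H.
  by apply: eq_Rintegral => x _; have [_ ->] := dG (row_of x); rewrite /DG wave_row.
by apply/eqP; rewrite mulNr -addr_eq0; apply/eqP.
Qed.

Lemma modeE (z : R[i]) k x :
  mode z k x = complex.Re z * cos (phase k x + 0) + complex.Im z * cos (phase k x + pi / 2).
Proof. by rewrite /mode addr0 cosDpihalf mulrN. Qed.

Lemma integral_mul_mode g (z : R[i]) k : mu.-integrable setT (EFin \o g) ->
  \int[mu]_x (g x * mode z k x) = complex.Re z * \int[mu]_x (g x * cos (phase k x + 0)) +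
    complex.Im z * \int[mu]_x (g x * cos (phase k x + pi / 2)).
Proof.
move=> gi; have h1 := integrable_mul_cos_phase k 0 gi; have h2 := integrable_mul_cos_phase k (pi / 2) gi.
rewrite -(RintegralZl _ _ h1)// -(RintegralZl _ _ h2)// -RintegralD//.
- by apply: eq_Rintegral => x _; rewrite modeE; ring.
- by apply: integrable_scale => //; exact: h1.
- by apply: integrable_scale => //; exact: h2.
Qed.

Lemma is_weak_deriv_wser (b g : K -> R[i]) i : csummable b -> csummable g ->
  (forall k, g k = Complex (- fr k i ^+ 2) 0 * b k) ->
  is_weak_deriv [:: i; i] (wser b) (wser g).
Proof.
move=> bs gs gb; split; [exact: Lfun_wser|exact: Lfun_wser|].
move=> psi spsi ppsi; rewrite sqrrN expr1n mul1r.
have [c0 _] := spsi [::]; have [c2 _] := spsi [:: i; i].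
have i0 := integrable_continuous_row c0; have i2 := integrable_continuous_row c2.
have h0 := @cvg_integral_wser R d g _ gs i0; have h2 := @cvg_integral_wser R d b _ bs i2.
under eq_Rintegral do rewrite mulrC; under [RHS]eq_Rintegral do rewrite mulrC.
apply: (rcvg_unique h2).
rewrite (_ : (fun k => \int[mu]_x (_ * mode (b k) k x)) =
   (fun k => \int[mu]_x (psi (row_of x) * mode (g k) k x))); first exact: h0.
apply/funext => k; rewrite !integral_mul_mode// !integral_partials_wave//.
by rewrite gb ReM ImM/=; ring.
Qed.

Lemma integrable_Lfun1 f : f \in Lfun mu 1%E -> mu.-integrable setT (EFin \o f).
Proof. by move/Lfun1_integrable. Qed.

(** Waves are smooth and periodic, hence test functions, so two weak derivatives have the same
    Fourier coefficients. *)
Lemma weak_deriv_unique l f g g' : is_weak_deriv l f g -> is_weak_deriv l f g' ->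
  {ae mu, forall x, g x = g' x}.
Proof.
move=> [_ /integrable_Lfun1 gi H] [_ /integrable_Lfun1 gi' H'].
have di : mu.-integrable setT (EFin \o (fun x => g x - g' x)) by exact: integrable_sub.
have := fourier_uniqueness di _.
have s0 : ((-1) ^+ size l : R) != 0 by rewrite signr_eq0.
move=> U; have {}U : {ae mu, forall x, g x - g' x = 0}.
  apply: U => k th.
  have e1 := H _ (@smooth_wave R d k th) (@periodic_wave R d k th).
  have e2 := H' _ (@smooth_wave R d k th) (@periodic_wave R d k th).
  have E : \int[mu]_x (g x * wave k th (row_of x)) = \int[mu]_x (g' x * wave k th (row_of x)).
    by apply: (mulfI s0); rewrite -e1 -e2.
  transitivity (\int[mu]_x (g x * cos (phase k x + th)) - \int[mu]_x (g' x * cos (phase k x + th))).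
    rewrite -RintegralB//; try exact: integrable_mul_cos_phase.
    by apply: eq_Rintegral => x _; rewrite mulrBl.
  apply/eqP; rewrite subr_eq0; apply/eqP.
  under eq_Rintegral do rewrite -wave_row; rewrite E.
  by apply: eq_Rintegral => x _; rewrite wave_row.
by apply: filterS U => x /eqP; rewrite subr_eq0 => /eqP.
Qed.

Lemma weak_derivP l f : has_weak_deriv l f -> is_weak_deriv l f (weak_deriv l f).
Proof. by move=> [g fg]; rewrite /weak_deriv; case: xgetP => // H; have := H g. Qed.

Lemma is_weak_deriv_ae l f f' g : f' \in Lfun mu 1%E ->
  {ae mu, forall x, f x = f' x} -> is_weak_deriv l f g -> is_weak_deriv l f' g.
Proof.
move=> f'1 ff' [f1 g1 H]; split => // psi spsi ppsi; rewrite -H//.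
have [c _] := spsi l; have fi := integrable_Lfun1 f1; have fi' := integrable_Lfun1 f'1.
have m h : mu.-integrable setT (EFin \o h) ->
    measurable_fun setT (EFin \o (fun x => h x * partials l psi (row_of x))).
  move=> hi; apply/measurable_EFinP; apply: measurable_funM; last exact: measurable_continuous_row.
  by apply/measurable_EFinP; exact: measurable_int hi.
rewrite /Rintegral; congr fine; apply: ae_eq_integral => //; [exact: m|exact: m|].
by apply: filterS ff' => x /= -> .
Qed.

Lemma csummableD c c' : csummable c -> csummable c' -> csummable (fun k => c k + c' k).
Proof.
move=> cs cs'; have := csummableB cs (csummableN cs').
by congr csummable; apply/funext => k; rewrite opprK.
Qed.

Lemma wserD c c' x : csummable c -> csummable c' ->
  wser (fun k => c k + c' k) x = wser c x + wser c' x.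
Proof.
move=> cs cs'; rewrite -[X in _ + X]opprK -(wserN x cs') -(wserB x cs (csummableN cs')).
by congr (wser _ x); apply/funext => k; rewrite opprK.
Qed.

Lemma csummable0 : csummable (fun _ : K => 0 : R[i]).
Proof. by rewrite /csummable /asum esum1// => k _; rewrite /cabs Normc.normc0. Qed.

Lemma wser0 x : wser (fun _ : K => 0 : R[i]) x = 0.
Proof.
have := @wserB R d (fun _ => 0) (fun _ => 0) x csummable0 csummable0.
by rewrite (_ : (fun k => 0 - 0) = (fun _ => 0 : R[i])) ?subrr//; apply/funext => k; rewrite subrr.
Qed.

Lemma wser_sum (J : Type) (s : seq J) (g : J -> K -> R[i]) x : (forall j, csummable (g j)) ->
  csummable (fun k => \sum_(j <- s) g j k) /\
  wser (fun k => \sum_(j <- s) g j k) x = \sum_(j <- s) wser (g j) x.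
Proof.
move=> gs; elim: s => [|j s [IHs IHe]].
  rewrite big_nil (_ : (fun k => _) = (fun _ => 0)); last by apply/funext => k; rewrite big_nil.
  by split; [exact: csummable0|exact: wser0].
rewrite big_cons -IHe (_ : (fun k => _) = (fun k => g j k + \sum_(j <- s) g j k)); last first.
  by apply/funext => k; rewrite big_cons.
by split; [exact: csummableD|exact: wserD].
Qed.

Lemma sqr_fr_le k i : fr k i ^+ 2 <= q k ^+ 2.
Proof.
rewrite sqr_freq_norm (bigD1 i)//= lerDl; apply: sumr_ge0 => j _; exact: sqr_ge0.
Qed.

(** The second derivative in direction i multiplies coefficients by - k_i^2. As k_i^2 <= |k|^2, its
    series is summable as soon as that of c is. *)
Lemma laplacian_wser (b c : K -> R[i]) f : f \in Lfun mu 1%E -> csummable b -> csummable c ->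
  (forall k, c k = Complex (q k ^+ 2) 0 * b k) -> {ae mu, forall x, f x = wser b x} ->
  has_laplacian f /\ {ae mu, forall x, laplacian f x = - wser c x}.
Proof.
move=> f1 bs cs cb fb.
pose g i k := Complex (- fr k i ^+ 2) 0 * b k.
have gs i : csummable (g i).
  apply: (csummable_le (A := fun k => (cabs c k)%:E)) cs => k.
  rewrite lee_fin /cabs cb /g !Normc.normcM !normc_real normrN ler_wpM2r ?normc_ge0//.
  by rewrite !ger0_norm ?sqr_ge0// sqr_fr_le.
have W i : is_weak_deriv [:: i; i] f (wser (g i)).
  apply: (is_weak_deriv_ae f1 _ (is_weak_deriv_wser bs (gs i) _)) => //.
  by apply: filterS fb => x ->.
have hw i : has_weak_deriv [:: i; i] f by exists (wser (g i)).
split=> //.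
have H : {ae mu, forall x, forall i, weak_deriv [:: i; i] f x = wser (g i) x}.
  by apply: ae_forall_count => i; exact: weak_deriv_unique (weak_derivP (hw i)) (W i).
apply: filterS H => x Hx; rewrite /laplacian.
transitivity (\sum_(i < d) wser (g i) x); first by apply: eq_bigr => i _; exact: Hx.
have [ss <-] := wser_sum (index_enum 'I_d) x gs; rewrite -(wserN x cs); congr (wser _ x).
apply/funext => k; rewrite cb; apply: complex_ext.
  rewrite ReN ReM/= mul0r subr0 sqr_freq_norm -mulNr -sumrN mulr_suml.
  elim/big_rec2: _ => // i y z _ <-; by rewrite ReD /g ReM/= mul0r subr0.
rewrite ImN ImM/= mul0r addr0 sqr_freq_norm -mulNr -sumrN mulr_suml.
by elim/big_rec2: _ => // i y z _ <-; rewrite ImD /g ImM/= mul0r addr0.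
Qed.

Lemma integral_bilaplacian_wave f k th :
  (forall l : seq 'I_d, (size l <= 4)%N -> has_weak_deriv l f) ->
  \int[mu]_x (bilaplacian f x * cos (phase k x + th)) =
  q k ^+ 4 * \int[mu]_x (f x * cos (phase k x + th)).
Proof.
move=> hf; have W i j := weak_derivP (hf [:: i; i; j; j] isT).
have wi i j : mu.-integrable setT (EFin \o weak_deriv [:: i; i; j; j] f).
  by have [_ /integrable_Lfun1] := W i j.
have E i j : \int[mu]_x (weak_deriv [:: i; i; j; j] f x * cos (phase k x + th)) =
    (fr k i ^+ 2 * fr k j ^+ 2) * \int[mu]_x (f x * cos (phase k x + th)).
  have [f1 _ H] := W i j; have fi := integrable_Lfun1 f1.
  have := H _ (@smooth_wave R d k th) (@periodic_wave R d k th).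
  rewrite (_ : (-1) ^+ size [:: i; i; j; j] = 1 :> R) ?mul1r => [h|]; last by rewrite /= -signr_odd expr0.
  transitivity (\int[mu]_x (weak_deriv [:: i; i; j; j] f x * wave k th (row_of x))).
    by apply: eq_Rintegral => x _; rewrite wave_row.
  rewrite -h -(RintegralZl _ _ (integrable_mul_cos_phase k th fi))//.
  apply: eq_Rintegral => x _.
  have := partials_wave [:: i; i; j; j] k th 1.
  rewrite (_ : (fun y => 1 * wave k th y) = wave k th); last by apply/funext => y; rewrite mul1r.
  move=> ->; rewrite wave_row !big_cons big_nil/= addrA.
  rewrite (_ : 4%:R * (pi / 2) = pi + pi); last by field.
  by rewrite addrA !cosDpi opprK; ring.
transitivity (\int[mu]_x (\sum_(i < d) \sum_(j < d) (weak_deriv [:: i; i; j; j] f x * cos (phase k x + th)))).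
  apply: eq_Rintegral => x _; rewrite /bilaplacian mulr_suml; apply: eq_bigr => i _.
  by rewrite mulr_suml.
rewrite Rintegral_bigsum//; last first.
  by move=> i; apply: integrable_bigsum => // j; exact: integrable_mul_cos_phase.
under eq_bigr => i _.
  rewrite Rintegral_bigsum//; last by move=> j; exact: integrable_mul_cos_phase.
  under eq_bigr do rewrite E -mulrA.
  rewrite -mulr_sumr -mulr_suml -sqr_freq_norm mulrA.
over.
by rewrite -mulr_suml -mulr_suml -sqr_freq_norm -exprD.
Qed.

Lemma integrable_bilaplacian f :
  (forall l : seq 'I_d, (size l <= 4)%N -> has_weak_deriv l f) ->
  mu.-integrable setT (EFin \o bilaplacian f).
Proof.
move=> hf; have W i j := weak_derivP (hf [:: i; i; j; j] isT).
apply: integrable_bigsum => // i; apply: integrable_bigsum => // j.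
by have [_ /integrable_Lfun1] := W i j.
Qed.

End weak_laplacian.

(** * Integrals of functions not known to be measurable *)

Section nonmeasurable_integrals.
Local Open Scope ereal_scope.
Variables (dd : measure_display) (T : measurableType dd) (R : realType).
Variable nu : {measure set T -> \bar R}.
Implicit Types (D : set T) (f g : T -> \bar R).

(* No measurability is assumed: the integral of a nonnegative function is the
   supremum of the integrals of the simple functions below it. *)
Lemma ge0_le_integral_nonmeas D f g : (forall x, D x -> 0 <= f x) ->
  (forall x, D x -> f x <= g x) -> \int[nu]_(x in D) f x <= \int[nu]_(x in D) g x.
Proof.
move=> f0 fg; have g0 x : D x -> 0 <= g x by move=> Dx; exact: le_trans (f0 x Dx) (fg x Dx).
rewrite (ge0_integralE nu f0) (ge0_integralE nu g0); apply: ereal_sup_le => _ [h /= hf <-].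
exists h => //= x; apply: le_trans (hf x) _.
by rewrite /patch; case: ifPn => // /set_mem; exact: fg.
Qed.

Lemma measurable_mem D (N : set T) : measurable D -> measurable N ->
  measurable_fun D (fun x => x \in N).
Proof.
move=> mD mN; apply: (measurable_fun_bool true).
rewrite (_ : _ `&` _ = D `&` N); first exact: measurableI.
by apply/seteqP; split => x /= [Dx xN]; split => //; [exact/set_mem|exact/mem_set].
Qed.

(** Raising g to +oo on the exceptional null set makes the inequality hold everywhere and preserves
    both the measurability and the integral of g. *)
Lemma ge0_ae_le_integral_nonmeas D f g : measurable D -> (forall x, D x -> 0 <= f x) ->
  (forall x, D x -> 0 <= g x) -> measurable_fun D g ->
  {ae nu, forall x, D x -> f x <= g x} -> \int[nu]_(x in D) f x <= \int[nu]_(x in D) g x.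
Proof.
move=> mD f0 g0 mg [N [mN N0 fgN]].
pose h x := if x \in N then +oo else g x.
have mh : measurable_fun D h.
  apply: measurable_fun_if => //; first exact: measurable_mem.
  by apply: measurable_funS mg => // x [].
apply: (@le_trans _ _ (\int[nu]_(x in D) h x)).
  apply: ge0_le_integral_nonmeas => // x Dx; rewrite /h; case: ifPn => [_|/negP xN]; first by rewrite leey.
  by apply: contrapT => fg; apply: xN; apply: mem_set; apply: fgN => H; apply: fg; exact: H.
suff -> : \int[nu]_(x in D) h x = \int[nu]_(x in D) g x by [].
apply: ae_eq_integral => //; exists N; split => // x /= hx; apply: contrapT => xN; apply: hx => Dx.
by rewrite /h memNset.
Qed.

Lemma ge0_ae_eq_integral_nonmeas D f g : measurable D -> (forall x, D x -> 0 <= f x) ->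
  (forall x, D x -> 0 <= g x) -> measurable_fun D g ->
  {ae nu, forall x, D x -> f x = g x} -> \int[nu]_(x in D) f x = \int[nu]_(x in D) g x.
Proof.
move=> mD f0 g0 mg fg; apply/eqP; rewrite eq_le; apply/andP; split.
  by apply: ge0_ae_le_integral_nonmeas => //; apply: filterS fg => x H Dx; rewrite H.
have [N [mN N0 fgN]] := fg.
pose h x := if x \in N then 0 else g x.
have mh : measurable_fun D h.
  apply: measurable_fun_if => //; first exact: measurable_mem.
  by apply: measurable_funS mg => // x [].
have -> : \int[nu]_(x in D) g x = \int[nu]_(x in D) h x; last first.
  apply: ge0_le_integral_nonmeas => x Dx; rewrite /h; case: ifPn => [_|/negP xN]//; try exact: g0; try exact: f0.
  suff -> : f x = g x by [].
  by apply: contrapT => fg'; apply: xN; apply: mem_set; apply: fgN => H; apply: fg'; exact: H.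
apply: ae_eq_integral => //; exists N; split => // x /= hx; apply: contrapT => xN; apply: hx => Dx.
by rewrite /h memNset.
Qed.

(** Used to trade integrands built from arbitrary representatives for measurable ones that agree
    with them almost everywhere. *)
Lemma ae_eq_integral_nonmeas D f g : measurable D -> measurable_fun D g ->
  {ae nu, forall x, D x -> f x = g x} -> \int[nu]_(x in D) f x = \int[nu]_(x in D) g x.
Proof.
move=> mD mg fg; rewrite integralE [RHS]integralE; congr (_ - _); apply: ge0_ae_eq_integral_nonmeas => //.
- exact: measurable_funepos.
- by apply: filterS fg => x H Dx; rewrite !funeposE H.
- exact: measurable_funeneg.
- by apply: filterS fg => x H Dx; rewrite !funenegE H.
Qed.

End nonmeasurable_integrals.

(** * Strong measurability of continuous curves *)

Section bochner_tools.
Variables (R : realType) (d : nat).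
Local Notation mu := (torus_measure R d).
Local Notation leb := (@lebesgue_measure R).
Implicit Types (T : R) (E : funSpace R d) (f : R -> d.-tuple R -> R).

Lemma cvge0 (X : Type) (F : set_system X) {FF : Filter F} (h : X -> \bar R) :
  (forall e : R, 0 < e -> \forall t \near F, (0 <= h t <= e%:E)%E) ->
  h t @[t --> F] --> 0%E.
Proof.
move=> H; apply/fine_cvgP; split.
  apply: filterS (H 1 ltr01) => t /andP[h0 h1].
  by rewrite ge0_fin_numE//; exact: le_lt_trans h1 (ltry _).
apply/cvgrPdist_le => e e0; apply: filterS (H e e0) => t /andP[h0 h1].
rewrite sub0r normrN ger0_norm ?fine_ge0// -lee_fin fineK//.
by rewrite ge0_fin_numE//; exact: le_lt_trans h1 (ltry _).
Qed.

Lemma cvge0_near (X : Type) (F : set_system X) {FF : Filter F} (h : X -> \bar R) (e : R) :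
  h t @[t --> F] --> 0%E -> 0 < e -> \forall t \near F, (h t <= e%:E)%E.
Proof.
move=> /fine_cvgP[fh /cvgrPdist_le H] e0; apply: filterS2 fh (H e e0) => t ft.
rewrite sub0r normrN => ht; rewrite -(fineK ft) lee_fin; apply: le_trans ht; exact: ler_norm.
Qed.

Lemma grid_index (T t : R) n : 0 < t -> t <= T ->
  exists m : nat, [/\ (m < n.+1)%N, T * m%:R / n.+1%:R < t & t <= T * m.+1%:R / n.+1%:R].
Proof.
move=> t0 tT; have n0 : (0 : R) < n.+1%:R by rewrite ltr0n.
have ex : exists m : nat, t <= T * m.+1%:R / n.+1%:R by exists n; rewrite mulfK ?gt_eqF.
exists (ex_minn ex); case: ex_minnP => m tm mmin; split => //.
  by apply: mmin; rewrite mulfK ?gt_eqF.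
case: m tm mmin => [|m] tm mmin; first by rewrite mulr0 mul0r.
by rewrite ltNge; apply/negP => h; have := mmin m h; rewrite ltnn.
Qed.

(** Each cell takes the value of f at its right endpoint, which is positive: the curve in H^4 is
    controlled at positive times only. *)
Definition grid_simple T f n : simple R d :=
  @Simple R d n.+1 (fun j : 'I_n.+1 => `]T * j%:R / n.+1%:R, T * j.+1%:R / n.+1%:R]%classic)
    (fun j => f (T * j.+1%:R / n.+1%:R)).

Lemma grid_simpleE T f n t : 0 < t -> t <= T ->
  exists s, [/\ t <= s, s <= t + T / n.+1%:R & simple_fun (grid_simple T f n) t = f s].
Proof.
move=> t0 tT; have T0 : 0 < T by exact: lt_le_trans tT.
have n0 : (0 : R) < n.+1%:R by rewrite ltr0n.
have [m [mn mt tm]] := grid_index n t0 tT.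
exists (T * m.+1%:R / n.+1%:R); split => //.
  rewrite -natr1 mulrDr mulr1 mulrDl lerD2r; exact: ltW.
apply/funext => x; rewrite /simple_fun/= (bigD1 (Ordinal mn))//= big1 ?addr0.
  by rewrite indicE mem_set ?mul1r//= in_itv/= mt tm.
move=> j jm; rewrite indicE memNset ?mul0r//= in_itv/= => /andP[jt tj].
move/eqP: jm; apply; apply/val_inj => /=; apply/eqP; rewrite eqn_leq; apply/andP; split.
  have : T * j%:R / n.+1%:R < T * m.+1%:R / n.+1%:R by exact: lt_le_trans tm.
  by rewrite ltr_pM2r ?invr_gt0// ltr_pM2l// ltr_nat ltnS.
have : T * m%:R / n.+1%:R < T * j.+1%:R / n.+1%:R by exact: lt_le_trans tj.
by rewrite ltr_pM2r ?invr_gt0// ltr_pM2l// ltr_nat ltnS.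
Qed.

Lemma ae_neq0 : {ae leb, forall t : R, t != 0}.
Proof.
exists [set 0]; split; [exact: measurable_set1|exact: lebesgue_measure_set1|].
by move=> t /= H; apply: contrapT => t0; apply: H; apply/eqP.
Qed.

Lemma strongly_measurable_grid T E f : 0 < T ->
  (forall t : R, 0 < t -> carrier E (f t)) ->
  (forall t : R, 0 < t -> fnorm E (f t \- f s) @[s --> t] --> 0%E) ->
  (forall t s : R, 0 < t -> 0 < s -> (0 <= fnorm E (f t \- f s)%R)%E) ->
  strongly_measurable T E f.
Proof.
move=> T0 cf nf n0; exists (grid_simple T f); split.
- move=> n j; split; first exact: measurable_itv.
  apply: cf; apply: divr_gt0; last by rewrite ltr0n.
  by apply: mulr_gt0 => //; rewrite ltr0n.
- apply: (@filterS _ _ (ae_filter_ringOfSetsType leb) _ _ _ ae_neq0) => t tn0.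
  by rewrite /= in_itv/= => /andP[t0 _]; apply: cf; rewrite lt_neqAle eq_sym tn0.
- have H (t : R) : 0 < t -> t <= T ->
      fnorm E (f t \- simple_fun (grid_simple T f n) t) @[n --> \oo] --> 0%E.
    move=> t0 tT; apply: cvge0 => e e0.
    have near_t : \forall s \near t, (fnorm E (f t \- f s)%R <= e%:E)%E.
      exact: (cvge0_near (nf t t0) e0).
    move/nbhs_ballP : near_t => [r /= r0 Hr].
    have [N _ HN] := near_infty_natSinv_lt (PosNum (divr_gt0 r0 T0)).
    exists N => // n /= Nn; have [s [ts st ->]] := grid_simpleE f n t0 tT.
    rewrite n0//=; last exact: lt_le_trans ts.
    apply: Hr; rewrite /ball/= distrC ger0_norm ?subr_ge0//.
    apply: (@le_lt_trans _ _ (T / n.+1%:R)); first by rewrite lerBlDl.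
    by have := HN n Nn; rewrite /= ltr_pdivlMr// mulrC.
  apply: (@filterS _ _ (ae_filter_ringOfSetsType leb) _ _ _ ae_neq0) => t tn0.
  by rewrite /= in_itv/= => /andP[t0 tT]; apply: H => //; rewrite lt_neqAle eq_sym tn0.
Qed.

End bochner_tools.

Section half_power.
Variable R : realType.

Lemma poweR_half_le (x : \bar R) (e : R) : (0 <= x)%E -> 0 <= e -> (x <= (e ^+ 2)%:E)%E ->
  (poweR x 2^-1 <= e%:E)%E.
Proof.
move=> x0 e0 xe; rewrite poweR12_sqrt//; case: x x0 xe => [x||]//=.
  rewrite !lee_fin => x0 xe; rewrite -(ger0_norm e0) -sqrtr_sqr.
  by rewrite ler_wsqrtr.
Qed.

Lemma poweR_half_lty (x : \bar R) : (x < +oo)%E -> (poweR x 2^-1 < +oo)%E.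
Proof.
case: x => [x _|//|_]; first by rewrite poweR_EFin ltry.
by rewrite /= ?ltry//; case: ifP => _; rewrite ltry.
Qed.

Lemma poweR_half_sqr (x : \bar R) : (0 <= x)%E -> poweR (poweR x 2^-1) 2 = x.
Proof. by move=> x0; rewrite -poweRrM mulVf// poweRe1. Qed.

End half_power.

(** * Regularity of the solution *)

Section regularity.
Variables (R : realType) (d : nat).
Local Notation mu := (torus_measure R d).
Local Notation K := (d.-tuple int).
Local Notation q := (@freq_norm R d).
Local Notation leb := (@lebesgue_measure R).
Implicit Types (k : K) (t s T : R) (z : K -> R[i]).

(* The mean-zero solution of - Laplacian w = wser z; in mode 0 the factor is 0^-1 = 0. *)
Definition pot z : K -> R[i] := fun k => Complex ((q k ^+ 2)^-1) 0 * z k.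

Lemma cabs_pot_le z k : cabs (pot z) k <= cabs z k.
Proof.
rewrite /cabs Normc.normcM normc_real ler_piMl ?normc_ge0//.
have [->|k0] := eqVneq k 0; first by rewrite freq_norm0 expr0n/= invr0 normr0.
have q1 := freq_norm_ge1 R k0.
by rewrite ger0_norm ?invr_ge0 ?sqr_ge0// invf_le1 ?exprn_gt0 ?(lt_le_trans ltr01)// exprn_ege1.
Qed.

Lemma csummable_pot z : csummable z -> csummable (pot z).
Proof. by apply: csummable_le => k; rewrite lee_fin; exact: cabs_pot_le. Qed.

Lemma hermitian_pot z : hermitian z -> hermitian (pot z).
Proof.
move=> zh k; rewrite /pot freq_normN zh.
by apply: complex_ext; rewrite ?ReM ?ImM/= ?ReM ?ImM/= ; ring.
Qed.

Lemma pot_mulK z k : z 0 = 0 -> z k = Complex (q k ^+ 2) 0 * pot z k.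
Proof.
move=> z0; have [->|k0] := eqVneq k 0; first by rewrite /pot z0 !mulr0.
have q1 := freq_norm_ge1 R k0; have qn : q k ^+ 2 != 0 by rewrite expf_eq0/= gt_eqF// (lt_le_trans ltr01).
by apply: complex_ext; rewrite /pot !(ReM, ImM)/= !(mul0r, subr0, addr0) mulrA divff// mul1r.
Qed.

Lemma potB z z' : pot (fun k => z k - z' k) = (fun k => pot z k - pot z' k).
Proof. by apply/funext => k; rewrite /pot mulrBr. Qed.

Lemma sqr_cabs_pot z k (m : nat) : z 0 = 0 -> (0 < m)%N ->
  q k ^+ (m + 4) * cabs (pot z) k ^+ 2 = q k ^+ m * cabs z k ^+ 2.
Proof.
move=> z0 m0; rewrite exprD -mulrA; congr (_ * _).
rewrite [in RHS]/cabs (pot_mulK k z0) Normc.normcM normc_real exprMn -/(cabs _ _).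
by rewrite ger0_norm ?sqr_ge0// -exprM.
Qed.

Lemma sobolev2_pot z : z 0 = 0 -> csummable z -> hermitian z ->
  sobolevH_norm 2 (wser (pot z)) = poweR (asum (fun k => cabs z k ^+ 2)) 2^-1.
Proof.
move=> z0 zs zh; rewrite /sobolevH_norm; congr (poweR _ _); apply: eq_esum => k _.
rewrite fourier_wser; [|exact: csummable_pot|exact: hermitian_pot].
rewrite (_ : 2 * 2 = 4%:R); last by rewrite -natrM.
rewrite powR_mulrn ?freq_norm_ge0//; congr (_%:E).
have -> : cabs z k = q k ^+ 2 * Normc.normc (pot z k).
  by rewrite /cabs {1}(pot_mulK k z0) Normc.normcM normc_real ger0_norm ?sqr_ge0.
by rewrite exprMn -exprM.
Qed.

Lemma sobolev4_pot z : z 0 = 0 -> csummable z -> hermitian z ->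
  sobolevH_norm 4 (wser (pot z)) = poweR (asum (fun k => q k ^+ 4 * cabs z k ^+ 2)) 2^-1.
Proof.
move=> z0 zs zh; rewrite /sobolevH_norm; congr (poweR _ _); apply: eq_esum => k _.
rewrite fourier_wser; [|exact: csummable_pot|exact: hermitian_pot].
rewrite (_ : 2 * 4 = 8%:R); last by rewrite -natrM.
by rewrite powR_mulrn ?freq_norm_ge0// -(sqr_cabs_pot k z0 (m := 4)).
Qed.

Variables (c : R -> K -> R[i]) (M : K -> R).
Variables (creg : regular c) (Mm : majorant M) (cM : below c M) (cz : forall t, c t 0 = 0).

Definition sol t : d.-tuple R -> R := wser (pot (c t)).

Let ch t : hermitian (c t). Proof. by have [H _ _ _] := creg. Qed.
Let cs t : csummable (c t). Proof. exact: below_csummable Mm cM. Qed.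
Let dz t s : c t 0 - c s 0 = 0. Proof. by rewrite !cz subrr. Qed.
Let ds t s : csummable (fun k => c t k - c s k). Proof. exact: csummableB. Qed.
Let dh t s : hermitian (fun k => c t k - c s k). Proof. exact: hermitianB. Qed.

Lemma solB t s : sol t \- sol s = wser (pot (fun k => c t k - c s k)).
Proof.
by apply/funext => x; rewrite potB wserB//; exact: csummable_pot.
Qed.

Lemma cabs_diff_le t s k : cabs (fun k => c t k - c s k) k <= 2 * M k.
Proof.
rewrite mulr_natl mulr2n; apply: le_trans (normcB_le _ _) _.
by apply: lerD; exact: (below_le _ _ Mm cM).
Qed.

Lemma cabs_diff_le1 t s k : cabs (fun k => c t k - c s k) k <= 1.
Proof. by apply: le_trans (cabs_diff_le t s k) _; have := majorant_le5 k Mm; lra. Qed.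

Lemma sqr_le_id (x : R) : 0 <= x <= 1 -> x ^+ 2 <= x.
Proof. by move=> /andP[x0 x1]; rewrite expr2 ler_piMl. Qed.

Lemma diff_near t (e : R) : 0 < e ->
  \forall s \near t, (asum (cabs (fun k => c s k - c t k)%R) <= e%:E)%E.
Proof. by move=> e0; exact: (cvge0_near (@regular_diff_cvg0 _ _ c M t creg Mm cM) e0). Qed.

Lemma sol_sobolev2_cvg t : sobolevH_norm 2 (sol s \- sol t) @[s --> t] --> 0%E.
Proof.
apply: cvge0 => e e0; have e20 : 0 < e ^+ 2 by rewrite exprn_gt0.
have := diff_near t e20; apply: filterS => s H; rewrite solB sobolev2_pot//.
rewrite poweR_ge0/=; apply: poweR_half_le; first by apply: asum_ge0 => k; exact: sqr_ge0.
  exact: ltW.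
apply: le_trans H; apply: le_asum => k; apply: sqr_le_id.
by rewrite cabs_ge0 cabs_diff_le1.
Qed.

Lemma asum_sqr_lty t : (asum (fun k => cabs (c t) k ^+ 2)%R < +oo)%E.
Proof.
apply: le_lt_trans (cs t); apply: le_asum => k; apply: sqr_le_id; rewrite cabs_ge0/=.
by apply: le_trans (below_le t k Mm cM) _; have := majorant_le5 k Mm; lra.
Qed.

Lemma sol_bochner_C T : bochner_C T (spaceH d 2) sol.
Proof.
move=> t _; split.
  split; first by apply: Lfun_wser; [rewrite lee_fin ler1n|exact: csummable_pot].
  rewrite sobolev2_pot//; apply: poweR_half_lty; exact: asum_sqr_lty.
apply: cvg_trans (@sol_sobolev2_cvg t); apply: cvg_app; exact: cvg_within.
Qed.

Lemma weight_antitone (tau t : R) k : 0 <= tau -> tau <= t -> weight t k <= weight tau k :> R.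
Proof.
move=> tau0 tt; rewrite /weight ler_expR lerN2; apply: ler_wpM2l; first exact/ltW/eps_gt0.
by apply: ler_wpM2l; [exact: freq_norm_ge0|apply: ler_wsqrtr; exact: ler_wsqrtr].
Qed.

Lemma lam_weight_le (tau : R) k : 0 < tau -> q k ^+ 4 * weight tau k <= weight_const R / tau.
Proof.
move=> tau0; have W0 := weight_const_gt0 R; have l0 := lam_ge0 R k; set lam := q k ^+ 4 in l0 *.
apply: (@le_trans _ _ (lam * (weight_const R * (1 + lam * tau) ^- 2))).
  by apply: ler_wpM2l => //; apply: weight_le_rational; exact: ltW.
have p0 : 0 < (1 + lam * tau) ^+ 2 by rewrite exprn_gt0// ltr_wpDr// mulr_ge0// ltW.
rewrite mulrCA ler_pM2l// ler_pdivrMr// mulrC ler_pdivlMr//.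
have := mulr_ge0 l0 (ltW tau0); move: (lam * tau) => y y0; nra.
Qed.

(** Near t > 0 all times exceed t / 2, and the weight decreases in time, so |k|^4 |c_k(s)| is at
    most a constant multiple of M_k uniformly in s. Squares are removed by |c_k(t) - c_k(s)| <=
    1. *)
Lemma sol_sobolev4_cvg t : 0 < t -> sobolevH_norm 4 (sol t \- sol s) @[s --> t] --> 0%E.
Proof.
move=> t0; have [M0 M5] := Mm; pose tau := t / 2.
have tau0 : 0 < tau by rewrite divr_gt0.
have C0 : 0 <= 2 * (weight_const R / tau).
  by apply: mulr_ge0 => //; apply: divr_ge0; apply: ltW => //; exact: weight_const_gt0.
have H : asum (fun k => q k ^+ 4 * cabs (fun k => c t k - c s k) k ^+ 2) @[s --> t] --> 0%E.
  apply: (@asum_dominated_cvg0 _ _ _ _ _ (fun s k => q k ^+ 4 * cabs (fun k => c t k - c s k) k ^+ 2)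
     (fun k => 2 * (weight_const R / tau) * M k)).
  - by move=> k; apply: mulr_ge0.
  - by rewrite asumZ//; apply: lte_mul_pinfty => //; exact: le_lt_trans M5 (ltry _).
  - have nt : \forall s \near t, tau < s by apply: lt_nbhsr; rewrite /tau; lra.
    apply: filterS nt => s ts k; rewrite mulr_ge0 ?lam_ge0 ?sqr_ge0//=.
    apply: (@le_trans _ _ (q k ^+ 4 * (2 * (M k * weight tau k)))).
      apply: ler_wpM2l; first exact: lam_ge0.
      apply: le_trans (sqr_le_id _) _; first by rewrite cabs_ge0 cabs_diff_le1.
      rewrite [leRHS]mulr_natl mulr2n; apply: le_trans (normcB_le _ _) _; apply: lerD.
        apply: le_trans (cM t k) _; apply: ler_wpM2l => //; apply: weight_antitone; first exact: ltW.
        by rewrite /tau; lra.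
      apply: le_trans (cM s k) _; apply: ler_wpM2l => //; apply: weight_antitone; exact: ltW.
    have := lam_weight_le k tau0; move: (q k ^+ 4) (weight tau k) (weight_const R / tau) (M0 k) => l w W m h.
    by rewrite (_ : l * (2 * (M k * w)) = 2 * (l * w) * M k) ?ler_wpM2r ?ler_wpM2l//; ring.
  - move=> k; have [_ _ cR cI] := creg.
    have h : cabs (fun k => c t k - c s k) k @[s --> t] --> 0.
      rewrite -(@Normc.normc0 R); apply: cvg_normc.
        rewrite -[complex.Re 0](subrr (complex.Re (c t k))).
        by under eq_fun do rewrite ReD ReN; apply: cvgB; [exact: cvg_cst|exact: cR].
      rewrite -[complex.Im 0](subrr (complex.Im (c t k))).
      by under eq_fun do rewrite ImD ImN; apply: cvgB; [exact: cvg_cst|exact: cI].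
    have h2 := cvgM h h; rewrite mulr0 in h2.
    by rewrite -[X in _ --> X](mulr0 (q k ^+ 4)); apply: cvgMr; exact: h2.
apply: cvge0 => e e0; have e20 : 0 < e ^+ 2 by rewrite exprn_gt0.
have Hn : \forall s \near t, (asum (fun k => q k ^+ 4 * cabs (fun k => c t k - c s k)%R k ^+ 2)%R <= (e ^+ 2)%:E)%E.
  exact: (cvge0_near H e20).
apply: filterS Hn => s Hs; rewrite solB sobolev4_pot// poweR_ge0/=.
apply: poweR_half_le => //; [|exact: ltW].
by apply: asum_ge0 => k; rewrite mulr_ge0 ?lam_ge0 ?sqr_ge0.
Qed.

(** An upper bound for the squared H^4 norm that is linear in the weight, thanks to |c_k|^2 <=
    |c_k|, so that [lam_integral_weight] controls its time integral. *)
Definition h4dom t : \bar R := \esum_(k in [set: K]) (M k * (q k ^+ 4 * weight t k))%:E.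

Lemma sobolev4_le t : (asum (fun k => q k ^+ 4 * cabs (c t) k ^+ 2)%R <= h4dom t)%E.
Proof.
have [M0 _] := Mm; apply: ge0_lee_esum => k; rewrite lee_fin [leRHS]mulrCA.
apply: ler_wpM2l; first exact: lam_ge0.
apply: le_trans (sqr_le_id _) (cM t k); rewrite cabs_ge0/=.
by apply: le_trans (below_le t k Mm cM) _; have := majorant_le5 k Mm; lra.
Qed.

Lemma h4dom_lty t : 0 < t -> (h4dom t < +oo)%E.
Proof.
move=> t0; have [M0 M5] := Mm; have W0 := weight_const_gt0 R.
apply: (@le_lt_trans _ _ (asum (fun k => weight_const R / t * M k))).
  apply: le_asum => k; rewrite mulrC; apply: ler_wpM2r => //; exact: lam_weight_le.
rewrite asumZ//; last by rewrite divr_ge0// ltW.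
by apply: lte_mul_pinfty => //; [rewrite lee_fin divr_ge0// ltW|exact: le_lt_trans M5 (ltry _)].
Qed.

Lemma continuous_h4term k : continuous (fun t => M k * (q k ^+ 4 * weight t k)).
Proof.
move=> t; apply: (@continuousM _ _ (cst (M k)) (fun t => q k ^+ 4 * weight t k)); first exact: cst_continuous.
by apply: (@continuousM _ _ (cst (q k ^+ 4)) (fun t => weight t k)); [exact: cst_continuous|exact: continuous_weight].
Qed.

Lemma h4term_ge0 k t : (0 <= (M k * (q k ^+ 4 * weight t k))%:E)%E.
Proof.
have [M0 _] := Mm; rewrite lee_fin; apply: mulr_ge0 => //.
by apply: mulr_ge0; [exact: lam_ge0|exact/ltW/weight_gt0].
Qed.

Lemma integral_h4dom T : 0 <= T -> (\int[leb]_(t in `[0%R, T]) h4dom t < +oo)%E.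
Proof.
move=> T0; have [M0 M5] := Mm; have W0 := weight_const_gt0 R.
rewrite integral_esum//; last 2 first.
- by move=> k t; exact: h4term_ge0.
- by move=> k; have /integrableP[] := integrable_continuous_itv 0 T (@continuous_h4term k).
apply: (@le_lt_trans _ _ (asum (fun k => weight_const R * M k))); last first.
  rewrite asumZ//; last exact: ltW.
  by apply: lte_mul_pinfty => //; [rewrite lee_fin ltW|exact: le_lt_trans M5 (ltry _)].
apply: ge0_lee_esum => k.
have wi : leb.-integrable `[0, T] (EFin \o (fun t => weight t k : R)).
  by apply: integrable_continuous_itv; exact: continuous_weight.
rewrite -EFin_Rintegral//; last by apply: integrable_continuous_itv; exact: continuous_h4term.
rewrite lee_fin.
have -> : \int[leb]_(t in `[0, T]) (M k * (q k ^+ 4 * weight t k)) =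
    M k * q k ^+ 4 * \int[leb]_(t in `[0, T]) weight t k.
  by rewrite -(RintegralZl _ _ wi)//; apply: eq_Rintegral => t _; rewrite mulrA.
rewrite mulrC mulrCA [leRHS]mulrC; apply: ler_wpM2l => //.
by rewrite mulrC; exact: lam_integral_weight.
Qed.

Lemma sol_bochner_L T : 0 < T -> bochner_L 2%:E T (spaceH d 4) sol.
Proof.
move=> T0; split.
  apply: strongly_measurable_grid => //.
  - move=> t t0; split; first by apply: Lfun_wser; [rewrite lee_fin ler1n|exact: csummable_pot].
    rewrite sobolev4_pot//; apply: poweR_half_lty; apply: le_lt_trans (sobolev4_le t) _; exact: h4dom_lty.
  - by move=> t t0; exact: sol_sobolev4_cvg.
  - by move=> t s _ _; exact: poweR_ge0.
rewrite unlock; apply: poweR_half_lty; apply: le_lt_trans (integral_h4dom (ltW T0)).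
rewrite [leRHS]integral_mkcond; apply: ge0_le_integral_nonmeas => t _; first exact: poweR_ge0.
rewrite /patch; case: ifPn => _; last first.
  by rewrite abse0 poweR0r.
rewrite (_ : fnorm (spaceH d 4) (sol t) = sobolevH_norm 4 (wser (pot (c t))))//.
rewrite sobolev4_pot// gee0_abs ?poweR_ge0// poweR_half_sqr; first exact: sobolev4_le.
by apply: asum_ge0 => k; rewrite mulr_ge0 ?lam_ge0 ?sqr_ge0.
Qed.

Lemma sol_laplacian t : has_laplacian (sol t) /\
  {ae mu, forall x, laplacian (sol t) x = - wser (c t) x}.
Proof.
apply: (@laplacian_wser _ _ (pot (c t))) => //.
- by apply: Lfun_wser => //; exact: csummable_pot.
- exact: csummable_pot.
- by move=> k; exact: pot_mulK.
- exact: aeW.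
Qed.

Lemma sol_Lfun1 t : sol t \in Lfun mu 1%E.
Proof. by apply: Lfun_wser => //; exact: csummable_pot. Qed.

Lemma sol_mean t : \int[mu]_x sol t x = 0.
Proof.
have := fourier_wser 0 (csummable_pot (cs t)) (hermitian_pot (@ch t)).
rewrite {2}/pot cz mulr0 => /(congr1 (@complex.Re R))/= /eqP.
rewrite mulf_eq0 invr_eq0 gt_eqF ?torus_volume_gt0//= => /eqP <-.
by apply: eq_Rintegral => x _; rewrite phase0 cos0 mulr1.
Qed.

Lemma measurable_laplacian f : has_laplacian f -> measurable_fun setT (@laplacian R d f).
Proof.
move=> hf; apply: measurable_sum => i; have [_ g1 _] := weak_derivP (hf i).
by have /integrable_Lfun1/(measurable_int _)/measurable_EFinP := g1.
Qed.

Lemma norm_laplacian_sol_le t : ('N[mu]_+oo[EFin \o laplacian (sol t)] <= asum (cabs (c t)))%E.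
Proof.
have fin : asum (cabs (c t)) \is a fin_num.
  by rewrite ge0_fin_numE ?asum_ge0//; [exact: cs|move=> k; exact: normc_ge0].
rewrite -(fineK fin); apply: Linf_le; have [_] := sol_laplacian t.
by apply: filterS => x ->; rewrite normrN; exact: norm_wser_le.
Qed.

Lemma laplacian_sol_carrier t : laplacian (sol t) \in Lfun mu +oo%E.
Proof.
have [hl le] := sol_laplacian t.
apply: (@Lfun_inf _ _ _ (fine (asum (cabs (c t))))); first exact: measurable_laplacian.
by apply: filterS le => x ->; rewrite normrN; exact: norm_wser_le.
Qed.

Lemma laplacian_sol_cvg t :
  'N[mu]_+oo[EFin \o (laplacian (sol t) \- laplacian (sol s))%R]%E @[s --> t] --> 0%E.
Proof.
apply: cvge0 => e e0.
have := diff_near t e0; apply: filterS => s H; rewrite Lnorm_ge0/=.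
have fin : asum (cabs (fun k => c s k - c t k)) \is a fin_num.
  by rewrite ge0_fin_numE ?asum_ge0//; [exact: ds|move=> k; exact: normc_ge0].
apply: le_trans H; rewrite -(fineK fin); apply: Linf_le.
have [_ l1] := sol_laplacian t; have [_ l2] := sol_laplacian s.
apply: filterS2 l1 l2 => x E1 E2; rewrite /= E1 E2 opprK addrC -wserB//.
exact: norm_wser_le.
Qed.

Lemma laplacian_sol_bochner T : 0 < T ->
  bochner_L +oo T (spaceL d +oo%E) (fun t => laplacian (sol t)).
Proof.
move=> T0; split.
  apply: strongly_measurable_grid => //.
  - by move=> t _; exact: laplacian_sol_carrier.
  - by move=> t _; exact: laplacian_sol_cvg.
  - by move=> t s _ _; exact: Lnorm_ge0.
apply: (@le_lt_trans _ _ 1%:E); last exact: ltry.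
rewrite unlock; case: ifPn => _ //; apply/ess_sup_inf.ess_supP; apply: aeW => t /=.
case: (boolP (t \in `[0%R, T]%classic)) => tT; last by rewrite patchN// abse0.
rewrite patchT// gee0_abs ?Lnorm_ge0//; apply: le_trans (norm_laplacian_sol_le t) _.
by apply: le_trans (below_asum t Mm cM) _; rewrite lee_fin; lra.
Qed.

End regularity.

(** * The fundamental lemma in time *)

Section cutoff.
Variable R : realType.
Local Notation leb := (@lebesgue_measure R).
Implicit Types (c x t a b : R) (m k n : nat).

(** The powers x^-m allow derivatives to stay in the family. As c tends to 0, [flat c 0] tends to 1
    at every x > 0. *)
Definition flat c m x : R := if 0 < x then x ^- m * expR (- (c / x)) else 0.

Lemma flat_ge0 c m x : 0 <= flat c m x.
Proof. by rewrite /flat; case: ifPn => // x0; rewrite mulr_ge0 ?expR_ge0// invr_ge0 exprn_ge0// ltW. Qed.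

Lemma exp_coeff_le n (y : R) : 0 <= y -> (n`!%:R)^-1 * y ^+ n <= expR y.
Proof.
move=> y0; apply: (@le_trans _ _ (series (exp_coeff y) n.+1)).
  rewrite /series/= big_nat_recr//= -[leLHS]add0r; apply: lerD; last by rewrite exp_coeffE.
  by apply: sumr_ge0 => i _; exact: exp_coeff_ge0.
apply: (@nondecreasing_cvgn_le R (series (exp_coeff y))); last exact: is_cvg_series_exp_coeff.
by apply/nondecreasing_seqP => i; rewrite /series/= big_nat_recr//= lerDl; exact: exp_coeff_ge0.
Qed.

(** The term of index m + 1 in the exponential series at c / x beats x^-m and leaves a factor x,
    which yields differentiability at 0. *)
Lemma flat_le c m x : 0 < c -> 0 < x -> flat c m x <= m.+1`!%:R / c ^+ m.+1 * x.
Proof.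
move=> c0 x0; rewrite /flat x0 expRN.
have cx0 : 0 <= c / x by rewrite divr_ge0// ltW.
have h := exp_coeff_le m.+1 cx0.
have f0 : (0 : R) < m.+1`!%:R by rewrite ltr0n fact_gt0.
have p0 : 0 < (m.+1`!%:R)^-1 * (c / x) ^+ m.+1 by rewrite mulr_gt0 ?invr_gt0// exprn_gt0// divr_gt0.
apply: (@le_trans _ _ (x ^- m * ((m.+1`!%:R)^-1 * (c / x) ^+ m.+1)^-1)).
  by rewrite ler_wpM2l ?invr_ge0 ?exprn_ge0 ?(ltW x0)// lef_pV2 ?posrE ?expR_gt0.
rewrite invfM invrK exprMn exprVn invfM invrK le_eqVlt; apply/orP; left; apply/eqP.
have cn : c ^+ m.+1 != 0 by rewrite gt_eqF// exprn_gt0.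
have xn : x ^+ m != 0 by rewrite gt_eqF// exprn_gt0.
rewrite [x ^+ m.+1]exprS; move: (x ^+ m) (c ^+ m.+1) xn cn => X C xn cn.
by field; apply/andP.
Qed.

Lemma is_derive_flat c m x : 0 < c ->
  is_derive x 1 (flat c m) (- m%:R * flat c m.+1 x + c * flat c m.+2 x).
Proof.
move=> c0; case: (ltgtP x 0) => [x0|x0|->].
- rewrite /flat ltNge (ltW x0)/= !mulr0 addr0.
  have H : \forall y \near x, (cst 0 : R -> R) y = (if 0 < y then y ^- m * expR (- (c / y)) else 0).
    have : \forall y \near x, y < 0 by apply: lt_nbhsl.
    by apply: filterS => y y0; rewrite ltNge (ltW y0).
  exact: (near_eq_is_derive H (is_derive_cst _ _ _)).
- have H : \forall y \near x, (fun y => y ^- m * expR (- c * y^-1)) y = flat c m y.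
    have : \forall y \near x, 0 < y by apply: lt_nbhsr.
    by apply: filterS => y y0; rewrite /flat y0 mulNr.
  apply: (near_eq_is_derive H) => {H}.
  have xn : x != 0 by rewrite gt_eqF.
  have hV : is_derive x 1 (fun y : R => y^-1) (- x ^- 2 *: 1) by exact: (is_deriveV xn (is_derive_id x 1)).
  have hE : is_derive x 1 (fun y => expR (- c * y^-1)) (expR (- c * x^-1) * (- c * (- x ^- 2 *: 1))).
    exact: (is_derive1_comp (is_derive_expR _) (is_deriveZ (- c) hV)).
  have hX := is_deriveX m hV.
  have hM := is_deriveM hX hE.
  rewrite [X in is_derive _ _ _ X](_ : _ = (x^-1 ^+ m) *: (expR (- c * x^-1) * (- c * (- x ^- 2 *: 1))) +
     expR (- c * x^-1) *: ((m%:R * x^-1 ^+ m.-1) *: (- x ^- 2 *: 1))); last first.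
    rewrite /flat x0 -![_ *: _]/(_ * _) !mulr1 !exprVn -mulNr.
    move: (expR _) => e; case: m hX hM => [|m] _ _ /=; first by field.
    have xm : x ^+ m != 0 by rewrite expf_eq0 (negPf xn) andbF.
    rewrite !exprS; move: (x ^+ m) xm => X xm.
    by field; apply/andP.
  rewrite (_ : (fun y => y ^- m * expR (- c * y^-1)) = (fun y : R => y^-1 ^+ m) * (fun y => expR (- c * y^-1))).
    by rewrite exprfctE in hM; exact: hM.
  by apply/funext => y; rewrite [RHS]/GRing.mul/= exprVn.
- have z j : flat c j 0 = 0 by rewrite /flat ltxx.
  rewrite !z !mulr0 addr0.
  have H : (fun h : R => h^-1 *: ((flat c m \o shift 0) (h *: (1 : R)) - flat c m 0)) @ 0^' --> (0 : R).
    apply/cvgrPdist_le => e e0.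
    pose C := m.+2`!%:R / c ^+ m.+2.
    have C0 : 0 < C by rewrite divr_gt0 ?exprn_gt0// ltr0n fact_gt0.
    have eC : 0 < e / C by rewrite divr_gt0.
    have nz : \forall h \near nbhs (0 : R)^', h != 0 by exact: nbhs_dnbhs_neq.
    have ns : \forall h \near nbhs (0 : R)^', h < e / C.
      by apply: cvg_within; apply: lt_nbhsl.
    apply: filterS2 nz ns => h h0 he; rewrite z subr0 sub0r normrN /= addr0 -![_ *: _]/(_ * _) mulr1.
    case: (ltP 0 h) => hh; last by rewrite /flat ltNge hh/= mulr0 normr0 ltW.
    have -> : h^-1 * flat c m h = flat c m.+1 h by rewrite /flat hh exprS invfM mulrA.
    rewrite ger0_norm ?flat_ge0//; apply: le_trans (flat_le _ c0 hh) _.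
    by rewrite -ler_pdivlMl// mulrC ltW.
  apply: DeriveDef; first by apply/cvg_ex; exists 0; exact: H.
  by apply: cvg_lim; [exact: Rhausdorff|exact: H].
Qed.

Variables (c a b : R) (c0 : 0 < c).

Definition lflat m t := flat c m (t - a).
Definition rflat m t := flat c m (b - t).

Lemma is_derive_lflat m t : is_derive t 1 (lflat m) (- m%:R * lflat m.+1 t + c * lflat m.+2 t).
Proof.
have h : is_derive t 1 (fun s => s - a) 1.
  by rewrite -[X in is_derive _ _ _ X]subr0; apply: is_deriveB.
by have := @is_derive1_comp R (flat c m) (fun s => s - a) t _ 1 (is_derive_flat m (t - a) c0) h; rewrite mulr1.
Qed.

Lemma is_derive_rflat m t : is_derive t 1 (rflat m) (m%:R * rflat m.+1 t - c * rflat m.+2 t).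
Proof.
have h : is_derive t 1 (fun s => b - s) (-1).
  by rewrite -[X in is_derive _ _ _ X]sub0r; apply: is_deriveB.
by have := @is_derive1_comp R (flat c m) (fun s => b - s) t _ (-1) (is_derive_flat m (b - t) c0) h; rewrite mulrN1 opprD mulNr opprK.
Qed.

Lemma continuous_lflat m : continuous (lflat m).
Proof. by move=> t; exact: is_derive_continuous (is_derive_lflat m t). Qed.

Lemma continuous_rflat m : continuous (rflat m).
Proof. by move=> t; exact: is_derive_continuous (is_derive_rflat m t). Qed.

(* Linear combinations of the products lflat m * rflat k are closed under
   differentiation, so they are smooth. *)
Definition fterm := (R * nat * nat)%type.
Definition feval (s : seq fterm) t : R :=
  \sum_(p <- s) p.1.1 * (lflat p.1.2 t * rflat p.2 t).
Definition fdiff1 (p : fterm) : seq fterm :=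
  let: (r, m, k) := p in
  [:: (- r * m%:R, m.+1, k); (r * c, m.+2, k); (r * k%:R, m, k.+1); (- r * c, m, k.+2)].
Definition fdiff (s : seq fterm) := flatten [seq fdiff1 p | p <- s].

Lemma is_derive_feval s t : is_derive t 1 (feval s) (feval (fdiff s) t).
Proof.
elim: s => [|[[r m] k] s IH].
  rewrite /feval big_nil (_ : (fun t => _) = cst 0); first exact: is_derive_cst.
  by apply/funext => x; rewrite big_nil.
have h := is_deriveZ r (is_deriveM (is_derive_lflat m t) (is_derive_rflat k t)).
have H := is_deriveD h IH.
rewrite (_ : feval ((r, m, k) :: s) = (r *: (lflat m * rflat k)) + feval s); last first.
  by apply/funext => x; rewrite /feval big_cons.
rewrite [X in is_derive _ _ _ X](_ : _ = r *: (lflat m t *: (k%:R * rflat k.+1 t - c * rflat k.+2 t) +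
   rflat k t *: (- m%:R * lflat m.+1 t + c * lflat m.+2 t)) + feval (fdiff s) t); first exact: H.
rewrite (_ : fdiff ((r, m, k) :: s) = fdiff1 (r, m, k) ++ fdiff s)// /feval big_cat; congr (_ + _).
rewrite /fdiff1 !big_cons big_nil/=.
rewrite -![_ *: _]/(_ * _).
by move: (lflat m t) (lflat m.+1 t) (lflat m.+2 t) (rflat k t) (rflat k.+1 t) (rflat k.+2 t) => *; ring.
Qed.

Lemma derive1n_feval n s : (feval s)^`(n)%classic = feval (iter n fdiff s).
Proof.
elim: n s => [|n IH] s; first by rewrite derive1n0.
rewrite derive1Sn iterSr -IH; congr (_^`(n)%classic).
by apply/funext => t; rewrite derive1E; have [_ ->] := is_derive_feval s t.
Qed.

(** A smooth function supported in [a, b] that tends to 1 on the interior as c tends to 0. *)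
Definition cutoff t : R := lflat 0 t * rflat 0 t.

Lemma cutoffE : cutoff = feval [:: (1, 0%N, 0%N)].
Proof. by apply/funext => t; rewrite /feval big_cons big_nil/= mul1r addr0. Qed.

Lemma derive_cutoff t : cutoff^`()%classic t = c * (lflat 2 t * rflat 0 t) - c * (lflat 0 t * rflat 2 t).
Proof.
rewrite cutoffE derive1E; have [_ ->] := is_derive_feval [:: (1, 0%N, 0%N)] t.
by rewrite /feval /fdiff/= !big_cons big_nil/= ; ring.
Qed.

Lemma cutoff_out t : ~ (a <= t <= b) -> cutoff t = 0.
Proof.
move=> H; rewrite /cutoff /lflat /rflat /flat !subr_gt0.
case: (ltP a t) => at_; last by rewrite mul0r.
case: (ltP t b) => tb; last by rewrite mulr0.
by exfalso; apply: H; rewrite !ltW.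
Qed.

Lemma cutoff_time_test T : 0 < a -> a < b -> b < T -> time_test T cutoff.
Proof.
move=> a0 ab bT; split.
  by move=> n t; rewrite cutoffE derive1n_feval; have [] := is_derive_feval (iter n fdiff [:: (1, 0%N, 0%N)]) t.
by exists a, b; split => // t; exact: cutoff_out.
Qed.

Lemma lflat0_le1 t : 0 <= lflat 0 t <= 1.
Proof.
rewrite flat_ge0/= /lflat /flat; case: ifPn => // t0.
by rewrite expr0 invr1 mul1r -expR0 ler_expR oppr_le0 divr_ge0// ltW.
Qed.

Lemma rflat0_le1 t : 0 <= rflat 0 t <= 1.
Proof.
rewrite flat_ge0/= /rflat /flat; case: ifPn => // t0.
by rewrite expr0 invr1 mul1r -expR0 ler_expR oppr_le0 divr_ge0// ltW.
Qed.

(** On x > 0 the derivative of [flat c 0] is c * [flat c 2]; this bounds its product with x^2 by c,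
    the second moment condition of [kernel_bound]. *)
Lemma flat2_mul x : flat c 2 x * x ^+ 2 <= 1.
Proof.
rewrite /flat; case: ifPn => x0; last by rewrite mul0r.
rewrite mulrAC mulVf ?mul1r ?gt_eqF ?exprn_gt0//.
by rewrite -expR0 ler_expR oppr_le0 divr_ge0// ltW.
Qed.

Lemma flat0_ge x : 0 < x -> 1 - flat c 0 x <= c / x.
Proof.
move=> x0; rewrite /flat x0 expr0 invr1 mul1r.
by have := expR_ge1Dx (- (c / x)); lra.
Qed.

End cutoff.

Section kernel.
Variable R : realType.
Local Notation leb := (@lebesgue_measure R).

(* An approximate identity at x0, controlled through its second moment. *)
Lemma kernel_bound (k w g : R -> R) (a b x0 c e dl B : R) :
  0 < c -> a < b -> 0 < dl -> 0 <= e -> a <= x0 <= b ->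
  continuous k -> continuous w -> continuous g ->
  (forall t, a <= t <= b -> 0 <= k t /\ k t * (t - x0) ^+ 2 <= c) ->
  (forall t, a <= t <= b -> 0 <= w t <= 1) ->
  (forall t, a <= t <= b -> `|g t| <= B) ->
  (forall t, a <= t <= b -> `|t - x0| <= dl -> `|g t - g x0| <= e /\ 1 - w t <= 2 * c / (b - a)) ->
  1 - c / (b - a) <= \int[leb]_(t in `[a, b]) k t <= 1 ->
  `|\int[leb]_(t in `[a, b]) (k t * (w t * g t)) - g x0| <=
    e + c * (3 * B / (b - a) + 2 * B * (b - a) / dl ^+ 2).
Proof.
move=> c0 ab dl0 e0 x0I ck cw cg kk ww gB near_x0 /andP[m1 m2].
have ba0 : 0 < b - a by rewrite subr_gt0.
have B0 : 0 <= B by apply: le_trans (gB x0 x0I).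
have ki := integrable_continuous_itv a b ck.
have cwg : continuous (fun t => k t * (w t * g t)).
  move=> t; apply: (@continuousM _ _ k (fun t => w t * g t)); first exact: ck.
  by apply: (@continuousM _ _ w g); [exact: cw|exact: cg].
have wi := integrable_continuous_itv a b cwg.
set m := \int[leb]_(t in `[a, b]) k t in m1 m2 *.
pose C := e + 2 * c * B / (b - a).
have C0 : 0 <= C by rewrite addr_ge0// divr_ge0 ?(ltW ba0)// !mulr_ge0// ltW.
(* Within dl of x0 the hypothesis of closeness applies; farther away (t - x0)^2 / dl^2 exceeds 1,
   and its product with k is controlled by the second moment. *)
have pw t : a <= t <= b -> `|w t * g t - g x0| <= C + 2 * B / dl ^+ 2 * (t - x0) ^+ 2.
  move=> tI; have /andP[w0 w1] := ww t tI.
  case: (leP `|t - x0| dl) => td.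
    have [h1 h2] := near_x0 t tI td.
    have d2 : 0 <= 2 * B / dl ^+ 2 * (t - x0) ^+ 2.
      by apply: mulr_ge0; [apply: divr_ge0; [exact: mulr_ge0|exact: sqr_ge0]|exact: sqr_ge0].
    apply: (@le_trans _ _ C); last by rewrite lerDl.
    rewrite (_ : w t * g t - g x0 = (g t - g x0) - (1 - w t) * g t); last by ring.
    apply: le_trans (ler_normB _ _) _; apply: lerD => //.
    rewrite normrM ger0_norm ?subr_ge0//.
    apply: (@le_trans _ _ (2 * c / (b - a) * B)).
      by apply: ler_pM => //; [rewrite subr_ge0|exact: gB].
    by rewrite mulrAC.
  apply: (@le_trans _ _ (2 * B)).
    apply: le_trans (ler_normB _ _) _; rewrite mulr_natl mulr2n; apply: lerD; last exact: gB.
    rewrite normrM ger0_norm//; apply: le_trans (gB t tI); exact: ler_piMl.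
  rewrite -[leLHS]add0r; apply: lerD => //.
  rewrite -[leLHS]mulr1 -[leRHS]mulrA; apply: ler_wpM2l; first by rewrite mulr_ge0.
  rewrite mulrC.
  rewrite ler_pdivlMr ?exprn_gt0// mul1r -(real_normK (num_real (t - x0))).
  by rewrite lerXn2r ?nnegrE ?(ltW dl0)// ltW.
have E : \int[leb]_(t in `[a, b]) (k t * (w t * g t)) - g x0 * m =
    \int[leb]_(t in `[a, b]) (k t * (w t * g t - g x0)).
  have := Rintegral_comb 1 (- g x0) a b cwg ck; rewrite mul1r mulNr => <-.
  by apply: eq_Rintegral => t _; ring.
have cD : continuous (fun t => k t * (w t * g t - g x0)).
  move=> t; apply: (@continuousM _ _ k (fun t => w t * g t - g x0)); first exact: ck.
  apply: (@continuousB _ _ _ (fun t => w t * g t) (cst (g x0))); last exact: cst_continuous.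
  by apply: (@continuousM _ _ w g); [exact: cw|exact: cg].
have h1 : `|\int[leb]_(t in `[a, b]) (k t * (w t * g t - g x0))| <= C + 2 * B / dl ^+ 2 * (c * (b - a)).
  apply: le_trans (le_normr_Rintegral _ (integrable_continuous_itv a b cD)) _ => //.
  have c1 : continuous (fun _ : R => 1 : R) by exact: cst_continuous.
  apply: (@le_trans _ _ (\int[leb]_(t in `[a, b]) (C * k t + 2 * B / dl ^+ 2 * c * 1))).
    apply: le_Rintegral => //.
    - apply: integrable_continuous_itv => t; apply: (@continuous_comp _ _ _ (fun t => k t * (w t * g t - g x0)) (@Num.norm R R)); [exact: cD|exact: norm_continuous].
    - by apply: integrable_continuous_itv; exact: continuous_comb.
    move=> t; rewrite /= in_itv/= => tI; have [k0 kc] := kk t tI.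
    rewrite normrM ger0_norm//; apply: le_trans (ler_wpM2l k0 (pw t tI)) _.
    rewrite mulrDr [k t * C]mulrC lerD2l mulr1 mulrCA; apply: ler_wpM2l => //.
    by apply: divr_ge0; [exact: mulr_ge0|exact: sqr_ge0].
  rewrite Rintegral_comb// -/m; apply: lerD; first by rewrite ler_piMr.
  have -> : \int[leb]_(t in `[a, b]) 1 = b - a.
    by rewrite (@FTC2_at _ id)//; [exact: ltW|move=> s _; exact: cst_continuous].
  by rewrite mulrA.
rewrite -E in h1.
have h2 : `|g x0 * m - g x0| <= B * (c / (b - a)).
  rewrite -[X in _ - X]mulr1 -mulrBr normrM; apply: ler_pM => //; first exact: gB.
  by rewrite ler0_norm ?subr_le0//; lra.
rewrite (_ : _ - g x0 = (\int[leb]_(t in `[a, b]) (k t * (w t * g t)) - g x0 * m) + (g x0 * m - g x0)); last by ring.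
apply: le_trans (ler_normD _ _) _; apply: le_trans (lerD h1 h2) _.
rewrite le_eqVlt; apply/orP; left; apply/eqP; rewrite /C; field.
by apply/andP; split; rewrite gt_eqF.
Qed.

Lemma Rintegral_sub_itv (h : R -> R) (a b T : R) : 0 <= a -> b <= T ->
  (forall t, ~ (a <= t <= b) -> h t = 0) ->
  \int[leb]_(t in `[0, T]) h t = \int[leb]_(t in `[a, b]) h t.
Proof.
move=> a0 bT h0.
have E : `[a, b]%classic = `[0, T]%classic `&` `[a, b]%classic :> set R.
  apply/seteqP; split => t /=; last by case.
  rewrite !in_itv/= => /andP[at_ tb]; split; last by rewrite at_.
  by rewrite (le_trans a0 at_) (le_trans tb bT).
rewrite [in RHS]E Rintegral_mkcondr; apply: eq_Rintegral => t _; rewrite /patch.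
case: ifPn => // /negP tI; apply: h0 => /andP[at_ tb]; apply: tI; apply/mem_set.
by rewrite /= in_itv/= at_.
Qed.

End kernel.

(** * The du Bois-Reymond lemma *)

Section du_bois_reymond.
Variable R : realType.
Local Notation leb := (@lebesgue_measure R).
Implicit Types (g f z : R -> R) (a b c e s t T : R).

Lemma continuous_bounded_itv g a b : a <= b -> continuous g ->
  exists B, forall t, a <= t <= b -> `|g t| <= B.
Proof.
move=> ab cg.
have [|x _ H] := @EVT_max R (fun t => `|g t|) a b ab.
  apply: continuous_subspaceT => t.
  by apply: (@continuous_comp _ _ _ g (@Num.norm R R)); [exact: cg|exact: norm_continuous].
by exists `|g x| => t tI; apply: H; rewrite in_itv.
Qed.

Lemma continuous_near_closed g x0 e : continuous g -> 0 < e ->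
  exists2 dl, 0 < dl & forall t, `|t - x0| <= dl -> `|g t - g x0| <= e.
Proof.
move=> cg e0; have := cg x0 => /cvgrPdist_le /(_ _ e0).
move=> /nbhs_ballP[r /= r0 H]; exists (r / 2); first by rewrite divr_gt0.
move=> t tr; rewrite distrC; apply: H; rewrite /ball/= distrC; apply: le_lt_trans tr _.
by rewrite ltr_pdivrMr//; lra.
Qed.

(** The kernel c * [lflat c a 2] is the derivative of [lflat c a 0], so its mass on [a, b] is close
    to 1, and it concentrates at a as c tends to 0. *)
Lemma lflat_kernel g a b e : a < b -> continuous g -> 0 < e ->
  exists K, forall c, 0 < c ->
    `|\int[leb]_(t in `[a, b]) (c * lflat c a 2 t * (rflat c b 0 t * g t)) - g a| <= e + c * K.
Proof.
move=> ab cg e0; have ba0 : 0 < b - a by rewrite subr_gt0.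
have [B gB] := continuous_bounded_itv (ltW ab) cg.
have [dl dl0 gdl] := continuous_near_closed a cg e0.
(* At distance at most (b - a) / 2 from a, the other factor [rflat c b 0] differs from 1 by at most
   2 c / (b - a). *)
pose dm := Num.min dl ((b - a) / 2).
have dm0 : 0 < dm by rewrite lt_min dl0 divr_gt0.
exists (3 * B / (b - a) + 2 * B * (b - a) / dm ^+ 2) => c c0.
apply: kernel_bound => //.
- exact: ltW.
- by rewrite lexx ltW.
- move=> t; apply: (@continuousM _ _ (cst c)); first exact: cst_continuous.
  exact: continuous_lflat.
- exact: continuous_rflat.
- move=> t _; split; first by rewrite mulr_ge0 ?flat_ge0// ltW.
  by rewrite -mulrA -[leRHS]mulr1; apply: ler_wpM2l; [exact: ltW|exact: flat2_mul].
- by move=> t _; exact: rflat0_le1.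
- move=> t /andP[at_ tb]; rewrite le_min => /andP[t1 t2]; split; first exact: gdl.
  have bt : (b - a) / 2 <= b - t by move: t2; rewrite ger0_norm ?subr_ge0//; lra.
  have bt0 : 0 < b - t by apply: lt_le_trans bt; rewrite divr_gt0.
  apply: le_trans (flat0_ge c bt0) _.
  rewrite -mulrA mulrCA; apply: ler_wpM2l; first exact: ltW.
  by rewrite -[X in X / _]invrK -invfM lef_pV2 ?posrE ?mulr_gt0 ?invr_gt0// mulrC.
have -> : \int[leb]_(t in `[a, b]) (c * lflat c a 2 t) = lflat c a 0 b - lflat c a 0 a.
  apply: FTC2_at; first exact: ltW.
    by move=> s _; have := is_derive_lflat a c0 0 s; rewrite oppr0 mul0r add0r.
  move=> s _; apply: (@continuousM _ _ (cst c)); first exact: cst_continuous.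
  exact: continuous_lflat.
have -> : lflat c a 0 a = 0 by rewrite /lflat /flat subrr ltxx.
rewrite subr0; have /andP[_ ->] := lflat0_le1 a c0 b; rewrite andbT.
by have := flat0_ge c ba0; rewrite /lflat; lra.
Qed.

Lemma rflat_kernel g a b e : a < b -> continuous g -> 0 < e ->
  exists K, forall c, 0 < c ->
    `|\int[leb]_(t in `[a, b]) (c * rflat c b 2 t * (lflat c a 0 t * g t)) - g b| <= e + c * K.
Proof.
move=> ab cg e0; have ba0 : 0 < b - a by rewrite subr_gt0.
have [B gB] := continuous_bounded_itv (ltW ab) cg.
have [dl dl0 gdl] := continuous_near_closed b cg e0.
pose dm := Num.min dl ((b - a) / 2).
have dm0 : 0 < dm by rewrite lt_min dl0 divr_gt0.
exists (3 * B / (b - a) + 2 * B * (b - a) / dm ^+ 2) => c c0.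
apply: kernel_bound => //.
- exact: ltW.
- by rewrite lexx ltW.
- move=> t; apply: (@continuousM _ _ (cst c)); first exact: cst_continuous.
  exact: continuous_rflat.
- exact: continuous_lflat.
- move=> t _; split; first by rewrite mulr_ge0 ?flat_ge0// ltW.
  rewrite -sqrrN opprB -mulrA -[leRHS]mulr1; apply: ler_wpM2l; first exact: ltW.
  exact: flat2_mul.
- by move=> t _; exact: lflat0_le1.
- move=> t /andP[at_ tb]; rewrite le_min => /andP[t1 t2]; split; first exact: gdl.
  have bt : (b - a) / 2 <= t - a by move: t2; rewrite ler0_norm ?subr_le0//; lra.
  have bt0 : 0 < t - a by apply: lt_le_trans bt; rewrite divr_gt0.
  apply: le_trans (flat0_ge c bt0) _.
  rewrite -mulrA mulrCA; apply: ler_wpM2l; first exact: ltW.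
  by rewrite -[X in X / _]invrK -invfM lef_pV2 ?posrE ?mulr_gt0 ?invr_gt0// mulrC.
have -> : \int[leb]_(t in `[a, b]) (c * rflat c b 2 t) = - rflat c b 0 b - - rflat c b 0 a.
  apply: (@FTC2_at R (fun t => - rflat c b 0 t)); first exact: ltW.
    move=> s _; rewrite (_ : c * _ = - (0 * rflat c b 1 s - c * rflat c b 2 s)); last by ring.
    by apply: is_deriveN; exact: (is_derive_rflat b c0 0 s).
  move=> s _; apply: (@continuousM _ _ (cst c)); first exact: cst_continuous.
  exact: continuous_rflat.
have -> : rflat c b 0 b = 0 by rewrite /rflat /flat subrr ltxx.
rewrite oppr0 sub0r opprK; have /andP[_ ->] := rflat0_le1 b c0 a; rewrite andbT.
by have := flat0_ge c ba0; rewrite /rflat; lra.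
Qed.

Lemma cvg_cutoff (a b t : R) : a < t < b -> cutoff (harmonic n) a b t @[n --> \oo] --> (1 : R).
Proof.
move=> /andP[at_ tb].
have ta0 : 0 < t - a by rewrite subr_gt0.
have bt0 : 0 < b - t by rewrite subr_gt0.
have C : (fun n => 1 - harmonic n * ((t - a)^-1 + (b - t)^-1)) @ \oo --> 1 - 0 * ((t - a)^-1 + (b - t)^-1).
  have C1 : (cst 1 : nat -> R) @ \oo --> (1 : R) by exact: cvg_cst.
  have C2 : (fun n => harmonic n * ((t - a)^-1 + (b - t)^-1)) @ \oo --> 0 * ((t - a)^-1 + (b - t)^-1).
    by apply: cvgMl; exact: cvg_harmonic.
  exact: cvgB C1 C2.
rewrite mul0r subr0 in C.
have D : (cst 1 : nat -> R) @ \oo --> (1 : R) by exact: cvg_cst.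
apply: (squeeze_cvgr _ C D).
apply: nearW => n; have c0 : (0 : R) < harmonic n by rewrite /harmonic/= invr_gt0.
have /andP[l0 l1] := lflat0_le1 a c0 t; have /andP[r0 r1] := rflat0_le1 b c0 t.
have h1 : 1 - lflat (harmonic n) a 0 t <= harmonic n * (t - a)^-1 by apply: flat0_ge.
have h2 : 1 - rflat (harmonic n) b 0 t <= harmonic n * (b - t)^-1 by apply: flat0_ge.
rewrite /cutoff /cst; move: (harmonic n) (t - a)^-1 (b - t)^-1 (lflat _ _ _ _) (rflat _ _ _ _) l0 l1 r0 r1 h1 h2.
move=> h x y l r *; apply/andP; split; last by nra.
by rewrite mulrDr; nra.
Qed.

Lemma cvg_cutoff_integral f a b : a < b -> leb.-integrable `[a, b] (EFin \o f) ->
  \int[leb]_(t in `[a, b]) (cutoff (harmonic n) a b t * f t) @[n --> \oo] -->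
  \int[leb]_(t in `[a, b]) f t.
Proof.
move=> ab fi.
have fo : leb.-integrable `]a, b[ (EFin \o f).
  by apply: integrableS fi => //; exact: subset_itv_oo_cc.
have E h : leb.-integrable `[a, b] (EFin \o h) ->
    \int[leb]_(t in `[a, b]) h t = \int[leb]_(t in `]a, b[) h t.
  move=> hi; rewrite /Rintegral; congr fine; apply: integral_itv_bndoo.
  apply: (@measurable_int _ _ _ leb); apply: integrableS hi => //; exact: subset_itv_oo_cc.
have ci n : leb.-integrable `[a, b] (EFin \o (fun t => cutoff (harmonic n) a b t * f t)).
  have c0 : (0 : R) < harmonic n by rewrite /harmonic/= invr_gt0.
  have mc : measurable_fun setT (cutoff (harmonic n) a b).
    apply: continuous_measurable_fun => t; apply: (@continuousM _ _ (lflat _ _ _) (rflat _ _ _)).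
      exact: continuous_lflat.
    exact: continuous_rflat.
  apply: (le_integrable _ _ _ fi) => //.
    apply/measurable_EFinP; apply: measurable_funM; first exact: measurable_funTS.
    by apply/measurable_EFinP; exact: (@measurable_int _ _ _ leb).
  move=> t _; rewrite /= lee_fin normrM.
  have /andP[l0 l1] := lflat0_le1 a c0 t; have /andP[r0 r1] := rflat0_le1 b c0 t.
  rewrite ler_piMl// ger0_norm; last by rewrite mulr_ge0.
  by rewrite mulr_ile1.
rewrite (E _ fi); under eq_fun do rewrite (E _ (ci _)).
apply: (@Rdominated_convergence _ _ _ leb _ _ _ (fun t => `|f t|) _ _ _ _ _ _).2 => //.
- move=> n; apply/measurable_EFinP; apply: (@measurable_int _ _ _ leb).
  by apply: integrableS (ci n) => //; exact: subset_itv_oo_cc.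
- by apply/measurable_EFinP; exact: (@measurable_int _ _ _ leb).
- apply: aeW => t; rewrite /= in_itv/= => tI.
  rewrite -[X in _ --> X]mul1r; apply: cvgMl; exact: cvg_cutoff.
- exact: (integrable_norm fo).
- move=> n t _; have c0 : (0 : R) < harmonic n by rewrite /harmonic/= invr_gt0.
  have /andP[l0 l1] := lflat0_le1 a c0 t; have /andP[r0 r1] := rflat0_le1 b c0 t.
  rewrite normrM ler_piMl// ger0_norm; last by rewrite mulr_ge0.
  by rewrite mulr_ile1.
Qed.

Lemma cvg_of_linear_bound (u : R -> R) (l : R) :
  (forall e, 0 < e -> exists K, forall c, 0 < c -> `|u c - l| <= e + c * K) ->
  u (harmonic n) @[n --> \oo] --> l.
Proof.
move=> H; apply/cvgrPdist_le => e e0.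
have e20 : 0 < e / 2 by rewrite divr_gt0.
have [K KH] := H _ e20.
have C : harmonic n * K @[n --> \oo] --> 0 * K by apply: cvgMl; exact: cvg_harmonic.
move: C; rewrite mul0r => /cvgr0Pnorm_le /(_ _ e20); apply: filterS => n hn.
have c0 : (0 : R) < harmonic n by rewrite /harmonic/= invr_gt0.
rewrite distrC; apply: le_trans (KH _ c0) _.
by have := ler_norm (harmonic n * K); lra.
Qed.

(** The derivative of the cutoff is the difference of two kernels concentrating at a and at b. *)
Lemma cvg_derive_cutoff_integral g a b : a < b -> continuous g ->
  \int[leb]_(t in `[a, b]) ((cutoff (harmonic n) a b)^`()%classic t * g t) @[n --> \oo] -->
  g a - g b.
Proof.
move=> ab cg.
have A : \int[leb]_(t in `[a, b]) (harmonic n * lflat (harmonic n) a 2 t * (rflat (harmonic n) b 0 t * g t)) @[n --> \oo] --> g a.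
  by apply: (@cvg_of_linear_bound (fun c => \int[leb]_(t in `[a, b]) (c * lflat c a 2 t * (rflat c b 0 t * g t)))) => e e0; exact: lflat_kernel.
have B : \int[leb]_(t in `[a, b]) (harmonic n * rflat (harmonic n) b 2 t * (lflat (harmonic n) a 0 t * g t)) @[n --> \oo] --> g b.
  by apply: (@cvg_of_linear_bound (fun c => \int[leb]_(t in `[a, b]) (c * rflat c b 2 t * (lflat c a 0 t * g t)))) => e e0; exact: rflat_kernel.
rewrite (_ : (fun n => _) = (fun n =>
   \int[leb]_(t in `[a, b]) (harmonic n * lflat (harmonic n) a 2 t * (rflat (harmonic n) b 0 t * g t)) -
   \int[leb]_(t in `[a, b]) (harmonic n * rflat (harmonic n) b 2 t * (lflat (harmonic n) a 0 t * g t)))).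
  exact: cvgB.
apply/funext => n; have c0 : (0 : R) < harmonic n by rewrite /harmonic/= invr_gt0.
have cl := fun m => @continuous_lflat _ _ a c0 m; have cr := fun m => @continuous_rflat _ _ b c0 m.
have cM (x y : R -> R) : continuous x -> continuous y -> continuous (fun t => harmonic n * x t * (y t * g t)).
  move=> cx cy t; apply: (@continuousM _ _ (fun t => harmonic n * x t) (fun t => y t * g t)).
    by apply: (@continuousM _ _ (cst (harmonic n)) x); [exact: cst_continuous|exact: cx].
  by apply: (@continuousM _ _ y g); [exact: cy|exact: cg].
have := Rintegral_comb 1 (-1) a b (cM _ _ (cl 2) (cr 0)) (cM _ _ (cr 2) (cl 0)).
rewrite mul1r mulN1r => <-; apply: eq_Rintegral => t _; rewrite derive_cutoff//.
move: (harmonic n) (lflat _ _ _ _) (lflat _ _ _ _) (rflat _ _ _ _) (rflat _ _ _ _) => *; ring.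
Qed.

Lemma derive_cutoff_out c a b t : 0 < c -> ~ (a <= t <= b) -> (cutoff c a b)^`()%classic t = 0.
Proof.
move=> c0 H; rewrite derive_cutoff// /lflat /rflat /flat !subr_gt0.
case: (ltP a t) => at_; last by rewrite !mul0r !mulr0 subr0.
case: (ltP t b) => tb; last by rewrite !mulr0 subr0.
by exfalso; apply: H; rewrite !ltW.
Qed.

Variables (g f : R -> R) (T : R).
Hypothesis T0 : 0 < T.
Hypothesis cg : continuous g.
Hypothesis fi : leb.-integrable `[0%R, T] (EFin \o f).
Hypothesis weak_deriv_gf : forall eta, time_test T eta ->
  \int[leb]_(t in `[0, T]) (eta^`()%classic t * g t) +
  \int[leb]_(t in `[0, T]) (eta t * f t) = 0.

(** Since 0 < a and b < T the cutoffs of [a, b] are admissible, and the weak identity passes to the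
    limit c = 1 / (n + 1) -> 0. *)
Lemma dubois_interior a b : 0 < a -> a < b -> b < T ->
  g b - g a = \int[leb]_(t in `[a, b]) f t.
Proof.
move=> a0 ab bT.
have fab : leb.-integrable `[a, b] (EFin \o f).
  apply: integrableS fi => // t /=; rewrite !in_itv/= => /andP[h1 h2].
  by rewrite (le_trans (ltW a0) h1) (le_trans h2 (ltW bT)).
have A := cvg_derive_cutoff_integral ab cg.
have B := cvg_cutoff_integral ab fab.
have C : cst 0 @ \oo --> g a - g b + \int[leb]_(t in `[a, b]) f t.
  rewrite (_ : cst 0 = (fun n => \int[leb]_(t in `[a, b]) ((cutoff (harmonic n) a b)^`()%classic t * g t) +
     \int[leb]_(t in `[a, b]) (cutoff (harmonic n) a b t * f t))); first exact: cvgD.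
  apply/funext => n; have c0 : (0 : R) < harmonic n by rewrite /harmonic/= invr_gt0.
  have := weak_deriv_gf (cutoff_time_test c0 a0 ab bT).
  rewrite (@Rintegral_sub_itv _ _ a b T (ltW a0) (ltW bT)); last first.
    by move=> t tI; rewrite derive_cutoff_out// mul0r.
  rewrite (@Rintegral_sub_itv _ _ a b T (ltW a0) (ltW bT)) => [//|t tI].
  by rewrite cutoff_out// mul0r.
have D : (cst 0 : nat -> R) @ \oo --> (0 : R) by exact: cvg_cst.
have E : g a - g b + \int[leb]_(t in `[a, b]) f t = 0 by exact: (cvg_unique (@Rhausdorff R) C D).
by move/eqP: E; rewrite addr_eq0 => /eqP/(congr1 -%R); rewrite opprB opprK.
Qed.

(* The identity on compact subintervals of ]0, T[ extends to the endpoints by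
   continuity. *)
Lemma dubois t : 0 <= t <= T -> g t - g 0 = \int[leb]_(s in `[0, t]) f s.
Proof.
pose H t := g t - \int[leb]_(s in `[0, t]) f s.
have cH : {within `[0, T], continuous H}.
  apply: (@within_continuousB _ _ _ _ g _); first exact: continuous_subspaceT.
  exact: (parameterized_integral_continuous (ltW T0) fi).
have [ci c0 cT] := (continuous_within_itvP H T0).1 cH.
have T20 : 0 < T / 2 by rewrite divr_gt0.
have T2T : T / 2 < T by rewrite ltr_pdivrMr//; lra.
have Hab a b : 0 < a -> a <= b -> b < T -> H a = H b.
  rewrite le_eqVlt => a0 /predU1P[->//|ab] bT.
  have I : leb.-integrable `[0%R, b] (EFin \o f).
    apply: integrableS fi => // s /=; rewrite !in_itv/= => /andP[-> h2].
    exact: le_trans h2 (ltW bT).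
  have := dubois_interior a0 ab bT; have := @Rintegral_itvB R f (BLeft 0) (BRight b) a I.
  rewrite !bnd_simp (ltW ab) (ltW a0) /H => /(_ isT isT) E.
  have -> : \int[leb]_(s in `[a, b]) f s = \int[leb]_(s in `]a, b]) f s.
    symmetry; apply: Rintegral_itv_obnd_cbnd; apply: integrableS I => // s /=; rewrite !in_itv/= => /andP[h1 ->].
    by rewrite (le_trans (ltW a0) (ltW h1)).
  by move: E; move: (\int[leb]_(t in `[0, b]) f t) (\int[leb]_(t in `[0, a]) f t) => x y <- ; lra.
have Hin a : 0 < a < T -> H a = H (T / 2).
  move=> /andP[a0 aT]; case: (leP a (T / 2)) => h; first exact: Hab.
  by symmetry; apply: Hab => //; exact: ltW.
have H0 : H 0 = H (T / 2).
  apply: (cvg_unique (@Rhausdorff R) c0); apply: cvg_near_cst.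
  have n1 : \forall x \near (0:R)^'+, 0 < x by exact: nbhs_right_gt.
  have n2 : \forall x \near (0:R)^'+, x < T by exact: nbhs_right_lt.
  by apply: filterS2 n1 n2 => x x0 xT; apply: Hin; rewrite x0.
have HT : H T = H (T / 2).
  apply: (cvg_unique (@Rhausdorff R) cT); apply: cvg_near_cst.
  have n1 : \forall x \near T^'-, x < T by exact: nbhs_left_lt.
  have n2 : \forall x \near T^'-, 0 < x by exact: nbhs_left_gt.
  by apply: filterS2 n1 n2 => x xT x0; apply: Hin; rewrite x0.
move=> /andP[t0 tT]; have : H t = H 0.
  rewrite H0; move: t0 tT; rewrite !le_eqVlt => /predU1P[<-//|t0] /predU1P[->//|tT].
  by apply: Hin; rewrite t0.
rewrite /H (_ : \int[leb]_(s in `[0, 0]) f s = 0); last by rewrite set_itv1 Rintegral_set1.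
by lra.
Qed.
End du_bois_reymond.

(** * Integration by parts in time *)

Section weak_ibp.
Variable R : realType.
Local Notation leb := (@lebesgue_measure R).
Implicit Types (f g z zeta : R -> R) (s t T : R).

Lemma mem_itvE (x a b : R) : (x \in `[a, b]%classic) = (a <= x <= b).
Proof. by rewrite mem_setE in_itv. Qed.

Lemma integrable_patch D f : measurable D -> leb.-integrable D (EFin \o f) ->
  leb.-integrable setT (EFin \o (f \_ D)).
Proof. by move=> mD fi; rewrite -restrict_EFin; apply/(integrable_mkcond _ mD). Qed.

Lemma Rintegral_patchZ f (x : R) (a b : R) : leb.-integrable `[a, b] (EFin \o f) ->
  (\int[leb]_t (x * (f \_ `[a, b]) t)%:E)%E = (x * \int[leb]_(t in `[a, b]) f t)%:E.
Proof.
move=> fi; have fi' : leb.-integrable setT (EFin \o (f \_ `[a, b])).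
  exact: integrable_patch.
rewrite -EFin_Rintegral//; last by apply: integrable_scale.
by rewrite RintegralZl// -Rintegral_mkcond.
Qed.

(** Fubini's theorem on the triangle 0 <= t <= s <= T; the function h below carries its
    indicator. *)
Lemma Rintegral_exchange f z T : 0 <= T ->
  leb.-integrable `[0%R, T] (EFin \o f) -> continuous z ->
  \int[leb]_(s in `[0, T]) (z s * \int[leb]_(t in `[0, s]) f t) =
  \int[leb]_(t in `[0, T]) (f t * \int[leb]_(s in `[t, T]) z s).
Proof.
move=> T0 fi cz.
have [B zB] := continuous_bounded_itv T0 cz.
have B0 : 0 <= B by apply: le_trans (zB 0 _) => //; rewrite lexx.
pose F := f \_ `[0, T]; pose Z := z \_ `[0, T].
pose h (p : measurableTypeR R * measurableTypeR R) : R := F p.1 * (if p.1 <= p.2 then Z p.2 else 0).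
have Fi : leb.-integrable setT (EFin \o F).
  exact: integrable_patch.
have Zi : leb.-integrable setT (EFin \o Z).
  by apply: integrable_patch => //; exact: integrable_continuous_itv.
have mF : measurable_fun (@setT (measurableTypeR R)) F by apply/measurable_EFinP; exact: (@measurable_int _ _ _ leb).
have mZ : measurable_fun (@setT (measurableTypeR R)) Z by apply/measurable_EFinP; exact: (@measurable_int _ _ _ leb).
have mh : measurable_fun setT (EFin \o h).
  apply/measurable_EFinP; apply: measurable_funM; first exact: (measurableT_comp mF measurable_fst).
  apply: measurable_fun_ifT => //; last exact: (measurableT_comp mZ measurable_snd).
  by apply: measurable_fun_ler; [exact: measurable_fst|exact: measurable_snd].
have ZB s : `|Z s| <= B.
  by rewrite /Z patchE mem_itvE; case: ifPn => // sI; [exact: zB|rewrite normr0].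
have hi : (leb \x leb)%E.-integrable setT (EFin \o h).
  apply/(integrable12ltyP _ _ mh).
  apply: (@le_lt_trans _ _ (\int[leb]_t (`|F t| * (B * T))%:E)%E).
    apply: ge0_le_integral => //.
    - by move=> t _; apply: integral_ge0.
    - by apply: (@measurable_fun_fubini_tonelli_F _ _ _ _ _ leb (fun p => `|(EFin \o h) p|%E)) => //; exact: measurableT_comp.
    - apply/measurable_EFinP; apply: measurable_funM => //; exact: measurableT_comp.
    move=> t _.
    have M : (\int[leb]_s ((`|F t| * B) * ((cst (1 : R)) \_ `[0%R, T]) s)%:E)%E = (`|F t| * (B * T))%:E.
      rewrite Rintegral_patchZ; last by apply: integrable_continuous_itv; exact: cst_continuous.
      have -> : \int[leb]_(t in `[0, T]) (cst 1 t) = T - 0.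
        by apply: (@FTC2_at _ id) => // u _; exact: cst_continuous.
      by rewrite subr0 mulrA.
    rewrite -M; apply: ge0_le_integral => //.
    - by apply: measurableT_comp => //; exact: (measurableT_comp mh (pair1_measurable t)).
    - apply/measurable_EFinP; apply: measurable_funM => //.
      by apply/(measurable_restrictT _ _).1 => //.
    move=> s _; rewrite /= lee_fin /h normrM/= -mulrA; apply: ler_wpM2l => //.
    rewrite patchE mem_itvE; case: (boolP (0 <= s <= T)) => sI.
      by rewrite /cst mulr1; case: (t <= s) => //; rewrite normr0.
    by rewrite /Z patchE mem_itvE (negPf sI) if_same normr0; exact: (mulr_ge0 B0 (lexx 0)).
  have Fn : leb.-integrable setT (EFin \o (fun t => `|F t|)) by exact: (integrable_norm Fi).
  rewrite (_ : (fun t => _) = (fun t => (B * T * `|F t|)%:E)).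
    by apply: integrable_lty => //; apply: integrable_scale.
  by apply/funext => t; rewrite mulrC.
have E1 : (\int[leb]_t \int[leb]_s (EFin \o h) (t, s) =
    \int[leb]_t (((fun t => f t * \int[leb]_(s in `[t, T]) z s)%R \_ `[0%R, T]) t)%:E)%E.
  apply: eq_integral => t _; rewrite patchE mem_itvE; case: ifPn => tI.
    rewrite -Rintegral_patchZ; last exact: integrable_continuous_itv.
    apply: eq_integral => s _; rewrite /= /h /F patchE mem_itvE tI /= /Z !patchE !mem_itvE.
    have /andP[t0 tT] := tI; case: (leP t s) => ts/=; last by [].
    by rewrite (le_trans t0 ts).
  rewrite -[RHS](@integral0 _ _ _ leb setT); apply: eq_integral => s _.
  by rewrite /= /h /F patchE mem_itvE (negPf tI) mul0r.
have E2 : (\int[leb]_s \int[leb]_t (EFin \o h) (t, s) =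
    \int[leb]_s (((fun s => z s * \int[leb]_(t in `[0, s]) f t)%R \_ `[0%R, T]) s)%:E)%E.
  apply: eq_integral => s _; rewrite patchE mem_itvE; case: ifPn => sI.
    have /andP[s0 sT] := sI.
    rewrite -Rintegral_patchZ; last first.
      apply: integrableS fi => // t /=; rewrite !in_itv/= => /andP[-> ts]; exact: le_trans ts sT.
    apply: eq_integral => t _; rewrite /= /h /F patchE mem_itvE /= /Z !patchE !mem_itvE sI.
    case: (leP t s) => ts/=; last by rewrite andbF !mulr0.
    by rewrite (le_trans ts sT) !andbT mulrC; case: ifP.
  rewrite -[RHS](@integral0 _ _ _ leb setT); apply: eq_integral => t _.
  by rewrite /= /h /Z patchE mem_itvE (negPf sI) if_same mulr0.
rewrite Rintegral_mkcond [RHS]Rintegral_mkcond /Rintegral -E1 -E2; congr fine.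
exact/esym/Fubini.
Qed.

Variables (g f zeta z : R -> R) (T : R).
Hypothesis T0 : 0 < T.
Hypothesis cg : continuous g.
Hypothesis fi : leb.-integrable `[0%R, T] (EFin \o f).
Hypothesis weak_deriv_gf : forall eta, time_test T eta ->
  \int[leb]_(t in `[0, T]) (eta^`()%classic t * g t) +
  \int[leb]_(t in `[0, T]) (eta t * f t) = 0.
Hypothesis cz : continuous z.
Hypothesis czeta : continuous zeta.
Hypothesis zetaE : forall t, 0 <= t <= T -> zeta t = zeta 0 + \int[leb]_(s in `[0, t]) z s.

Lemma integrable_mul_continuous : leb.-integrable `[0%R, T] (EFin \o (fun t => f t * zeta t)).
Proof.
have [B zB] := continuous_bounded_itv (ltW T0) czeta.
apply: (le_integrable _ _ _ (integrable_scale B _ fi)) => //.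
  apply/measurable_EFinP; apply: measurable_funM.
    by apply/measurable_EFinP; exact: (@measurable_int _ _ _ leb).
  by apply: measurable_funTS; exact: continuous_measurable_fun.
move=> t; rewrite /= in_itv/= => tI; rewrite lee_fin normrM [`|B * _|]normrM mulrC.
by apply: ler_wpM2r => //; apply: le_trans (zB t tI) (ler_norm _).
Qed.

(** On [0, T] both g and zeta are primitives, by [dubois] and [zetaE]. As f is merely integrable,
    Fubini on the triangle takes the place of the product rule. *)
Lemma weak_ibp : g T = 0 ->
  \int[leb]_(t in `[0, T]) (f t * zeta t + g t * z t) = - (g 0 * zeta 0).
Proof.
move=> gT; have gE := dubois T0 cg fi weak_deriv_gf.
have T00 := ltW T0; have TT : 0 <= T <= T by rewrite T00 lexx.
have fzi := integrable_mul_continuous.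
have gzi : leb.-integrable `[0%R, T] (EFin \o (fun t => g t * z t)).
  by apply: integrable_continuous_itv => t; apply: continuousM; [exact: cg|exact: cz].
have zi : leb.-integrable `[0%R, T] (EFin \o z) by exact: integrable_continuous_itv.
have hT t : 0 <= t <= T -> \int[leb]_(s in `[t, T]) z s = zeta T - zeta t.
  move=> tI; have /andP[t0 tT] := tI; rewrite (zetaE TT) (zetaE tI).
  have := @Rintegral_itvB R z (BLeft 0) (BRight T) t zi; rewrite !bnd_simp => /(_ t0 tT) E.
  rewrite -[LHS]Rintegral_itv_obnd_cbnd; first by rewrite -E; ring.
  by apply: integrableS zi => // s /=; rewrite !in_itv/= => /andP[h1 ->]; rewrite (le_trans t0 (ltW h1)).
have X := Rintegral_exchange T00 fi cz.
have L : \int[leb]_(s in `[0, T]) (z s * \int[leb]_(t in `[0, s]) f t) =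
   \int[leb]_(s in `[0, T]) (g s * z s) - g 0 * \int[leb]_(s in `[0, T]) z s.
  rewrite -RintegralZl// -RintegralB//; last by apply: integrable_scale.
  by apply: eq_Rintegral => s; rewrite mem_itvE => sI; rewrite -gE//; ring.
have Rr : \int[leb]_(t in `[0, T]) (f t * \int[leb]_(s in `[t, T]) z s) =
   zeta T * \int[leb]_(t in `[0, T]) f t - \int[leb]_(t in `[0, T]) (f t * zeta t).
  rewrite -RintegralZl// -RintegralB//; last by apply: integrable_scale.
  by apply: eq_Rintegral => t; rewrite mem_itvE => tI; rewrite hT//; ring.
have GT := gE T TT; have ZT := zetaE TT.
rewrite RintegralD//; move: L Rr; rewrite X => ->; rewrite -GT gT.
move: ZT; move: (\int[leb]_(t in `[0, T]) z t) (\int[leb]_(t in `[0, T]) (f t * zeta t)) (\int[leb]_(t in `[0, T]) (g t * z t)).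
by move: (zeta T) (zeta 0) (g 0) => zT z0 g0 x y w ->; move=> E; rewrite -(subrK (g0 * x) w) E; ring.
Qed.

End weak_ibp.

(** * The weak formulation *)

Section dominated_nonmeas.
Variables (dd : measure_display) (T : measurableType dd) (R : realType).
Variable nu : {measure set T -> \bar R}.
Implicit Types (D : set T).

Lemma ge0_ae_le_integral_measl D (f g : T -> \bar R) : measurable D ->
  (forall x, D x -> 0 <= f x)%E -> (forall x, D x -> 0 <= g x)%E -> measurable_fun D f ->
  {ae nu, forall x, D x -> (f x <= g x)%E} -> (\int[nu]_(x in D) f x <= \int[nu]_(x in D) g x)%E.
Proof.
move=> mD f0 g0 mf [N [mN N0 fgN]].
pose h x := (if x \in N then 0 else f x)%E.
have mh : measurable_fun D h.
  apply: measurable_fun_if => //; first exact: measurable_mem.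
  by apply: measurable_funS mf => // x [].
have -> : (\int[nu]_(x in D) f x = \int[nu]_(x in D) h x)%E.
  apply: ae_eq_integral => //; exists N; split => // x /= hx; apply: contrapT => xN; apply: hx => Dx.
  by rewrite /h memNset.
apply: ge0_le_integral_nonmeas => x Dx; rewrite /h; case: ifPn => [_|/negP xN]//; try exact: g0; try exact: f0.
by apply: contrapT => fg'; apply: xN; apply: mem_set; apply: fgN => H; apply: fg'; exact: H.
Qed.

Lemma integrable_nonmeas_bound D (f : T -> R) (N : T -> \bar R) (C : R) : measurable D -> 0 < C ->
  measurable_fun D f -> {ae nu, forall x, D x -> (`|f x|%:E <= C%:E * N x)%E} ->
  (forall x, D x -> 0 <= N x)%E -> (\int[nu]_(x in D) N x < +oo)%E ->
  nu.-integrable D (EFin \o f).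
Proof.
move=> mD C0 mf fN N0 Noo.
have I : nu.-integrable D (EFin \o (fun x => C^-1 * f x)).
  have m : measurable_fun D (EFin \o (fun x => C^-1 * f x)).
    by apply/measurable_EFinP; apply: measurable_funM.
  apply/integrableP; split => //; apply: le_lt_trans Noo.
  apply: ge0_ae_le_integral_measl => //; first exact: measurableT_comp.
  apply: filterS fN => x H Dx; rewrite /= normrM gtr0_norm ?invr_gt0//.
  have := H Dx; have := N0 x Dx; case: (N x) => [y| |]//; last by move=> _ _; rewrite leey.
  by rewrite -EFinM !lee_fin => _; rewrite ler_pdivrMl.
rewrite (_ : EFin \o f = EFin \o (fun x => C * (C^-1 * f x))); first exact: integrable_scale.
by apply/funext => x /=; rewrite mulrA divff ?gt_eqF// mul1r.
Qed.

(** The dominating N, in practice a norm of the test function at time t, need not be measurable. The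
    supremum of the |F_n| / C is measurable and lies below N almost everywhere, so it dominates in
    its place; F' is a measurable version of the limit. *)
Lemma dominated_convergence_nonmeas D (F_ : nat -> T -> R) (F : T -> R) (N : T -> \bar R) (C : R) :
  measurable D -> 0 < C -> (forall n, measurable_fun D (F_ n)) ->
  {ae nu, forall x, D x -> F_ n x @[n --> \oo] --> F x} ->
  {ae nu, forall x, D x -> forall n, (`|F_ n x|%:E <= C%:E * N x)%E} ->
  (forall x, D x -> 0 <= N x)%E -> (\int[nu]_(x in D) N x < +oo)%E ->
  exists F', [/\ nu.-integrable D (EFin \o F'), {ae nu, forall x, D x -> F' x = F x} &
    \int[nu]_(x in D) F_ n x @[n --> \oo] --> \int[nu]_(x in D) F' x].
Proof.
move=> mD C0 mF FF FN N0 Noo.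
have [Z [mZ Z0 ZF]] := FF.
have cF x : D x -> ~ Z x -> F_ n x @[n --> \oo] --> F x.
  by move=> Dx Zx; apply: contrapT => H; apply: Zx; apply: ZF => H'; apply: H; exact: H'.
pose F' x := if x \in Z then 0 else F x.
have mF' : measurable_fun D F'.
  apply: (@measurable_fun_cvg _ _ _ _ (fun n x => if x \in Z then 0 else F_ n x)).
    move=> n; apply: measurable_fun_if => //; first exact: measurable_mem.
    by apply: measurable_funS (mF n) => // x [].
  move=> x Dx; rewrite /F'; case: ifPn => [_|/negP xZ]; first exact: cvg_cst.
  by apply: cF => // Zx; apply: xZ; exact: mem_set.
pose h x := esups (fun n => (C^-1 * `|F_ n x|)%:E) 0.
have hn x n : ((C^-1 * `|F_ n x|)%:E <= h x)%E.
  by apply: ereal_sup_ubound; exists n.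
have h0 x : (0 <= h x)%E by apply: le_trans (hn x 0%N); rewrite lee_fin mulr_ge0// invr_ge0 ltW.
have mh : measurable_fun D h.
  apply: measurable_fun_esups => n; apply/measurable_EFinP; apply: measurable_funM => //.
  exact: measurableT_comp (mF n).
have hi : nu.-integrable D h.
  apply/integrableP; split => //; apply: le_lt_trans Noo.
  apply: ge0_ae_le_integral_measl => //; first exact: measurableT_comp.
  apply: filterS FN => x H Dx; rewrite gee0_abs//; apply: ub_ereal_sup => _ [n _ <-] /=.
  have := H Dx n; have := N0 x Dx; case: (N x) => [y| |]//; last by move=> _ _; rewrite leey.
  by rewrite -EFinM !lee_fin => _; rewrite ler_pdivrMl.
have aeF' : {ae nu, forall x, D x -> F' x = F x}.
  exists Z; split => // x /= hx; apply: contrapT => xZ; apply: hx => Dx.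
  by rewrite /F' memNset.
have cE : {ae nu, forall x, D x -> (EFin \o F_ n) x @[n --> \oo] --> (EFin \o F') x}.
  exists Z; split => // x /= hx; apply: contrapT => xZ; apply: hx => Dx.
  rewrite /F' memNset//; apply: cvg_EFin; [exact: nearW|exact: cF].
have bE : {ae nu, forall x n, D x -> (`|(EFin \o F_ n) x| <= C%:E * h x)%E}.
  apply: aeW => x n Dx; rewrite /= -(@lee_pmul2l _ C^-1%:E) ?fin_numE ?lte_fin ?invr_gt0//.
  by rewrite muleA -!EFinM mulVf ?gt_eqF// mul1e.
have hCi : nu.-integrable D (fun x => C%:E * h x)%E by exact: integrableZl.
have [F'i _ cv] := @dominated_convergence _ _ _ nu D mD (fun n => EFin \o F_ n)
  (EFin \o F') _ (fun n => (measurable_EFinP _ _).2 (mF n))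
  ((measurable_EFinP _ _).2 mF') cE hCi bE.
exists F'; split => //; apply: fine_cvg; rewrite fineK//; exact: integrable_fin_num.
Qed.

End dominated_nonmeas.

(** * Fourier coefficients of Bochner functions *)

Section coefficients.
Variables (R : realType) (d : nat).
Local Notation mu := (torus_measure R d).
Local Notation leb := (@lebesgue_measure R).
Local Notation L1 := (spaceL d (1 : R)%:E).
Implicit Types (f g : d.-tuple R -> R) (F : R -> d.-tuple R -> R) (s : simple R d)
  (k : d.-tuple int) (th t T : R).

Definition coef k th f : R := \int[mu]_x (f x * cos (phase k x + th)).

Lemma Lfun1P f : f \in Lfun mu 1%E <-> mu.-integrable setT (EFin \o f).
Proof. exact: Lfun1_integrable. Qed.

Lemma norm_integral_mul_le f g (B : R) : mu.-integrable setT (EFin \o f) ->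
  measurable_fun setT g -> (forall x, `|g x| <= B) ->
  (`|\int[mu]_x (f x * g x)|%:E <= B%:E * 'N[mu]_1[EFin \o f])%E.
Proof.
move=> fi mg gB.
have fgi : mu.-integrable setT (EFin \o (fun x => f x * g x)) by exact: (integrable_mul_bounded (M := B)).
have B0 : 0 <= B by exact: le_trans (gB [tuple of nseq d 0]).
apply: (@le_trans _ _ (\int[mu]_x `|f x * g x|)%:E); first by rewrite lee_fin; exact: le_normr_Rintegral.
have fgn := integrable_norm fgi.
rewrite /Rintegral fineK; last exact: (integrable_fin_num measurableT fgn).
rewrite Lnorm1 -ge0_integralZl//; last first.
  by apply: measurableT_comp => //; exact: (@measurable_int _ _ _ mu).
apply: ge0_le_integral => //.
- by apply: (@measurable_int _ _ _ mu); exact: fgn.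
- apply: emeasurable_funM => //; apply: measurableT_comp => //; exact: (@measurable_int _ _ _ mu).
by move=> x _; rewrite /= -EFinM lee_fin normrM mulrC ler_wpM2r.
Qed.

Lemma coef_le k th f : mu.-integrable setT (EFin \o f) ->
  (`|coef k th f|%:E <= 'N[mu]_1[EFin \o f])%E.
Proof.
move=> fi; rewrite -[leRHS]mul1e; apply: norm_integral_mul_le => //.
  exact: measurable_cos_phase.
by move=> x; exact: norm_cos_le1.
Qed.

Lemma coefB k th f g : mu.-integrable setT (EFin \o f) -> mu.-integrable setT (EFin \o g) ->
  coef k th (f \- g) = coef k th f - coef k th g.
Proof.
move=> fi gi; rewrite /coef -RintegralB//; try exact: integrable_mul_cos_phase.
by apply: eq_Rintegral => x _; rewrite mulrBl.
Qed.

Lemma coefZ k th (a : R) f : mu.-integrable setT (EFin \o f) ->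
  coef k th (fun x => a * f x) = a * coef k th f.
Proof.
move=> fi; rewrite /coef -RintegralZl//; last exact: integrable_mul_cos_phase.
by apply: eq_Rintegral => x _; rewrite mulrA.
Qed.

Lemma coef_sum k th (J : Type) (r : seq J) (a : J -> R) (h : J -> d.-tuple R -> R) :
  (forall j, mu.-integrable setT (EFin \o h j)) ->
  coef k th (fun x => \sum_(j <- r) a j * h j x) = \sum_(j <- r) a j * coef k th (h j).
Proof.
move=> hi; rewrite /coef.
transitivity (\int[mu]_x (\sum_(j <- r) (a j * (h j x * cos (phase k x + th))))).
  by apply: eq_Rintegral => x _; rewrite mulr_suml; apply: eq_bigr => j _; rewrite mulrA.
have I j := integrable_mul_cos_phase k th (hi j).
rewrite Rintegral_bigsum//; last by move=> j; exact: integrable_scale.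
by apply: eq_bigr => j _; rewrite RintegralZl.
Qed.

Lemma simple_integrable s j : simple_in L1 s -> mu.-integrable setT (EFin \o @simple_val R d s j).
Proof. by move=> /(_ j)[_ /Lfun1P]. Qed.

Lemma simple_fun_integrable s t : simple_in L1 s -> mu.-integrable setT (EFin \o simple_fun s t).
Proof.
move=> sL; apply: integrable_bigsum => // j; apply: integrable_scale => //; exact: simple_integrable.
Qed.

Lemma simple_integral_integrable s T : simple_in L1 s ->
  mu.-integrable setT (EFin \o simple_integral T s).
Proof.
move=> sL; apply: integrable_bigsum => // j; apply: integrable_scale => //; exact: simple_integrable.
Qed.

Lemma coef_simple k th s t : simple_in L1 s ->
  coef k th (simple_fun s t) = \sum_(j < simple_len s) \1_(simple_set j) t * coef k th (simple_val j).
Proof. by move=> sL; apply: coef_sum => j; exact: simple_integrable. Qed.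

Lemma indic_integrable_itv (A : set R) T : measurable A -> leb.-integrable `[0%R, T] (EFin \o \1_A).
Proof.
move=> mA; apply: (le_integrable _ _ _ (integrable_continuous_itv 0 T (@cst_continuous _ _ (1 : R)))) => //.
  by apply/measurable_EFinP; exact: measurable_indic.
by move=> t _; rewrite /= lee_fin normr1 indicE; case: (_ \in _); rewrite ?normr1 ?normr0.
Qed.

Lemma coef_simple_integrable k th s T : simple_in L1 s ->
  leb.-integrable `[0%R, T] (EFin \o (fun t => coef k th (simple_fun s t))).
Proof.
move=> sL; rewrite (_ : (fun t => _) = (fun t => \sum_(j < simple_len s) (coef k th (simple_val j) * \1_(simple_set j) t))).
  apply: integrable_bigsum => // j; apply: integrable_scale => //; apply: indic_integrable_itv.
  by have [] := sL j.
by apply/funext => t; rewrite coef_simple//; apply: eq_bigr => j _; rewrite mulrC.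
Qed.

Lemma integral_coef_simple k th s T : simple_in L1 s ->
  \int[leb]_(t in `[0, T]) coef k th (simple_fun s t) = coef k th (simple_integral T s).
Proof.
move=> sL; rewrite [RHS]coef_sum; last by move=> j; exact: simple_integrable.
transitivity (\int[leb]_(t in `[0, T]) (\sum_(j < simple_len s) (coef k th (simple_val j) * \1_(simple_set j) t))).
  by apply: eq_Rintegral => t _; rewrite coef_simple//; apply: eq_bigr => j _; rewrite mulrC.
have I (j : 'I_(simple_len s)) : leb.-integrable `[0%R, T] (EFin \o \1_(simple_set j)).
  by apply: indic_integrable_itv; have [] := sL j.
rewrite Rintegral_bigsum//; last by move=> j; apply: integrable_scale => //; exact: I.
apply: eq_bigr => j _; rewrite (RintegralZl _ _ (I j))//.
by rewrite mulrC /Rintegral integral_indic//; have [] := sL j.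
Qed.

Lemma coef_cvg k th f (g : nat -> d.-tuple R -> R) : mu.-integrable setT (EFin \o f) ->
  (forall n, mu.-integrable setT (EFin \o g n)) ->
  'N[mu]_1[EFin \o (f \- g n)%R]%E @[n --> \oo] --> 0%E ->
  coef k th (g n) @[n --> \oo] --> coef k th f.
Proof.
move=> fi gi H; apply/cvgrPdist_le => e e0.
have N : \forall n \near \oo, ('N[mu]_1[EFin \o (f \- g n)%R] <= e%:E)%E.
  exact: (@cvge0_near R nat \oo _ _ e H e0).
apply: filterS N => n hn.
rewrite -coefB// -lee_fin; apply: le_trans hn; apply: coef_le.
exact: (integrable_sub _ fi (gi n)).
Qed.

(** At almost every time the simple approximations converge in L^1, hence so do all their
    coefficients. One set Z of exceptional times serves every frequency, and coefficients are set to
    0 on it. *)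
Lemma coef_measurable T F : strongly_measurable T L1 F ->
  exists Z : set R, [/\ measurable Z, leb Z = 0,
    forall t, `[0, T]%classic t -> ~ Z t -> F t \in Lfun mu 1%E &
    forall k th, measurable_fun `[0, T]%classic (fun t => if t \in Z then 0 else coef k th (F t))].
Proof.
move=> [s [sL [Z1 [mZ1 Z10 Z1P]] [Z2 [mZ2 Z20 Z2P]]]].
have H1 t : `[0, T]%classic t -> ~ Z1 t -> F t \in Lfun mu 1%E.
  by move=> tI nZ; apply: contrapT => H; apply: nZ; apply: Z1P => H'; apply: H; exact: H'.
have H2 t : `[0, T]%classic t -> ~ Z2 t -> fnorm L1 (F t \- simple_fun (s n) t) @[n --> \oo] --> 0%E.
  by move=> tI nZ; apply: contrapT => H; apply: nZ; apply: Z2P => H'; apply: H; exact: H'.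
exists (Z1 `|` Z2); split.
- exact: measurableU.
- by apply: null_set_setU.
- by move=> t tI /not_orP[z1 _]; exact: H1.
move=> k th.
apply: (@measurable_fun_cvg _ _ _ _ (fun n t => if t \in Z1 `|` Z2 then 0 else coef k th (simple_fun (s n) t))).
  move=> n; apply: measurable_fun_if => //; first by apply: measurable_mem => //; exact: measurableU.
  have mc : measurable_fun `[0, T]%classic (fun t => coef k th (simple_fun (s n) t)).
    by apply/measurable_EFinP; apply: (@measurable_int _ _ _ leb); exact: coef_simple_integrable.
  by apply: measurable_funS mc => // x [].
move=> t tI; case: ifPn => [_|/negP tZ]; first exact: cvg_cst.
have [z1 z2] : ~ Z1 t /\ ~ Z2 t by apply/not_orP => H; apply: tZ; exact/mem_set.
apply: coef_cvg; first by apply/Lfun1P; exact: H1.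
  by move=> n; exact: simple_fun_integrable.
exact: H2.
Qed.

(** A Fourier coefficient is a bounded functional on L^1: it commutes with the integral of simple
    functions and then with the limit. *)
Lemma coef_bochner_integral T F I (G : R -> R) k th : has_bochner_integral T L1 F I ->
  leb.-integrable `[0%R, T] (EFin \o G) ->
  {ae leb, forall t, `[0, T]%classic t -> G t = coef k th (F t)} ->
  \int[leb]_(t in `[0, T]) G t = coef k th I.
Proof.
move=> [IL [s [[sL sF _] sI sJ]]] Gi GF.
have ci n := coef_simple_integrable k th T (sL n).
apply: (@rcvg_unique _ (fun n => coef k th (simple_integral T (s n)))); last first.
  apply: coef_cvg => //; first by apply/Lfun1P.
  by move=> n; exact: simple_integral_integrable.
apply/cvgrPdist_le => e e0.
have N : \forall n \near \oo, (\int[leb]_(t in `[0%R, T]) fnorm L1 (F t \- simple_fun (s n) t)%R <= e%:E)%E.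
  exact: (@cvge0_near R nat \oo _ _ e sI e0).
apply: filterS N => n hn.
rewrite -integral_coef_simple// -(RintegralB _ Gi (ci n))//.
rewrite -lee_fin; apply: le_trans hn.
have di : leb.-integrable `[0%R, T] (EFin \o (fun t => G t - coef k th (simple_fun (s n) t))).
  exact: integrable_sub.
apply: (@le_trans _ _ (\int[leb]_(t in `[0, T]) `|G t - coef k th (simple_fun (s n) t)|)%:E).
  by rewrite lee_fin; exact: le_normr_Rintegral.
rewrite EFin_Rintegral//; last exact: (integrable_norm di).
apply: ge0_ae_le_integral_measl => //.
- by move=> t _; exact: Lnorm_ge0.
- by apply: (@measurable_int _ _ _ leb); exact: (integrable_norm di).
apply: (@filterS2 _ _ (ae_filter_ringOfSetsType leb) _ _ _ _ GF sF) => t H1 H2 tI.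
have Fi : mu.-integrable setT (EFin \o F t) by apply/Lfun1P; exact: H2.
have si := simple_fun_integrable t (sL n).
rewrite H1// -coefB//; apply: coef_le; exact: (integrable_sub _ Fi si).
Qed.

End coefficients.

Section time_identities.
Variables (R : realType) (d : nat).
Local Notation mu := (torus_measure R d).
Local Notation leb := (@lebesgue_measure R).
Local Notation K := (d.-tuple int).
Local Notation q := (@freq_norm R d).
Local Notation L1 := (spaceL d (1 : R)%:E).
Implicit Types (k : K) (th s t T a b : R) (phi psi : R -> d.-tuple R -> R).

Definition rot a b (z : R[i]) : R := a * complex.Re z + b * complex.Im z.

(** The projection onto [0, T]: it turns continuity within the interval into continuity on the
    line. *)
Definition clamp T t : R := Num.max (Num.min t T) 0.

Lemma clamp_itv T t : 0 <= T -> 0 <= clamp T t <= T.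
Proof. by move=> T0; rewrite /clamp le_max lexx ge_max T0 ge_min lexx !orbT. Qed.

Lemma clamp_id T t : 0 <= t <= T -> clamp T t = t.
Proof. by move=> /andP[t0 tT]; rewrite /clamp min_l// max_l. Qed.

Lemma continuous_clamp T : continuous (clamp T).
Proof.
rewrite (_ : clamp T = (fun t => Num.max (Num.min t T) 0))// => t.
have cm : {for t, continuous (fun t => Num.min t T)}.
  by apply: continuous_min; [exact: cvg_id|exact: cvg_cst].
have c0 : {for t, continuous (fun _ : R => 0 : R)} by exact: cvg_cst.
exact: (continuous_max cm c0).
Qed.

Lemma coef_clamp_continuous T phi k th : 0 <= T -> bochner_C T L1 phi ->
  continuous (fun t => coef k th (phi (clamp T t))).
Proof.
move=> T0 H t; have cI s : `[0, T]%classic (clamp T s) by rewrite /= in_itv/= clamp_itv.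
have Li s : mu.-integrable setT (EFin \o phi (clamp T s)) by apply/Lfun1P; have [] := H _ (cI s).
apply/cvgrPdist_le => e e0.
have [_ C] := H _ (cI t).
have N : \forall s \near within `[0, T]%classic (nbhs (clamp T t)),
    (fnorm L1 (phi s \- phi (clamp T t))%R <= e%:E)%E by exact: (@cvge0_near R R _ _ _ e C e0).
have N' : \forall s \near clamp T t, `[0, T]%classic s -> (fnorm L1 (phi s \- phi (clamp T t))%R <= e%:E)%E.
  exact: N.
have N'' : \forall s \near t, `[0, T]%classic (clamp T s) ->
    (fnorm L1 (phi (clamp T s) \- phi (clamp T t))%R <= e%:E)%E by exact: (@continuous_clamp T t _ N').
apply: filterS N'' => s /(_ (cI s)) h.
rewrite distrC -coefB// -lee_fin; apply: le_trans h; apply: coef_le.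
exact: (integrable_sub _ (Li s) (Li t)).
Qed.

Lemma bochner_L1_integral T (E : funSpace R d) psi : (forall t, 0 <= fnorm E (psi t))%E ->
  bochner_L 1 T E psi -> (\int[leb]_(t in `[0%R, T]) fnorm E (psi t) < +oo)%E.
Proof.
move=> E0 [_]; rewrite Lnorm1; apply: le_lt_trans; rewrite [leLHS]integral_mkcond.
apply: ge0_le_integral_nonmeas => t _; first by rewrite patchE; case: ifPn.
by rewrite lee_abs.
Qed.

Lemma time_test_continuous T eta : time_test T eta ->
  continuous eta /\ continuous (eta^`()%classic : R -> R).
Proof.
move=> [H _]; split => t.
  have := H 0%N t; rewrite derive1n0 => D.
  by apply: differentiable_continuous; exact/derivable1_diffP.
have := H 1%N t; rewrite derive1n1 => D.
by apply: differentiable_continuous; exact/derivable1_diffP.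
Qed.

(** Taking a coefficient of the vector-valued time derivative produces the scalar weak derivative
    required by [dubois]. *)
Lemma time_weak T phi psi (Z : set R) k th : 0 < T -> bochner_C T L1 phi ->
  is_time_deriv T L1 phi psi -> measurable Z -> leb Z = 0 ->
  (forall t, `[0, T]%classic t -> ~ Z t -> psi t \in Lfun mu 1%E) ->
  leb.-integrable `[0%R, T] (EFin \o (fun t => if t \in Z then 0 else coef k th (psi t))) ->
  forall eta, time_test T eta ->
  \int[leb]_(t in `[0, T]) (eta^`()%classic t * coef k th (phi (clamp T t))) +
  \int[leb]_(t in `[0, T]) (eta t * (if t \in Z then 0 else coef k th (psi t))) = 0.
Proof.
move=> T0 C D mZ Z0 psiL fi eta he.
have [ce ce'] := time_test_continuous he.
have [I [H1 H2]] := D eta he.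
have Ii : mu.-integrable setT (EFin \o I) by apply/Lfun1P; have [] := H1.
have cg := @coef_clamp_continuous T phi k th (ltW T0) C.
rewrite (@coef_bochner_integral _ _ _ _ _ _ k th H1); first last.
- apply: aeW => t tI; have tI' : 0 <= t <= T by move: tI; rewrite /= in_itv.
  rewrite clamp_id// coefZ//; apply/Lfun1P; by have [] := C t tI.
- by apply: integrable_continuous_itv => t; apply: continuousM; [exact: ce'|exact: cg].
rewrite (@coef_bochner_integral _ _ _ _ _ _ k th H2); first last.
- exists Z; split => // t /= ht; apply: contrapT => tZ; apply: ht => tI.
  by rewrite memNset// coefZ//; apply/Lfun1P; exact: psiL.
- rewrite (_ : (fun t => _) = (fun t => (if t \in Z then 0 else coef k th (psi t)) * eta t)); last first.
    by apply/funext => t; rewrite mulrC.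
  exact: integrable_mul_continuous.
have -> : coef k th (fun x => - I x) = - coef k th I; last by rewrite subrr.
rewrite -[RHS]mulN1r -coefZ//; congr (coef _ _ _); by apply/funext => x; rewrite mulN1r.
Qed.

Variables (c0 : K -> R[i]) (c : R -> K -> R[i]) (M : K -> R).
Variables (creg : regular c) (Mm : majorant M) (cM : below c M).
Variable cfix : forall t k, c t k = mild_map c0 c t k.

Lemma continuous_rot_c a b k : continuous (fun t => rot a b (c t k)).
Proof.
have [_ _ cR cI] := creg.
exact: (@continuous_comb R a b _ _ (cR k) (cI k)).
Qed.

Definition rate a b k t : R := - q k ^+ 4 * (rot a b (c t k) + rot a b (nonlin (c t) k)).

Lemma continuous_rate a b k : continuous (rate a b k).
Proof.
move=> t; apply: (@continuousM _ _ (cst (- q k ^+ 4)) (fun t => rot a b (c t k) + rot a b (nonlin (c t) k))).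
  exact: cst_continuous.
apply: (@continuousD _ _ _ (fun t => rot a b (c t k)) (fun t => rot a b (nonlin (c t) k))).
  exact: continuous_rot_c.
exact: (@continuous_rot R d c M k a b creg Mm cM).
Qed.

Lemma mode_ode a b k t : 0 <= t ->
  rot a b (c t k) = rot a b (c 0 k) + \int[leb]_(s in `[0, t]) rate a b k s.
Proof.
move=> t0.
pose y := duh (q k ^+ 4) (rot a b (c0 k)) (fun s => rot a b (nonlin (c s) k)).
have cN := @continuous_rot R d c M k a b creg Mm cM.
have E s : 0 <= s -> rot a b (c s k) = y s.
  by move=> s0; rewrite cfix /rot (mild_rot c0 s k a b creg Mm cM) max_l.
have Hd s : 0 <= s <= t -> is_derive s 1 y (rate a b k s).
  move=> /andP[s0 _]; have s1 : -1 < s by apply: lt_le_trans s0; rewrite ltrN10.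
  have -> : rate a b k s = - q k ^+ 4 * (y s + rot a b (nonlin (c s) k)) by rewrite /rate (E s s0).
  exact: (@is_derive_duh R (q k ^+ 4) (rot a b (c0 k)) (fun s => rot a b (nonlin (c s) k)) s cN s1).
have cr s : 0 <= s <= t -> {for s, continuous (rate a b k)} by move=> _; exact: continuous_rate.
have -> : \int[leb]_(s in `[0, t]) rate a b k s = y t - y 0.
  clearbody y; move: (rate a b k) Hd cr => z Hd cr; exact: (FTC2_at t0 Hd cr).
by rewrite -E// -E//; rewrite addrC subrK.
Qed.

Lemma mode_weak T phi psi (Z : set R) k th a b : 0 < T -> test_function T phi psi ->
  measurable Z -> leb Z = 0 ->
  (forall t, `[0, T]%classic t -> ~ Z t -> psi t \in Lfun mu 1%E) ->
  leb.-integrable `[0%R, T] (EFin \o (fun t => if t \in Z then 0 else coef k th (psi t))) ->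
  \int[leb]_(t in `[0, T]) ((if t \in Z then 0 else coef k th (psi t)) * rot a b (c t k) +
    coef k th (phi (clamp T t)) * rate a b k t) =
  - (coef k th (phi 0) * rot a b (c 0 k)).
Proof.
move=> T0 [_ D _ C phiT] mZ Z0 psiL fi; have T00 := ltW T0.
have := @weak_ibp R _ _ _ _ T T0 (@coef_clamp_continuous T phi k th T00 C) fi
  (time_weak T0 C D mZ Z0 psiL fi) (@continuous_rate a b k) (@continuous_rot_c a b k).
rewrite !clamp_id ?lexx ?T00//; apply.
  by move=> t /andP[t0 _]; exact: mode_ode.
(* The endpoint term at T vanishes because [phi T] is 0 almost everywhere. *)
have phiTL : mu.-integrable setT (EFin \o phi T).
  by apply/Lfun1P; have [] := C T; rewrite //= in_itv/= T00 lexx.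
rewrite /coef /Rintegral (_ : (\int[mu]_x _)%E = 0%E)//.
rewrite -(@integral0 _ _ _ mu setT); apply: ae_eq_integral => //.
  by apply: (@measurable_int _ _ _ mu); exact: integrable_mul_cos_phase.
by apply: filterS phiT => x Hx _; rewrite Hx mul0r.
Qed.

End time_identities.

Section termwise.
Variables (R : realType) (d : nat).
Local Notation mu := (torus_measure R d).
Local Notation leb := (@lebesgue_measure R).
Local Notation K := (d.-tuple int).
Local Notation q := (@freq_norm R d).
Local Notation L1 := (spaceL d (1 : R)%:E).
Implicit Types (k : K) (z : K -> R[i]) (f p b v : d.-tuple R -> R).

Lemma measurable_psum (D : set R) (F : R -> K -> R) n :
  (forall k, measurable_fun D (fun t => F t k)) -> measurable_fun D (fun t => psum (F t) n).
Proof.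
move=> mF; apply: measurable_sum => j; by case: (pickle_inv j) => [k|]//=.
Qed.

Lemma Rintegral_psum (D : set R) (F : R -> K -> R) n : measurable D ->
  (forall k, leb.-integrable D (EFin \o (fun t => F t k))) ->
  \int[leb]_(t in D) psum (F t) n = psum (fun k => \int[leb]_(t in D) F t k) n.
Proof.
move=> mD Fi; rewrite /psum Rintegral_bigsum//; last first.
  move=> j; case: (pickle_inv j) => [k|]; [exact: Fi|exact: integrable0].
apply: eq_bigr => j _; case: (pickle_inv j) => [k|]//=.
by rewrite /Rintegral integral0.
Qed.

Lemma psum_mode_le z f n : mu.-integrable setT (EFin \o f) -> (asum (cabs z) <= 1)%E ->
  (`|psum (fun k => \int[mu]_x (f x * mode (z k) k x)) n|%:E <= 'N[mu]_1[EFin \o f])%E.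
Proof.
move=> fi z1.
have Nf : 'N[mu]_1[EFin \o f]%E \is a fin_num.
  rewrite ge0_fin_numE ?Lnorm_ge0// Lnorm1.
  by have /integrableP[] := fi.
pose r := fine ('N[mu]_1[EFin \o f]%E).
have rE : r%:E = 'N[mu]_1[EFin \o f]%E by rewrite fineK.
have r0 : 0 <= r by rewrite fine_ge0// Lnorm_ge0.
rewrite -rE lee_fin.
apply: (@le_trans _ _ (psum (fun k => r * cabs z k) n)).
  apply: norm_psum_le => k; rewrite -lee_fin EFinM rE muleC.
  apply: norm_integral_mul_le => //; first exact: measurable_mode.
  by move=> x; exact: norm_mode_le.
rewrite psumZ -[leRHS]mulr1; apply: ler_wpM2l => //.
by rewrite -lee_fin; apply: le_trans (psum_asum n (cabs_ge0 z)) z1.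
Qed.

Lemma asum_nonlin_le z : hermitian z -> (asum (cabs z) <= (5^-1)%:E)%E ->
  (asum (cabs (nonlin z)) <= (25^-1)%:E)%E.
Proof.
move=> zh z5; have h : (5^-1 : R) <= 1 by rewrite invf_le1// ler1n.
by have := asum_ftabs_expT2 zh z5 h; rewrite (_ : 5^-1 ^+ 2 = 25^-1)//; rewrite exprVn -natrX.
Qed.

(** If z are the coefficients of p, these are the coefficients of e^p - 1, the linear part being
    added back to the nonlinearity. *)
Definition esource z k : R[i] := z k + nonlin z k.

Lemma csummable_esource z : hermitian z -> (asum (cabs z) <= (5^-1)%:E)%E ->
  csummable (esource z) /\ (asum (cabs (esource z)) <= 1)%E.
Proof.
move=> zh z5.
have H : (asum (cabs (esource z)) <= (5^-1 + 25^-1)%:E)%E.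
  apply: (@le_trans _ _ (asum (fun k => cabs z k + cabs (nonlin z) k))).
    by apply: le_asum => k; exact: normcD_le.
  rewrite asumD; try exact: cabs_ge0.
  by rewrite EFinD; apply: leeD => //; exact: asum_nonlin_le.
split; first by apply: le_lt_trans H _; rewrite ltry.
by apply: le_trans H _; rewrite lee_fin; lra.
Qed.

Lemma csummable5 z : (asum (cabs z) <= (5^-1)%:E)%E -> csummable z.
Proof. by move=> z5; apply: le_lt_trans z5 _; rewrite ltry. Qed.

Lemma exp_wser z : hermitian z -> (asum (cabs z) <= (5^-1)%:E)%E ->
  {ae mu, forall x, expR (wser z x) = 1 + wser (esource z) x}.
Proof.
move=> zh z5; have zs := csummable5 z5.
have ns : csummable (nonlin z) by apply: le_lt_trans (asum_nonlin_le zh z5) _; rewrite ltry.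
have ei := integrable_bm (bm_expT_wser 2 zs).
apply: filterS (fourier_inversion ei ns) => x H.
rewrite (wserD x zs ns) -H /expT big_nat_recr//= big_nat1 expr0 expr1 /= !factE.
by rewrite invr1 !mul1r; lra.
Qed.

Lemma measurable_Rintegrable f : mu.-integrable setT (EFin \o f) -> measurable_fun setT f.
Proof. by move=> fi; apply/measurable_EFinP; exact: (@measurable_int _ _ _ mu). Qed.

(** Almost everywhere e^(-v) is 1 plus the series of [esource z], and the constant 1 drops out
    because b, in practice the bilaplacian of the test function, has integral 0. *)
Lemma inner_integral z p b v : hermitian z -> (asum (cabs z) <= (5^-1)%:E)%E ->
  mu.-integrable setT (EFin \o p) -> mu.-integrable setT (EFin \o b) ->
  \int[mu]_x b x = 0 -> {ae mu, forall x, v x = - wser z x} ->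
  \int[mu]_x (p x * v x + b x * expR (- v x)) =
  - (\int[mu]_x (p x * wser z x)) + \int[mu]_x (b x * wser (esource z) x).
Proof.
move=> zh z5 pI bI b0 vz; have zs := csummable5 z5.
have [es _] := csummable_esource zh z5.
have [mw [B wB]] := bm_wser zs; have [me [B' eB]] := bm_wser es.
have pwi : mu.-integrable setT (EFin \o (fun x => p x * wser z x)) by exact: (integrable_mul_bounded (M := B)).
have bei : mu.-integrable setT (EFin \o (fun x => b x * wser (esource z) x)) by exact: (integrable_mul_bounded (M := B')).
transitivity (\int[mu]_x ((-1) * (p x * wser z x) + (b x + b x * wser (esource z) x))).
  rewrite /Rintegral; congr fine; apply: ae_eq_integral_nonmeas => //.
    apply/measurable_EFinP; apply: measurable_funD.
      by apply: measurable_funM => //; exact: measurable_Rintegrable.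
    by apply: measurable_funD; exact: measurable_Rintegrable.
  apply: filterS2 vz (exp_wser zh z5) => x vx ex _.
  by rewrite vx opprK ex mulrDr mulr1 mulN1r mulrN.
rewrite RintegralD//; last 2 first.
- exact: integrable_scale.
- exact: integrable_add.
by rewrite RintegralD// b0 add0r RintegralZl// mulN1r.
Qed.

End termwise.

(** * Summation over frequencies *)

Section weak_formulation.
Variables (R : realType) (d : nat).
Local Notation mu := (torus_measure R d).
Local Notation leb := (@lebesgue_measure R).
Local Notation K := (d.-tuple int).
Local Notation q := (@freq_norm R d).
Local Notation L1 := (spaceL d (1 : R)%:E).
Local Notation W4 := (spaceW1 R d 4).
Implicit Types (k : K) (t : R) (f : d.-tuple R -> R).

Lemma W4_norm_ge0 f : (0 <= fnorm W4 f)%E.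
Proof. by apply: sume_ge0 => n _; apply: sume_ge0 => l _; exact: Lnorm_ge0. Qed.

Lemma weak_deriv_norm_le f (l : 4.-tuple 'I_d) : ('N[mu]_1[EFin \o weak_deriv l f] <= fnorm W4 f)%E.
Proof.
rewrite /= (bigD1 (Ordinal (isT : (4 < 5)%N)))//= (bigD1 l)//= -addeA leeDl//.
apply: adde_ge0; apply: sume_ge0 => n _; first exact: Lnorm_ge0.
by apply: sume_ge0 => l' _; exact: Lnorm_ge0.
Qed.

Lemma Lnorm1_sum (J : Type) (r : seq J) (h : J -> d.-tuple R -> R) (B : \bar R) : (0 <= B)%E ->
  (forall j, mu.-integrable setT (EFin \o h j)) ->
  (forall j, 'N[mu]_1[EFin \o h j] <= B)%E ->
  ('N[mu]_1[EFin \o (fun x => \sum_(j <- r) h j x)%R] <= (size r)%:R%:E * B)%E.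
Proof.
move=> B0 hi hB; elim: r => [|j r IH].
  rewrite Lnorm1 (eq_integral (cst 0%E)) ?integral0 ?mule_ge0//.
  by move=> x _; rewrite /= big_nil normr0.
have m i : measurable_fun setT (h i) by exact: measurable_Rintegrable.
have ms r' : measurable_fun setT (fun x => \sum_(j <- r') h j x) by apply: measurable_sum => i; exact: m.
rewrite Lnorm1 /=.
apply: (@le_trans _ _ (\int[mu]_x (`|(h j x)%:E| + `|(\sum_(j <- r) h j x)%:E|))%E).
  apply: ge0_le_integral => //.
  - by apply/measurable_EFinP; apply: measurableT_comp => //; exact: ms.
  - by apply: emeasurable_funD; apply: measurableT_comp => //; apply/measurable_EFinP.
  by move=> x _; rewrite big_cons -EFinD lee_fin; exact: ler_normD.
rewrite ge0_integralD//; last 2 first.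
- by apply: measurableT_comp => //; apply/measurable_EFinP.
- by apply: measurableT_comp => //; apply/measurable_EFinP; exact: ms.
rewrite -natr1 EFinD ge0_muleDl ?lee_fin// addeC mul1e; apply: leeD; first by rewrite Lnorm1 in IH.
by have := hB j; rewrite Lnorm1.
Qed.

Lemma bilaplacian_norm_le f : carrier W4 f ->
  ('N[mu]_1[EFin \o bilaplacian f] <= (d * d)%:R%:E * fnorm W4 f)%E.
Proof.
move=> [fL hf]; have W i j := weak_derivP (hf [:: i; i; j; j] isT).
have wi i j : mu.-integrable setT (EFin \o weak_deriv [:: i; i; j; j] f).
  by have [_ /integrable_Lfun1] := W i j.
have wn i j := weak_deriv_norm_le f [tuple i; i; j; j].
have sz : size (index_enum 'I_d) = d by rewrite -sum1_size sum_nat_const card_ord muln1.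
have I i : ('N[mu]_1[EFin \o (fun x => \sum_(j < d) weak_deriv [:: i; i; j; j] f x)%R] <= d%:R%:E * fnorm W4 f)%E.
  have := @Lnorm1_sum _ (index_enum 'I_d) _ _ (W4_norm_ge0 f) (wi i) (wn i).
  by rewrite sz.
have d0 : (0 <= d%:R%:E * fnorm W4 f)%E by rewrite mule_ge0 ?W4_norm_ge0// lee_fin.
have := @Lnorm1_sum _ (index_enum 'I_d) (fun i x => \sum_(j < d) weak_deriv [:: i; i; j; j] f x) _ d0 _ I.
rewrite sz natrM EFinM -muleA; apply.
by move=> i; exact: integrable_bigsum.
Qed.

Variables (c : R -> K -> R[i]) (M : K -> R).
Variables (creg : regular c) (Mm : majorant M) (cM : below c M).
Variables (T : R) (phi psi : R -> d.-tuple R -> R) (T0 : 0 < T).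
Variable tf : test_function T phi psi.

Let ch t : hermitian (c t). Proof. by have [H _ _ _] := creg. Qed.
Let c5 t : (asum (cabs (c t)) <= (5^-1)%:E)%E. Proof. exact: below_asum Mm cM. Qed.

Let T00 : 0 <= T := ltW T0.

Lemma phi_L1 t : 0 <= t <= T -> mu.-integrable setT (EFin \o phi t).
Proof.
by have [_ _ _ C _] := tf; move=> tI; apply/Lfun1P; have [] := C t; rewrite //= in_itv.
Qed.

Lemma phi_W4 : {ae leb, forall t, `[0, T]%classic t -> carrier W4 (phi t)}.
Proof. by have [_ _ [[s [_ H _]] _] _ _] := tf. Qed.

(** The k-th term in the pairing of the bilaplacian of phi with e^p - 1. With |k|^4 times a
    coefficient of phi in place of a coefficient of its bilaplacian, it is continuous in time; the
    two agree whenever phi t lies in W^{4,1}, see [bil_term_integral]. *)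
Definition bil_term t k : R := q k ^+ 4 *
  (rot 1 0 (esource (c t) k) * coef k 0 (phi (clamp T t)) +
   rot 0 1 (esource (c t) k) * coef k (pi / 2) (phi (clamp T t))).

Lemma rotD (a b : R) (z w : R[i]) : rot a b (z + w) = rot a b z + rot a b w.
Proof. by rewrite /rot ReD ImD; ring. Qed.

Lemma rateE (a b : R) k t : rate c a b k t = - (q k ^+ 4 * rot a b (esource (c t) k)).
Proof. by rewrite /rate /esource rotD mulNr. Qed.

Lemma bil_termE t k :
  bil_term t k = - (coef k 0 (phi (clamp T t)) * rate c 1 0 k t +
    coef k (pi / 2) (phi (clamp T t)) * rate c 0 1 k t).
Proof.
rewrite !rateE /bil_term; move: (rot 1 0 _) (rot 0 1 _) (coef k _ _) (coef k _ _) (q k) => *; ring.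
Qed.

Lemma continuous_bil_term k : continuous (fun t => bil_term t k).
Proof.
have [_ _ _ C _] := tf.
have cg th := @coef_clamp_continuous R d T phi k th T00 C.
have cr a b := @continuous_rate R d c M creg Mm cM a b k.
rewrite (_ : (fun t => _) = (fun t => -1 * (coef k 0 (phi (clamp T t)) * rate c 1 0 k t) +
   -1 * (coef k (pi / 2) (phi (clamp T t)) * rate c 0 1 k t))); last first.
  by apply/funext => t; rewrite bil_termE opprD !mulN1r.
apply: continuous_comb => t.
  by apply: (@continuousM _ _ (fun t => coef k 0 (phi (clamp T t))) (rate c 1 0 k)); [exact: cg|exact: cr].
by apply: (@continuousM _ _ (fun t => coef k (pi / 2) (phi (clamp T t))) (rate c 0 1 k)); [exact: cg|exact: cr].
Qed.

Lemma integral_mode_rot f (z : R[i]) k : mu.-integrable setT (EFin \o f) ->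
  \int[mu]_x (f x * mode z k x) = rot 1 0 z * coef k 0 f + rot 0 1 z * coef k (pi / 2) f.
Proof. by move=> fi; rewrite integral_mul_mode// /rot /coef !mul1r !mul0r addr0 add0r. Qed.

Lemma bil_term_integral t k : 0 <= t <= T -> carrier W4 (phi t) ->
  bil_term t k = \int[mu]_x (bilaplacian (phi t) x * mode (esource (c t) k) k x).
Proof.
move=> tI [_ hf]; rewrite integral_mode_rot; last exact: integrable_bilaplacian.
rewrite /coef !integral_bilaplacian_wave// /bil_term clamp_id//.
rewrite -/(coef k 0 (phi t)) -/(coef k (pi / 2) (phi t)).
move: (rot 1 0 _) (rot 0 1 _) (coef k _ _) (coef k _ _) (q k) => *; ring.
Qed.

Lemma bil_limit : exists B : R -> R, [/\ leb.-integrable `[0%R, T] (EFin \o B),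
  {ae leb, forall t, `[0, T]%classic t ->
     B t = \int[mu]_x (bilaplacian (phi t) x * wser (esource (c t)) x)} &
  psum (fun k => \int[leb]_(t in `[0, T]) bil_term t k) n @[n --> \oo] -->
     \int[leb]_(t in `[0, T]) B t].
Proof.
have [_ _ W _ _] := tf.
have Wi := bochner_L1_integral (fun t => W4_norm_ge0 (phi t)) W.
have d0 : (0 : R) < (d * d).+1%:R by rewrite ltr0n.
have E n : psum (fun k => \int[leb]_(t in `[0, T]) bil_term t k) n =
    \int[leb]_(t in `[0, T]) psum (bil_term t) n.
  rewrite Rintegral_psum// => k; apply: integrable_continuous_itv; exact: continuous_bil_term.
have [||||||//|B [H1 H2 H3]] := @dominated_convergence_nonmeas _ _ R leb `[0, T]%classic (fun n t => psum (bil_term t) n)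
  (fun t => \int[mu]_x (bilaplacian (phi t) x * wser (esource (c t)) x)) (fun t => fnorm W4 (phi t)) (d * d).+1%:R => //; last first.
- exists B; split => //; rewrite (_ : (fun n => _) = (fun n => \int[leb]_(t in `[0, T]) psum (bil_term t) n)) => //.
  by apply/funext.
- by move=> t _; exact: W4_norm_ge0.
- apply: (@filterS _ _ (ae_filter_ringOfSetsType leb) _ _ _ phi_W4) => t H tI n.
  have Wt := H tI; have tI' : 0 <= t <= T by move: tI; rewrite /= in_itv.
  have [_ e1] := csummable_esource (@ch t) (c5 t).
  have bi := integrable_bilaplacian (proj2 Wt).
  rewrite (_ : bil_term t = (fun k => \int[mu]_x (bilaplacian (phi t) x * mode (esource (c t) k) k x))).
    apply: le_trans (psum_mode_le n bi e1) _; apply: le_trans (bilaplacian_norm_le Wt) _.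
    by apply: lee_wpmul2r; [exact: W4_norm_ge0|rewrite lee_fin ler_nat].
  by apply/funext => k; exact: bil_term_integral.
- apply: (@filterS _ _ (ae_filter_ringOfSetsType leb) _ _ _ phi_W4) => t H tI.
  have Wt := H tI; have tI' : 0 <= t <= T by move: tI; rewrite /= in_itv.
  have [es _] := csummable_esource (@ch t) (c5 t).
  have bi := integrable_bilaplacian (proj2 Wt).
  rewrite (_ : bil_term t = (fun k => \int[mu]_x (bilaplacian (phi t) x * mode (esource (c t) k) k x))).
    exact: cvg_integral_wser.
  by apply/funext => k; exact: bil_term_integral.
- move=> n; apply: measurable_psum => k; apply: measurable_funTS.
  by apply: continuous_measurable_fun; exact: continuous_bil_term.
Qed.

End weak_formulation.

Section weak_equation.
Variables (R : realType) (d : nat).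
Local Notation mu := (torus_measure R d).
Local Notation leb := (@lebesgue_measure R).
Local Notation K := (d.-tuple int).
Local Notation q := (@freq_norm R d).
Local Notation L1 := (spaceL d (1 : R)%:E).
Local Notation W4 := (spaceW1 R d 4).
Implicit Types (k : K) (t : R) (f : d.-tuple R -> R).

Variables (c0 : K -> R[i]) (c : R -> K -> R[i]) (M : K -> R).
Variables (creg : regular c) (Mm : majorant M) (cM : below c M).
Variable cfix : forall t k, c t k = mild_map c0 c t k.
Variables (T : R) (phi psi : R -> d.-tuple R -> R) (T0 : 0 < T).
Variable tf : test_function T phi psi.

Let ch t : hermitian (c t). Proof. by have [H _ _ _] := creg. Qed.
Let c5 t : (asum (cabs (c t)) <= (5^-1)%:E)%E. Proof. exact: below_asum Mm cM. Qed.
Let c1 t : (asum (cabs (c t)) <= 1)%E.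
Proof. by apply: le_trans (c5 t) _; rewrite lee_fin invf_le1// ler1n. Qed.
Let cs t : csummable (c t). Proof. exact: csummable5. Qed.

Section exceptional_set.
Variable Z : set R.
Variables (mZ : measurable Z) (Z0 : leb Z = 0).
Variable psiL : forall t, `[0, T]%classic t -> ~ Z t -> psi t \in Lfun mu 1%E.
Variable psim : forall k th,
  measurable_fun `[0, T]%classic (fun t => if t \in Z then 0 else coef k th (psi t)).

(** Only at almost every time is psi t known to lie in L^1, hence the value 0 on Z. *)
Definition psi_coef k th t : R := if t \in Z then 0 else coef k th (psi t).

Definition psi_term t k : R :=
  psi_coef k 0 t * rot 1 0 (c t k) + psi_coef k (pi / 2) t * rot 0 1 (c t k).

Lemma ae_psi (P : R -> Prop) :
  (forall t, `[0, T]%classic t -> mu.-integrable setT (EFin \o psi t) -> t \notin Z -> P t) ->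
  {ae leb, forall t, `[0, T]%classic t -> P t}.
Proof.
move=> H; exists Z; split => // t /= ht; apply: contrapT => tZ; apply: ht => tI.
by apply: H => //; [apply/Lfun1P; exact: psiL|exact/negP/(contra_not set_mem)].
Qed.

Lemma psi_norm_integral : (\int[leb]_(t in `[0%R, T]) fnorm L1 (psi t) < +oo)%E.
Proof.
have [[_ P] _ _ _ _] := tf; apply: bochner_L1_integral P => t; exact: Lnorm_ge0.
Qed.

Lemma psi_coef_integrable k th : leb.-integrable `[0%R, T] (EFin \o psi_coef k th).
Proof.
apply: (@integrable_nonmeas_bound _ _ R leb _ _ (fun t => fnorm L1 (psi t)) 1) => //.
- exact: psim.
- apply: ae_psi => t tI pI tZ; rewrite /psi_coef (negPf tZ) mul1e; exact: coef_le.
- by move=> t _; exact: Lnorm_ge0.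
- exact: psi_norm_integral.
Qed.

Lemma psi_term_integrable k : leb.-integrable `[0%R, T] (EFin \o (fun t => psi_term t k)).
Proof.
apply: integrable_add => //; apply: integrable_mul_continuous => //.
- exact: psi_coef_integrable.
- exact: (@continuous_rot_c R d c creg).
- exact: psi_coef_integrable.
- exact: (@continuous_rot_c R d c creg).
Qed.

Lemma psi_termE t k : t \notin Z -> mu.-integrable setT (EFin \o psi t) ->
  psi_term t k = \int[mu]_x (psi t x * mode (c t k) k x).
Proof.
move=> tZ pI; rewrite /psi_term /psi_coef (negPf tZ) integral_mode_rot//.
by rewrite [coef k 0 _ * _]mulrC [coef k (pi / 2) _ * _]mulrC.
Qed.

Lemma psi_limit : exists A : R -> R, [/\ leb.-integrable `[0%R, T] (EFin \o A),
  {ae leb, forall t, `[0, T]%classic t -> A t = \int[mu]_x (psi t x * wser (c t) x)} &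
  psum (fun k => \int[leb]_(t in `[0, T]) psi_term t k) n @[n --> \oo] -->
     \int[leb]_(t in `[0, T]) A t].
Proof.
have E n : psum (fun k => \int[leb]_(t in `[0, T]) psi_term t k) n =
    \int[leb]_(t in `[0, T]) psum (psi_term t) n.
  rewrite Rintegral_psum// => k; exact: psi_term_integrable.
have [||||||//|A [H1 H2 H3]] := @dominated_convergence_nonmeas _ _ R leb `[0, T]%classic (fun n t => psum (psi_term t) n)
  (fun t => \int[mu]_x (psi t x * wser (c t) x)) (fun t => fnorm L1 (psi t)) 1 => //; last first.
- exists A; split => //; rewrite (_ : (fun n => _) = (fun n => \int[leb]_(t in `[0, T]) psum (psi_term t) n)) => //.
  by apply/funext.
- exact: psi_norm_integral.
- by move=> t _; exact: Lnorm_ge0.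
- apply: ae_psi => t tI pI tZ n; rewrite mul1e.
  rewrite (_ : psi_term t = (fun k => \int[mu]_x (psi t x * mode (c t k) k x))); first exact: psum_mode_le.
  by apply/funext => k; exact: psi_termE.
- apply: ae_psi => t tI pI tZ.
  rewrite (_ : psi_term t = (fun k => \int[mu]_x (psi t x * mode (c t k) k x))); first exact: cvg_integral_wser.
  by apply/funext => k; exact: psi_termE.
- move=> n; apply: measurable_psum => k; apply/measurable_EFinP.
  by apply: (@measurable_int _ _ _ leb); exact: psi_term_integrable.
Qed.

(** The sum of two instances of [mode_weak]: phase 0 with the real part of c_k, and phase pi / 2
    with its imaginary part. *)
Lemma mode_balance k :
  \int[leb]_(t in `[0, T]) psi_term t k - \int[leb]_(t in `[0, T]) bil_term c T phi t k =
  - \int[mu]_x (phi 0 x * mode (c 0 k) k x).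
Proof.
have [_ _ _ C _] := tf.
have W th a b := mode_weak creg Mm cM cfix a b T0 tf mZ Z0 psiL (psi_coef_integrable k th).
have I0 : 0 <= (0 : R) <= T by rewrite lexx ltW.
rewrite (integral_mode_rot _ _ (phi_L1 tf I0)).
have gi th a b : leb.-integrable `[0%R, T]
    (EFin \o (fun t => coef k th (phi (clamp T t)) * rate c a b k t)).
  apply: integrable_continuous_itv => t.
  apply: (@continuousM _ _ (fun t => coef k th (phi (clamp T t))) (rate c a b k)).
    exact: (@coef_clamp_continuous R d T phi k th (ltW T0) C).
  exact: (@continuous_rate R d c M creg Mm cM a b k).
have fi th a b : leb.-integrable `[0%R, T] (EFin \o (fun t => psi_coef k th t * rot a b (c t k))).
  by apply: integrable_mul_continuous => //; [exact: psi_coef_integrable|exact: (@continuous_rot_c R d c creg)].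
have bi : leb.-integrable `[0%R, T] (EFin \o (fun t => bil_term c T phi t k)).
  by apply: integrable_continuous_itv; exact: (continuous_bil_term creg Mm cM T0 tf).
rewrite -(RintegralB _ (psi_term_integrable k) bi)//.
transitivity (\int[leb]_(t in `[0, T])
   ((psi_coef k 0 t * rot 1 0 (c t k) + coef k 0 (phi (clamp T t)) * rate c 1 0 k t) +
    (psi_coef k (pi / 2) t * rot 0 1 (c t k) + coef k (pi / 2) (phi (clamp T t)) * rate c 0 1 k t))).
  by apply: eq_Rintegral => t _; rewrite bil_termE opprK /psi_term addrACA.
have si th a b : leb.-integrable `[0%R, T] (EFin \o (fun t => psi_coef k th t * rot a b (c t k) +
    coef k th (phi (clamp T t)) * rate c a b k t)).
  by apply: integrable_add.
rewrite (RintegralD _ (si 0 1 0) (si (pi / 2) 0 1))//.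
by rewrite (W 0 1 0) (W (pi / 2) 0 1) opprD [coef k 0 _ * _]mulrC [coef k (pi / 2) _ * _]mulrC.
Qed.

End exceptional_set.

Lemma weak_equation (v : R -> d.-tuple R -> R) (v0 : d.-tuple R -> R) :
  (forall t, {ae mu, forall x, v t x = - wser (c t) x}) ->
  {ae mu, forall x, v0 x = - wser (c 0) x} ->
  \int[mu]_x (phi 0 x * v0 x) +
    \int[leb]_(t in `[0, T]%classic)
      (\int[mu]_x (psi t x * v t x + bilaplacian (phi t) x * expR (- v t x))) = 0.
Proof.
move=> vE v0E; have [[_ [sP _]] _ _ _ _] := tf.
have [Z [mZ Z0 psiL psim]] := coef_measurable sP.
have [A [Ai AE Acv]] := psi_limit mZ Z0 psiL psim.
have [B [Bi BE Bcv]] := bil_limit creg Mm cM T0 tf.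
have I0 : 0 <= (0 : R) <= T by rewrite lexx ltW.
have phi0 := phi_L1 tf I0.
have [mw [b wb]] := bm_wser (cs 0).
have pwi : mu.-integrable setT (EFin \o (fun x => phi 0 x * wser (c 0) x)).
  exact: (integrable_mul_bounded (M := b)).
have -> : \int[mu]_x (phi 0 x * v0 x) = - \int[mu]_x (phi 0 x * wser (c 0) x).
  rewrite -[RHS]mulN1r -RintegralZl// /Rintegral; congr fine; apply: ae_eq_integral_nonmeas => //.
    by apply/measurable_EFinP; apply: measurable_funM => //; exact: measurable_Rintegrable.
  by apply: filterS v0E => x H _; rewrite H mulN1r mulrN.
(* The inner integral is replaced by B - A, an integrable function of time that agrees with it
   almost everywhere. *)
have -> : \int[leb]_(t in `[0, T]%classic)
      (\int[mu]_x (psi t x * v t x + bilaplacian (phi t) x * expR (- v t x))) =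
    \int[leb]_(t in `[0, T]) (B t - A t).
  rewrite /Rintegral; congr fine; apply: ae_eq_integral_nonmeas => //.
    by apply: (@measurable_int _ _ _ leb); exact: (integrable_sub _ Bi Ai).
  have P := ae_psi mZ Z0 psiL (fun t _ pI _ => pI).
  have BW := @filterS2 _ _ (ae_filter_ringOfSetsType leb) _ _ _
    (fun t H1 H2 => conj H1 H2) BE (phi_W4 tf).
  have AP := @filterS2 _ _ (ae_filter_ringOfSetsType leb) _ _ _
    (fun t H1 H2 => conj H1 H2) AE P.
  apply: (@filterS2 _ _ (ae_filter_ringOfSetsType leb) _ _ _ _ AP BW) => t [hA hP] [hB hW] tI.
  congr EFin; rewrite (hA tI) (hB tI) addrC.
  have Wt := hW tI; have bI := integrable_bilaplacian (proj2 Wt).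
  apply: inner_integral => //; first exact: hP.
  (* The integral of the bilaplacian is its mode 0, which carries the factor |0|^4 = 0. *)
  transitivity (\int[mu]_x (bilaplacian (phi t) x * cos (phase 0 x + 0))).
    by apply: eq_Rintegral => x _; rewrite phase0 addr0 cos0 mulr1.
  by rewrite integral_bilaplacian_wave ?freq_norm0 ?expr0n ?mul0r//; exact: (proj2 Wt).
rewrite RintegralB//.
(* By [mode_balance] the partial sums of the pairing of phi 0 with the series of c 0 also converge
   to the integral of B - A; uniqueness of the limit closes the identity. *)
have C : psum (fun k => \int[mu]_x (phi 0 x * mode (c 0 k) k x)) n @[n --> \oo] -->
    \int[leb]_(t in `[0, T]) B t - \int[leb]_(t in `[0, T]) A t.
  rewrite (_ : (fun n => _) = (fun n => psum (fun k => \int[leb]_(t in `[0, T]) bil_term c T phi t k) n -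
    psum (fun k => \int[leb]_(t in `[0, T]) psi_term Z t k) n)); first exact: cvgB.
  apply/funext => n; rewrite -[X in _ - X]mul1r -mulNr -psumZ -psumD; congr (psum _ n).
  apply/funext => k; have := mode_balance mZ Z0 psiL psim k; rewrite mulN1r.
  by move=> /(congr1 -%R); rewrite opprK opprB => <-.
by rewrite (rcvg_unique C (@cvg_integral_wser R d (c 0) (phi 0) (cs 0) phi0)) addNr.
Qed.

End weak_equation.

(** * The initial data *)

Section initial_data.
Variables (R : realType) (d : nat) (u0 : d.-tuple R -> R).
Local Notation mu := (torus_measure R d).
Local Notation K := (d.-tuple int).
Local Notation q := (@freq_norm R d).
Implicit Types (k : K).

Lemma deltaE (r : R) : delta r = 1 - hfun r.
Proof. by rewrite /delta /hfun; ring. Qed.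

(** Since e^r >= 1, [hfun r] is at least 7 r. *)
Lemma hfun_lt1 (r : R) : 0 <= r -> hfun r < 1 -> r <= 7^-1.
Proof.
move=> r0; rewrite /hfun => h; have e1 : 1 <= expR r by rewrite -expR0 ler_expR.
have p : 1 + 7 * r <= 1 + 7 * r + 6 * r ^+ 2 + r ^+ 3.
  by rewrite -addrA lerDl addr_ge0// ?mulr_ge0// exprn_ge0.
have : 1 + 7 * r <= expR r * (1 + 7 * r + 6 * r ^+ 2 + r ^+ 3).
  apply: le_trans p _; rewrite ler_peMl//.
  by rewrite !addr_ge0// ?mulr_ge0// exprn_ge0.
by lra.
Qed.

Variables (hu0 : wiener_space 2 u0) (hmean : \int[mu]_x u0 x = 0).

(** The Fourier coefficients of - Laplacian u0, that is, of p at time 0. *)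
Definition symbol0 k : R[i] := Complex (q k ^+ 2) 0 * fourier u0 k.

Lemma u0_integrable : mu.-integrable setT (EFin \o u0).
Proof. by apply/Lfun1P; have [] := hu0. Qed.

Lemma fourier_u0_0 : fourier u0 0 = 0.
Proof.
apply: complex_ext => /=.
  rewrite (_ : Rintegral _ _ _ = 0) ?mulr0// -[RHS]hmean.
  by apply: eq_Rintegral => x _; rewrite phase0 cos0 mulr1.
rewrite (_ : Rintegral _ _ _ = 0) ?mulr0 ?oppr0//.
rewrite (_ : (fun x => _) = cst 0); first by rewrite Rintegral_cst// mul0r.
by apply/funext => x; rewrite phase0 sin0 mulr0.
Qed.

Lemma symbol0_0 : symbol0 0 = 0.
Proof. by rewrite /symbol0 fourier_u0_0 mulr0. Qed.

Lemma cabs_symbol0 k : cabs symbol0 k = q k ^+ 2 * Normc.normc (fourier u0 k).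
Proof. by rewrite /cabs /symbol0 Normc.normcM normc_real ger0_norm// exprn_ge0// freq_norm_ge0. Qed.

Lemma asum_symbol0 : asum (cabs symbol0) = wiener_norm 2 u0.
Proof.
apply: eq_esum => k _; rewrite cabs_symbol0.
by rewrite powR_mulrn ?freq_norm_ge0.
Qed.

Lemma asum_symbol0_fine : asum (cabs symbol0) = (fine (wiener_norm 2 u0))%:E.
Proof.
have [_ h] := hu0; rewrite asum_symbol0 fineK// ge0_fin_numE// -asum_symbol0.
by apply: asum_ge0 => k; exact: cabs_ge0.
Qed.

Lemma csummable_symbol0 : csummable symbol0.
Proof. by rewrite /csummable asum_symbol0; have [] := hu0. Qed.

Lemma hermitian_symbol0 : hermitian symbol0.
Proof.
move=> k; rewrite /symbol0 freq_normN fourier_opp; last exact: u0_integrable.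
by apply: complex_ext; rewrite /= ?mul0r; ring.
Qed.

Lemma pot_symbol0 : pot symbol0 = fourier u0.
Proof.
apply/funext => k; rewrite /pot /symbol0 mulrA.
have [->|k0] := eqVneq k 0; first by rewrite fourier_u0_0 mulr0.
have q1 := freq_norm_ge1 R k0; have qn : q k ^+ 2 != 0 by rewrite expf_eq0/= gt_eqF// (lt_le_trans ltr01).
by apply: complex_ext; rewrite !(ReM, ImM)/= !(mul0r, mulr0, subr0, addr0) mulVf// mul1r.
Qed.

Lemma csummable_fourier_u0 : csummable (fourier u0).
Proof. by rewrite -pot_symbol0; apply: csummable_pot; exact: csummable_symbol0. Qed.

Lemma laplacian_u0 : {ae mu, forall x, laplacian u0 x = - wser symbol0 x}.
Proof.
have [uL _] := hu0.
by have [] := @laplacian_wser R d (fourier u0) symbol0 u0 uL csummable_fourier_u0 csummable_symbol0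
  (fun k => erefl) (fourier_inversion u0_integrable csummable_fourier_u0).
Qed.

End initial_data.

Theorem theorem2p9 (R : realType) (d : nat) (hd : d = 1%N \/ d = 2%N)
    (u0 : d.-tuple R -> R)
    (hu0 : wiener_space 2 u0)
    (hmean : \int[torus_measure R d]_x u0 x = 0)
    (hdelta : 0 < delta (fine (wiener_norm 2 u0))) :
  exists u : R -> d.-tuple R -> R,
    [/\ global_weak_solution u u0,
        {ae torus_measure R d, forall x, u 0 x = u0 x},
        forall T, 0 < T ->
          bochner_C T (spaceH d 2) u /\ bochner_L 2%:E T (spaceH d 4) u &
        forall t, 0 <= t ->
          ('N[torus_measure R d]_+oo[EFin \o laplacian (u t)] <=
           (fine (wiener_norm 2 u0) *
            expR (- delta (fine (wiener_norm 2 u0)) * t))%:E)%E].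
Proof.
set r := fine (wiener_norm 2 u0).
have c0r : asum (cabs (symbol0 u0)) = r%:E := asum_symbol0_fine hu0.
have r0 : 0 <= r by rewrite -lee_fin -c0r; apply: asum_ge0 => k; exact: cabs_ge0.
have hr : hfun r < 1 by move: hdelta; rewrite deltaE subr_gt0.
have r7 := hfun_lt1 r0 hr.
have c00 := symbol0_0 hmean.
have c07 : (asum (cabs (symbol0 u0)) <= (7^-1)%:E)%E by rewrite c0r lee_fin.
have [c [M [creg Mm cM cfix]]] := exists_mild (hermitian_symbol0 hu0) c07.
have [_ cmax _ _] := creg.
(* The mean of p stays 0, as the inversion of the Laplacian by [pot] requires. *)
have cz t : c t 0 = 0.
  apply: Normc.eq0_normc; apply/eqP; rewrite eq_le; apply/andP; split; last exact: normc_ge0.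
  rewrite cmax; apply: le_trans (cabs_le_dom creg Mm cM cfix 0 (max_ge0r t)) _.
  by rewrite dom0// max_ge0r.
have cE : c 0 = symbol0 u0 by apply/funext => k; exact: (mild0 cfix).
exists (sol c); split.
- split=> [t t0|T T0].
    by split; [exact: sol_Lfun1 Mm cM t|exact: sol_mean creg Mm cM cz t|have [] := sol_laplacian Mm cM cz t].
  split; first exact (laplacian_sol_bochner creg Mm cM cz T0).
  move=> phi psi tf; apply: (weak_equation creg Mm cM cfix T0 tf).
    by move=> t; have [] := sol_laplacian Mm cM cz t.
  by rewrite cE; exact: laplacian_u0.
- have := fourier_inversion (u0_integrable hu0) (csummable_fourier_u0 hu0 hmean).
  by apply: filterS => x ->; rewrite /sol cE pot_symbol0.
- by move=> T T0; split; [exact: (@sol_bochner_C R d c M creg Mm cM cz T)|exact (sol_bochner_L creg Mm cM cz T0)].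
- move=> t t0; apply: le_trans (norm_laplacian_sol_le Mm cM cz t) _.
  rewrite deltaE; exact: (decay c00 creg Mm cM cfix c0r r7 hr t0).
Qed.
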